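(* There is a constant $C$ such that for each $m,\varepsilon>0$ and each $(x,t)\in\varepsilon\mathbb{Z}^2$ with $|x|\ne|t|$, setting $s:=\sqrt{|t^2-x^2|}$ and $\Delta:=\frac{1}{||x|-|t||}+m^2(|x|+|t|)$, the following hold, where each $O(\varepsilon\Delta)$ denotes a quantity of absolute value at most $C\varepsilon\Delta$: $$\widetilde{A}_1(x,t,m,\varepsilon)=\begin{cases}m\varepsilon\,(J_0(ms)+O(\varepsilon\Delta)),&|x|<|t|,\ (x+t)/\varepsilon\text{ odd};\\ -im\varepsilon\,(Y_0(ms)+O(\varepsilon\Delta)),&|x|<|t|,\ (x+t)/\varepsilon\text{ even};\\ 0,&|x|>|t|,\ (x+t)/\varepsilon\text{ odd};\\ 2im\varepsilon\,(K_0(ms)+O(\varepsilon\Delta))/\pi,&|x|>|t|,\ (x+t)/\varepsilon\text{ even};\end{cases}$$ $$\widetilde{A}_2(x,t,m,\varepsilon)=\begin{cases}-m\varepsilon(t+x)(J_1(ms)+O(\varepsilon\Delta))/s,&|x|<|t|,\ (x+t)/\varepsilon\text{ even};\\ im\varepsilon(t+x)(Y_1(ms)+O(\varepsilon\Delta))/s,&|x|<|t|,\ (x+t)/\varepsilon\text{ odd};\\ 0,&|x|>|t|,\ (x+t)/\varepsilon\text{ even};\\ 2im\varepsilon(t+x)(K_1(ms)+O(\varepsilon\Delta))/(\pi s),&|x|>|t|,\ (x+t)/\varepsilon\text{ odd}.\end{cases}$$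
   Context: $J_n,Y_n$ are the Bessel functions of the first and second kind and $K_n$ the modified Bessel function of the second kind. Fix $\varepsilon,m>0$. For $\delta\in(0,1)$ let $A_k(x,t)=A_k(x,t,m,\varepsilon,\delta)$, $k\in\{1,2\}$, be the unique pair of complex-valued functions on $\{(x,t)\in\mathbb{R}^2:2x/\varepsilon,2t/\varepsilon,(x+t)/\varepsilon\in\mathbb{Z}\}$ satisfying: (1) for $2x/\varepsilon,2t/\varepsilon$ even, $A_1(x,t)=\frac{1}{\sqrt{1+m^2\varepsilon^2}}(A_1(x+\frac{\varepsilon}{2},t-\frac{\varepsilon}{2})+m\varepsilon A_2(x+\frac{\varepsilon}{2},t-\frac{\varepsilon}{2}))$ and $A_2(x,t)=\frac{1}{\sqrt{1+m^2\varepsilon^2}}(A_2(x-\frac{\varepsilon}{2},t-\frac{\varepsilon}{2})-m\varepsilon A_1(x-\frac{\varepsilon}{2},t-\frac{\varepsilon}{2}))+2\delta_{x0}\delta_{t0}$; (2) for $2x/\varepsilon,2t/\varepsilon$ odd, $A_1(x,t)=\frac{1}{\sqrt{1-\delta^2}}(A_1(x+\frac{\varepsilon}{2},t-\frac{\varepsilon}{2})-i\delta A_2(x+\frac{\varepsilon}{2},t-\frac{\varepsilon}{2}))$ and $A_2(x,t)=\frac{1}{\sqrt{1-\delta^2}}(A_2(x-\frac{\varepsilon}{2},t-\frac{\varepsilon}{2})+i\delta A_1(x-\frac{\varepsilon}{2},t-\frac{\varepsilon}{2}))$; (3) $\sum_{(x,t)\in\varepsilon\mathbb{Z}^2}(|A_1(x,t)|^2+|A_2(x,t)|^2)<\infty$.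 (Existence and uniqueness are known.) $\delta_{xy}$ is the Kronecker delta. The lattice propagator is $\widetilde{A}_k(x,t,m,\varepsilon):=\lim_{\delta\searrow0}A_k(x,t,m,\varepsilon,\delta)$ for $(x,t)\in\varepsilon\mathbb{Z}^2$ (the limit is known to exist). *)

(* Defs.v *)
From Stdlib Require Import Reals ZArith ClassicalEpsilon.
From Coquelicot Require Import Coquelicot.
Open Scope R_scope.

Definition improper0 (f : R -> R) : R := real (Lim (fun b => RInt f 0 b) p_infty).

(** Bessel functions of integer order, via their standard integral
    representations (DLMF 10.9.2, 10.9.7, 10.32.9); Y_n and K_n for x > 0. *)
Definition BesselJ (n : nat) (x : R) : R :=
  / PI * RInt (fun tau => cos (INR n * tau - x * sin tau)) 0 PI.

Definition BesselY (n : nat) (x : R) : R :=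
  / PI * RInt (fun th => sin (x * sin th - INR n * th)) 0 PI
  - / PI * improper0 (fun u => (exp (INR n * u) + (-1) ^ n * exp (- (INR n * u)))
                                * exp (- (x * sinh u))).

Definition BesselK (n : nat) (x : R) : R :=
  improper0 (fun u => exp (- (x * cosh u)) * cosh (INR n * u)).

(** Lattice points: (x,t) = (eps*a/2, eps*b/2) with a, b integers of equal parity.
    "2x/eps, 2t/eps even" <-> a, b even; "odd" <-> a, b odd.
    (x + eps/2, t - eps/2) <-> (a+1, b-1); (x - eps/2, t - eps/2) <-> (a-1, b-1).
    Values of A at a+b odd are irrelevant. *)
Definition kron00 (a b : Z) : C := if (Z.eqb a 0 && Z.eqb b 0)%bool then RtoC 1 else RtoC 0.

Definition lattice_system (m eps delta : R) (A1 A2 : Z -> Z -> C) : Prop :=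
  (forall a b : Z, Z.even a = true -> Z.even b = true ->
     A1 a b = (RtoC (/ sqrt (1 + m ^ 2 * eps ^ 2))
                 * (A1 (a + 1)%Z (b - 1)%Z + RtoC (m * eps) * A2 (a + 1)%Z (b - 1)%Z))%C /\
     A2 a b = (RtoC (/ sqrt (1 + m ^ 2 * eps ^ 2))
                 * (A2 (a - 1)%Z (b - 1)%Z - RtoC (m * eps) * A1 (a - 1)%Z (b - 1)%Z)
               + RtoC 2 * kron00 a b)%C) /\
  (forall a b : Z, Z.odd a = true -> Z.odd b = true ->
     A1 a b = (RtoC (/ sqrt (1 - delta ^ 2))
                 * (A1 (a + 1)%Z (b - 1)%Z - Ci * RtoC delta * A2 (a + 1)%Z (b - 1)%Z))%C /\
     A2 a b = (RtoC (/ sqrt (1 - delta ^ 2))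
                 * (A2 (a - 1)%Z (b - 1)%Z + Ci * RtoC delta * A1 (a - 1)%Z (b - 1)%Z))%C) /\
  (* square summability over (x,t) in eps Z^2, i.e. a = 2p, b = 2q:
     partial sums over the squares |p|,|q| <= N are bounded *)
  (exists M : R, forall N : nat,
     sum_f_R0 (fun p => sum_f_R0 (fun q =>
        Cmod (A1 (2 * (Z.of_nat p - Z.of_nat N))%Z (2 * (Z.of_nat q - Z.of_nat N))%Z) ^ 2
      + Cmod (A2 (2 * (Z.of_nat p - Z.of_nat N))%Z (2 * (Z.of_nat q - Z.of_nat N))%Z) ^ 2)
        (2 * N)) (2 * N) <= M).

(** The (known to exist and be unique) solution A(m,eps,delta), chosen by choice. *)
Definition A_sol (m eps delta : R) : (Z -> Z -> C) * (Z -> Z -> C) :=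
  epsilon (inhabits ((fun _ _ => RtoC 0), (fun _ _ => RtoC 0)))
          (fun A => lattice_system m eps delta (fst A) (snd A)).

(** Limit as delta decreases to 0 (known to exist). *)
Definition C_lim_right0 (f : R -> C) : C :=
  epsilon (inhabits (RtoC 0)) (fun l => filterlim f (at_right 0) (locally l)).

(** Lattice propagator at (x,t) = (eps*i, eps*j) in eps Z^2. *)
Definition Atilde1 (m eps : R) (i j : Z) : C :=
  C_lim_right0 (fun delta => fst (A_sol m eps delta) (2 * i)%Z (2 * j)%Z).
Definition Atilde2 (m eps : R) (i j : Z) : C :=
  C_lim_right0 (fun delta => snd (A_sol m eps delta) (2 * i)%Z (2 * j)%Z).

(* Main.v *)
Require Import Defs.
From Stdlib Require Import Reals ZArith Lra Lia Psatz ClassicalEpsilon.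
From Coquelicot Require Import Coquelicot.
Open Scope R_scope.

(** Eliminating [A_1] and the half-integer sites turns the system into a discrete Klein-Gordon
    equation with a slightly complex mass for a single Green function. The imaginary part of the
    equation against the conjugate of a homogeneous solution is a flux divergence, which forces
    square summable solutions to vanish; a Fourier integral gives a solution, and lets [delta -> 0].

    With [eta = e^(v + i phi)] the limit is the integral of
    [(1 + M eta)^((t-1-x)/2) (1 - M/eta)^((t-1+x)/2)], [M = m eps], along the curve of real momenta.
    Inside the light cone the curve is moved to the circle [|eta|^2 = (t+x)/(t-x)], where the
    integrand is close to [e^(i M s sin phi)], plus two real segments, where it is close to
    [e^(- M s sinh w)]: these are the integrals for [J] and [Y]. Outside the cone the circle is sent
    to infinity and a real integral close to that of [e^(- M s cosh w)] remains, which gives [K].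
    For [A_2] an integration by parts removes the factor [eta] where it is large. *)

(** * Uniqueness and existence of the lattice propagator *)

(** The exponents [(t-1-x)/2] and [(t-1+x)/2] are integers or half-integers together, and this is
    why the answer depends on the parity of [x + t]. On the real axis an integer power is real and
    drops out of the imaginary part, which leaves the circle alone and hence [J]; the real part of a
    half-integer power is that power cut off where its base turns negative, and supplies the
    exponential half of [Y] and all of [K]. The estimates are uniform: [eps * Delta] need not be
    small. In lattice units, with [K = |t-x|], [L = |t+x|] and [z = M sqrt (K L)], the radius is
    chosen so that [a K = b L = z] for [a = M |eta|] and [b = M / |eta|]. Every error then reduces
    to [a], [b], [z a], [z b], [1/K], [1/L], all bounded by a multiple of [eps * Delta]; where these
    are large, crude modulus bounds suffice. Inside the cone [A_2] carries the exponent [(t-2-x)/2],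
    negative when [t - x = 1]. A linear relation between the values at [x] and [-x] moves such
    points to the other side; only the site [(0, 1)] is computed directly. *)

Definition sym_sum (N : nat) (f : Z -> R) : R :=
  sum_f_R0 (fun i => f (Z.of_nat i - Z.of_nat N)%Z) (2 * N).

Lemma sym_sum_S N f :
  sym_sum (S N) f = f (- Z.of_nat (S N))%Z + sym_sum N f + f (Z.of_nat (S N)).
Proof.
unfold sym_sum.
replace (2 * S N)%nat with (S (S (2 * N))) by lia.
rewrite tech5, decomp_sum by lia. simpl pred.
replace (Z.of_nat 0 - Z.of_nat (S N))%Z with (- Z.of_nat (S N))%Z by lia.
replace (Z.of_nat (S (S (2 * N))) - Z.of_nat (S N))%Z with (Z.of_nat (S N)) by lia.
do 2 f_equal. apply sum_eq; intros i _. f_equal. lia.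
Qed.

Lemma sym_sum_ext N f g : (forall z, f z = g z) -> sym_sum N f = sym_sum N g.
Proof. intros H; apply sum_eq; intros; apply H. Qed.

Lemma sym_sum_plus N f g : sym_sum N (fun z => f z + g z) = sym_sum N f + sym_sum N g.
Proof. unfold sym_sum; rewrite <- plus_sum; reflexivity. Qed.

Lemma sym_sum_scal N k f : sym_sum N (fun z => k * f z) = k * sym_sum N f.
Proof. unfold sym_sum; rewrite scal_sum; apply sum_eq; intros; ring. Qed.

Lemma sym_sum_minus N f g : sym_sum N (fun z => f z - g z) = sym_sum N f - sym_sum N g.
Proof.
replace (sym_sum N f - sym_sum N g) with (sym_sum N f + (-1) * sym_sum N g) by ring.
rewrite <- sym_sum_scal, <- sym_sum_plus. apply sym_sum_ext; intros; ring.
Qed.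

Lemma sym_sum_le N f g : (forall z, f z <= g z) -> sym_sum N f <= sym_sum N g.
Proof. intros H; apply sum_Rle; intros; apply H. Qed.

Lemma sym_sum_pos N f : (forall z, 0 <= f z) -> 0 <= sym_sum N f.
Proof. intros H; apply cond_pos_sum; intros; apply H. Qed.

Lemma sym_sum_abs N f : Rabs (sym_sum N f) <= sym_sum N (fun z => Rabs (f z)).
Proof. apply Rsum_abs. Qed.

Lemma sym_sum_mono N f : (forall z, 0 <= f z) -> sym_sum N f <= sym_sum (S N) f.
Proof. intros H; rewrite sym_sum_S. pose proof (H (- Z.of_nat (S N))%Z). pose proof (H (Z.of_nat (S N))). lra. Qed.

Lemma sym_sum_telescope N F :
  sym_sum N (fun q => F q - F (q - 1)%Z) = F (Z.of_nat N) - F (- Z.of_nat N - 1)%Z.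
Proof.
induction N as [|N IH].
- unfold sym_sum; simpl. reflexivity.
- rewrite sym_sum_S, IH.
  replace (Z.of_nat (S N) - 1)%Z with (Z.of_nat N) by lia.
  replace (- Z.of_nat N - 1)%Z with (- Z.of_nat (S N))%Z by lia. ring.
Qed.

(** Unfolds to the double sum in the summability clause of [lattice_system], so that clause converts
    directly to a bound on [box_sum]. *)
Definition box_sum (N : nat) (e : Z -> Z -> R) : R :=
  sym_sum N (fun p => sym_sum N (fun q => e p q)).

(** The flux through the boundary of the box of size [N + 1] involves sites at distance [N + 1] and
    [N + 2]. The four horizontal segments are disjoint and lie between the boxes of sizes [N] and
    [N + 2], and so do the four vertical ones; the two families meet near the corners, hence the
    factor 2. *)
Lemma box_sum_layers N e : (forall p q, 0 <= e p q) ->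
  let l := fun q => sym_sum (S N) (fun p => e p q) in
  let r := fun p => sym_sum (S N) (fun q => e p q) in
  let n := Z.of_nat N in
  l (n + 1)%Z + l (n + 2)%Z + l (- n - 1)%Z + l (- n - 2)%Z +
  (r (n + 1)%Z + r (n + 2)%Z + r (- n - 1)%Z + r (- n - 2)%Z)
   <= 2 * (box_sum (S (S N)) e - box_sum N e).
Proof.
intros He l r n.
assert (H1 : l (n + 1)%Z + l (n + 2)%Z + l (- n - 1)%Z + l (- n - 2)%Z
   <= box_sum (S (S N)) e - box_sum N e).
{ unfold box_sum.
  apply Rle_trans with (sym_sum (S N) (fun p => sym_sum (S (S N)) (fun q => e p q)) - box_sum N e).
  2: { apply Rplus_le_compat_r. apply sym_sum_mono. intros; apply sym_sum_pos; auto. }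
  apply Rle_trans with (sym_sum (S N) (fun p => sym_sum (S (S N)) (fun q => e p q))
      - sym_sum (S N) (fun p => sym_sum N (fun q => e p q))).
  2: { apply Rplus_le_compat_l, Ropp_le_contravar. unfold box_sum.
       apply (sym_sum_mono N). intros; apply sym_sum_pos; auto. }
  rewrite <- sym_sum_minus. unfold l. rewrite <- !sym_sum_plus.
  apply sym_sum_le; intros p. rewrite !sym_sum_S.
  replace (- Z.of_nat (S (S N)))%Z with (- n - 2)%Z by lia.
  replace (Z.of_nat (S (S N))) with (n + 2)%Z by lia.
  replace (- Z.of_nat (S N))%Z with (- n - 1)%Z by lia.
  replace (Z.of_nat (S N)) with (n + 1)%Z by lia. lra. }
assert (H2 : r (n + 1)%Z + r (n + 2)%Z + r (- n - 1)%Z + r (- n - 2)%Z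
   <= box_sum (S (S N)) e - box_sum N e).
{ assert (Hr : forall p, r p <= sym_sum (S (S N)) (fun q => e p q)).
  { intros p; apply sym_sum_mono; auto. }
  assert (Hm : sym_sum N (fun p => sym_sum N (fun q => e p q)) <=
               sym_sum N (fun p => sym_sum (S (S N)) (fun q => e p q))).
  { apply sym_sum_le; intros p. eapply Rle_trans; [|apply Hr]. apply sym_sum_mono; auto. }
  unfold box_sum. rewrite (sym_sum_S (S N) (fun p => sym_sum (S (S N)) (fun q => e p q))),
    (sym_sum_S N (fun p => sym_sum (S (S N)) (fun q => e p q))).
  replace (- Z.of_nat (S (S N)))%Z with (- n - 2)%Z by lia.
  replace (Z.of_nat (S (S N))) with (n + 2)%Z by lia.
  replace (- Z.of_nat (S N))%Z with (- n - 1)%Z by lia.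
  replace (Z.of_nat (S N)) with (n + 1)%Z by lia.
  pose proof (Hr (n+1)%Z). pose proof (Hr (n+2)%Z). pose proof (Hr (-n-1)%Z). pose proof (Hr (-n-2)%Z).
  simpl in *. lra. }
lra.
Qed.

Lemma box_sum_point N e p q : (forall p q, 0 <= e p q) ->
  (Z.abs p <= Z.of_nat N)%Z -> (Z.abs q <= Z.of_nat N)%Z -> e p q <= box_sum N e.
Proof.
intros He Hp Hq.
assert (H : forall f z, (forall z, 0 <= f z) -> (Z.abs z <= Z.of_nat N)%Z -> f z <= sym_sum N f).
{ intros f z Hf. clear -Hf. revert z; induction N as [|N IH]; intros z Hz.
  - replace z with 0%Z by lia. unfold sym_sum; simpl. lra.
  - rewrite sym_sum_S. pose proof (Hf (- Z.of_nat (S N))%Z). pose proof (Hf (Z.of_nat (S N))).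
    pose proof (sym_sum_pos N f Hf).
    destruct (Z.le_gt_cases (Z.abs z) (Z.of_nat N)) as [h|h].
    + specialize (IH z h). lra.
    + assert (z = Z.of_nat (S N) \/ z = - Z.of_nat (S N))%Z as [->| ->] by lia; lra. }
unfold box_sum.
eapply Rle_trans; [apply (H (fun q => e p q) q); auto|].
apply (H (fun p => sym_sum N (fun q => e p q)) p); auto. intros; apply sym_sum_pos; auto.
Qed.

(** Once the box contains a point with [e p q > 0], every two further layers add at least
    [k * e p q], so the sums grow linearly and exceed any [B]. *)
Lemma box_sum_growth (e : Z -> Z -> R) (k B : R) :
  0 < k -> (forall p q, 0 <= e p q) -> (forall N, box_sum N e <= B) ->
  (forall N, k * box_sum (S N) e <= box_sum (S (S N)) e - box_sum N e) ->
  forall p q, e p q = 0.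
Proof.
intros Hk He HB Hg p q.
destruct (Req_dec (e p q) 0) as [|Hne]; auto. exfalso.
set (s := e p q) in *. assert (Hs : 0 < s) by (pose proof (He p q); unfold s in *; lra).
set (N0 := Z.to_nat (Z.max (Z.abs p) (Z.abs q))).
assert (Hbig : forall n, s <= box_sum (N0 + n) e).
{ intros n; apply box_sum_point; auto; lia. }
assert (Hlin : forall n, INR n * (k * s) <= box_sum (N0 + 2 * n) e).
{ induction n as [|n IH].
  - simpl (INR 0). rewrite Rmult_0_l. apply Rlt_le, Rlt_le_trans with s; auto.
  - replace (N0 + 2 * S n)%nat with (S (S (N0 + 2 * n))) by lia.
    specialize (Hg (N0 + 2 * n)%nat). rewrite S_INR.
    specialize (Hbig (S (2 * n))%nat). replace (N0 + S (2*n))%nat with (S (N0 + 2 * n)) in Hbig by lia.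
    assert (k * s <= k * box_sum (S (N0 + 2 * n)) e) by (apply Rmult_le_compat_l; lra). lra. }
destruct (archimed (B / (k * s))) as [Ha _].
assert (Hks : 0 < k * s) by (apply Rmult_lt_0_compat; auto).
set (n := Z.to_nat (up (B / (k * s)))).
assert (B / (k * s) < INR n).
{ unfold n. rewrite INR_IZR_INZ. eapply Rlt_le_trans; [apply Ha|]. apply IZR_le. lia. }
specialize (Hlin n). specialize (HB (N0 + 2 * n)%nat).
assert (B < INR n * (k * s)).
{ apply Rmult_lt_reg_r with (/ (k * s)); [apply Rinv_0_lt_compat; auto|].
  replace (INR n * (k * s) * / (k * s)) with (INR n) by (field; lra). auto. }
lra.
Qed.

Lemma Cmod_sqr z : Cmod z ^ 2 = fst z ^ 2 + snd z ^ 2.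
Proof. unfold Cmod. rewrite pow2_sqrt; nra. Qed.

(* The imaginary part of conj(B) times the equation is a discrete divergence plus k |B|^2. *)
Lemma KG_l2_unique (B : Z -> Z -> C) (c k bnd : R) :
  0 < c -> 0 < k ->
  (forall p q, (B p (q + 1)%Z + B p (q - 1)%Z = RtoC c * (B (p + 1)%Z q + B (p - 1)%Z q) + Ci * RtoC k * B p q)%C) ->
  (forall N, box_sum N (fun p q => Cmod (B p q) ^ 2) <= bnd) ->
  forall p q, B p q = RtoC 0.
Proof.
intros Hc Hk HKG Hb.
set (e := fun p q => Cmod (B p q) ^ 2) in *.
assert (He : forall p q, 0 <= e p q) by (intros; unfold e; apply pow2_ge_0).
assert (Hz : forall p q, e p q = 0).
{ apply (box_sum_growth e (k / (2 * (1 + c))) bnd); auto.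
  { apply Rdiv_lt_0_compat; lra. }
  intros N.
  (* [im u v] is the imaginary part of [conj u * v]; [Jt] and [Jx] are the time and space components
     of the current, the latter entering with weight [c]. *)
  set (im := fun (u v : C) => fst u * snd v - snd u * fst v).
  set (Jt := fun p q => im (B p q) (B p (q + 1)%Z)).
  set (Jx := fun p q => im (B p q) (B (p + 1)%Z q)).
  assert (Hdiv : forall p q, k * e p q = (Jt p q - Jt p (q - 1)%Z) - c * (Jx p q - Jx (p - 1)%Z q)).
  { intros p q. specialize (HKG p q). unfold Jt, Jx, im, e. rewrite Cmod_sqr.
    replace (q - 1 + 1)%Z with q by lia. replace (p - 1 + 1)%Z with p by lia.
    destruct (B p q) as [a b]. destruct (B p (q+1)%Z) as [a1 b1]. destruct (B p (q-1)%Z) as [a2 b2].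
    destruct (B (p+1)%Z q) as [a3 b3]. destruct (B (p-1)%Z q) as [a4 b4].
    unfold Cplus, Cmult, RtoC, Ci in HKG. simpl in *. injection HKG; intros H1 H2.
    ring_simplify in H1. ring_simplify in H2.
    assert (E : a * (b1 + b2) - b * (a1 + a2) = c * (a * (b3 + b4) - b * (a3 + a4)) + k * (a ^ 2 + b ^ 2)).
    { rewrite H1, H2. ring. }
    lra. }
  assert (Him : forall u v, Rabs (im u v) <= (Cmod u ^ 2 + Cmod v ^ 2) / 2).
  { intros u v; rewrite !Cmod_sqr; unfold im; apply Rabs_le.
    pose proof (pow2_ge_0 (fst u + snd v)). pose proof (pow2_ge_0 (fst u - snd v)).
    pose proof (pow2_ge_0 (snd u + fst v)). pose proof (pow2_ge_0 (snd u - fst v)). split; nra. }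
  set (n := Z.of_nat (S N)).
  (* Summed over the box, the divergence telescopes to the flux through the four sides. *)
  assert (Hsum : k * box_sum (S N) e =
     (sym_sum (S N) (fun p => Jt p n) - sym_sum (S N) (fun p => Jt p (- n - 1)%Z))
     - c * (sym_sum (S N) (fun q => Jx n q) - sym_sum (S N) (fun q => Jx (- n - 1)%Z q))).
  { unfold box_sum. rewrite <- sym_sum_scal.
    rewrite (sym_sum_ext _ _ (fun p => (Jt p n - Jt p (- n - 1)%Z) -
      c * (sym_sum (S N) (fun q => Jx p q) - sym_sum (S N) (fun q => Jx (p - 1)%Z q)))).
    - rewrite sym_sum_minus, sym_sum_scal,
        (sym_sum_telescope (S N) (fun p => sym_sum (S N) (fun q => Jx p q))), sym_sum_minus. reflexivity.
    - intros p. rewrite <- sym_sum_scal.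
      rewrite (sym_sum_ext _ _ (fun q => (Jt p q - Jt p (q - 1)%Z) - c * (Jx p q - Jx (p - 1)%Z q))) by (intros; apply Hdiv).
      rewrite sym_sum_minus, sym_sum_scal, (sym_sum_telescope (S N) (fun q => Jt p q)), sym_sum_minus.
      reflexivity. }
  set (l := fun q => sym_sum (S N) (fun p => e p q)).
  set (r := fun p => sym_sum (S N) (fun q => e p q)).
  assert (Ht : forall q, Rabs (sym_sum (S N) (fun p => Jt p q)) <= (l q + l (q + 1)%Z) / 2).
  { intros q; eapply Rle_trans; [apply sym_sum_abs|]. unfold l.
    replace ((sym_sum (S N) (fun p => e p q) + sym_sum (S N) (fun p => e p (q + 1)%Z)) / 2)
      with (/ 2 * (sym_sum (S N) (fun p => e p q) + sym_sum (S N) (fun p => e p (q + 1)%Z))) by lra.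
    rewrite <- sym_sum_plus, <- sym_sum_scal.
    apply sym_sum_le; intros p. unfold Jt, e. specialize (Him (B p q) (B p (q+1)%Z)). lra. }
  assert (Hx : forall p, Rabs (sym_sum (S N) (fun q => Jx p q)) <= (r p + r (p + 1)%Z) / 2).
  { intros p; eapply Rle_trans; [apply sym_sum_abs|]. unfold r.
    replace ((sym_sum (S N) (fun q => e p q) + sym_sum (S N) (fun q => e (p + 1)%Z q)) / 2)
      with (/ 2 * (sym_sum (S N) (fun q => e p q) + sym_sum (S N) (fun q => e (p + 1)%Z q))) by lra.
    rewrite <- sym_sum_plus, <- sym_sum_scal.
    apply sym_sum_le; intros q. unfold Jx, e. specialize (Him (B p q) (B (p+1)%Z q)). lra. }
  pose proof (box_sum_layers N e He) as HL. cbv zeta in HL. fold l r in HL.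
  pose proof (Ht n) as T1. pose proof (Ht (- n - 1)%Z) as T2.
  pose proof (Hx n) as X1. pose proof (Hx (- n - 1)%Z) as X2.
  unfold n in *.
  replace (Z.of_nat N + 1)%Z with (Z.of_nat (S N)) in HL by lia.
  replace (Z.of_nat N + 2)%Z with (Z.of_nat (S N) + 1)%Z in HL by lia.
  replace (- Z.of_nat N - 1)%Z with (- Z.of_nat (S N))%Z in HL by lia.
  replace (- Z.of_nat N - 2)%Z with (- Z.of_nat (S N) - 1)%Z in HL by lia.
  replace (- Z.of_nat (S N) - 1 + 1)%Z with (- Z.of_nat (S N))%Z in T2, X2 by lia.
  set (n' := Z.of_nat (S N)) in *.
  apply Rabs_le_between in T1, T2, X1, X2.
  assert (Hl : forall q, 0 <= l q) by (intros; apply sym_sum_pos; auto).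
  assert (Hr : forall p, 0 <= r p) by (intros; apply sym_sum_pos; auto).
  pose proof (Hl n'); pose proof (Hl (n'+1)%Z); pose proof (Hl (-n')%Z); pose proof (Hl (-n'-1)%Z).
  pose proof (Hr n'); pose proof (Hr (n'+1)%Z); pose proof (Hr (-n')%Z); pose proof (Hr (-n'-1)%Z).
  set (LL := l n' + l (n'+1)%Z + l (-n')%Z + l (-n'-1)%Z) in *.
  set (RR := r n' + r (n'+1)%Z + r (-n')%Z + r (-n'-1)%Z) in *.
  assert (HL0 : 0 <= LL) by (unfold LL; lra). assert (HR0 : 0 <= RR) by (unfold RR; lra).
  assert (Hfin : k * box_sum (S N) e <= LL / 2 + c * (RR / 2)).
  { rewrite Hsum.
    assert (- (sym_sum (S N) (fun q => Jx n' q) - sym_sum (S N) (fun q => Jx (- n' - 1)%Z q)) <= RR / 2).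
    { unfold RR. lra. }
    assert (c * - (sym_sum (S N) (fun q => Jx n' q) - sym_sum (S N) (fun q => Jx (- n' - 1)%Z q)) <= c * (RR / 2)) by (apply Rmult_le_compat_l; lra).
    unfold LL. lra. }
  assert (LL + RR <= 2 * (box_sum (S (S N)) e - box_sum N e)) by lra.
  assert (LL / 2 + c * (RR / 2) <= (1 + c) * ((LL + RR) / 2)) by (assert (0 <= c * LL) by (apply Rmult_le_pos; lra); lra).
  assert ((1 + c) * ((LL + RR) / 2) <= (1 + c) * (box_sum (S (S N)) e - box_sum N e)) by (apply Rmult_le_compat_l; lra).
  assert (k * box_sum (S N) e <= (1 + c) * (box_sum (S (S N)) e - box_sum N e)) by lra.
  assert (0 <= box_sum (S (S N)) e - box_sum N e) by lra.
  apply Rmult_le_reg_l with (2 * (1 + c)); [lra|].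
  replace (2 * (1 + c) * (k / (2 * (1 + c)) * box_sum (S N) e)) with (k * box_sum (S N) e) by (field; lra).
  assert (0 <= (1 + c) * (box_sum (S (S N)) e - box_sum N e)) by (apply Rmult_le_pos; lra). lra. }
intros p q. specialize (Hz p q). unfold e in Hz.
apply Cmod_eq_0. apply Rsqr_0_uniq. rewrite Rsqr_pow2. exact Hz.
Qed.

Definition norm1 (M : R) : R := / sqrt (1 + M ^ 2).
Definition norm2 (d : R) : R := / sqrt (1 - d ^ 2).

Lemma norm1_pos M : 0 < norm1 M.
Proof. apply Rinv_0_lt_compat, sqrt_lt_R0. nra. Qed.

Lemma norm1_sqr M : norm1 M * norm1 M * (1 + M * M) = 1.
Proof.
unfold norm1. assert (H : 0 < 1 + M ^ 2) by nra.
rewrite <- Rinv_mult, sqrt_sqrt by lra. field. nra.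
Qed.

Lemma norm2_pos d : 0 < d < 1 -> 0 < norm2 d.
Proof. intros; apply Rinv_0_lt_compat, sqrt_lt_R0. nra. Qed.

Lemma norm2_sqr d : d ^ 2 < 1 -> norm2 d * norm2 d * (1 - d * d) = 1.
Proof.
intros Hd. unfold norm2. assert (H : 0 < 1 - d ^ 2) by nra.
rewrite <- Rinv_mult, sqrt_sqrt by lra. field. nra.
Qed.

(** * Elimination of the half-integer sites, and uniqueness *)

Section System.
Variables m eps d : R.
Let M := m * eps.
Let c := norm1 M * norm2 d.
Hypothesis HM : 0 < M.
Hypothesis Hd : 0 < d < 1.

(** The half-steps are normalized so that a full time step has determinant 1; this gives the value
    at time [q - 1] the coefficient 1 in the second-order equation. *)
Lemma system_det : c * c * ((1 + M * M) * (1 - d * d)) = 1.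
Proof.
unfold c. replace (norm1 M * norm2 d * (norm1 M * norm2 d) * ((1 + M * M) * (1 - d * d)))
 with ((norm1 M * norm1 M * (1 + M * M)) * (norm2 d * norm2 d * (1 - d * d))) by ring.
rewrite norm1_sqr, norm2_sqr; nra.
Qed.

Lemma even_double p : Z.even (2 * p) = true.
Proof. rewrite Z.even_mul; reflexivity. Qed.

Lemma odd_double_p1 p : Z.odd (2 * p + 1) = true.
Proof. rewrite Z.odd_add, Z.odd_mul; reflexivity. Qed.

Lemma odd_double_m1 p : Z.odd (2 * p - 1) = true.
Proof. rewrite Z.odd_sub, Z.odd_mul; reflexivity. Qed.

Lemma norm1_meps : / sqrt (1 + m ^ 2 * eps ^ 2) = norm1 M.
Proof. unfold norm1, M. repeat f_equal. ring. Qed.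

(** The clause at odd sites expresses them through the even sites half a step earlier; substituted
    into the clause at even sites, it leaves a one-step recurrence in time. *)
Lemma system_even A1 A2 : lattice_system m eps d A1 A2 ->
  let a1 p q := A1 (2 * p)%Z (2 * q)%Z in let a2 p q := A2 (2 * p)%Z (2 * q)%Z in
  forall p q,
   (a1 p (q + 1)%Z = RtoC c * (a1 (p + 1)%Z q - Ci * RtoC d * a2 (p + 1)%Z q
                     + RtoC M * a2 p q + Ci * RtoC (M * d) * a1 p q) /\
   a2 p (q + 1)%Z = RtoC c * (a2 (p - 1)%Z q + Ci * RtoC d * a1 (p - 1)%Z q
                     - RtoC M * a1 p q + Ci * RtoC (M * d) * a2 p q) + RtoC 2 * kron00 p (q + 1))%C.
Proof.
intros [He [Ho _]] a1 a2 p q. unfold a1, a2.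
destruct (He (2 * p)%Z (2 * (q + 1))%Z) as [E1 E2]; try apply even_double.
rewrite norm1_meps in E1, E2. change (m * eps) with M in E1, E2.
replace (2 * (q + 1) - 1)%Z with (2 * q + 1)%Z in E1, E2 by lia.
assert (H1 := Ho (2 * p + 1)%Z (2 * q + 1)%Z (odd_double_p1 _) (odd_double_p1 _)).
assert (H2 := Ho (2 * p - 1)%Z (2 * q + 1)%Z (odd_double_m1 _) (odd_double_p1 _)).
fold (norm2 d) in H1, H2.
destruct H1 as [H11 H12], H2 as [H21 H22].
replace (2 * q + 1 - 1)%Z with (2 * q)%Z in * by lia.
replace (2 * p + 1 - 1)%Z with (2 * p)%Z in * by lia.
replace (2 * p - 1 + 1)%Z with (2 * p)%Z in * by lia.
replace (2 * p + 1 + 1)%Z with (2 * (p + 1))%Z in * by lia.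
replace (2 * p - 1 - 1)%Z with (2 * (p - 1))%Z in * by lia.
replace (kron00 (2 * p) (2 * (q + 1))) with (kron00 p (q + 1)) in E2.
2:{ unfold kron00. replace (Z.eqb (2 * p) 0) with (Z.eqb p 0).
    replace (Z.eqb (2 * (q + 1)) 0) with (Z.eqb (q + 1) 0). reflexivity.
    destruct (Z.eqb_spec (q + 1) 0), (Z.eqb_spec (2 * (q + 1)) 0); auto; lia.
    destruct (Z.eqb_spec p 0), (Z.eqb_spec (2 * p) 0); auto; lia. }
rewrite E1, E2, H11, H12, H21, H22. unfold c. rewrite !RtoC_mult.
assert (Hi : (Ci * Ci = - (1))%C) by (unfold Ci, Cmult, Copp, RtoC; simpl; f_equal; ring).
split; ring.
Qed.

(** Cayley-Hamilton for the time step, a two by two matrix over the commuting spatial shifts: its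
    trace is [c] times the sum of the two shifts plus [2 i c M d], and its determinant is 1. *)
Lemma homogeneous_KG (b1 b2 : Z -> Z -> C) :
  (forall p q,
   (b1 p (q + 1)%Z = RtoC c * (b1 (p + 1)%Z q - Ci * RtoC d * b2 (p + 1)%Z q
                     + RtoC M * b2 p q + Ci * RtoC (M * d) * b1 p q) /\
   b2 p (q + 1)%Z = RtoC c * (b2 (p - 1)%Z q + Ci * RtoC d * b1 (p - 1)%Z q
                     - RtoC M * b1 p q + Ci * RtoC (M * d) * b2 p q))%C) ->
  forall p q,
   (b1 p (q + 1)%Z + b1 p (q - 1)%Z =
     RtoC c * (b1 (p + 1)%Z q + b1 (p - 1)%Z q) + Ci * RtoC (2 * c * M * d) * b1 p q /\
    b2 p (q + 1)%Z + b2 p (q - 1)%Z =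
     RtoC c * (b2 (p + 1)%Z q + b2 (p - 1)%Z q) + Ci * RtoC (2 * c * M * d) * b2 p q)%C.
Proof.
intros H p q.
assert (Hc : (RtoC c * RtoC c * ((1 + RtoC M * RtoC M) * (1 - RtoC d * RtoC d)) = 1)%C).
{ rewrite <- !RtoC_mult, <- RtoC_plus, <- RtoC_minus, <- !RtoC_mult, system_det. reflexivity. }
assert (Hi : (Ci * Ci = - (1))%C) by (unfold Ci, Cmult, Copp, RtoC; simpl; f_equal; ring).
destruct (H p q) as [E1 E2]. rewrite E1, E2. clear E1 E2.
pose proof (H p (q - 1)%Z) as E0. pose proof (H (p + 1)%Z (q - 1)%Z) as Ep. pose proof (H (p - 1)%Z (q - 1)%Z) as Em.
replace (q - 1 + 1)%Z with q in * by lia.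
replace (p + 1 - 1)%Z with p in * by lia.
replace (p - 1 + 1)%Z with p in * by lia.
destruct E0 as [E01 E02], Ep as [Ep1 Ep2], Em as [Em1 Em2].
rewrite !RtoC_mult in *.
set (C := RtoC c) in *. set (D := RtoC d) in *. set (m' := RtoC M) in *.
rewrite Ep2, Em1.
set (x1 := b1 (p + 1)%Z q). set (x2 := b2 (p - 1)%Z q).
set (u1 := b1 p (q - 1)%Z) in *. set (u2 := b2 p (q - 1)%Z) in *.
set (v1 := b1 (p + 1)%Z (q-1)%Z) in *. set (v2 := b2 (p + 1)%Z (q-1)%Z) in *.
set (w1 := b1 (p - 1)%Z (q-1)%Z) in *. set (w2 := b2 (p - 1)%Z (q-1)%Z) in *.
rewrite E01, E02.
(* The determinant identity is applied only to the term at [q - 1]; what remains is a polynomial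
   identity modulo [Ci * Ci = -1]. *)
assert (K : forall z : Complex.C, (z = C * C * ((1 + m' * m') * (1 - D * D)) * z)%C) by (intros; rewrite Hc; ring).
split.
- match goal with |- (?X + u1)%C = _ => transitivity (X + C * C * ((1 + m' * m') * (1 - D * D)) * u1)%C end;
  [rewrite <- (K u1); reflexivity|ring [Hi]].
- match goal with |- (?X + u2)%C = _ => transitivity (X + C * C * ((1 + m' * m') * (1 - D * D)) * u2)%C end;
  [rewrite <- (K u2); reflexivity|ring [Hi]].
Qed.

(** The source cancels in the difference of two solutions, whose components then satisfy the
    homogeneous equation with [k = 2 c M d]. Since [d > 0] this is positive and [KG_l2_unique]
    applies. Even sites are the ones at which the propagator is read. *)
Lemma lattice_system_unique A1 A2 B1 B2 :
  lattice_system m eps d A1 A2 -> lattice_system m eps d B1 B2 ->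
  forall p q, A1 (2 * p)%Z (2 * q)%Z = B1 (2 * p)%Z (2 * q)%Z /\
              A2 (2 * p)%Z (2 * q)%Z = B2 (2 * p)%Z (2 * q)%Z.
Proof.
intros HA HB.
pose proof (system_even _ _ HA) as EA. pose proof (system_even _ _ HB) as EB. cbv zeta in EA, EB.
destruct HA as [_ [_ [SA HSA]]]. destruct HB as [_ [_ [SB HSB]]].
set (b1 := fun p q => (A1 (2 * p)%Z (2 * q)%Z - B1 (2 * p)%Z (2 * q)%Z)%C).
set (b2 := fun p q => (A2 (2 * p)%Z (2 * q)%Z - B2 (2 * p)%Z (2 * q)%Z)%C).
pose proof (homogeneous_KG b1 b2) as HKG.
assert (Hcpos : 0 < c) by (apply Rmult_lt_0_compat; [apply norm1_pos|apply norm2_pos; auto]).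
assert (Hk : 0 < 2 * c * M * d) by (apply Rmult_lt_0_compat; [apply Rmult_lt_0_compat; [lra|auto]|lra]).
assert (Hdiff : forall u v : C, Cmod (u - v) ^ 2 <= 2 * Cmod u ^ 2 + 2 * Cmod v ^ 2).
{ intros [u1 u2] [v1 v2]. rewrite !Cmod_sqr. simpl.
  pose proof (pow2_ge_0 (u1 + v1)). pose proof (pow2_ge_0 (u2 + v2)). nra. }
assert (HS : forall N, box_sum N (fun p q => Cmod (b1 p q) ^ 2 + Cmod (b2 p q) ^ 2) <= 2 * SA + 2 * SB).
{ intros N.
  set (ea := fun p q : Z => Cmod (A1 (2 * p)%Z (2 * q)%Z) ^ 2 + Cmod (A2 (2 * p)%Z (2 * q)%Z) ^ 2).
  set (eb := fun p q : Z => Cmod (B1 (2 * p)%Z (2 * q)%Z) ^ 2 + Cmod (B2 (2 * p)%Z (2 * q)%Z) ^ 2).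
  apply Rle_trans with (2 * box_sum N ea + 2 * box_sum N eb).
  - unfold box_sum. rewrite <- !sym_sum_scal, <- sym_sum_plus. apply sym_sum_le; intros p.
    rewrite <- !sym_sum_scal, <- sym_sum_plus. apply sym_sum_le; intros q. unfold b1, b2, ea, eb.
    pose proof (Hdiff (A1 (2 * p)%Z (2 * q)%Z) (B1 (2 * p)%Z (2 * q)%Z)).
    pose proof (Hdiff (A2 (2 * p)%Z (2 * q)%Z) (B2 (2 * p)%Z (2 * q)%Z)). lra.
  - specialize (HSA N). specialize (HSB N).
    change (box_sum N ea <= SA) in HSA. change (box_sum N eb <= SB) in HSB. lra. }
assert (HKG' : forall p q, (b1 p (q + 1)%Z = RtoC c * (b1 (p + 1)%Z q - Ci * RtoC d * b2 (p + 1)%Z q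
                     + RtoC M * b2 p q + Ci * RtoC (M * d) * b1 p q) /\
   b2 p (q + 1)%Z = RtoC c * (b2 (p - 1)%Z q + Ci * RtoC d * b1 (p - 1)%Z q
                     - RtoC M * b1 p q + Ci * RtoC (M * d) * b2 p q))%C).
{ intros p q. destruct (EA p q) as [a1 a2], (EB p q) as [c1 c2]. unfold b1, b2.
  rewrite a1, a2, c1, c2. split; ring. }
specialize (HKG HKG').
assert (Hsub : forall (f : Z -> Z -> R) N, (forall p q, f p q <= Cmod (b1 p q) ^ 2 + Cmod (b2 p q) ^ 2) ->
   box_sum N f <= 2 * SA + 2 * SB).
{ intros f N Hf. eapply Rle_trans; [|apply (HS N)]. unfold box_sum.
  apply sym_sum_le; intros p; apply sym_sum_le; intros q; apply Hf. }
intros p q. split.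
- assert (H := KG_l2_unique b1 c (2 * c * M * d) (2 * SA + 2 * SB) Hcpos Hk (fun p q => proj1 (HKG p q))).
  assert (H0 : b1 p q = RtoC 0).
  { apply H. intros N. apply Hsub. intros; pose proof (pow2_ge_0 (Cmod (b2 p0 q0))); lra. }
  unfold b1 in H0. replace (A1 (2 * p)%Z (2 * q)%Z) with (A1 (2 * p)%Z (2 * q)%Z - B1 (2 * p)%Z (2 * q)%Z + B1 (2 * p)%Z (2 * q)%Z)%C by ring.
  rewrite H0. ring.
- assert (H := KG_l2_unique b2 c (2 * c * M * d) (2 * SA + 2 * SB) Hcpos Hk (fun p q => proj2 (HKG p q))).
  assert (H0 : b2 p q = RtoC 0).
  { apply H. intros N. apply Hsub. intros; pose proof (pow2_ge_0 (Cmod (b1 p0 q0))); lra. }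
  unfold b2 in H0. replace (A2 (2 * p)%Z (2 * q)%Z) with (A2 (2 * p)%Z (2 * q)%Z - B2 (2 * p)%Z (2 * q)%Z + B2 (2 * p)%Z (2 * q)%Z)%C by ring.
  rewrite H0. ring.
Qed.

End System.

Lemma sym_sum_shift N f : (forall z, 0 <= f z) ->
  sym_sum N (fun z => f (z + 1)%Z) <= sym_sum (S N) f.
Proof.
intros Hf.
assert (H := sym_sum_telescope N (fun q => f (q + 1)%Z)). cbv beta in H.
rewrite (sym_sum_ext _ _ (fun q => f (q + 1)%Z - f q)) in H
  by (intros; do 2 f_equal; lia).
rewrite sym_sum_minus in H.
replace (- Z.of_nat N - 1 + 1)%Z with (- Z.of_nat N)%Z in H by lia.
rewrite sym_sum_S. replace (Z.of_nat (S N)) with (Z.of_nat N + 1)%Z by lia.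
pose proof (Hf (- Z.of_nat N)%Z). pose proof (Hf (- (Z.of_nat N + 1))%Z). lra.
Qed.

Lemma box_sum_le N e f : (forall p q, e p q <= f p q) -> box_sum N e <= box_sum N f.
Proof. intros H; apply sym_sum_le; intros; apply sym_sum_le; auto. Qed.

Lemma box_sum_plus N e f : box_sum N (fun p q => e p q + f p q) = box_sum N e + box_sum N f.
Proof. unfold box_sum. rewrite <- sym_sum_plus. apply sym_sum_ext; intros; apply sym_sum_plus. Qed.

Lemma box_sum_scal N k e : box_sum N (fun p q => k * e p q) = k * box_sum N e.
Proof. unfold box_sum. rewrite <- sym_sum_scal. apply sym_sum_ext; intros; apply sym_sum_scal. Qed.

(** * From a scalar Green function back to a solution of the system *)

Section Build.
Variables m eps d : R.
Let M := m * eps.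
Let c := norm1 M * norm2 d.
Hypothesis HM : 0 < M.
Hypothesis Hd : 0 < d < 1.
Variable G : Z -> Z -> C.
Hypothesis HG : forall p q, (G p (q + 1)%Z + G p (q - 1)%Z =
   RtoC c * (G (p + 1)%Z q + G (p - 1)%Z q) + Ci * RtoC (2 * c * M * d) * G p q + RtoC 2 * kron00 p q)%C.
Hypothesis HG2 : exists B, forall N, box_sum N (fun p q => Cmod (G p q) ^ 2) <= B.

(** If [T] is the time step matrix and [E] the time shift, then [det (E - T)] is [E] times the
    Klein-Gordon operator. A source in the second component is therefore answered by the second
    column of the adjugate of [E - T] applied to [G]; [green1] and [green2] are its entries. *)
Definition green1 p q := (RtoC c * (RtoC M * G p q - Ci * RtoC d * G (p + 1)%Z q))%C.
Definition green2 p q := (G p (q + 1)%Z - RtoC c * (G (p + 1)%Z q + Ci * RtoC (M * d) * G p q))%C.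

(** Odd sites are filled in by the clause that defines them. The parity of [a] alone decides, since
    the system only relates sites where [a] and [b] have equal parity. *)
Definition green_sol1 (a b : Z) : C :=
  if Z.even a then green1 (a / 2) (b / 2) else
  (RtoC (norm2 d) * (green1 ((a + 1) / 2) ((b - 1) / 2) - Ci * RtoC d * green2 ((a + 1) / 2) ((b - 1) / 2)))%C.
Definition green_sol2 (a b : Z) : C :=
  if Z.even a then green2 (a / 2) (b / 2) else
  (RtoC (norm2 d) * (green2 ((a - 1) / 2) ((b - 1) / 2) + Ci * RtoC d * green1 ((a - 1) / 2) ((b - 1) / 2)))%C.

Lemma green_sol1_even p q : green_sol1 (2 * p) (2 * q) = green1 p q.
Proof. unfold green_sol1. rewrite even_double. f_equal; rewrite Z.mul_comm; apply Z.div_mul; lia. Qed.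

Lemma green_sol2_even p q : green_sol2 (2 * p) (2 * q) = green2 p q.
Proof. unfold green_sol2. rewrite even_double. f_equal; rewrite Z.mul_comm; apply Z.div_mul; lia. Qed.

Lemma green_l2 : exists B, forall N,
  box_sum N (fun p q => Cmod (green1 p q) ^ 2 + Cmod (green2 p q) ^ 2) <= B.
Proof.
destruct HG2 as [B HB].
set (e := fun p q => Cmod (G p q) ^ 2) in *.
assert (He : forall p q, 0 <= e p q) by (intros; apply pow2_ge_0).
assert (Hc : 0 < c) by (apply Rmult_lt_0_compat; [apply norm1_pos|apply norm2_pos; auto]).
set (K := 1 + c + c * M + c * d + c * (M * d)).
assert (HK : 0 <= K).
{ assert (0 <= c * M) by (apply Rmult_le_pos; lra). assert (0 <= c * d) by (apply Rmult_le_pos; lra).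
  assert (0 <= c * (M * d)) by (apply Rmult_le_pos; [lra|apply Rmult_le_pos; lra]). unfold K; lra. }
(* Two components, three terms each by Cauchy-Schwarz with coefficients at most [K], and three
   translates of [G], each with square sum at most [B]. *)
exists (2 * (3 * K ^ 2) * (B + B + B)). intros N.
assert (Hpt : forall p q, Cmod (green1 p q) ^ 2 + Cmod (green2 p q) ^ 2 <=
   2 * (3 * K ^ 2) * (e p q + e (p + 1)%Z q + e p (q + 1)%Z)).
{ intros p q.
  set (x := Cmod (G p q)). set (y := Cmod (G (p+1)%Z q)). set (w := Cmod (G p (q+1)%Z)).
  assert (0 <= x) by apply Cmod_ge_0. assert (0 <= y) by apply Cmod_ge_0. assert (0 <= w) by apply Cmod_ge_0.
  assert (0 <= c * M) by (apply Rmult_le_pos; lra). assert (0 <= c * d) by (apply Rmult_le_pos; lra).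
  assert (0 <= c * (M * d)) by (apply Rmult_le_pos; [lra|apply Rmult_le_pos; lra]).
  assert (T : forall u v : C, Cmod (u - v) <= Cmod u + Cmod v).
  { intros u v; unfold Cminus. eapply Rle_trans; [apply Cmod_triangle|]. rewrite Cmod_opp. lra. }
  assert (B1 : Cmod (green1 p q) <= K * (x + y + w)).
  { unfold green1. rewrite Cmod_mult, Cmod_R, Rabs_pos_eq by lra.
    apply Rle_trans with (c * (M * x + d * y)).
    - apply Rmult_le_compat_l; [lra|]. eapply Rle_trans; [apply T|].
      rewrite !Cmod_mult, Cmod_Ci, !Cmod_R, !Rabs_pos_eq by lra. unfold x, y. lra.
    - assert (c * M * x <= c * M * (x + y + w)) by (apply Rmult_le_compat_l; lra).
      assert (c * d * y <= c * d * (x + y + w)) by (apply Rmult_le_compat_l; lra).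
      assert ((c * M + c * d) * (x + y + w) <= K * (x + y + w)) by (apply Rmult_le_compat_r; unfold K; lra). lra. }
  assert (B2 : Cmod (green2 p q) <= K * (x + y + w)).
  { unfold green2. eapply Rle_trans; [apply T|]. rewrite Cmod_mult, Cmod_R, Rabs_pos_eq by lra.
    apply Rle_trans with (w + c * (y + M * d * x)).
    - apply Rplus_le_compat_l, Rmult_le_compat_l; [lra|]. eapply Rle_trans; [apply Cmod_triangle|].
      rewrite !Cmod_mult, Cmod_Ci, !Cmod_R, !Rabs_pos_eq by (apply Rmult_le_pos; lra). unfold x, y. lra.
    - assert (c * (M * d) * x <= c * (M * d) * (x + y + w)) by (apply Rmult_le_compat_l; lra).
      assert (c * y <= c * (x + y + w)) by (apply Rmult_le_compat_l; lra).
      assert ((1 + c + c * (M * d)) * (x + y + w) <= K * (x + y + w)) by (apply Rmult_le_compat_r; unfold K; lra). lra. }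
  assert (S3 : (x + y + w) ^ 2 <= 3 * (x ^ 2 + y ^ 2 + w ^ 2)).
  { pose proof (pow2_ge_0 (x - y)). pose proof (pow2_ge_0 (x - w)). pose proof (pow2_ge_0 (y - w)). nra. }
  assert (Q1 : Cmod (green1 p q) ^ 2 <= (K * (x + y + w)) ^ 2) by (apply pow_incr; split; [apply Cmod_ge_0|auto]).
  assert (Q2 : Cmod (green2 p q) ^ 2 <= (K * (x + y + w)) ^ 2) by (apply pow_incr; split; [apply Cmod_ge_0|auto]).
  rewrite Rpow_mult_distr in Q1, Q2.
  assert (K ^ 2 * (x + y + w) ^ 2 <= K ^ 2 * (3 * (x ^ 2 + y ^ 2 + w ^ 2))) by (apply Rmult_le_compat_l; [apply pow2_ge_0|auto]).
  unfold e. fold x y w. lra. }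
eapply Rle_trans; [apply box_sum_le, Hpt|]. rewrite box_sum_scal, !box_sum_plus.
apply Rmult_le_compat_l; [pose proof (pow2_ge_0 K); lra|].
assert (box_sum N e <= B) by apply HB.
assert (box_sum N (fun p q => e (p + 1)%Z q) <= B).
{ eapply Rle_trans; [|apply (HB (S N))]. unfold box_sum.
  apply Rle_trans with (sym_sum (S N) (fun p => sym_sum N (fun q => e p q))).
  - apply (sym_sum_shift N (fun p => sym_sum N (fun q => e p q))). intros; apply sym_sum_pos; auto.
  - apply sym_sum_le; intros; apply sym_sum_mono; auto. }
assert (box_sum N (fun p q => e p (q + 1)%Z) <= B).
{ eapply Rle_trans; [|apply (HB (S N))]. unfold box_sum.
  apply Rle_trans with (sym_sum N (fun p => sym_sum (S N) (fun q => e p q))).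
  - apply sym_sum_le; intros; apply (sym_sum_shift N (fun q => e z q)); auto.
  - apply sym_sum_mono; intros; apply sym_sum_pos; auto. }
lra.
Qed.

Lemma green_system : lattice_system m eps d green_sol1 green_sol2.
Proof.
assert (Hi : (Ci * Ci = - (1))%C) by (unfold Ci, Cmult, Copp, RtoC; simpl; f_equal; ring).
assert (Hdet : (RtoC c * RtoC c * ((1 + RtoC M * RtoC M) * (1 - RtoC d * RtoC d)) = 1)%C).
{ unfold c. rewrite <- !RtoC_mult, <- RtoC_plus, <- RtoC_minus, <- !RtoC_mult.
  assert (E := system_det m eps d Hd). fold M in E. rewrite E. reflexivity. }
split; [|split].
- intros a b Ha Hb. apply Z.even_spec in Ha, Hb. destruct Ha as [p ->], Hb as [q ->].
  rewrite green_sol1_even, green_sol2_even.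
  replace (/ sqrt (1 + m ^ 2 * eps ^ 2)) with (norm1 M) by (symmetry; apply norm1_meps).
  change (m * eps) with M.
  unfold green_sol1, green_sol2.
  rewrite <- !Z.negb_odd, odd_double_p1, odd_double_m1. simpl negb. cbv iota.
  replace ((2 * p + 1 + 1) / 2)%Z with (p + 1)%Z by (replace (2 * p + 1 + 1)%Z with ((p + 1) * 2)%Z by lia; rewrite Z.div_mul; lia).
  replace ((2 * p + 1 - 1) / 2)%Z with p by (replace (2 * p + 1 - 1)%Z with (p * 2)%Z by lia; rewrite Z.div_mul; lia).
  replace ((2 * p - 1 + 1) / 2)%Z with p by (replace (2 * p - 1 + 1)%Z with (p * 2)%Z by lia; rewrite Z.div_mul; lia).
  replace ((2 * p - 1 - 1) / 2)%Z with (p - 1)%Z by (replace (2 * p - 1 - 1)%Z with ((p - 1) * 2)%Z by lia; rewrite Z.div_mul; lia).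
  replace ((2 * q - 1 - 1) / 2)%Z with (q - 1)%Z by (replace (2 * q - 1 - 1)%Z with ((q - 1) * 2)%Z by lia; rewrite Z.div_mul; lia).
  replace (kron00 (2 * p) (2 * q)) with (kron00 p q).
  2:{ unfold kron00. replace (Z.eqb (2 * p) 0) with (Z.eqb p 0).
    replace (Z.eqb (2 * q) 0) with (Z.eqb q 0). reflexivity.
    destruct (Z.eqb_spec q 0), (Z.eqb_spec (2 * q) 0); auto; lia.
    destruct (Z.eqb_spec p 0), (Z.eqb_spec (2 * p) 0); auto; lia. }
  pose proof (HG p q) as E. pose proof (HG (p + 1)%Z q) as Ep. 
  unfold green1, green2.
  replace (q - 1 + 1)%Z with q by lia.
  replace (p - 1 + 1)%Z with p by lia. 
  rewrite !RtoC_mult in *.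
  assert (Ecs : RtoC c = (RtoC (norm1 M) * RtoC (norm2 d))%C) by (unfold c; apply RtoC_mult).
  set (cc := RtoC c) in *. set (D := RtoC d) in *. set (m' := RtoC M) in *.
  set (n1 := RtoC (norm1 M)) in *. set (n2 := RtoC (norm2 d)) in *.
  split.
  + transitivity (cc * (m' * G p q - Ci * D * G (p + 1)%Z q))%C; [reflexivity|].
    transitivity (n1 * n2 * (m' * G p q - Ci * D * G (p + 1)%Z q))%C; [rewrite Ecs; ring|].
    ring [Hi].
  + set (g0 := G p (q - 1)%Z) in *. 
    (* The equation for [G] eliminates the value at [q + 1] and brings in the source; the remaining
       [g0] is multiplied by the determinant, equal to 1, to match the product of the two
       half-steps. *)
    assert (K : (g0 = cc * cc * ((1 + m' * m') * (1 - D * D)) * g0)%C) by (rewrite Hdet; ring).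
    assert (E' : (G p (q + 1)%Z = - g0 + (cc * (G (p + 1)%Z q + G (p - 1)%Z q) + Ci * (2 * cc * m' * D) * G p q +
        2 * kron00 p q))%C) by (rewrite <- E; ring).
    rewrite E'.
    transitivity (- (cc * cc * ((1 + m' * m') * (1 - D * D)) * g0) + (cc * (G (p + 1)%Z q + G (p - 1)%Z q) + Ci * (2 * cc * m' * D) * G p q +
        2 * kron00 p q) - cc * (G (p + 1)%Z q + Ci * (m' * D) * G p q))%C; [rewrite <- K; reflexivity|].
    rewrite Ecs. ring [Hi].
- intros a b Ha Hb. apply Z.odd_spec in Ha, Hb. destruct Ha as [p ->], Hb as [q ->].
  replace (2 * p + 1 + 1)%Z with (2 * (p + 1))%Z by lia.
  replace (2 * p + 1 - 1)%Z with (2 * p)%Z by lia.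
  replace (2 * q + 1 - 1)%Z with (2 * q)%Z by lia.
  rewrite !green_sol1_even, !green_sol2_even. fold (norm2 d).
  unfold green_sol1, green_sol2. rewrite <- !Z.negb_odd, odd_double_p1. simpl negb. cbv iota.
  replace (2 * p + 1 + 1)%Z with ((p + 1) * 2)%Z by lia.
  replace (2 * p + 1 - 1)%Z with (p * 2)%Z by lia.
  replace (2 * q + 1 - 1)%Z with (q * 2)%Z by lia.
  rewrite !Z.div_mul by lia. split; reflexivity.
- destruct green_l2 as [B HB]. exists B. intros N. eapply Rle_trans; [|apply (HB N)].
  apply Req_le. unfold box_sum. apply sum_eq; intros i _. apply sum_eq; intros j _.
  rewrite green_sol1_even, green_sol2_even. reflexivity.
Qed.
End Build.

(** Restores the type [R] in an equality stated over a convertible module carrier, where [ring]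
    would not find its structure. *)
Ltac ringR := match goal with |- @eq _ ?x ?y => change (@eq R x y) end; ring.

(** * Joint continuity, parametric integrals and complex-valued integrals *)

Lemma continuous_of_2d (f : R -> R -> R) x y :
  continuity_2d_pt f x y -> continuous (fun v => f x v) y.
Proof.
intros H. apply continuity_2d_pt_filterlim in H.
refine (filterlim_comp _ _ _ (fun v : R => (x, v)) (fun z : R * R => f (fst z) (snd z)) _ (locally (x, y)) _ _ H).
apply filterlim_locally. intros eps.
exists eps. intros v Hv. split; [apply ball_center|exact Hv].
Qed.

Lemma continuous_of_2d_l (f : R -> R -> R) x y :
  continuity_2d_pt f x y -> continuous (fun u => f u y) x.
Proof.
intros H. apply continuity_2d_pt_filterlim in H.
refine (filterlim_comp _ _ _ (fun u : R => (u, y)) (fun z : R * R => f (fst z) (snd z)) _ (locally (x, y)) _ _ H).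
apply filterlim_locally. intros eps.
exists eps. intros v Hv. split; [exact Hv|apply ball_center].
Qed.

Lemma ex_RInt_cont (f : R -> R) a b : (forall x, continuous f x) -> ex_RInt f a b.
Proof. intros H; apply (ex_RInt_continuous (V := R_CompleteNormedModule)); auto. Qed.

(** Uniform continuity of [f] near the compact segment. The [+ 1] in the chosen tolerance keeps its
    denominator positive when [a = b]. *)
Lemma RInt_param_continuous (f : R -> R -> R) a b x0 : a <= b ->
  (forall y, a <= y <= b -> continuity_2d_pt f x0 y) ->
  locally x0 (fun x => ex_RInt (f x) a b) ->
  continuous (fun x => RInt (f x) a b) x0.
Proof.
intros Hab Hf Hex.
apply filterlim_locally. intros eps.
assert (He : 0 < eps / (2 * (b - a + 1))) by (apply Rdiv_lt_0_compat; [apply cond_pos|lra]).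
destruct (uniform_continuity_2d_1d' f a b x0 Hf (mkposreal _ He)) as [dl Hd]. simpl in Hd.
destruct Hex as [d2 Hd2].
assert (Hm : 0 < Rmin dl d2) by (apply Rmin_pos; apply cond_pos).
exists (mkposreal _ Hm). intros x Hx. simpl in Hx.
unfold ball in Hx |- *; simpl in Hx |- *. unfold AbsRing_ball, abs, minus, plus, opp in *; simpl in *.
assert (Hx1 : Rabs (x - x0) < dl) by (eapply Rlt_le_trans; [exact Hx|apply Rmin_l]).
assert (Hx2 : Rabs (x - x0) < d2) by (eapply Rlt_le_trans; [exact Hx|apply Rmin_r]).
assert (E1 : ex_RInt (f x) a b) by (apply Hd2; exact Hx2).
assert (E0 : ex_RInt (f x0) a b) by (apply Hd2; apply ball_center).
replace (RInt (f x) a b + - RInt (f x0) a b) with (RInt (fun y => f x y - f x0 y) a b).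
2:{ rewrite (RInt_minus (f x) (f x0)); auto. }
eapply Rle_lt_trans.
{ apply (abs_RInt_le_const (fun y => f x y - f x0 y) a b (eps / (2 * (b - a + 1)))); auto.
  - apply (ex_RInt_minus (f x) (f x0)); auto.
  - intros t Ht. left. apply Hd; auto.
    + pose proof (cond_pos dl). split; lra.
    + apply Rabs_def2 in Hx1. lra.
    + replace (t - t) with 0 by ring. rewrite Rabs_R0. apply cond_pos. }
pose proof (cond_pos eps).
apply Rlt_le_trans with ((b - a + 1) * (eps / (b - a + 1))).
2:{ apply Req_le. field. lra. }
apply Rle_lt_trans with ((b - a + 1) * (eps / (2 * (b - a + 1)))).
- apply Rmult_le_compat_r; lra.
- apply Rmult_lt_compat_l; [lra|]. apply Rmult_lt_compat_l; auto.
  apply Rinv_lt_contravar; [|lra]. apply Rmult_lt_0_compat; lra.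
Qed.

(** Joint rather than separate continuity: it is what allows limits under the integral sign and
    restriction to curves. *)
Definition c2 (f : R -> R -> C) (x y : R) : Prop :=
  continuity_2d_pt (fun u v => fst (f u v)) x y /\ continuity_2d_pt (fun u v => snd (f u v)) x y.

Lemma c2_ext f g x y : (forall u v, f u v = g u v) -> c2 f x y -> c2 g x y.
Proof.
intros H [H1 H2]; split; [refine (continuity_2d_pt_ext _ _ _ _ _ H1)|refine (continuity_2d_pt_ext _ _ _ _ _ H2)];
  intros; cbv beta; rewrite H; reflexivity.
Qed.

Lemma c2_const k x y : c2 (fun _ _ => k) x y.
Proof. split; apply continuity_2d_pt_const. Qed.

Lemma c2_pair f g x y : continuity_2d_pt f x y -> continuity_2d_pt g x y ->
  c2 (fun u v => (f u v, g u v)) x y.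
Proof. intros; split; auto. Qed.

Lemma c2_plus f g x y : c2 f x y -> c2 g x y -> c2 (fun u v => f u v + g u v)%C x y.
Proof. intros [H1 H2] [H3 H4]; split; simpl; apply continuity_2d_pt_plus; auto. Qed.

Lemma c2_opp f x y : c2 f x y -> c2 (fun u v => - f u v)%C x y.
Proof. intros [H1 H2]; split; simpl; apply continuity_2d_pt_opp; auto. Qed.

Lemma c2_minus f g x y : c2 f x y -> c2 g x y -> c2 (fun u v => f u v - g u v)%C x y.
Proof. intros; apply c2_plus; auto; apply c2_opp; auto. Qed.

Lemma c2_mult f g x y : c2 f x y -> c2 g x y -> c2 (fun u v => f u v * g u v)%C x y.
Proof.
intros [H1 H2] [H3 H4]; split; simpl.
- apply continuity_2d_pt_minus; apply continuity_2d_pt_mult; auto.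
- apply continuity_2d_pt_plus; apply continuity_2d_pt_mult; auto.
Qed.

Lemma c2_pow f n x y : c2 f x y -> c2 (fun u v => f u v ^ n)%C x y.
Proof.
intros H; induction n as [|n IH]; simpl.
- apply c2_const.
- apply (c2_mult f (fun u v => (f u v ^ n)%C)); auto.
Qed.

Lemma Cnonzero_sqr (z : C) : z <> RtoC 0 -> 0 < fst z ^ 2 + snd z ^ 2.
Proof. intros H. rewrite <- Cmod_sqr. apply pow_lt. apply Cmod_gt_0. auto. Qed.

Lemma c2_inv f x y : c2 f x y -> f x y <> RtoC 0 -> c2 (fun u v => / f u v)%C x y.
Proof.
intros [H1 H2] H0. apply Cnonzero_sqr in H0.
assert (K : continuity_2d_pt (fun u v => / (fst (f u v) ^ 2 + snd (f u v) ^ 2)) x y).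
{ apply continuity_2d_pt_inv; [|lra].
  apply continuity_2d_pt_ext with (fun u v => fst (f u v) * fst (f u v) + snd (f u v) * snd (f u v)).
  intros; ring. apply continuity_2d_pt_plus; apply continuity_2d_pt_mult; auto. }
split; simpl.
- apply (continuity_2d_pt_mult (fun u v => fst (f u v)) (fun u v => / (fst (f u v) ^ 2 + snd (f u v) ^ 2))); auto.
- apply (continuity_2d_pt_mult (fun u v => - snd (f u v)) (fun u v => / (fst (f u v) ^ 2 + snd (f u v) ^ 2))); auto.
  apply continuity_2d_pt_opp; auto.
Qed.

Lemma continuity_2d_pt_comp1 (g : R -> R) (f : R -> R -> R) x y :
  continuous g (f x y) -> continuity_2d_pt f x y -> continuity_2d_pt (fun u v => g (f u v)) x y.
Proof. intros H Hf. apply continuity_1d_2d_pt_comp; auto. apply continuity_pt_filterlim; auto. Qed.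

(** A square root only for arguments of positive real part. *)
Definition csqrt_right (z : C) : C :=
  let s := sqrt ((Cmod z + fst z) / 2) in (s, snd z / (2 * s)).

Lemma Cmod_ge_re (z : C) : Rabs (fst z) <= Cmod z.
Proof. apply re_le_Cmod. Qed.

Lemma csqrt_right_re z : 0 < fst z -> 0 < fst (csqrt_right z).
Proof. intros H. simpl. apply sqrt_lt_R0. pose proof (Cmod_ge_0 z). lra. Qed.

Lemma csqrt_right_sqr z : 0 < fst z -> (csqrt_right z * csqrt_right z = z)%C.
Proof.
intros H. pose proof (csqrt_right_re z H) as Hs. unfold csqrt_right in *. simpl in Hs.
set (s := sqrt _) in *.
assert (E : s * s = (Cmod z + fst z) / 2) by (apply sqrt_sqrt; pose proof (Cmod_ge_0 z); lra).
pose proof (Cmod_sqr z) as F.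
destruct z as [a b]. unfold Cmult. cbn [fst snd] in *. f_equal.
- apply Rmult_eq_reg_r with (s * s); [|nra].
  replace ((s * s - b / (2 * s) * (b / (2 * s))) * (s * s)) with ((s * s) * (s * s) - b ^ 2 / 4) by (field; lra).
  rewrite E. nra.
- field. lra.
Qed.

Lemma c2_csqrt_right f x y : c2 f x y -> 0 < fst (f x y) -> c2 (fun u v => csqrt_right (f u v)) x y.
Proof.
intros [H1 H2] H0.
assert (K : continuity_2d_pt (fun u v => sqrt ((Cmod (f u v) + fst (f u v)) / 2)) x y).
{ apply (continuity_2d_pt_comp1 sqrt (fun u v => (Cmod (f u v) + fst (f u v)) / 2)).
  - apply continuous_sqrt.
  - apply continuity_2d_pt_mult; [|apply continuity_2d_pt_const]. apply continuity_2d_pt_plus; auto.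
    unfold Cmod. apply (continuity_2d_pt_comp1 sqrt); [apply continuous_sqrt|].
    apply continuity_2d_pt_ext with (fun u v => fst (f u v) * fst (f u v) + snd (f u v) * snd (f u v)).
    intros; ring. apply continuity_2d_pt_plus; apply continuity_2d_pt_mult; auto. }
split; simpl; auto.
apply continuity_2d_pt_mult; auto. apply continuity_2d_pt_inv.
- apply continuity_2d_pt_mult; auto. apply continuity_2d_pt_const.
- pose proof (csqrt_right_re _ H0). simpl in *. lra.
Qed.

Definition CInt (f : R -> C) (a b : R) : C :=
  (RInt (fun x => fst (f x)) a b, RInt (fun x => snd (f x)) a b).

Definition ccont (f : R -> C) : Prop :=
  forall x, continuous (fun x => fst (f x)) x /\ continuous (fun x => snd (f x)) x.

Lemma ccont_c2 (f : R -> R -> C) x : (forall y, c2 f x y) -> ccont (f x).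
Proof. 
intros H y. destruct (H y) as [H1 H2]; split.
- apply (continuous_of_2d (fun u v => fst (f u v))); auto.
- apply (continuous_of_2d (fun u v => snd (f u v))); auto.
Qed.

Lemma c2_ccont f x y : ccont f -> c2 (fun _ v => f v) x y.
Proof.
intros H. destruct (H y) as [H1 H2]. split.
- apply (continuity_2d_pt_comp1 (fun v => fst (f v)) (fun _ v => v)); auto. apply continuity_2d_pt_id2.
- apply (continuity_2d_pt_comp1 (fun v => snd (f v)) (fun _ v => v)); auto. apply continuity_2d_pt_id2.
Qed.

Lemma ccont_RtoC (f : R -> R) : (forall x, continuous f x) -> ccont (fun x => RtoC (f x)).
Proof. intros H x; split; auto. apply continuous_const. Qed.

Lemma ccont_plus f g : ccont f -> ccont g -> ccont (fun x => f x + g x)%C.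
Proof. intros; apply (ccont_c2 (fun _ x => f x + g x)%C 0). intros; apply c2_plus; apply c2_ccont; auto. Qed.

Lemma ccont_mult f g : ccont f -> ccont g -> ccont (fun x => f x * g x)%C.
Proof. intros; apply (ccont_c2 (fun _ x => f x * g x)%C 0). intros; apply c2_mult; apply c2_ccont; auto. Qed.

Lemma ccont_const k : ccont (fun _ => k).
Proof. intros x; split; apply continuous_const. Qed.

Lemma CInt_ext f g a b : (forall x, f x = g x) -> CInt f a b = CInt g a b.
Proof. intros H; unfold CInt; f_equal; apply RInt_ext; intros; rewrite H; auto. Qed.

Lemma RInt_lin u v k1 k2 a b : ex_RInt u a b -> ex_RInt v a b ->
  RInt (fun x => k1 * u x + k2 * v x) a b = k1 * RInt u a b + k2 * RInt v a b.
Proof.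
intros Hu Hv. apply is_RInt_unique.
apply (is_RInt_plus (V := R_NormedModule) (fun x => k1 * u x) (fun x => k2 * v x)).
- apply (is_RInt_scal (V := R_NormedModule) u). apply (RInt_correct (V := R_CompleteNormedModule)); auto.
- apply (is_RInt_scal (V := R_NormedModule) v). apply (RInt_correct (V := R_CompleteNormedModule)); auto.
Qed.

Lemma RInt_plus_R u v a b : ex_RInt u a b -> ex_RInt v a b ->
  RInt (fun x => u x + v x) a b = RInt u a b + RInt v a b.
Proof.
intros Hu Hv. rewrite (RInt_ext _ (fun x => 1 * u x + 1 * v x)) by (intros; rewrite !Rmult_1_l; reflexivity).
rewrite RInt_lin by auto. ringR.
Qed.

Lemma ccont_ex_fst f a b : ccont f -> ex_RInt (fun x => fst (f x)) a b.
Proof. intros Hf. apply ex_RInt_cont. intros x. exact (proj1 (Hf x)). Qed.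

Lemma ccont_ex_snd f a b : ccont f -> ex_RInt (fun x => snd (f x)) a b.
Proof. intros Hf. apply ex_RInt_cont. intros x. exact (proj2 (Hf x)). Qed.

Lemma CInt_plus f g a b : ccont f -> ccont g ->
  CInt (fun x => f x + g x)%C a b = (CInt f a b + CInt g a b)%C.
Proof.
intros Hf Hg. unfold CInt, Cplus; cbn [fst snd].
f_equal.
- exact (RInt_plus_R _ _ a b (ccont_ex_fst f a b Hf) (ccont_ex_fst g a b Hg)).
- exact (RInt_plus_R _ _ a b (ccont_ex_snd f a b Hf) (ccont_ex_snd g a b Hg)).
Qed.

Lemma CInt_scal k f a b : ccont f -> CInt (fun x => k * f x)%C a b = (k * CInt f a b)%C.
Proof.
intros Hf. destruct k as [k1 k2].
assert (E1 : ex_RInt (fun x => fst (f x)) a b) by exact (ccont_ex_fst f a b Hf).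
assert (E2 : ex_RInt (fun x => snd (f x)) a b) by exact (ccont_ex_snd f a b Hf).
unfold CInt, Cmult; cbn [fst snd]. f_equal.
- rewrite (RInt_ext _ (fun x => k1 * fst (f x) + (- k2) * snd (f x)))
    by (intros; unfold Rminus; rewrite Ropp_mult_distr_l; reflexivity).
  rewrite RInt_lin by auto. ringR.
- rewrite RInt_lin by auto. ringR.
Qed.

Lemma ccont_scal k f : ccont f -> ccont (fun x => k * f x)%C.
Proof. intros Hf. exact (ccont_mult (fun _ => k) f (ccont_const k) Hf). Qed.

Lemma CInt_lin k1 k2 f g a b : ccont f -> ccont g ->
  CInt (fun x => k1 * f x + k2 * g x)%C a b = (k1 * CInt f a b + k2 * CInt g a b)%C.
Proof.
intros Hf Hg.
rewrite (CInt_plus (fun x => k1 * f x)%C (fun x => k2 * g x)%C a b (ccont_scal _ _ Hf) (ccont_scal _ _ Hg)).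
rewrite (CInt_scal k1 f a b Hf), (CInt_scal k2 g a b Hg). reflexivity.
Qed.

Lemma CInt_lin3 k1 k2 k3 f g h a b : ccont f -> ccont g -> ccont h ->
  CInt (fun x => k1 * f x + (k2 * g x + k3 * h x))%C a b
   = (k1 * CInt f a b + (k2 * CInt g a b + k3 * CInt h a b))%C.
Proof.
intros Hf Hg Hh.
rewrite (CInt_plus (fun x => k1 * f x)%C (fun x => k2 * g x + k3 * h x)%C a b (ccont_scal _ _ Hf)
  (ccont_plus _ _ (ccont_scal _ _ Hg) (ccont_scal _ _ Hh))).
rewrite (CInt_scal k1 f a b Hf), (CInt_lin k2 k3 g h a b Hg Hh). reflexivity.
Qed.

Lemma RInt_scal_R u k a b : ex_RInt u a b -> RInt (fun x => k * u x) a b = k * RInt u a b.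
Proof. intros Hu. exact (RInt_scal (V := R_CompleteNormedModule) u a b k Hu). Qed.

Lemma sin_IZR_PI n : sin (IZR n * PI) = 0.
Proof. apply sin_eq_0_1. exists n; ring. Qed.

Lemma continuous_cos_lin k x : continuous (fun p => cos (k * p)) x.
Proof. apply (continuous_comp (fun p => k * p) cos); [|apply continuous_cos].
apply (continuous_mult (K := R_AbsRing) (fun _ => k) (fun p => p)); [apply continuous_const|apply continuous_id]. Qed.

Lemma RInt_cos_IZR n : RInt (fun p => cos (IZR n * p)) 0 PI = if Z.eqb n 0 then PI else 0.
Proof.
destruct (Z.eqb_spec n 0) as [->|Hn].
- rewrite (RInt_ext _ (fun _ => 1)) by (intros; rewrite Rmult_0_l, cos_0; reflexivity).
  rewrite RInt_const. unfold scal; simpl; unfold mult; simpl. ring.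
- assert (Hn' : IZR n <> 0) by (apply not_0_IZR; auto).
  rewrite (is_RInt_unique _ _ _ _ (is_RInt_derive (V := R_CompleteNormedModule)
    (fun p => sin (IZR n * p) / IZR n) (fun p => cos (IZR n * p)) 0 PI
    ltac:(intros x _; auto_derive; auto; field; auto) ltac:(intros x _; apply continuous_cos_lin))).
  unfold minus, plus, opp; simpl. rewrite sin_IZR_PI, Rmult_0_r, sin_0. field. auto.
Qed.

Lemma continuous_mult_R (f g : R -> R) x : continuous f x -> continuous g x -> continuous (fun x => f x * g x) x.
Proof. apply (continuous_mult (K := R_AbsRing)). Qed.

Lemma continuous_plus_R (f g : R -> R) x : continuous f x -> continuous g x -> continuous (fun x => f x + g x) x.
Proof. apply (continuous_plus (V := R_NormedModule)). Qed.

Lemma RInt_cos_cos k l : RInt (fun p => cos (IZR k * p) * cos (IZR l * p)) 0 PI =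
  / 2 * (if Z.eqb (k - l) 0 then PI else 0) + / 2 * (if Z.eqb (k + l) 0 then PI else 0).
Proof.
rewrite (RInt_ext _ (fun p => / 2 * cos (IZR (k - l) * p) + / 2 * cos (IZR (k + l) * p))).
- rewrite (RInt_lin (fun p => cos (IZR (k - l) * p)) (fun p => cos (IZR (k + l) * p)))
    by (apply ex_RInt_cont; intros; apply continuous_cos_lin).
  rewrite !RInt_cos_IZR. reflexivity.
- intros p _. rewrite minus_IZR, plus_IZR, Rmult_minus_distr_r, Rmult_plus_distr_r, cos_minus, cos_plus.
  match goal with |- @eq _ ?x ?y => change (@eq R x y) end. field.
Qed.

(** * Bessel's inequality for cosine coefficients *)

Section Bessel.
Variable h : R -> R.
Hypothesis Hh : forall x, continuous h x.
Let a (k : Z) := RInt (fun p => cos (IZR k * p) * h p) 0 PI.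

(** The remainder of [h] after removing its projections on [cos p], ..., [cos (N p)]. The constant
    mode, whose norm on [[0, PI]] is different, stays in and is estimated apart. *)
Fixpoint cos_residual (N : nat) : R -> R :=
  match N with
  | O => h
  | S n => fun p => cos_residual n p + (- (2 / PI) * a (Z.of_nat (S n))) * cos (IZR (Z.of_nat (S n)) * p)
  end.

Lemma cos_residual_cont N x : continuous (cos_residual N) x.
Proof.
revert x; induction N as [|N IH]; intros x; simpl; auto.
apply continuous_plus_R; auto.
apply continuous_mult_R; [apply continuous_const|apply continuous_cos_lin].
Qed.

Lemma cos_residual_coef N k : (Z.of_nat N < k)%Z ->
  RInt (fun p => cos (IZR k * p) * cos_residual N p) 0 PI = a k.
Proof.
induction N as [|N IH]; intros Hk; auto.
rewrite (RInt_ext _ (fun p => 1 * (cos (IZR k * p) * cos_residual N p) +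
   (- (2 / PI) * a (Z.of_nat (S N))) * (cos (IZR k * p) * cos (IZR (Z.of_nat (S N)) * p)))).
2:{ intros p _. cbn [cos_residual]. ringR. }
rewrite RInt_lin.
- rewrite RInt_cos_cos, IH by lia.
  destruct (Z.eqb_spec (k - Z.of_nat (S N)) 0); [lia|]. destruct (Z.eqb_spec (k + Z.of_nat (S N)) 0); [lia|]. ringR.
- apply ex_RInt_cont; intros; apply continuous_mult_R; [apply continuous_cos_lin|apply cos_residual_cont].
- apply ex_RInt_cont; intros; apply continuous_mult_R; apply continuous_cos_lin.
Qed.

(** Pythagoras: the part removed is orthogonal to the new remainder, and [cos (k p)] has squared
    norm [PI / 2]. The coefficient of the old remainder is still [a k], since lower frequencies do
    not contribute. *)
Lemma cos_residual_sqr N :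
  RInt (fun p => cos_residual (S N) p * cos_residual (S N) p) 0 PI =
  RInt (fun p => cos_residual N p * cos_residual N p) 0 PI - 2 / PI * a (Z.of_nat (S N)) ^ 2.
Proof.
set (k := Z.of_nat (S N)). set (al := - (2 / PI) * a k).
assert (E1 : ex_RInt (fun p => cos_residual N p * cos_residual N p) 0 PI).
{ apply ex_RInt_cont; intros; apply continuous_mult_R; apply cos_residual_cont. }
assert (E2 : ex_RInt (fun p => cos (IZR k * p) * cos_residual N p) 0 PI).
{ apply ex_RInt_cont; intros; apply continuous_mult_R; [apply continuous_cos_lin|apply cos_residual_cont]. }
assert (E3 : ex_RInt (fun p => cos (IZR k * p) * cos (IZR k * p)) 0 PI).
{ apply ex_RInt_cont; intros; apply continuous_mult_R; apply continuous_cos_lin. }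
rewrite (RInt_ext _ (fun p => 1 * (cos_residual N p * cos_residual N p) +
   1 * (2 * al * (cos (IZR k * p) * cos_residual N p) + al * al * (cos (IZR k * p) * cos (IZR k * p))))).
2:{ intros p _. cbn [cos_residual]. fold k al. ringR. }
rewrite RInt_lin; auto.
2:{ apply (ex_RInt_plus (V := R_NormedModule) (fun p => 2 * al * (cos (IZR k * p) * cos_residual N p)));
    apply (ex_RInt_scal (V := R_NormedModule)); auto. }
rewrite RInt_lin by auto. rewrite RInt_cos_cos, cos_residual_coef by (unfold k; lia).
rewrite Z.sub_diag, Z.eqb_refl. destruct (Z.eqb_spec (k + k) 0); [unfold k in *; lia|].
unfold al. pose proof PI_RGT_0. match goal with |- @eq _ ?x ?y => change (@eq R x y) end. field. lra.
Qed.

(** The remainder has nonnegative square norm, which bounds the terms [k <> 0], paired by evenness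
    of [a], by [PI^2 B^2]; the term [k = 0] obeys the same bound directly. *)
Lemma bessel_inequality B : (forall p, Rabs (h p) <= B) ->
  forall N, sym_sum N (fun k => a k ^ 2) <= 2 * PI ^ 2 * B ^ 2.
Proof.
intros HB N. pose proof PI_RGT_0 as Hpi.
assert (HB0 : 0 <= B) by (eapply Rle_trans; [apply Rabs_pos|apply (HB 0)]).
assert (Ha0 : a 0 ^ 2 <= PI ^ 2 * B ^ 2).
{ assert (H : Rabs (a 0) <= (PI - 0) * B).
  { apply abs_RInt_le_const; [lra|apply ex_RInt_cont; intros; apply continuous_mult_R; auto; apply continuous_cos_lin|].
    intros t _. rewrite Rmult_0_l, cos_0, Rmult_1_l. auto. }
  rewrite Rminus_0_r in H. rewrite <- Rpow_mult_distr, <- (pow2_abs (a 0)). apply pow_incr. split; [apply Rabs_pos|auto]. }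
assert (Hsq : RInt (fun p => h p * h p) 0 PI <= PI * B ^ 2).
{ replace (PI * B ^ 2) with (RInt (fun _ => B ^ 2) 0 PI).
  2:{ rewrite RInt_const. unfold scal; simpl; unfold mult; simpl. ring. }
  apply RInt_le; [lra|apply ex_RInt_cont; intros; apply continuous_mult_R; auto|apply ex_RInt_const|].
  intros x _. replace (h x * h x) with (Rabs (h x) ^ 2) by (rewrite pow2_abs; ring).
  apply pow_incr; split; [apply Rabs_pos|auto]. }
assert (Heven : forall k, a (- k) = a k).
{ intros k; apply RInt_ext; intros p _. rewrite opp_IZR, <- Ropp_mult_distr_l, cos_neg. reflexivity. }
assert (Hrec : RInt (fun p => cos_residual N p * cos_residual N p) 0 PI =
   RInt (fun p => h p * h p) 0 PI - / PI * (sym_sum N (fun k => a k ^ 2) - a 0 ^ 2)).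
{ clear -Hpi Heven Hh. induction N as [|N IH].
  - change (RInt (fun p => h p * h p) 0 PI = RInt (fun p => h p * h p) 0 PI - / PI * (a 0 ^ 2 - a 0 ^ 2)). rewrite Rminus_diag, Rmult_0_r, Rminus_0_r. reflexivity.
  - rewrite cos_residual_sqr, IH, sym_sum_S, Heven. match goal with |- @eq _ ?x ?y => change (@eq R x y) end. field. lra. }
assert (Hpos : 0 <= RInt (fun p => cos_residual N p * cos_residual N p) 0 PI).
{ apply RInt_ge_0; [lra|apply ex_RInt_cont; intros; apply continuous_mult_R; apply cos_residual_cont|].
  intros; apply Rle_0_sqr. }
assert (H : / PI * (sym_sum N (fun k => a k ^ 2) - a 0 ^ 2) <= PI * B ^ 2) by lra.
apply (Rmult_le_compat_l PI) in H; [|lra].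
rewrite <- Rmult_assoc, Rinv_r, Rmult_1_l in H by lra. lra.
Qed.
End Bessel.

Lemma sym_sum_swap N K (f : Z -> Z -> R) :
  sym_sum N (fun p => sym_sum K (fun q => f p q)) = sym_sum K (fun q => sym_sum N (fun p => f p q)).
Proof.
induction N as [|N IH].
- unfold sym_sum at 1; simpl. apply sym_sum_ext; intros; reflexivity.
- rewrite sym_sum_S, IH, <- !sym_sum_plus. apply sym_sum_ext; intros q. rewrite sym_sum_S. reflexivity.
Qed.

Lemma sym_sum_geom r N : 0 <= r < 1 -> sym_sum N (fun q => r ^ Z.abs_nat q) <= 2 / (1 - r).
Proof.
intros Hr.
assert (H : sym_sum N (fun q => r ^ Z.abs_nat q) <= (2 - 2 * r ^ (S N)) / (1 - r)).
{ induction N as [|N IH].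
  - unfold sym_sum; simpl. apply Rmult_le_reg_r with (1 - r); [lra|]. field_simplify; lra.
  - rewrite sym_sum_S. replace (Z.abs_nat (- Z.of_nat (S N))) with (S N) by lia. replace (Z.abs_nat (Z.of_nat (S N))) with (S N) by lia.
    apply Rle_trans with (r ^ S N + (2 - 2 * r ^ S N) / (1 - r) + r ^ S N); [lra|].
    apply Req_le. simpl. field. lra. }
eapply Rle_trans; [apply H|]. apply Rmult_le_compat_r; [left; apply Rinv_0_lt_compat; lra|].
pose proof (pow_le r (S N) (proj1 Hr)). lra.
Qed.

Lemma Ci_sqr : (Ci * Ci = - (1))%C.
Proof. unfold Ci, Cmult, Copp, RtoC; simpl; f_equal; ring. Qed.

Lemma Cmult_cancel_l (k u v : C) : k <> RtoC 0 -> (k * u = k * v)%C -> u = v.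
Proof.
intros Hk H. replace u with (/ k * (k * u))%C by (field; auto). rewrite H. field; auto.
Qed.

(** Fourier symbols: [disp_cos] is the cosine of the (complex) frequency, [disp_sin] a square
    root of [1 - disp_cos ^ 2], and [disp_exp] the root of [W + / W = 2 disp_cos] in the unit disk. *)
Definition nrm (M d : R) : R := norm1 M * norm2 d.
Definition disp_cos (M d p : R) : C := (nrm M d * cos p, nrm M d * (M * d)).
Definition disp_sin (M d p : R) : C := csqrt_right (1 - disp_cos M d p * disp_cos M d p)%C.
Definition disp_exp (M d p : R) : C := (disp_cos M d p - Ci * disp_sin M d p)%C.
(** The factor [Ci / disp_sin] normalizes the kink at time 0: by [mode_0_1] it produces exactly the
    source 2. *)
Definition mode (M d : R) (n : nat) (p : R) : C := (disp_exp M d p ^ n * (Ci * / disp_sin M d p))%C.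
Definition green (M d : R) (x t : Z) : C :=
  (RtoC (/ PI) * CInt (fun p => RtoC (cos (IZR x * p)) * mode M d (Z.abs_nat t) p) 0 PI)%C.

(** * The regularized Green function as a Fourier integral *)

Section Small.
Variables M d : R.
Hypothesis HM : 0 < M.
Hypothesis Hd : d ^ 2 < 1.
Hypothesis Hn : nrm M d < 1.

Lemma nrm_pos : 0 < nrm M d.
Proof. apply Rmult_lt_0_compat; [apply norm1_pos|]. apply Rinv_0_lt_compat, sqrt_lt_R0. lra. Qed.

(** Keeps [1 - disp_cos^2] in the right half-plane, away from 0, so [csqrt_right] is a genuine
    continuous root there, including at [d = 0]. *)
Lemma disp_arg_re p : 1 - nrm M d ^ 2 <= fst (1 - disp_cos M d p * disp_cos M d p)%C.
Proof.
unfold disp_cos. simpl. pose proof (COS_bound p). pose proof nrm_pos.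
assert (cos p ^ 2 <= 1) by nra.
assert (0 <= nrm M d ^ 2 * (1 - cos p ^ 2)) by (apply Rmult_le_pos; nra).
assert (0 <= (nrm M d * (M * d)) ^ 2) by apply pow2_ge_0. nra.
Qed.

Lemma disp_arg_pos p : 0 < fst (1 - disp_cos M d p * disp_cos M d p)%C.
Proof. pose proof (disp_arg_re p). pose proof nrm_pos. nra. Qed.

Lemma disp_sin_sqr p : (disp_sin M d p * disp_sin M d p = 1 - disp_cos M d p * disp_cos M d p)%C.
Proof. apply csqrt_right_sqr, disp_arg_pos. Qed.

Lemma disp_sin_re_pos p : 0 < fst (disp_sin M d p).
Proof. apply csqrt_right_re, disp_arg_pos. Qed.

Lemma disp_sin_neq_0 p : disp_sin M d p <> RtoC 0.
Proof. intros E. pose proof (disp_sin_re_pos p) as H. rewrite E in H. simpl in H. lra. Qed.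

Lemma disp_exp_quadratic p :
  (disp_exp M d p * disp_exp M d p + 1 = 2 * disp_cos M d p * disp_exp M d p)%C.
Proof. pose proof (disp_sin_sqr p) as E. unfold disp_exp. ring [Ci_sqr E]. Qed.

Lemma mode_rec n p :
  (mode M d (S (S n)) p + mode M d n p = 2 * disp_cos M d p * mode M d (S n) p)%C.
Proof.
unfold mode. simpl. pose proof (disp_exp_quadratic p) as E.
transitivity ((disp_exp M d p * disp_exp M d p + 1) * disp_exp M d p ^ n * (Ci * / disp_sin M d p))%C; [ring|].
rewrite E. ring.
Qed.

Lemma mode_0_1 p : (mode M d 1 p + mode M d 1 p = 2 * disp_cos M d p * mode M d 0 p + 2)%C.
Proof.
unfold mode, disp_exp. simpl. pose proof (disp_sin_neq_0 p).
replace ((disp_cos M d p - Ci * disp_sin M d p) * 1 * (Ci * / disp_sin M d p))%C with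
  (disp_cos M d p * Ci * / disp_sin M d p - (Ci * Ci) * (disp_sin M d p * / disp_sin M d p))%C by ring.
rewrite Ci_sqr, Cinv_r by auto. ring.
Qed.

Lemma norm2_cont : continuous norm2 d.
Proof.
unfold norm2. apply (continuous_comp (fun x => sqrt (1 - x ^ 2)) Rinv).
- apply (continuous_comp (fun x => 1 - x ^ 2) sqrt); [|apply continuous_sqrt].
  apply (ex_derive_continuous (V := R_NormedModule)). auto_derive. auto.
- apply continuity_pt_filterlim, continuity_pt_inv; [apply continuity_pt_id|].
  apply Rgt_not_eq, sqrt_lt_R0. lra.
Qed.

Lemma disp_cos_c2 p : c2 (disp_cos M) d p.
Proof.
assert (K : continuity_2d_pt (fun u _ => nrm M u) d p).
{ unfold nrm. apply continuity_2d_pt_mult; [apply continuity_2d_pt_const|].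
  apply (continuity_2d_pt_comp1 norm2 (fun u _ => u)); [apply norm2_cont|apply continuity_2d_pt_id1]. }
apply c2_pair.
- apply continuity_2d_pt_mult; auto.
  apply (continuity_2d_pt_comp1 cos (fun _ v => v)); [apply continuous_cos|apply continuity_2d_pt_id2].
- apply (continuity_2d_pt_mult (fun u _ => nrm M u)); auto.
  apply continuity_2d_pt_mult; [apply continuity_2d_pt_const|apply continuity_2d_pt_id1].
Qed.

Lemma disp_sin_c2 p : c2 (disp_sin M) d p.
Proof.
apply (c2_csqrt_right (fun u v => 1 - disp_cos M u v * disp_cos M u v)%C); [|apply disp_arg_pos].
apply c2_minus; [apply c2_const|]. apply c2_mult; apply disp_cos_c2.
Qed.

Lemma disp_exp_c2 p : c2 (disp_exp M) d p.
Proof.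
apply (c2_minus (disp_cos M) (fun u v => Ci * disp_sin M u v)%C); [apply disp_cos_c2|].
apply c2_mult; [apply c2_const|apply disp_sin_c2].
Qed.

Lemma mode_c2 n p : c2 (fun u v => mode M u n v) d p.
Proof.
apply (c2_mult (fun u v => disp_exp M u v ^ n)%C (fun u v => Ci * / disp_sin M u v)%C).
- apply c2_pow, disp_exp_c2.
- apply c2_mult; [apply c2_const|]. apply c2_inv; [apply disp_sin_c2|apply disp_sin_neq_0].
Qed.

Lemma mode_ccont n : ccont (mode M d n).
Proof. apply (ccont_c2 (fun u v => mode M u n v)). intros; apply mode_c2. Qed.

Lemma cos_ccont k : ccont (fun p => RtoC (cos (k * p))).
Proof. apply ccont_RtoC. intros; apply continuous_cos_lin. Qed.

Lemma cos_mode_ccont k n : ccont (fun p => RtoC (cos (k * p)) * mode M d n p)%C.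
Proof. apply ccont_mult; [apply cos_ccont|apply mode_ccont]. Qed.

Lemma green_shift x t :
  CInt (fun p => 2 * disp_cos M d p * (RtoC (cos (IZR x * p)) * mode M d (Z.abs_nat t) p))%C 0 PI =
  (RtoC PI * (RtoC (nrm M d) * (green M d (x + 1) t + green M d (x - 1) t) +
     Ci * RtoC (2 * nrm M d * M * d) * green M d x t))%C.
Proof.
set (n := Z.abs_nat t).
rewrite (CInt_ext _ (fun p => RtoC (nrm M d) * (RtoC (cos (IZR (x + 1) * p)) * mode M d n p) +
  (RtoC (nrm M d) * (RtoC (cos (IZR (x - 1) * p)) * mode M d n p) +
  Ci * RtoC (2 * nrm M d * M * d) * (RtoC (cos (IZR x * p)) * mode M d n p)))%C).
2:{ intros p. rewrite plus_IZR, minus_IZR, Rmult_plus_distr_r, Rmult_minus_distr_r, Rmult_1_l, cos_minus, cos_plus.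
    unfold disp_cos. rewrite RtoC_minus, RtoC_plus, !RtoC_mult.
    replace (nrm M d * cos p, nrm M d * (M * d)) with (RtoC (nrm M d) * (RtoC (cos p) + Ci * (RtoC M * RtoC d)))%C.
    ring. unfold Cmult, Cplus, RtoC, Ci; simpl; f_equal; ring. }
rewrite (CInt_lin3 _ _ _ _ _ _ 0 PI (cos_mode_ccont _ n) (cos_mode_ccont _ n) (cos_mode_ccont _ n)).
unfold green. fold n. rewrite RtoC_inv by (apply PI_neq0).
assert (RtoC PI <> RtoC 0) by (intros E; apply RtoC_inj in E; apply (PI_neq0 E)).
field. auto.
Qed.

Lemma green_even_t x t : green M d x (- t) = green M d x t.
Proof. unfold green. repeat f_equal. replace (Z.abs_nat (- t)) with (Z.abs_nat t) by lia. reflexivity. Qed.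

Lemma green_even_x x t : green M d (- x) t = green M d x t.
Proof.
unfold green. f_equal. apply CInt_ext. intros p. rewrite opp_IZR, <- Ropp_mult_distr_l, cos_neg. reflexivity.
Qed.

(** In Fourier space this is [mode_rec]. At [t = 0] both time neighbours are the mode with [n = 1],
    and [mode_0_1] leaves [2 cos (x p)], whose mean over [[0, PI]] gives the Kronecker source. *)
Lemma green_KG x t :
  (green M d x (t + 1) + green M d x (t - 1) =
   RtoC (nrm M d) * (green M d (x + 1) t + green M d (x - 1) t) +
     Ci * RtoC (2 * nrm M d * M * d) * green M d x t + RtoC 2 * kron00 x t)%C.
Proof.
assert (HPI : RtoC PI <> RtoC 0) by (intros E; apply RtoC_inj in E; apply (PI_neq0 E)).
assert (main : (RtoC PI * (green M d x (t + 1) + green M d x (t - 1)) =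
   CInt (fun p => 2 * disp_cos M d p * (RtoC (cos (IZR x * p)) * mode M d (Z.abs_nat t) p))%C 0 PI
    + RtoC PI * (2 * kron00 x t))%C).
{ unfold green. rewrite <- Cmult_plus_distr_l, <- (CInt_plus _ _ 0 PI (cos_mode_ccont _ _) (cos_mode_ccont _ _)).
  rewrite RtoC_inv by (apply PI_neq0). rewrite Cmult_assoc, Cinv_r, Cmult_1_l by auto.
  destruct (Z.eq_dec t 0) as [->|Ht].
  - simpl Z.abs_nat.
    rewrite (CInt_ext _ (fun p => 2 * disp_cos M d p * (RtoC (cos (IZR x * p)) * mode M d 0 p) +
      2 * RtoC (cos (IZR x * p)))%C).
    2:{ intros p. rewrite <- Cmult_plus_distr_l. change (Pos.to_nat 1) with 1%nat. rewrite mode_0_1. ring. }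
    assert (Hz : ccont (fun p => 2 * disp_cos M d p * (RtoC (cos (IZR x * p)) * mode M d 0 p))%C).
    { apply (ccont_mult (fun p => 2 * disp_cos M d p)%C); [|apply cos_mode_ccont].
      apply ccont_scal. apply ccont_c2. intros; apply disp_cos_c2. }
    rewrite (CInt_plus _ _ 0 PI Hz (ccont_scal 2 _ (cos_ccont _))), (CInt_scal 2 _ 0 PI (cos_ccont _)).
    f_equal. unfold CInt, kron00. simpl. rewrite RInt_cos_IZR, RInt_const.
    unfold scal; simpl; unfold mult; simpl.
    destruct (Z.eqb x 0); simpl; unfold Cmult, RtoC; simpl; f_equal; ring.
  - replace (kron00 x t) with (RtoC 0).
    2:{ unfold kron00. destruct (Z.eqb_spec t 0); [lia|]. rewrite Bool.andb_false_r. reflexivity. }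
    rewrite !Cmult_0_r, Cplus_0_r. apply CInt_ext. intros p.
    rewrite <- Cmult_plus_distr_l.
    replace (mode M d (Z.abs_nat (t + 1)) p + mode M d (Z.abs_nat (t - 1)) p)%C with
      (2 * disp_cos M d p * mode M d (Z.abs_nat t) p)%C; [ring|].
    destruct (Z.lt_total t 0) as [H|[H|H]]; [|lia|].
    + replace (Z.abs_nat t) with (S (Z.abs_nat (t + 1))) by lia.
      replace (Z.abs_nat (t - 1)) with (S (S (Z.abs_nat (t + 1)))) by lia.
      rewrite <- mode_rec. ring.
    + replace (Z.abs_nat t) with (S (Z.abs_nat (t - 1))) by lia.
      replace (Z.abs_nat (t + 1)) with (S (S (Z.abs_nat (t - 1)))) by lia.
      rewrite <- mode_rec. ring. }
rewrite green_shift in main.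
apply (Cmult_cancel_l (RtoC PI)); auto.
rewrite main. ring.
Qed.
Lemma disp_sin_re_ge p : sqrt (1 - nrm M d ^ 2) <= fst (disp_sin M d p).
Proof.
unfold disp_sin, csqrt_right. cbv zeta. cbn [fst]. apply sqrt_le_1_alt.
pose proof (disp_arg_re p) as H. pose proof (Cmod_ge_re (1 - disp_cos M d p * disp_cos M d p)%C) as H1.
pose proof (Rle_abs (fst (1 - disp_cos M d p * disp_cos M d p)%C)).
lra.
Qed.

(* [/ W = z + i R] and [|/ W|^2 - |W|^2 = 4 (Im z Re R - Re z Im R)]. *)
Lemma disp_exp_contract p : 0 < d ->
  Cmod (disp_exp M d p) ^ 2 <= / (1 + 2 * (nrm M d * (M * d) * sqrt (1 - nrm M d ^ 2))).
Proof.
intros Hd0.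
set (rho := sqrt (1 - nrm M d ^ 2)). set (y := nrm M d * (M * d)).
pose proof nrm_pos as Hnp.
assert (Hrho : 0 < rho) by (apply sqrt_lt_R0; nra).
assert (Hy : 0 < y) by (apply Rmult_lt_0_compat; auto; apply Rmult_lt_0_compat; auto).
pose proof (disp_sin_re_ge p) as Hs. fold rho in Hs.
pose proof (disp_sin_sqr p) as HR.
pose proof (disp_sin_neq_0 p).
assert (Hprod : ((disp_cos M d p + Ci * disp_sin M d p) * disp_exp M d p = 1)%C).
{ unfold disp_exp. ring [Ci_sqr HR]. }
apply (f_equal Cmod) in Hprod. rewrite Cmod_mult, Cmod_1 in Hprod.
assert (Hdiff : Cmod (disp_cos M d p + Ci * disp_sin M d p) ^ 2 - Cmod (disp_exp M d p) ^ 2 >= 4 * (y * rho)).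
{ rewrite !Cmod_sqr. unfold disp_exp.
  destruct (disp_sin M d p) as [s r] eqn:Es. unfold disp_cos in *. fold y in HR |- *.
  set (x := nrm M d * cos p) in *. simpl in *.
  unfold Cmult, Cminus, Cplus, Copp, RtoC in HR; simpl in HR. injection HR; intros HR2 HR1.
  assert (Hr : s * r = - (x * y)) by lra.
  (* The imaginary part of [R^2 = 1 - z^2] reads [s r = - x y] with [s > 0] and [y > 0], so the term
     [- 4 x r] has the favourable sign. *)
  assert (x * r <= 0).
  { assert (E : s * (x * r) = - (x * x * y)) by (replace (s * (x * r)) with (x * (s * r)) by ring; rewrite Hr; ring).
    assert (0 <= x * x * y) by (apply Rmult_le_pos; nra).
    destruct (Rle_lt_dec (x * r) 0); auto. exfalso.
    assert (0 < s * (x * r)) by (apply Rmult_lt_0_compat; lra). lra. }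
  assert (y * rho <= y * s) by (apply Rmult_le_compat_l; lra).
  match goal with |- ?a >= _ => replace a with (4 * (y * s) - 4 * (x * r)) by ring end. lra. }
set (w := Cmod (disp_exp M d p)) in *. set (v := Cmod (disp_cos M d p + Ci * disp_sin M d p)) in *.
assert (Hw : 0 <= w) by apply Cmod_ge_0.
assert (Hwp : 0 < w) by (destruct Hw as [|E]; auto; rewrite <- E in Hprod; lra).
assert (Hk : 0 < y * rho) by (apply Rmult_lt_0_compat; auto).
assert (Ev : v ^ 2 * w ^ 2 = 1) by (rewrite <- Rpow_mult_distr, Hprod; ring).
assert (Hw2 : 0 < w ^ 2) by (apply pow_lt; auto).
assert (Hlt : w ^ 2 < 1).
{ destruct (Rlt_le_dec (w ^ 2) 1); auto. exfalso. assert (v ^ 2 > w ^ 2) by lra. nra. }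
apply Rmult_le_reg_r with (1 + 2 * (y * rho)); [lra|]. rewrite Rinv_l by lra.
assert (1 - w ^ 2 * w ^ 2 >= 4 * (y * rho) * w ^ 2).
{ replace 1 with (v ^ 2 * w ^ 2) by auto. replace (v ^ 2 * w ^ 2 - w ^ 2 * w ^ 2) with ((v ^ 2 - w ^ 2) * w ^ 2) by ring.
  apply Rmult_ge_compat_r; lra. }
nra.
Qed.

(** For [d > 0] the root [disp_exp] is bounded away from the unit circle, so the modes decay
    geometrically in [|t|]. At fixed [t] Bessel's inequality sums over [x]; then the geometric
    series sums over [t]. *)
Lemma green_l2_bounded : 0 < d -> exists B, forall N, box_sum N (fun p q => Cmod (green M d p q) ^ 2) <= B.
Proof.
intros Hd0.
set (rho := sqrt (1 - nrm M d ^ 2)). pose proof nrm_pos as Hnp.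
assert (Hrho : 0 < rho) by (apply sqrt_lt_R0; nra).
assert (Hk : 0 < nrm M d * (M * d) * rho) by (apply Rmult_lt_0_compat; auto; apply Rmult_lt_0_compat; auto; apply Rmult_lt_0_compat; auto).
set (r := / (1 + 2 * (nrm M d * (M * d) * rho))).
assert (Hr : 0 <= r < 1).
{ split; [left; apply Rinv_0_lt_compat; lra|]. unfold r. apply (Rmult_lt_reg_r (1 + 2 * (nrm M d * (M * d) * rho))); [lra|]. rewrite Rinv_l; lra. }
assert (Hmode : forall n p, Cmod (mode M d n p) ^ 2 <= r ^ n * (/ rho) ^ 2).
{ intros n p. unfold mode. rewrite !Cmod_mult, Cmod_pow, Cmod_Ci, Cmod_inv, Rmult_1_l, Rpow_mult_distr.
  2: apply disp_sin_neq_0.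
  apply Rmult_le_compat; try apply pow2_ge_0.
  - rewrite <- pow_mult, Nat.mul_comm, pow_mult. apply pow_incr. split; [apply pow2_ge_0|].
    apply disp_exp_contract; auto.
  - apply pow_incr. split; [left; apply Rinv_0_lt_compat, Cmod_gt_0, disp_sin_neq_0|].
    apply Rinv_le_contravar; auto. eapply Rle_trans; [apply (disp_sin_re_ge p)|].
    eapply Rle_trans; [apply Rle_abs|apply re_le_Cmod]. }
assert (Hrow : forall N q, sym_sum N (fun p => Cmod (green M d p q) ^ 2) <= 4 * (/ rho) ^ 2 * r ^ Z.abs_nat q).
{ intros N q. set (n := Z.abs_nat q).
  set (u := fun p => fst (mode M d n p)). set (v := fun p => snd (mode M d n p)).
  assert (Hu : forall x, continuous u x) by (intros x; apply (mode_ccont n x)).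
  assert (Hv : forall x, continuous v x) by (intros x; apply (mode_ccont n x)).
  set (Bd := sqrt (r ^ n * (/ rho) ^ 2)).
  assert (HBd : Bd ^ 2 = r ^ n * (/ rho) ^ 2).
  { unfold Bd. rewrite pow2_sqrt; auto. apply Rmult_le_pos; [apply pow_le; lra|apply pow2_ge_0]. }
  assert (Hle : forall p, Cmod (mode M d n p) <= Bd).
  { intros p. unfold Bd. rewrite <- (sqrt_pow2 (Cmod (mode M d n p))) by apply Cmod_ge_0.
    apply sqrt_le_1_alt, Hmode. }
  assert (Bu : forall p, Rabs (u p) <= Bd) by (intros p; eapply Rle_trans; [apply (re_le_Cmod (mode M d n p))|auto]).
  assert (Bv : forall p, Rabs (v p) <= Bd).
  { intros p. eapply Rle_trans; [|apply (Hle p)]. eapply Rle_trans; [|apply Rmax_Cmod]. apply Rmax_r. }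
  pose proof (bessel_inequality u Hu Bd Bu N) as S1. pose proof (bessel_inequality v Hv Bd Bv N) as S2.
  rewrite (sym_sum_ext _ _ (fun p => (/ PI) ^ 2 * (RInt (fun x => cos (IZR p * x) * u x) 0 PI ^ 2
      + RInt (fun x => cos (IZR p * x) * v x) 0 PI ^ 2))).
  2:{ intros p. unfold green. rewrite Cmod_mult, Rpow_mult_distr, Cmod_R, pow2_abs, Cmod_sqr.
      fold n. unfold CInt. cbn [fst snd]. do 2 f_equal; f_equal; apply RInt_ext; intros x _; unfold u, v; simpl; ring. }
  rewrite sym_sum_scal, sym_sum_plus. pose proof PI_RGT_0.
  apply Rle_trans with ((/ PI) ^ 2 * (2 * PI ^ 2 * Bd ^ 2 + 2 * PI ^ 2 * Bd ^ 2)).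
  - apply Rmult_le_compat_l; [apply pow2_ge_0|]. lra.
  - rewrite HBd. apply Req_le. field. lra. }
exists (4 * (/ rho) ^ 2 * (2 / (1 - r))). intros N. unfold box_sum. rewrite sym_sum_swap.
eapply Rle_trans; [apply sym_sum_le; intros q; apply Hrow|].
rewrite sym_sum_scal. apply Rmult_le_compat_l.
- pose proof (pow2_ge_0 (/ rho)); lra.
- apply sym_sum_geom; auto.
Qed.
End Small.

(** * The limit of vanishing regularization *)

Lemma nrm_0 M : nrm M 0 = norm1 M.
Proof. unfold nrm, norm2. replace (1 - 0 ^ 2) with 1 by ring. rewrite sqrt_1. field. Qed.

Lemma norm1_lt_1 M : 0 < M -> norm1 M < 1.
Proof. intros HM. pose proof (norm1_pos M). pose proof (norm1_sqr M). assert (0 < M * M) by nra.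
destruct (Rlt_le_dec (norm1 M) 1) as [|Hge]; auto. exfalso. assert (1 <= norm1 M * norm1 M) by nra. nra. Qed.

Lemma nrm_small M : 0 < M -> locally 0 (fun d => d ^ 2 < 1 /\ nrm M d < 1).
Proof.
intros HM. apply filter_and.
- assert (H : continuous (fun x : R => x ^ 2) 0) by (apply (ex_derive_continuous (V := R_NormedModule)); auto_derive; auto).
  apply (H (fun y => y < 1)). apply (open_lt 1). lra.
- assert (H : continuous (nrm M) 0).
  { apply continuous_mult_R; [apply continuous_const|apply norm2_cont; lra]. }
  apply (H (fun y => y < 1)). apply (open_lt 1). rewrite nrm_0. apply norm1_lt_1; auto.
Qed.

Lemma continuous_C_pair (f : R -> C) x : continuous (fun y => fst (f y)) x -> continuous (fun y => snd (f y)) x ->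
  continuous f x.
Proof.
intros H1 H2. apply filterlim_locally. intros eps.
pose proof (proj1 (filterlim_locally _ _) H1 eps) as K1. pose proof (proj1 (filterlim_locally _ _) H2 eps) as K2.
generalize (filter_and _ _ K1 K2). apply filter_imp. intros y [B1 B2]. split; auto.
Qed.

Definition ccont_at (f : R -> C) (x : R) : Prop :=
  continuous (fun x => fst (f x)) x /\ continuous (fun x => snd (f x)) x.

Lemma ccont_at_mult f g x : ccont_at f x -> ccont_at g x -> ccont_at (fun y => f y * g y)%C x.
Proof.
intros [F1 F2] [G1 G2]. split; unfold Cmult; cbn [fst snd].
- apply (continuous_minus (V := R_NormedModule)); apply continuous_mult_R; assumption.
- apply continuous_plus_R; apply continuous_mult_R; assumption.
Qed.

Lemma ccont_at_minus f g x : ccont_at f x -> ccont_at g x -> ccont_at (fun y => f y - g y)%C x.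
Proof. intros [F1 F2] [G1 G2]. split; apply (continuous_minus (V := R_NormedModule)); assumption. Qed.

Lemma ccont_at_plus f g x : ccont_at f x -> ccont_at g x -> ccont_at (fun y => f y + g y)%C x.
Proof. intros [F1 F2] [G1 G2]. split; apply continuous_plus_R; assumption. Qed.

Lemma ccont_at_RtoC (f : R -> R) x : continuous f x -> ccont_at (fun y => RtoC (f y)) x.
Proof. intros H; split; [exact H|apply continuous_const]. Qed.

Lemma ccont_at_const k x : ccont_at (fun _ => k) x.
Proof. split; apply continuous_const. Qed.

(** The integrand is jointly continuous up to [d = 0] because [norm1 M < 1] keeps [disp_sin] away
    from 0 there; the limit therefore passes under the integral. *)
Lemma green_continuous M x t : 0 < M -> ccont_at (fun d => green M d x t) 0.
Proof.
intros HM. set (n := Z.abs_nat t).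
destruct (nrm_small M HM) as [e He].
assert (H0 : 0 ^ 2 < 1 /\ nrm M 0 < 1) by (apply He, ball_center).
assert (K : forall y, c2 (fun u p => RtoC (cos (IZR x * p)) * mode M u n p)%C 0 y).
{ intros y. apply (c2_mult (fun _ p => RtoC (cos (IZR x * p))) (fun u p => mode M u n p)).
  - apply (c2_ccont (fun p => RtoC (cos (IZR x * p)))), cos_ccont.
  - apply mode_c2; tauto. }
assert (Hex : locally 0 (fun u => ccont (fun p => RtoC (cos (IZR x * p)) * mode M u n p)%C)).
{ exists e. intros u Hu. apply cos_mode_ccont; auto; apply He; auto. }
pose proof PI_RGT_0.
assert (C1 : continuous (fun d => fst (CInt (fun p => RtoC (cos (IZR x * p)) * mode M d n p)%C 0 PI)) 0).
{ apply (RInt_param_continuous (fun d p => fst (RtoC (cos (IZR x * p)) * mode M d n p)%C) 0 PI); [lra|intros; apply K|].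
  revert Hex. apply filter_imp. intros u Hu. apply (ccont_ex_fst _ 0 PI Hu). }
assert (C2 : continuous (fun d => snd (CInt (fun p => RtoC (cos (IZR x * p)) * mode M d n p)%C 0 PI)) 0).
{ apply (RInt_param_continuous (fun d p => snd (RtoC (cos (IZR x * p)) * mode M d n p)%C) 0 PI); [lra|intros; apply K|].
  revert Hex. apply filter_imp. intros u Hu. apply (ccont_ex_snd _ 0 PI Hu). }
unfold green. fold n.
apply (ccont_at_mult (fun _ => RtoC (/ PI)) (fun d => CInt (fun p => RtoC (cos (IZR x * p)) * mode M d n p)%C 0 PI));
  [apply ccont_at_const|split; assumption].
Qed.

(** The solution built from [green] shows that the choice operator picks an actual solution, and
    uniqueness identifies the two at even sites. *)
Lemma A_sol_green m eps d : 0 < m -> 0 < eps -> 0 < d -> d ^ 2 < 1 -> nrm (m * eps) d < 1 ->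
  forall p q,
   fst (A_sol m eps d) (2 * p)%Z (2 * q)%Z = green1 m eps d (green (m * eps) d) p q /\
   snd (A_sol m eps d) (2 * p)%Z (2 * q)%Z = green2 m eps d (green (m * eps) d) p q.
Proof.
intros Hm He Hd Hd1 Hn p q.
assert (HM : 0 < m * eps) by (apply Rmult_lt_0_compat; auto).
assert (Hd' : 0 < d < 1) by (split; [auto|nra]).
assert (HS : lattice_system m eps d (green_sol1 m eps d (green (m * eps) d)) (green_sol2 m eps d (green (m * eps) d))).
{ apply green_system; auto.
  - intros; apply green_KG; auto.
  - apply green_l2_bounded; auto. }
assert (HA : lattice_system m eps d (fst (A_sol m eps d)) (snd (A_sol m eps d))).
{ unfold A_sol. apply (epsilon_spec (inhabits _) (fun A => lattice_system m eps d (fst A) (snd A))).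
  eexists (_, _). exact HS. }
destruct (lattice_system_unique m eps d HM Hd' _ _ _ _ HA HS p q) as [E1 E2].
rewrite E1, E2, green_sol1_even, green_sol2_even. auto.
Qed.

Lemma C_lim_right0_eq (f g : R -> C) : continuous g 0 ->
  at_right 0 (fun d => f d = g d) -> C_lim_right0 f = g 0.
Proof.
intros Hg Hfg.
assert (H : filterlim f (at_right 0) (locally (g 0))).
{ apply (filterlim_ext_loc g).
  - revert Hfg. apply filter_imp. intros; symmetry; auto.
  - apply filterlim_filter_le_1 with (2 := Hg). apply filter_le_within. }
unfold C_lim_right0.
assert (H' : filterlim f (at_right 0) (locally (epsilon (inhabits (RtoC 0)) (fun l => filterlim f (at_right 0) (locally l))))).
{ apply (epsilon_spec (inhabits (RtoC 0)) (fun l => filterlim f (at_right 0) (locally l))). exists (g 0). exact H. }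
apply (filterlim_locally_unique (V := C_R_NormedModule) f _ _ H' H).
Qed.

(** All terms with a factor [d] vanish in the limit, so the propagator is expressed through
    [green M 0] and [norm1 M] alone. *)
Lemma Atilde_green m eps i j : 0 < m -> 0 < eps ->
  let M := m * eps in
  Atilde1 m eps i j = (RtoC (norm1 M * M) * green M 0 i j)%C /\
  Atilde2 m eps i j = (green M 0 i (j + 1) - RtoC (norm1 M) * green M 0 (i + 1) j)%C.
Proof.
intros Hm He M.
assert (HM : 0 < M) by (apply Rmult_lt_0_compat; auto).
assert (Hloc : at_right 0 (fun d => 0 < d /\ d ^ 2 < 1 /\ nrm M d < 1)).
{ destruct (nrm_small M HM) as [e Hs]. exists e. intros d Hb Hd. split; auto. }
assert (Hnrm : ccont_at (fun d => RtoC (nrm M d)) 0).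
{ apply ccont_at_RtoC. apply continuous_mult_R; [apply continuous_const|apply norm2_cont; lra]. }
assert (Hid : ccont_at (fun d => RtoC d) 0) by (apply ccont_at_RtoC, continuous_id).
assert (HMid : ccont_at (fun d => RtoC (M * d)) 0).
{ apply ccont_at_RtoC, continuous_mult_R; [apply continuous_const|apply continuous_id]. }
pose proof (fun x t => green_continuous M x t HM) as Hg.
split.
- unfold Atilde1.
  rewrite (C_lim_right0_eq _ (fun d => green1 m eps d (green M d) i j)).
  + unfold green1. fold M. change (norm1 M * norm2 0) with (nrm M 0). rewrite nrm_0, RtoC_mult. ring.
  + assert (K := ccont_at_mult _ _ _ Hnrm (ccont_at_minus _ _ _ (ccont_at_mult _ _ _ (ccont_at_const (RtoC M) _) (Hg i j))
      (ccont_at_mult _ _ _ (ccont_at_mult _ _ _ (ccont_at_const Ci _) Hid) (Hg (i + 1)%Z j)))).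
    exact (continuous_C_pair _ _ (proj1 K) (proj2 K)).
  + revert Hloc. apply filter_imp. intros d (H1 & H2 & H3). apply A_sol_green; auto.
- unfold Atilde2.
  rewrite (C_lim_right0_eq _ (fun d => green2 m eps d (green M d) i j)).
  + unfold green2. fold M. change (norm1 M * norm2 0) with (nrm M 0). rewrite nrm_0, Rmult_0_r. ring.
  + assert (K := ccont_at_minus _ _ _ (Hg i (j + 1)%Z) (ccont_at_mult _ _ _ Hnrm (ccont_at_plus _ _ _ (Hg (i + 1)%Z j)
      (ccont_at_mult _ _ _ (ccont_at_mult _ _ _ (ccont_at_const Ci _) HMid) (Hg i j))))).
    exact (continuous_C_pair _ _ (proj1 K) (proj2 K)).
  + revert Hloc. apply filter_imp. intros d (H1 & H2 & H3). apply A_sol_green; auto.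
Qed.

(** * The Green function without regularization *)

Definition sin_om (c p : R) : R := sqrt (1 - (c * cos p) ^ 2).
(** This is [arccos (c cos p)], the lattice frequency of momentum [p]. Through [atan] it is smooth
    in [p], since [sin_om] does not vanish for [c < 1]. *)
Definition om (c p : R) : R := PI / 2 - atan (c * cos p / sin_om c p).

Section Frequency.
Variable c : R.
Hypothesis Hc : 0 < c < 1.

Lemma sin_om_arg p : 0 < 1 - (c * cos p) ^ 2.
Proof. pose proof (COS_bound p). assert (cos p ^ 2 <= 1) by nra. rewrite Rpow_mult_distr. nra. Qed.

Lemma sin_om_pos p : 0 < sin_om c p.
Proof. apply sqrt_lt_R0, sin_om_arg. Qed.

Lemma sin_om_sqr p : sin_om c p ^ 2 = 1 - (c * cos p) ^ 2.
Proof. apply pow2_sqrt. left; apply sin_om_arg. Qed.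

Lemma om_hyp p : sqrt (1 + (c * cos p / sin_om c p)²) = / sin_om c p.
Proof.
pose proof (sin_om_pos p) as H. pose proof (sin_om_sqr p) as E.
replace (1 + (c * cos p / sin_om c p)²) with ((/ sin_om c p)²).
- apply sqrt_Rsqr. left; apply Rinv_0_lt_compat; auto.
- unfold Rsqr. replace (c * cos p / sin_om c p * (c * cos p / sin_om c p)) with ((c * cos p) ^ 2 / sin_om c p ^ 2) by (field; lra).
  replace ((c * cos p) ^ 2) with (1 - sin_om c p ^ 2) by lra. field. lra.
Qed.

Lemma cos_om p : cos (om c p) = c * cos p.
Proof.
unfold om. rewrite cos_shift, sin_atan, om_hyp. pose proof (sin_om_pos p). field. lra.
Qed.

Lemma sin_om_eq p : sin (om c p) = sin_om c p.
Proof.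
unfold om. rewrite sin_shift, cos_atan, om_hyp. pose proof (sin_om_pos p). field. lra.
Qed.

Lemma om_derive p : is_derive (om c) p (c * sin p / sin_om c p).
Proof.
pose proof (sin_om_arg p) as Ha. pose proof (sin_om_pos p) as Hp. pose proof (sin_om_sqr p) as E.
assert (Eq : 1 + - (c * cos p * (c * cos p * 1)) = 1 - (c * cos p) ^ 2) by ring.
unfold om, sin_om in *. auto_derive; rewrite !Eq; set (s := sqrt (1 - (c * cos p) ^ 2)) in *.
- repeat split; auto. lra.
- assert (Hq : 1 + c * cos p * / s * (c * cos p * / s * 1) = / (s * s)).
  { replace (c * cos p * / s * (c * cos p * / s * 1)) with ((c * cos p) ^ 2 / s ^ 2) by (field; lra).
    replace ((c * cos p) ^ 2) with (1 - s ^ 2) by lra. field. lra. }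
  rewrite Hq, Rinv_inv.
  transitivity (c * sin p * (s ^ 2 + (c * cos p) ^ 2) / s); [field; lra|]. rewrite E. field. lra.
Qed.

Lemma om_cont p : continuous (om c) p.
Proof. apply (ex_derive_continuous (V := R_NormedModule)). eexists; apply om_derive. Qed.

Lemma sin_om_cont p : continuous (sin_om c) p.
Proof.
apply (continuous_comp (fun p => 1 - (c * cos p) ^ 2) sqrt); [|apply continuous_sqrt].
apply (ex_derive_continuous (V := R_NormedModule)). auto_derive. auto.
Qed.

Lemma inv_sin_om_cont p : continuous (fun p => / sin_om c p) p.
Proof.
apply (continuous_comp (sin_om c) Rinv); [apply sin_om_cont|].
apply continuity_pt_filterlim, continuity_pt_inv; [apply continuity_pt_id|].
pose proof (sin_om_pos p); unfold id; lra.
Qed.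

Lemma cos_n_om_cont k p : continuous (fun p => cos (k * om c p)) p.
Proof.
apply (continuous_comp (fun p => k * om c p) cos); [|apply continuous_cos].
apply continuous_mult_R; [apply continuous_const|apply om_cont].
Qed.

Lemma sin_n_om_cont k p : continuous (fun p => sin (k * om c p)) p.
Proof.
apply (continuous_comp (fun p => k * om c p) sin); [|apply continuous_sin].
apply continuous_mult_R; [apply continuous_const|apply om_cont].
Qed.
End Frequency.

Lemma de_moivre th n : ((cos th, sin th) ^ n)%C = (cos (INR n * th), sin (INR n * th)).
Proof.
induction n as [|n IH].
- simpl. rewrite Rmult_0_l, cos_0, sin_0. reflexivity.
- rewrite Cpow_S, IH, S_INR, Rmult_plus_distr_r, Rmult_1_l, cos_plus, sin_plus.
  unfold Cmult; simpl. f_equal; ring.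
Qed.

Section Massive.
Variable M : R.
Hypothesis HM : 0 < M.
Let c := norm1 M.

Lemma norm1_bounds : 0 < norm1 M < 1.
Proof. split; [apply norm1_pos|apply norm1_lt_1; auto]. Qed.

Definition cos_mode (n : Z) (p : R) : R := cos (IZR n * om (norm1 M) p) / sin_om (norm1 M) p.
Definition sin_mode (n : Z) (p : R) : R := sin (IZR n * om (norm1 M) p) / sin_om (norm1 M) p.

Lemma cos_mode_cont n p : continuous (cos_mode n) p.
Proof. apply continuous_mult_R; [apply cos_n_om_cont|apply inv_sin_om_cont]; apply norm1_bounds. Qed.

Lemma sin_mode_cont n p : continuous (sin_mode n) p.
Proof. apply continuous_mult_R; [apply sin_n_om_cont|apply inv_sin_om_cont]; apply norm1_bounds. Qed.

(** At [d = 0] the root in the disk lies on the unit circle and equals [e^(- i om)]; multiplied by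
    [i / sin_om], its powers have the sine as real and the cosine as imaginary part. *)
Lemma mode_massive n p : mode M 0 n p = (sin_mode (Z.of_nat n) p, cos_mode (Z.of_nat n) p).
Proof.
pose proof norm1_bounds as Hc. fold c in Hc.
assert (Ec : disp_cos M 0 p = RtoC (c * cos p)).
{ unfold disp_cos. rewrite nrm_0. unfold RtoC. f_equal. ring. }
pose proof (sin_om_arg c Hc p) as Ha.
assert (Es : disp_sin M 0 p = RtoC (sin_om c p)).
{ unfold disp_sin. rewrite Ec. rewrite <- RtoC_mult, <- RtoC_minus.
  unfold csqrt_right. rewrite Cmod_R. unfold RtoC. cbn [fst snd].
  replace (1 - c * cos p * (c * cos p)) with (1 - (c * cos p) ^ 2) by ring.
  rewrite Rabs_pos_eq by lra. unfold sin_om. f_equal; [f_equal; field|unfold Rdiv; ring]. }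
assert (Ee : disp_exp M 0 p = (cos (- om c p), sin (- om c p))).
{ unfold disp_exp. rewrite Ec, Es, cos_neg, sin_neg, cos_om, sin_om_eq by auto.
  unfold Cminus, Cplus, Cmult, Copp, Ci, RtoC; simpl. f_equal; ring. }
pose proof (sin_om_pos c Hc p) as Hs.
unfold mode. rewrite Ee, Es, de_moivre. unfold sin_mode, cos_mode. fold c. rewrite <- INR_IZR_INZ.
replace (INR n * - om c p) with (- (INR n * om c p)) by ring. rewrite cos_neg, sin_neg.
rewrite <- RtoC_inv by lra.
unfold Cmult, Ci, RtoC, Rdiv; simpl. f_equal; ring.
Qed.

Definition gre (x t : Z) : R := / PI * RInt (fun p => cos (IZR x * p) * sin_mode (Z.abs t) p) 0 PI.
Definition gim (x t : Z) : R := / PI * RInt (fun p => cos (IZR x * p) * cos_mode (Z.abs t) p) 0 PI.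

Lemma green_massive x t : green M 0 x t = (gre x t, gim x t).
Proof.
unfold green. rewrite (CInt_ext _ (fun p => (cos (IZR x * p) * sin_mode (Z.abs t) p, cos (IZR x * p) * cos_mode (Z.abs t) p))).
- unfold CInt, gre, gim, Cmult, RtoC; cbn [fst snd]. f_equal; ring.
- intros p. rewrite mode_massive. replace (Z.of_nat (Z.abs_nat t)) with (Z.abs t) by lia.
  unfold Cmult, RtoC; simpl. f_equal; ring.
Qed.

Let G := green M 0.

Lemma green0_KG x t : (x, t) <> (0, 0)%Z ->
  (G x (t + 1)%Z + G x (t - 1)%Z = RtoC c * (G (x + 1)%Z t + G (x - 1)%Z t))%C.
Proof.
intros H. unfold G. rewrite green_KG; auto.
- rewrite nrm_0. fold c. replace (2 * c * M * 0) with 0 by ring.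
  replace (kron00 x t) with (RtoC 0); [ring|].
  unfold kron00. destruct (Z.eqb_spec x 0), (Z.eqb_spec t 0); auto. subst; contradiction.
- lra.
- rewrite nrm_0. apply norm1_bounds.
Qed.

(* Integrate [d/dp (sin (x p) sin (t om))] and [d/dp (sin (x p) cos (t om))] over [0, PI]. *)
Lemma green0_flip x t : (0 <= t)%Z ->
  (RtoC (2 * IZR x) * G x (t + 1)%Z =
   RtoC c * (RtoC (IZR x - IZR t) * G (x + 1)%Z t + RtoC (IZR x + IZR t) * G (x - 1)%Z t))%C.
Proof.
intros Ht. pose proof norm1_bounds as Hc. fold c in Hc. pose proof PI_RGT_0 as Hpi.
set (X := IZR x). set (T := IZR t).
assert (HD : forall F F' : R -> R, (forall p, is_derive F p (F' p)) -> (forall p, continuous F' p) ->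
   F 0 = 0 -> F PI = 0 -> RInt F' 0 PI = 0).
{ intros F F' HF HF' E0 E1. rewrite (is_RInt_unique _ _ _ _ (is_RInt_derive (V := R_CompleteNormedModule) F F' 0 PI
     (fun p _ => HF p) (fun p _ => HF' p))). rewrite E0, E1. unfold minus, plus, opp; simpl. ring. }
assert (Hs := fun p => sin_om_pos c Hc p).
assert (Hder : forall p, is_derive (om c) p (c * sin p / sin_om c p)) by (intros; apply om_derive; auto).
assert (Csx : forall p, continuous (fun p => sin (X * p)) p).
{ intros p. apply (continuous_comp (fun p => X * p) sin); [|apply continuous_sin].
  apply continuous_mult_R; [apply continuous_const|apply continuous_id]. }
assert (I1 : RInt (fun p => X * (cos (X * p) * sin (T * om c p)) + T * c * (sin (X * p) * (sin p * cos_mode t p))) 0 PI = 0).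
{ apply (HD (fun p => sin (X * p) * sin (T * om c p))).
  - intros p. unfold cos_mode. fold c T. auto_derive.
    + exists (c * sin p / sin_om c p). auto.
    + replace (Derive (fun x0 : R => om c x0) p) with (c * sin p / sin_om c p) by (symmetry; apply is_derive_unique, Hder). specialize (Hs p). field. lra.
  - intros p. apply continuous_plus_R; apply continuous_mult_R; try apply continuous_const; apply continuous_mult_R.
    + apply continuous_cos_lin. + apply sin_n_om_cont; auto. + apply Csx.
    + apply continuous_mult_R; [apply continuous_sin|apply cos_mode_cont].
  - rewrite Rmult_0_r, sin_0. ring.
  - unfold X. rewrite sin_IZR_PI. ring. }
assert (I2 : RInt (fun p => X * (cos (X * p) * cos (T * om c p)) + (- (T * c)) * (sin (X * p) * (sin p * sin_mode t p))) 0 PI = 0).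
{ apply (HD (fun p => sin (X * p) * cos (T * om c p))).
  - intros p. unfold sin_mode. fold c T. auto_derive.
    + exists (c * sin p / sin_om c p). auto.
    + replace (Derive (fun x0 : R => om c x0) p) with (c * sin p / sin_om c p) by (symmetry; apply is_derive_unique, Hder). specialize (Hs p). field. lra.
  - intros p. apply continuous_plus_R; apply continuous_mult_R; try apply continuous_const; apply continuous_mult_R.
    + apply continuous_cos_lin. + apply cos_n_om_cont; auto. + apply Csx.
    + apply continuous_mult_R; [apply continuous_sin|apply sin_mode_cont].
  - rewrite Rmult_0_r, sin_0. ring.
  - unfold X. rewrite sin_IZR_PI. ring. }
assert (Hex : forall k n, ex_RInt (fun p => cos (k * p) * cos_mode n p) 0 PI).
{ intros; apply ex_RInt_cont; intros; apply continuous_mult_R; [apply continuous_cos_lin|apply cos_mode_cont]. }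
assert (Hex' : forall k n, ex_RInt (fun p => cos (k * p) * sin_mode n p) 0 PI).
{ intros; apply ex_RInt_cont; intros; apply continuous_mult_R; [apply continuous_cos_lin|apply sin_mode_cont]. }
assert (Hlin : forall (u v w : R -> R) k1 k2 k3, ex_RInt u 0 PI -> ex_RInt v 0 PI -> ex_RInt w 0 PI ->
  RInt (fun p => k1 * u p + 1 * (k2 * v p + k3 * w p)) 0 PI = k1 * RInt u 0 PI + (k2 * RInt v 0 PI + k3 * RInt w 0 PI)).
{ intros u v w k1 k2 k3 Hu Hv Hw. rewrite RInt_lin; auto.
  - rewrite RInt_lin by auto. ringR.
  - apply (ex_RInt_plus (V := R_NormedModule) (fun p => k2 * v p)); apply (ex_RInt_scal (V := R_NormedModule)); auto. }
unfold G. rewrite !green_massive. unfold gre, gim.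
rewrite !(Z.abs_eq t), (Z.abs_eq (t + 1)) by lia.
(* Expanding [cos ((x + 1) p)], [cos ((x - 1) p)] and [sin ((t + 1) om)] with [cos om = c cos p]
   turns this combination into twice the integrand of [I2]; [J2] below is -2 times [I1] in the same
   way. *)
assert (J1 : 2 * X * RInt (fun p => cos (X * p) * sin_mode (t + 1) p) 0 PI =
   c * ((X - T) * RInt (fun p => cos (IZR (x + 1) * p) * sin_mode t p) 0 PI + (X + T) * RInt (fun p => cos (IZR (x - 1) * p) * sin_mode t p) 0 PI)).
{ apply Rminus_diag_uniq. 
  replace (2 * X * RInt (fun p => cos (X * p) * sin_mode (t + 1) p) 0 PI -
   c * ((X - T) * RInt (fun p => cos (IZR (x + 1) * p) * sin_mode t p) 0 PI + (X + T) * RInt (fun p => cos (IZR (x - 1) * p) * sin_mode t p) 0 PI))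
   with (2 * X * RInt (fun p => cos (X * p) * sin_mode (t + 1) p) 0 PI + ((- c * (X - T)) * RInt (fun p => cos (IZR (x + 1) * p) * sin_mode t p) 0 PI +
     (- c * (X + T)) * RInt (fun p => cos (IZR (x - 1) * p) * sin_mode t p) 0 PI)) by ring.
  rewrite <- Hlin by auto.
  match type of I2 with RInt ?f 0 PI = 0 =>
    assert (J : RInt (fun p => (2) * f p) 0 PI = 0); [rewrite RInt_scal_R, I2; [apply Rmult_0_r|]|refine (eq_trans _ J)] end.
  { apply ex_RInt_cont; intros p; apply continuous_plus_R; apply continuous_mult_R; try apply continuous_const; apply continuous_mult_R.
    - apply continuous_cos_lin. - apply cos_n_om_cont; auto. - apply Csx.
    - apply continuous_mult_R; [apply continuous_sin|apply sin_mode_cont]. }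
  apply RInt_ext. intros p _.
  unfold sin_mode. fold c. rewrite !plus_IZR, minus_IZR. fold X T.
  rewrite !Rmult_plus_distr_r, Rmult_minus_distr_r, !Rmult_1_l, sin_plus, cos_plus, cos_minus, cos_om, sin_om_eq by auto.
  specialize (Hs p). match goal with |- @eq _ ?x ?y => change (@eq R x y) end. field. lra. }
assert (J2 : 2 * X * RInt (fun p => cos (X * p) * cos_mode (t + 1) p) 0 PI =
   c * ((X - T) * RInt (fun p => cos (IZR (x + 1) * p) * cos_mode t p) 0 PI + (X + T) * RInt (fun p => cos (IZR (x - 1) * p) * cos_mode t p) 0 PI)).
{ apply Rminus_diag_uniq. 
  replace (2 * X * RInt (fun p => cos (X * p) * cos_mode (t + 1) p) 0 PI -
   c * ((X - T) * RInt (fun p => cos (IZR (x + 1) * p) * cos_mode t p) 0 PI + (X + T) * RInt (fun p => cos (IZR (x - 1) * p) * cos_mode t p) 0 PI))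
   with (2 * X * RInt (fun p => cos (X * p) * cos_mode (t + 1) p) 0 PI + ((- c * (X - T)) * RInt (fun p => cos (IZR (x + 1) * p) * cos_mode t p) 0 PI +
     (- c * (X + T)) * RInt (fun p => cos (IZR (x - 1) * p) * cos_mode t p) 0 PI)) by ring.
  rewrite <- Hlin by auto.
  match type of I1 with RInt ?f 0 PI = 0 =>
    assert (J : RInt (fun p => (-2) * f p) 0 PI = 0); [rewrite RInt_scal_R, I1; [apply Rmult_0_r|]|refine (eq_trans _ J)] end.
  { apply ex_RInt_cont; intros p; apply continuous_plus_R; apply continuous_mult_R; try apply continuous_const; apply continuous_mult_R.
    - apply continuous_cos_lin. - apply sin_n_om_cont; auto. - apply Csx.
    - apply continuous_mult_R; [apply continuous_sin|apply cos_mode_cont]. }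
  apply RInt_ext. intros p _.
  unfold cos_mode. fold c. rewrite !plus_IZR, minus_IZR. fold X T.
  rewrite !Rmult_plus_distr_r, Rmult_minus_distr_r, !Rmult_1_l, !cos_plus, cos_minus, cos_om, sin_om_eq by auto.
  specialize (Hs p). match goal with |- @eq _ ?x ?y => change (@eq R x y) end. field. lra. }
fold X. unfold Cmult, Cplus, RtoC; cbn [fst snd]. f_equal.
- transitivity (/ PI * (2 * X * RInt (fun p => cos (X * p) * sin_mode (t + 1) p) 0 PI)); [ring|rewrite J1; ring].
- transitivity (/ PI * (2 * X * RInt (fun p => cos (X * p) * cos_mode (t + 1) p) 0 PI)); [ring|rewrite J2; ring].
Qed.
End Massive.

(** * The contour integral *)

(** On the boundary of the strip the slice integrals are only known to be continuous, so
    differentiability is required in the open interval alone. The mean value theorem is applied to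
    the difference between [H] and a primitive of [h]. *)
Lemma FTC_open (H h : R -> R) a b : a < b ->
  (forall x, a <= x <= b -> continuous H x) -> (forall x, a <= x <= b -> continuous h x) ->
  (forall x, a < x < b -> is_derive H x (h x)) -> RInt h a b = H b - H a.
Proof.
intros Hab HH Hh Hd.
(* Extend h by constants: its primitive is then differentiable at the end points too. *)
set (k := fun x => h (Rmax a (Rmin x b))).
assert (Ck : forall x, continuous k x).
{ intros x. unfold k. apply (continuous_comp (fun x => Rmax a (Rmin x b)) h).
  - assert (E : forall y, Rmax a (Rmin y b) = (a + (y + b - Rabs (y - b)) / 2 + Rabs (a - (y + b - Rabs (y - b)) / 2)) / 2).
    { intros y. unfold Rmax, Rmin, Rabs. repeat (destruct Rle_dec || destruct Rcase_abs); lra. }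
    apply (continuous_ext (fun y => (a + (y + b - Rabs (y - b)) / 2 + Rabs (a - (y + b - Rabs (y - b)) / 2)) / 2)).
    { intros; symmetry; apply E. }
    assert (C1 : continuous (fun y => Rabs (y - b)) x).
    { apply (continuous_comp (fun y => y - b) Rabs); [|apply continuous_Rabs].
      apply (continuous_minus (V := R_NormedModule)); [apply continuous_id|apply continuous_const]. }
    assert (C2 : continuous (fun y => (y + b - Rabs (y - b)) / 2) x).
    { apply continuous_mult_R; [|apply continuous_const]. apply (continuous_minus (V := R_NormedModule)); auto.
      apply continuous_plus_R; [apply continuous_id|apply continuous_const]. }
    apply continuous_mult_R; [|apply continuous_const]. apply continuous_plus_R.
    + apply continuous_plus_R; auto. apply continuous_const.
    + apply (continuous_comp (fun y => a - (y + b - Rabs (y - b)) / 2) Rabs); [|apply continuous_Rabs].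
      apply (continuous_minus (V := R_NormedModule)); auto. apply continuous_const.
  - apply Hh. unfold Rmax, Rmin. repeat destruct Rle_dec; lra. }
assert (Dk : forall x, is_derive (fun y => RInt k a y) x (k x)).
{ intros x. apply is_derive_RInt with a; auto.
  apply filter_forall. intros y. apply RInt_correct, ex_RInt_cont; auto. }
assert (Ekh : forall x, a <= x <= b -> k x = h x).
{ intros x Hx. unfold k. rewrite Rmin_left, Rmax_right by lra. reflexivity. }
destruct (MVT_gen (fun x => RInt k a x - H x) a b (fun x => k x - h x)) as [x0 [Hx0 E]].
- rewrite Rmin_left, Rmax_right by lra. intros x Hx.
  apply (is_derive_minus (K := R_AbsRing) (V := R_NormedModule)); auto.
- rewrite Rmin_left, Rmax_right by lra. intros x Hx. apply continuity_pt_filterlim.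
  apply (continuous_minus (V := R_NormedModule)); auto.
  apply (ex_derive_continuous (V := R_NormedModule)). eexists; apply Dk.
- rewrite Rmin_left, Rmax_right in Hx0 by lra. rewrite Ekh in E by auto.
  rewrite RInt_point in E. unfold zero in E; simpl in E.
  replace (RInt h a b) with (RInt k a b).
  + lra.
  + apply RInt_ext. rewrite Rmin_left, Rmax_right by lra. intros x Hx. apply Ekh; lra.
Qed.

Lemma locally_2d_strip (P : R -> R -> Prop) phi v :
  0 < phi < PI -> (forall p u, 0 < p < PI -> P p u) -> locally_2d P phi v.
Proof.
intros Hp H. assert (He : 0 < Rmin phi (PI - phi)) by (apply Rmin_pos; lra).
exists (mkposreal _ He). simpl. intros p u Hpp _. apply H.
pose proof (Rmin_l phi (PI - phi)). pose proof (Rmin_r phi (PI - phi)).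
apply Rabs_def2 in Hpp. lra.
Qed.

Lemma locally_strip (P : R -> Prop) phi :
  0 < phi < PI -> (forall p, 0 < p < PI -> P p) -> locally phi P.
Proof.
intros Hp H. assert (He : 0 < Rmin phi (PI - phi)) by (apply Rmin_pos; lra).
exists (mkposreal _ He). intros p Hb. apply H.
unfold ball in Hb; simpl in Hb. unfold AbsRing_ball, abs, minus, plus, opp in Hb; simpl in Hb.
pose proof (Rmin_l phi (PI - phi)). pose proof (Rmin_r phi (PI - phi)).
apply Rabs_def2 in Hb. lra.
Qed.

(** Green's theorem on the region between the graph of [w] and the line [v = l],
    for one of the two Cauchy-Riemann components. *)
Section ContourReal.
Variables (a k ka : R -> R -> R) (w dw : R -> R) (l v0 : R).
Hypothesis Hda : forall phi v, 0 < phi < PI -> is_derive (fun p => a p v) phi (ka phi v).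
Hypothesis Hdk : forall phi v, 0 < phi < PI -> is_derive (fun u => k phi u) v (ka phi v).
Hypothesis Hca : forall phi v, 0 < phi < PI -> continuity_2d_pt a phi v.
Hypothesis Hcka : forall phi v, 0 < phi < PI -> continuity_2d_pt ka phi v.
Hypothesis Hw : forall phi, continuous w phi.
Hypothesis Hdw : forall phi, is_derive w phi (dw phi).
Hypothesis Hcdw : forall phi, continuous dw phi.
Hypothesis Hl : v0 < l.
Hypothesis Hwpi : v0 < w PI.
Hypothesis Ha0 : locally 0 (fun phi => forall v, continuity_2d_pt a phi v /\ continuity_2d_pt k phi v).
Hypothesis Hapi : locally PI (fun phi => forall v, v0 < v -> continuity_2d_pt a phi v /\ continuity_2d_pt k phi v).
Hypothesis Hck : forall phi v, 0 < phi < PI -> continuity_2d_pt k phi v.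

Let H phi := RInt (fun v => a phi v) l (w phi).

(** The Leibniz rule; the Cauchy-Riemann hypotheses make the [phi]-derivative of [a] also the
    [v]-derivative of [k], so its slice integral is a difference of values of [k]. *)
Lemma slice_integral_derive phi : 0 < phi < PI ->
  is_derive H phi (a phi (w phi) * dw phi + (k phi (w phi) - k phi l)).
Proof.
intros Hphi. unfold H.
assert (Hex : forall p x y, 0 < p < PI -> ex_RInt (fun v => a p v) x y).
{ intros p x y Hp. apply ex_RInt_cont. intros v. apply continuous_of_2d, Hca, Hp. }
assert (HD : forall p v, 0 < p < PI -> Derive (fun z => a z v) p = ka p v).
{ intros p v Hp. apply is_derive_unique, Hda, Hp. }
assert (HDc : forall p v, 0 < p < PI -> continuity_2d_pt (fun u v => Derive (fun z => a z v) u) p v).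
{ intros p v Hp. apply continuity_2d_pt_ext_loc with ka; auto.
  apply locally_2d_strip; auto. intros; symmetry; auto. }
replace (k phi (w phi) - k phi l) with (RInt (fun v => Derive (fun u => a u v) phi) l (w phi)).
2:{ rewrite (RInt_ext _ (fun v => ka phi v)) by (intros; apply HD; auto).
    rewrite (is_RInt_unique _ _ _ _ (is_RInt_derive (V := R_CompleteNormedModule) (fun v => k phi v) (fun v => ka phi v) l (w phi)
      (fun v _ => Hdk phi v Hphi) (fun v _ => continuous_of_2d ka phi v (Hcka phi v Hphi)))). reflexivity. }
rewrite Rplus_comm.
apply (is_derive_RInt_param_bound_comp_aux3 a l w phi (dw phi)); auto.
- apply locally_strip; auto.
- exists (mkposreal 1 Rlt_0_1). apply locally_strip; auto.
- exists (mkposreal 1 Rlt_0_1). apply locally_strip; auto. intros p Hp t _. eexists; apply Hda; auto.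
- apply locally_2d_strip; auto.
- apply continuity_pt_filterlim, continuous_of_2d, Hca; auto.
Qed.

(** Rescaling the slice to [[0, 1]] fixes the bounds of integration and reduces the claim to
    continuity of a parametric integral. *)
Lemma slice_integral_cont_at phi0 :
  locally phi0 (fun phi => forall s, 0 <= s <= 1 -> continuity_2d_pt a phi (l + s * (w phi - l))) ->
  continuous H phi0.
Proof.
intros Hloc.
assert (Hpt : forall s, 0 <= s <= 1 -> continuity_2d_pt a phi0 (l + s * (w phi0 - l))) by (apply (locally_singleton _ _ Hloc)).
assert (Hline : forall phi s, continuity_2d_pt (fun p s => l + s * (w p - l)) phi s).
{ intros phi s. apply continuity_2d_pt_plus; [apply continuity_2d_pt_const|].
  apply continuity_2d_pt_mult; [apply continuity_2d_pt_id2|]. apply continuity_2d_pt_minus; [|apply continuity_2d_pt_const].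
  apply (continuity_2d_pt_comp1 w (fun p _ => p)); [apply Hw|apply continuity_2d_pt_id1]. }
assert (Hcomp : forall phi s, continuity_2d_pt a phi (l + s * (w phi - l)) ->
   continuity_2d_pt (fun p s => a p (l + s * (w p - l))) phi s).
{ intros phi s Hc. apply continuity_2d_pt_filterlim in Hc. apply continuity_2d_pt_filterlim.
  refine (filterlim_comp _ _ _ (fun z : R * R => (fst z, l + snd z * (w (fst z) - l))) (fun z : R * R => a (fst z) (snd z)) _ _ _ _ Hc).
  pose proof (proj1 (continuity_2d_pt_filterlim _ _ _) (Hline phi s)) as HL. cbv beta in HL. cbn [fst snd] in HL.
  apply filterlim_locally. intros eps.
  pose proof (proj1 (filterlim_locally _ _) HL eps) as K.
  assert (K2 : locally (phi, s) (fun z : R * R => ball phi eps (fst z))).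
  { exists eps. intros z [Hz _]. exact Hz. }
  generalize (filter_and _ _ K K2). apply filter_imp. intros z [B1 B2]. split; [exact B2|exact B1]. }
apply (continuous_ext_loc _ (fun phi => (w phi - l) * RInt (fun s => a phi (l + s * (w phi - l))) 0 1)).
- revert Hloc. apply filter_imp. intros phi Hphi. unfold H.
  rewrite <- RInt_scal_R.
  2:{ apply (ex_RInt_continuous (V := R_CompleteNormedModule)). rewrite Rmin_left, Rmax_right by lra. intros s Hs.
      apply (continuous_of_2d (fun p s => a p (l + s * (w p - l)))), Hcomp, Hphi, Hs. }
  transitivity (RInt (fun v => a phi v) (l + 0 * (w phi - l)) (l + 1 * (w phi - l))).
  2:{ replace (l + 0 * (w phi - l)) with l by ring. replace (l + 1 * (w phi - l)) with (w phi) by ring. reflexivity. }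
  rewrite <- (RInt_comp (V := R_CompleteNormedModule) (fun v => a phi v) (fun s => l + s * (w phi - l)) (fun _ => w phi - l)).
  + reflexivity.
  + rewrite Rmin_left, Rmax_right by lra. intros s Hs. apply continuous_of_2d, Hphi, Hs.
  + intros s _. split; [auto_derive; auto; ring|apply continuous_const].
- apply continuous_mult_R.
  + apply (continuous_minus (V := R_NormedModule)); [apply Hw|apply continuous_const].
  + apply (RInt_param_continuous (fun p s => a p (l + s * (w p - l)))); [lra| |].
    * intros s Hs. apply Hcomp, Hpt, Hs.
    * revert Hloc. apply filter_imp. intros phi Hphi. apply (ex_RInt_continuous (V := R_CompleteNormedModule)).
      rewrite Rmin_left, Rmax_right by lra. intros s Hs.
      apply (continuous_of_2d (fun p s => a p (l + s * (w p - l)))), Hcomp, Hphi, Hs.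
Qed.

Lemma continuous_along (f : R -> R -> R) phi :
  continuity_2d_pt f phi (w phi) -> continuous (fun p => f p (w p)) phi.
Proof.
intros Hf. apply continuity_2d_pt_filterlim in Hf.
refine (filterlim_comp _ _ _ (fun p : R => (p, w p)) (fun z : R * R => f (fst z) (snd z)) _ _ _ _ Hf).
apply filterlim_locally. intros eps.
pose proof (proj1 (filterlim_locally _ _) (Hw phi) eps) as K.
assert (K2 : locally phi (fun p : R => ball phi eps p)) by (exists eps; auto).
generalize (filter_and _ _ K K2). apply filter_imp. intros z [B1 B2]. split; [exact B2|exact B1].
Qed.

(** Near [phi = PI] continuity is available only for [v > v0]. Both ends of a slice, [l] and [w p],
    lie above [v0] there, hence so does the whole slice. *)
Lemma contour_region phi : 0 <= phi <= PI -> (locally phi (fun p => forall s, 0 <= s <= 1 ->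
    continuity_2d_pt a p (l + s * (w p - l)) /\ continuity_2d_pt k p (l + s * (w p - l)))).
Proof.
pose proof PI_RGT_0 as Hpi0. intros [[H0|H0] [H1|H1]]; [|rewrite H1|rewrite <- H0|lra].
- apply locally_strip; [lra|]. intros; split; auto.
- assert (K : locally PI (fun p => v0 < w p)) by (apply (Hw PI (fun y => v0 < y)), (open_gt v0), Hwpi).
  generalize (filter_and _ _ K Hapi). apply filter_imp. intros p [B1 B2] s Hs. apply B2.
  destruct (Rle_lt_dec l (w p)).
  + assert (0 <= s * (w p - l)) by (apply Rmult_le_pos; lra). lra.
  + assert (s * (l - w p) <= 1 * (l - w p)) by (apply Rmult_le_compat_r; lra). lra.
- revert Ha0. apply filter_imp. intros p Hp s _. apply Hp.
Qed.

Lemma contour_real :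
  RInt (fun phi => a phi (w phi) * dw phi + (k phi (w phi) - k phi l)) 0 PI
   = RInt (fun v => a PI v) l (w PI) - RInt (fun v => a 0 v) l (w 0).
Proof.
pose proof PI_RGT_0 as Hpi.
apply (FTC_open H (fun phi => a phi (w phi) * dw phi + (k phi (w phi) - k phi l))); auto.
- intros phi Hphi. apply slice_integral_cont_at. generalize (contour_region phi Hphi). apply filter_imp.
  intros p Hp s Hs. apply Hp, Hs.
- intros phi Hphi. pose proof (locally_singleton _ _ (contour_region phi Hphi)) as Hp. cbv beta in Hp.
  destruct (Hp 1) as [A1 K1]; [lra|]. destruct (Hp 0) as [_ K0]; [lra|].
  replace (l + 1 * (w phi - l)) with (w phi) in * by ring. replace (l + 0 * (w phi - l)) with l in * by ring.
  apply continuous_plus_R; [apply continuous_mult_R; [apply continuous_along; auto|auto]|].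
  apply (continuous_minus (V := R_NormedModule)); [apply continuous_along; auto|].
  apply continuous_of_2d_l; auto.
- intros phi Hphi. apply slice_integral_derive; auto.
Qed.
End ContourReal.

(** * Holomorphic functions on the strip *)

Definition cder (f : R -> C) (x : R) (l : C) : Prop :=
  is_derive (fun y => fst (f y)) x (fst l) /\ is_derive (fun y => snd (f y)) x (snd l).

(** [f phi v] is holomorphic in [v + i phi] on the strip [0 < phi < PI], with complex derivative [g]. *)
Definition strip_hol (f g : R -> R -> C) : Prop := forall phi v, 0 < phi < PI ->
  cder (fun u => f phi u) v (g phi v) /\ cder (fun p => f p v) phi (Ci * g phi v)%C /\
  c2 f phi v /\ c2 g phi v.

(** The pair [(dw phi, 1)] is the velocity [w' + i] of the curve. Cauchy's theorem splits into two
    uses of [contour_real]: one with [a = Re f], [k = - Im f], and one with [a = Im f], [k = Re f].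
    The last two integrals run along the sides [phi = PI] and [phi = 0]. *)
Lemma contour_shift (f g : R -> R -> C) (w dw : R -> R) (l v0 : R) :
  strip_hol f g ->
  (forall phi, is_derive w phi (dw phi)) -> (forall phi, continuous dw phi) ->
  v0 < l -> v0 < w PI ->
  locally 0 (fun phi => forall v, c2 f phi v) ->
  locally PI (fun phi => forall v, v0 < v -> c2 f phi v) ->
  CInt (fun phi => f phi (w phi) * (dw phi, 1))%C 0 PI =
  (Ci * CInt (fun phi => f phi l) 0 PI + CInt (fun v => f PI v) l (w PI) - CInt (fun v => f 0 v) l (w 0))%C.
Proof.
intros Hf Hdw Hcdw Hl Hwpi H0 Hpi.
assert (Hw : forall phi, continuous w phi).
{ intros; apply (ex_derive_continuous (V := R_NormedModule)). eexists; apply Hdw. }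
assert (E1 : RInt (fun phi => fst (f phi (w phi)) * dw phi + (- snd (f phi (w phi)) - - snd (f phi l))) 0 PI
   = RInt (fun v => fst (f PI v)) l (w PI) - RInt (fun v => fst (f 0 v)) l (w 0)).
{ apply (contour_real (fun p v => fst (f p v)) (fun p v => - snd (f p v)) (fun p v => - snd (g p v)) w dw l v0); auto;
    try (intros phi v Hp; destruct (Hf phi v Hp) as ([D1 D2] & [D3 D4] & [C1 C2] & [C3 C4])).
  - replace (- snd (g phi v)) with (fst (Ci * g phi v)%C) by (simpl; ring). exact D3.
  - apply (is_derive_opp (K := R_AbsRing) (V := R_NormedModule)); exact D2.
  - exact C1.
  - apply continuity_2d_pt_opp; exact C4.
  - revert H0. apply filter_imp. intros p Hp v. split; [apply Hp|apply continuity_2d_pt_opp, Hp].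
  - revert Hpi. apply filter_imp. intros p Hp v Hv. split; [apply Hp, Hv|apply continuity_2d_pt_opp, Hp, Hv].
  - apply continuity_2d_pt_opp; exact C2. }
assert (E2 : RInt (fun phi => snd (f phi (w phi)) * dw phi + (fst (f phi (w phi)) - fst (f phi l))) 0 PI
   = RInt (fun v => snd (f PI v)) l (w PI) - RInt (fun v => snd (f 0 v)) l (w 0)).
{ apply (contour_real (fun p v => snd (f p v)) (fun p v => fst (f p v)) (fun p v => fst (g p v)) w dw l v0); auto;
    try (intros phi v Hp; destruct (Hf phi v Hp) as ([D1 D2] & [D3 D4] & [C1 C2] & [C3 C4])).
  - replace (fst (g phi v)) with (snd (Ci * g phi v)%C) by (simpl; ring). exact D4.
  - exact D1.
  - exact C2.
  - exact C3.
  - revert H0. apply filter_imp. intros p Hp v. split; apply Hp.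
  - revert Hpi. apply filter_imp. intros p Hp v Hv. split; apply Hp, Hv.
  - exact C1. }
assert (Hreg : forall phi, 0 <= phi <= PI -> c2 f phi (w phi) /\ c2 f phi l).
{ pose proof PI_RGT_0 as Hpi0. intros phi [[h0|h0] [h1|h1]]; [|rewrite h1|rewrite <- h0|lra].
  - split; apply Hf; lra.
  - pose proof (locally_singleton _ _ Hpi) as K. cbv beta in K. auto.
  - pose proof (locally_singleton _ _ H0) as K. cbv beta in K. auto. }
pose proof PI_RGT_0.
assert (Hex : forall h : R -> R, (forall phi, 0 <= phi <= PI -> continuous h phi) -> ex_RInt h 0 PI).
{ intros h Hh. apply (ex_RInt_continuous (V := R_CompleteNormedModule)). rewrite Rmin_left, Rmax_right by lra. exact Hh. }
assert (X1 : ex_RInt (fun phi => fst (f phi (w phi) * (dw phi, 1))%C) 0 PI).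
{ apply Hex. intros phi Hp. destruct (Hreg phi Hp) as [[A B] _]. unfold Cmult; cbn [fst snd].
  apply (continuous_minus (V := R_NormedModule)); apply continuous_mult_R; auto; try apply continuous_const.
  apply (continuous_along w Hw (fun p v => fst (f p v))); auto.
  apply (continuous_along w Hw (fun p v => snd (f p v))); auto. }
assert (X2 : ex_RInt (fun phi => snd (f phi (w phi) * (dw phi, 1))%C) 0 PI).
{ apply Hex. intros phi Hp. destruct (Hreg phi Hp) as [[A B] _]. unfold Cmult; cbn [fst snd].
  apply continuous_plus_R; apply continuous_mult_R; auto; try apply continuous_const.
  apply (continuous_along w Hw (fun p v => fst (f p v))); auto.
  apply (continuous_along w Hw (fun p v => snd (f p v))); auto. }
assert (X3 : ex_RInt (fun phi => fst (f phi l)) 0 PI).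
{ apply Hex. intros phi Hp. apply (continuous_of_2d_l (fun p v => fst (f p v))), (Hreg phi Hp). }
assert (X4 : ex_RInt (fun phi => snd (f phi l)) 0 PI).
{ apply Hex. intros phi Hp. apply (continuous_of_2d_l (fun p v => snd (f p v))), (Hreg phi Hp). }
rewrite (RInt_ext _ (fun phi => 1 * fst (f phi (w phi) * (dw phi, 1))%C + 1 * snd (f phi l))) in E1
  by (intros; simpl; ringR).
rewrite (RInt_ext _ (fun phi => 1 * snd (f phi (w phi) * (dw phi, 1))%C + (-1) * fst (f phi l))) in E2
  by (intros; simpl; ringR).
rewrite RInt_lin in E1, E2 by auto.
unfold CInt, Cminus, Cplus, Copp, Cmult at 2, Ci. cbn [fst snd].
apply injective_projections; cbn [fst snd]; simpl in E1, E2 |- *; lra.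
Qed.

Lemma cder_const k x : cder (fun _ => k) x (RtoC 0).
Proof. split; apply (is_derive_const (K := R_AbsRing) (V := R_NormedModule)). Qed.

Lemma cder_plus f g x a b : cder f x a -> cder g x b -> cder (fun y => f y + g y)%C x (a + b)%C.
Proof. intros [F1 F2] [G1 G2]; split; apply (is_derive_plus (K := R_AbsRing) (V := R_NormedModule)); assumption. Qed.

Lemma is_derive_mult_R (f g : R -> R) x a b : is_derive f x a -> is_derive g x b ->
  is_derive (fun y => f y * g y) x (a * g x + f x * b).
Proof. intros; apply (is_derive_mult f g x a b); auto. intros; apply Rmult_comm. Qed.

Lemma cder_mult f g x a b : cder f x a -> cder g x b -> cder (fun y => f y * g y)%C x (a * g x + f x * b)%C.
Proof.
intros [F1 F2] [G1 G2]; split; unfold Cmult, Cplus; cbn [fst snd].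
- evar_last.
  { apply (is_derive_minus (K := R_AbsRing) (V := R_NormedModule)); apply is_derive_mult_R; eassumption. }
  unfold minus, plus, opp; simpl. ring.
- evar_last.
  { apply (is_derive_plus (K := R_AbsRing) (V := R_NormedModule)); apply is_derive_mult_R; eassumption. }
  unfold plus; simpl. ring.
Qed.

Lemma is_derive_inv_R (f : R -> R) x a : is_derive f x a -> f x <> 0 -> is_derive (fun y => / f y) x (- a / f x ^ 2).
Proof. intros; apply is_derive_inv; auto. Qed.

Lemma cder_inv f x a : cder f x a -> f x <> RtoC 0 -> cder (fun y => / f y)%C x (- (a * (/ f x * / f x)))%C.
Proof.
intros [F1 F2] H0. apply Cnonzero_sqr in H0.
assert (D : is_derive (fun y => fst (f y) ^ 2 + snd (f y) ^ 2) x (2 * (fst a * fst (f x) + snd a * snd (f x)))).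
{ evar_last. { apply (is_derive_plus (K := R_AbsRing) (V := R_NormedModule)); apply is_derive_pow; eassumption. }
  unfold plus; simpl. ring. }
apply is_derive_inv_R in D; [|lra].
split; unfold Cinv, Cmult, Copp; cbn [fst snd].
- evar_last. { apply (is_derive_mult_R (fun y => fst (f y)) (fun y => / (fst (f y) ^ 2 + snd (f y) ^ 2))); eassumption. }
  simpl. field. lra.
- evar_last. { apply (is_derive_mult_R (fun y => - snd (f y)) (fun y => / (fst (f y) ^ 2 + snd (f y) ^ 2)));
    [apply (is_derive_opp (K := R_AbsRing) (V := R_NormedModule)); eassumption|eassumption]. }
  unfold opp; simpl. field. lra.
Qed.

(** A continuous square root on the closed upper half plane only. *)
Definition csqrt_up (z : C) : C := (sqrt ((Cmod z + fst z) / 2), sqrt ((Cmod z - fst z) / 2)).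

Lemma csqrt_up_sqr z : 0 <= snd z -> (csqrt_up z * csqrt_up z = z)%C.
Proof.
intros Hy. pose proof (Cmod_ge_re z) as H. apply Rabs_le_between in H. pose proof (Cmod_sqr z) as E.
unfold csqrt_up, Cmult; cbn [fst snd].
assert (A : 0 <= (Cmod z + fst z) / 2) by lra. assert (B : 0 <= (Cmod z - fst z) / 2) by lra.
destruct z as [x y]. cbn [fst snd] in *. f_equal.
- rewrite !sqrt_sqrt by auto. lra.
- rewrite <- !sqrt_mult by auto.
  replace ((Cmod (x, y) + x) / 2 * ((Cmod (x, y) - x) / 2)) with ((y / 2) * (y / 2)) by nra.
  replace ((Cmod (x, y) - x) / 2 * ((Cmod (x, y) + x) / 2)) with ((y / 2) * (y / 2)) by nra.
  rewrite sqrt_square by lra. lra.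
Qed.

Lemma csqrt_up_neq_0 z : z <> RtoC 0 -> csqrt_up z <> RtoC 0.
Proof.
intros Hz E. apply Cmod_gt_0 in Hz. unfold csqrt_up, RtoC in E. injection E; intros E2 E1.
pose proof (Cmod_ge_re z) as H. apply Rabs_le_between in H.
apply sqrt_eq_0 in E1; [|lra]. apply sqrt_eq_0 in E2; [|lra]. lra.
Qed.

Lemma c2_csqrt_up f x y : c2 f x y -> c2 (fun u v => csqrt_up (f u v)) x y.
Proof.
intros [H1 H2].
assert (K : continuity_2d_pt (fun u v => Cmod (f u v)) x y).
{ unfold Cmod. apply (continuity_2d_pt_comp1 sqrt); [apply continuous_sqrt|].
  apply continuity_2d_pt_ext with (fun u v => fst (f u v) * fst (f u v) + snd (f u v) * snd (f u v)).
  intros; ring. apply continuity_2d_pt_plus; apply continuity_2d_pt_mult; auto. }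
apply c2_pair; (apply (continuity_2d_pt_comp1 sqrt); [apply continuous_sqrt|]);
  (apply continuity_2d_pt_mult; [|apply continuity_2d_pt_const]).
- apply continuity_2d_pt_plus; auto.
- apply continuity_2d_pt_minus; auto.
Qed.

(** Strictly above the real axis both real square roots have positive arguments and are
    differentiable. The equations [E1], [E2], [E3] rewrite everything in terms of the components
    [s1], [s2] of the root, after which the claim is rational. *)
Lemma cder_csqrt_up f x a : cder f x a -> 0 < snd (f x) ->
  cder (fun y => csqrt_up (f y)) x (a * / (2 * csqrt_up (f x)))%C.
Proof.
intros [F1 F2] Hy.
set (X := fun y => fst (f y)) in *. set (Y := fun y => snd (f y)) in *.
assert (Hn : 0 < X x ^ 2 + Y x ^ 2) by (unfold Y in *; cbv beta in *; nra).
assert (Hm : Cmod (f x) = sqrt (X x ^ 2 + Y x ^ 2)) by reflexivity.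
set (r := sqrt (X x ^ 2 + Y x ^ 2)) in *.
assert (Hr : 0 < r) by (apply sqrt_lt_R0; auto).
assert (Er : r * r = X x * X x + Y x * Y x) by (unfold r; rewrite sqrt_sqrt; lra).
assert (HXr : X x < r /\ - X x < r) by (change (0 < Y x) in Hy; split; nra).
assert (Ef : f x = (X x, Y x)) by (unfold X, Y; destruct (f x); reflexivity).
set (s1 := sqrt ((r + X x) / 2)). set (s2 := sqrt ((r - X x) / 2)).
assert (P1 : 0 < s1) by (apply sqrt_lt_R0; lra). assert (P2 : 0 < s2) by (apply sqrt_lt_R0; lra).
assert (Es : csqrt_up (f x) = (s1, s2)) by (unfold csqrt_up; rewrite Hm; reflexivity).
assert (Esq := csqrt_up_sqr (f x) (Rlt_le _ _ Hy)). rewrite Es, Ef in Esq.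
unfold Cmult in Esq; cbn [fst snd] in Esq. injection Esq; intros E2 E1.
assert (E3 : r = s1 * s1 + s2 * s2) by (unfold s1, s2; rewrite !sqrt_sqrt by lra; lra).
assert (Dr : is_derive (fun y => sqrt (X y ^ 2 + Y y ^ 2)) x ((fst a * X x + snd a * Y x) / r)).
{ evar_last.
  { apply (is_derive_comp sqrt (fun y => X y ^ 2 + Y y ^ 2)).
    - apply is_derive_Reals, derivable_pt_lim_sqrt. auto.
    - apply (is_derive_plus (K := R_AbsRing) (V := R_NormedModule)); apply is_derive_pow; eassumption. }
  fold r. unfold scal, plus; simpl; unfold mult; simpl. field. lra. }
rewrite Es.
assert (Hden : s1 * s1 + s2 * s2 <> 0) by nra.
split.
- evar_last.
  { apply (is_derive_comp sqrt (fun y => (sqrt (X y ^ 2 + Y y ^ 2) + X y) * / 2)).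
    - apply is_derive_Reals, derivable_pt_lim_sqrt. fold r. lra.
    - apply (is_derive_mult_R _ (fun _ => / 2)); [apply (is_derive_plus (K := R_AbsRing) (V := R_NormedModule)); eassumption
       |apply (is_derive_const (K := R_AbsRing) (V := R_NormedModule))]. }
  fold r. change (sqrt ((r + X x) * / 2)) with s1. unfold scal, plus, zero; simpl; unfold mult; simpl. clearbody s1 s2 r.
  rewrite E3, <- E1, <- E2. field. split; [lra|]. split; [nra|]. nra.
- evar_last.
  { apply (is_derive_comp sqrt (fun y => (sqrt (X y ^ 2 + Y y ^ 2) - X y) * / 2)).
    - apply is_derive_Reals, derivable_pt_lim_sqrt. fold r. lra.
    - apply (is_derive_mult_R _ (fun _ => / 2)); [apply (is_derive_minus (K := R_AbsRing) (V := R_NormedModule)); eassumption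
       |apply (is_derive_const (K := R_AbsRing) (V := R_NormedModule))]. }
  fold r. change (sqrt ((r + - X x) * / 2)) with s2. change (sqrt ((r - X x) * / 2)) with s2.
  unfold scal, minus, opp, plus, zero; simpl; unfold mult; simpl. clearbody s1 s2 r.
  rewrite E3, <- E1, <- E2. field. split; [lra|]. split; [nra|]. nra.
Qed.

Lemma cder_eq f x a b : cder f x a -> a = b -> cder f x b.
Proof. intros H <-; exact H. Qed.

Lemma strip_hol_const k : strip_hol (fun _ _ => k) (fun _ _ => RtoC 0).
Proof.
intros phi v _. split; [|split; [|split]].
- apply cder_const.
- apply (cder_eq _ _ _ _ (cder_const k phi)). ring.
- apply c2_const.
- apply c2_const.
Qed.

Lemma strip_hol_plus f g a b : strip_hol f a -> strip_hol g b ->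
  strip_hol (fun p v => f p v + g p v)%C (fun p v => a p v + b p v)%C.
Proof.
intros Hf Hg phi v Hp. destruct (Hf phi v Hp) as (F1 & F2 & F3 & F4). destruct (Hg phi v Hp) as (G1 & G2 & G3 & G4).
split; [|split; [|split]].
- exact (cder_plus _ _ _ _ _ F1 G1).
- apply (cder_eq _ _ _ _ (cder_plus _ _ _ _ _ F2 G2)). ring.
- exact (c2_plus f g _ _ F3 G3).
- exact (c2_plus a b _ _ F4 G4).
Qed.

Lemma strip_hol_mult f g a b : strip_hol f a -> strip_hol g b ->
  strip_hol (fun p v => f p v * g p v)%C (fun p v => a p v * g p v + f p v * b p v)%C.
Proof.
intros Hf Hg phi v Hp. destruct (Hf phi v Hp) as (F1 & F2 & F3 & F4). destruct (Hg phi v Hp) as (G1 & G2 & G3 & G4).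
split; [|split; [|split]].
- exact (cder_mult _ _ _ _ _ F1 G1).
- apply (cder_eq _ _ _ _ (cder_mult _ _ _ _ _ F2 G2)). ring.
- exact (c2_mult f g _ _ F3 G3).
- exact (c2_plus _ _ _ _ (c2_mult a g _ _ F4 G3) (c2_mult f b _ _ F3 G4)).
Qed.

Lemma strip_hol_inv f a : strip_hol f a -> (forall p v, 0 < p < PI -> f p v <> RtoC 0) ->
  strip_hol (fun p v => / f p v)%C (fun p v => - (a p v * (/ f p v * / f p v)))%C.
Proof.
intros Hf H0 phi v Hp. destruct (Hf phi v Hp) as (F1 & F2 & F3 & F4).
split; [|split; [|split]].
- exact (cder_inv _ _ _ F1 (H0 phi v Hp)).
- apply (cder_eq _ _ _ _ (cder_inv _ _ _ F2 (H0 phi v Hp))). ring.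
- exact (c2_inv f _ _ F3 (H0 phi v Hp)).
- pose proof (c2_inv f _ _ F3 (H0 phi v Hp)) as I. exact (c2_opp _ _ _ (c2_mult _ _ _ _ F4 (c2_mult _ _ _ _ I I))).
Qed.

Lemma strip_hol_csqrt f a : strip_hol f a -> (forall p v, 0 < p < PI -> 0 < snd (f p v)) ->
  strip_hol (fun p v => csqrt_up (f p v)) (fun p v => a p v * / (2 * csqrt_up (f p v)))%C.
Proof.
intros Hf H0 phi v Hp. destruct (Hf phi v Hp) as (F1 & F2 & F3 & F4).
assert (Hne : f phi v <> RtoC 0).
{ intros E. specialize (H0 phi v Hp). rewrite E in H0. simpl in H0. lra. }
assert (Hne2 : (2 * csqrt_up (f phi v))%C <> RtoC 0).
{ intros E. apply (csqrt_up_neq_0 _ Hne). apply (Cmult_cancel_l 2); [intros E2; apply RtoC_inj in E2; lra|]. rewrite E. ring. }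
split; [|split; [|split]].
- exact (cder_csqrt_up _ _ _ F1 (H0 phi v Hp)).
- apply (cder_eq _ _ _ _ (cder_csqrt_up _ _ _ F2 (H0 phi v Hp))). ring.
- exact (c2_csqrt_up f _ _ F3).
- exact (c2_mult _ _ _ _ F4 (c2_inv _ _ _ (c2_mult _ _ _ _ (c2_const (RtoC 2) _ _) (c2_csqrt_up f _ _ F3)) Hne2)).
Qed.

Lemma strip_hol_pow f a n : strip_hol f a -> exists b, strip_hol (fun p v => f p v ^ n)%C b.
Proof.
intros Hf. induction n as [|n [b IH]].
- eexists. exact (strip_hol_const (RtoC 1)).
- eexists. exact (strip_hol_mult _ _ _ _ Hf IH).
Qed.

Definition eta (phi v : R) : C := (exp v * cos phi, exp v * sin phi).
Definition ieta (phi v : R) : C := (exp (- v) * cos phi, - (exp (- v) * sin phi)).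

Lemma continuity_2d_exp_trig (s : R) (h : R -> R) phi v : (forall x, continuous h x) ->
  continuity_2d_pt (fun p u => exp (s * u) * h p) phi v.
Proof.
intros Hh. apply continuity_2d_pt_mult.
- apply (continuity_2d_pt_comp1 (fun u => exp (s * u)) (fun _ u => u)); [|apply continuity_2d_pt_id2].
  apply (ex_derive_continuous (V := R_NormedModule)). auto_derive. auto.
- apply (continuity_2d_pt_comp1 h (fun p _ => p)); [apply Hh|apply continuity_2d_pt_id1].
Qed.

Lemma eta_c2 phi v : c2 eta phi v.
Proof.
apply (c2_ext (fun p u => (exp (1 * u) * cos p, exp (1 * u) * sin p))).
- intros; unfold eta; rewrite !Rmult_1_l; reflexivity.
- apply c2_pair; apply continuity_2d_exp_trig; intros; [apply continuous_cos|apply continuous_sin].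
Qed.

Lemma ieta_c2 phi v : c2 ieta phi v.
Proof.
apply (c2_ext (fun p u => (exp ((-1) * u) * cos p, - (exp ((-1) * u) * sin p)))).
- intros; unfold ieta. replace (-1 * v0) with (- v0) by ring. reflexivity.
- apply c2_pair; [|apply continuity_2d_pt_opp]; apply continuity_2d_exp_trig; intros; [apply continuous_cos|apply continuous_sin].
Qed.

Lemma strip_hol_eta : strip_hol eta eta.
Proof.
intros phi v _. split; [|split; [|split]]; try apply eta_c2.
- split; unfold eta; cbn [fst snd]; auto_derive; auto; ring.
- split; unfold eta, Ci, Cmult; cbn [fst snd]; auto_derive; auto; ring.
Qed.

Lemma strip_hol_ieta : strip_hol ieta (fun p v => - ieta p v)%C.
Proof.
intros phi v _. split; [|split; [|split]]; try apply ieta_c2; try apply c2_opp, ieta_c2.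
- split; unfold ieta, Copp; cbn [fst snd]; auto_derive; auto; ring.
- split; unfold ieta, Ci, Cmult, Copp; cbn [fst snd]; auto_derive; auto; ring.
Qed.

(** * The two factors of the integrand and the curve of real momenta *)

Section Factors.
Variable M : R.
Hypothesis HM : 0 < M.

Definition ufac (phi v : R) : C := (1 + RtoC M * eta phi v)%C.
Definition vfac (phi v : R) : C := (1 + RtoC (- M) * ieta phi v)%C.
(* normalized so that both have modulus 1 on the image of the Brillouin zone *)
Definition sfac (phi v : R) : C := (RtoC (sqrt (norm1 M)) * csqrt_up (ufac phi v))%C.
Definition tfac (phi v : R) : C := (RtoC (sqrt (norm1 M)) * csqrt_up (vfac phi v))%C.

Lemma ufac_eq phi v : ufac phi v = (1 + M * (exp v * cos phi), M * (exp v * sin phi)).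
Proof. unfold ufac, eta, Cplus, Cmult, RtoC; cbn [fst snd]. f_equal; ring. Qed.

Lemma vfac_eq phi v : vfac phi v = (1 - M * (exp (- v) * cos phi), M * (exp (- v) * sin phi)).
Proof. unfold vfac, ieta, Cplus, Cmult, RtoC; cbn [fst snd]. f_equal; ring. Qed.

Lemma ufac_im_pos phi v : 0 < phi < PI -> 0 < snd (ufac phi v).
Proof.
intros Hp. rewrite ufac_eq; cbn [snd]. apply Rmult_lt_0_compat; auto. apply Rmult_lt_0_compat; [apply exp_pos|].
apply sin_gt_0; tauto.
Qed.

Lemma vfac_im_pos phi v : 0 < phi < PI -> 0 < snd (vfac phi v).
Proof.
intros Hp. rewrite vfac_eq; cbn [snd]. apply Rmult_lt_0_compat; auto. apply Rmult_lt_0_compat; [apply exp_pos|].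
apply sin_gt_0; tauto.
Qed.

Lemma ufac_im_nonneg phi v : 0 <= phi <= PI -> 0 <= snd (ufac phi v).
Proof.
intros Hp. rewrite ufac_eq; cbn [snd]. apply Rmult_le_pos; [lra|]. apply Rmult_le_pos; [left; apply exp_pos|].
apply sin_ge_0; tauto.
Qed.

Lemma vfac_im_nonneg phi v : 0 <= phi <= PI -> 0 <= snd (vfac phi v).
Proof.
intros Hp. rewrite vfac_eq; cbn [snd]. apply Rmult_le_pos; [lra|]. apply Rmult_le_pos; [left; apply exp_pos|].
apply sin_ge_0; tauto.
Qed.

Lemma sqrt_norm1_pos : 0 < sqrt (norm1 M).
Proof. apply sqrt_lt_R0, norm1_pos. Qed.

Lemma sqrt_norm1_sqr : (RtoC (sqrt (norm1 M)) * RtoC (sqrt (norm1 M)) = RtoC (norm1 M))%C.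
Proof. rewrite <- RtoC_mult, sqrt_sqrt; auto. left; apply norm1_pos. Qed.

Lemma sfac_sqr phi v : 0 <= phi <= PI -> (sfac phi v * sfac phi v = RtoC (norm1 M) * ufac phi v)%C.
Proof.
intros Hp. unfold sfac. rewrite <- (csqrt_up_sqr _ (ufac_im_nonneg phi v Hp)) at 3. rewrite <- sqrt_norm1_sqr. ring.
Qed.

Lemma tfac_sqr phi v : 0 <= phi <= PI -> (tfac phi v * tfac phi v = RtoC (norm1 M) * vfac phi v)%C.
Proof.
intros Hp. unfold tfac. rewrite <- (csqrt_up_sqr _ (vfac_im_nonneg phi v Hp)) at 3. rewrite <- sqrt_norm1_sqr. ring.
Qed.

Lemma ufac_c2 phi v : c2 ufac phi v.
Proof. exact (c2_plus _ _ _ _ (c2_const (RtoC 1) _ _) (c2_mult _ _ _ _ (c2_const (RtoC M) _ _) (eta_c2 phi v))). Qed.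

Lemma vfac_c2 phi v : c2 vfac phi v.
Proof. exact (c2_plus _ _ _ _ (c2_const (RtoC 1) _ _) (c2_mult _ _ _ _ (c2_const (RtoC (- M)) _ _) (ieta_c2 phi v))). Qed.

Lemma sfac_c2 phi v : c2 sfac phi v.
Proof. exact (c2_mult _ _ _ _ (c2_const (RtoC (sqrt (norm1 M))) _ _) (c2_csqrt_up _ _ _ (ufac_c2 phi v))). Qed.

Lemma tfac_c2 phi v : c2 tfac phi v.
Proof. exact (c2_mult _ _ _ _ (c2_const (RtoC (sqrt (norm1 M))) _ _) (c2_csqrt_up _ _ _ (vfac_c2 phi v))). Qed.

Lemma sfac_neq_0 phi v : ufac phi v <> RtoC 0 -> sfac phi v <> RtoC 0.
Proof.
intros Hu E. apply (csqrt_up_neq_0 _ Hu). apply (Cmult_cancel_l (RtoC (sqrt (norm1 M)))).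
- intros E2; apply RtoC_inj in E2. pose proof sqrt_norm1_pos. lra.
- unfold sfac in E. rewrite E. ring.
Qed.

Lemma sfac_neq_0_strip phi v : 0 < phi < PI -> sfac phi v <> RtoC 0.
Proof.
intros Hp. apply sfac_neq_0. intros E. pose proof (ufac_im_pos phi v Hp) as H. rewrite E in H. simpl in H. lra.
Qed.

Lemma strip_hol_sfac : exists g, strip_hol sfac g.
Proof.
eexists. exact (strip_hol_mult _ _ _ _ (strip_hol_const (RtoC (sqrt (norm1 M)))) (strip_hol_csqrt _ _
  (strip_hol_plus _ _ _ _ (strip_hol_const (RtoC 1)) (strip_hol_mult _ _ _ _ (strip_hol_const (RtoC M)) strip_hol_eta)) ufac_im_pos)).
Qed.

Lemma strip_hol_tfac : exists g, strip_hol tfac g.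
Proof.
eexists. exact (strip_hol_mult _ _ _ _ (strip_hol_const (RtoC (sqrt (norm1 M)))) (strip_hol_csqrt _ _
  (strip_hol_plus _ _ _ _ (strip_hol_const (RtoC 1)) (strip_hol_mult _ _ _ _ (strip_hol_const (RtoC (- M))) strip_hol_ieta)) vfac_im_pos)).
Qed.

Definition zpow (z : C) (k : Z) : C :=
  (if Z.leb 0 k then z ^ Z.to_nat k else (/ z) ^ Z.to_nat (- k))%C.

Lemma zpow_S z k : z <> RtoC 0 -> zpow z (k + 1) = (z * zpow z k)%C.
Proof.
intros Hz. unfold zpow.
destruct (Z.leb_spec 0 k), (Z.leb_spec 0 (k + 1)); try lia.
- replace (Z.to_nat (k + 1)) with (S (Z.to_nat k)) by lia. apply Cpow_S.
- replace (Z.to_nat (k + 1)) with 0%nat by lia. replace (Z.to_nat (- k)) with 1%nat by lia. simpl. field. auto.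
- replace (Z.to_nat (- k)) with (S (Z.to_nat (- (k + 1)))) by lia. rewrite Cpow_S. field. auto.
Qed.

Lemma zpow_cis th k : zpow (cos th, sin th) k = (cos (IZR k * th), sin (IZR k * th)).
Proof.
unfold zpow. destruct (Z.leb_spec 0 k).
- rewrite de_moivre, INR_IZR_INZ, Z2Nat.id by lia. reflexivity.
- replace (/ (cos th, sin th))%C with ((cos (- th), sin (- th)) : C).
  + rewrite de_moivre, INR_IZR_INZ, Z2Nat.id by lia. rewrite opp_IZR.
    replace (- IZR k * - th) with (IZR k * th) by ring. reflexivity.
  + rewrite cos_neg, sin_neg. pose proof (sin2_cos2 th) as E. unfold Rsqr in E. unfold Cinv; cbn [fst snd].
    replace (cos th ^ 2 + sin th ^ 2) with 1 by lra. f_equal; field.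
Qed.

(** The contour integrand: [k] and [l] are twice the exponents of [1 + M eta] and [1 - M / eta]. *)
Definition contour_fun (k l : Z) (phi v : R) : C := (zpow (sfac phi v) k * tfac phi v ^ Z.to_nat l)%C.

Lemma contour_fun_hol k l : exists g, strip_hol (contour_fun k l) g.
Proof.
destruct strip_hol_sfac as [gs Hs]. destruct strip_hol_tfac as [gt Ht].
destruct (strip_hol_pow _ _ (Z.to_nat l) Ht) as [b Hb].
unfold contour_fun, zpow. destruct (Z.leb 0 k).
- destruct (strip_hol_pow _ _ (Z.to_nat k) Hs) as [a Ha]. eexists. exact (strip_hol_mult _ _ _ _ Ha Hb).
- destruct (strip_hol_pow _ _ (Z.to_nat (- k)) (strip_hol_inv _ _ Hs sfac_neq_0_strip)) as [a Ha].
  eexists. exact (strip_hol_mult _ _ _ _ Ha Hb).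
Qed.

Lemma contour_fun_eta_hol k l : exists g, strip_hol (fun p v => RtoC (norm1 M * M) * (eta p v * contour_fun k l p v))%C g.
Proof.
destruct (contour_fun_hol k l) as [g Hg]. eexists.
exact (strip_hol_mult _ _ _ _ (strip_hol_const _) (strip_hol_mult _ _ _ _ strip_hol_eta Hg)).
Qed.

Lemma contour_fun_c2 k l phi v : (0 <= k)%Z \/ ufac phi v <> RtoC 0 -> c2 (contour_fun k l) phi v.
Proof.
intros H. unfold contour_fun, zpow.
pose proof (c2_pow _ (Z.to_nat l) _ _ (tfac_c2 phi v)) as Ct.
destruct (Z.leb_spec 0 k).
- exact (c2_mult _ _ _ _ (c2_pow _ (Z.to_nat k) _ _ (sfac_c2 phi v)) Ct).
- destruct H as [H|H]; [lia|].
  exact (c2_mult _ _ _ _ (c2_pow _ (Z.to_nat (- k)) _ _ (c2_inv _ _ _ (sfac_c2 phi v) (sfac_neq_0 _ _ H))) Ct).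
Qed.

Lemma ufac_neq_0_left phi v : 0 < cos phi -> ufac phi v <> RtoC 0.
Proof.
intros Hc E. rewrite ufac_eq in E. injection E; intros _ E1.
assert (0 < M * (exp v * cos phi)) by (apply Rmult_lt_0_compat; auto; apply Rmult_lt_0_compat; auto; apply exp_pos). lra.
Qed.

(** The only zero of [1 + M eta] is [eta = - 1 / M], that is [phi = PI] and [v = - ln M]. Negative
    powers of [sfac] must stay to the right of it. *)
Lemma ufac_neq_0_far phi v : - ln M < v -> ufac phi v <> RtoC 0.
Proof.
intros Hv E. rewrite ufac_eq in E. injection E; intros E2 E1.
assert (He : 1 < M * exp v).
{ apply exp_increasing in Hv. rewrite exp_Ropp, exp_ln in Hv by auto.
  apply Rmult_lt_reg_l with (/ M); [apply Rinv_0_lt_compat; auto|].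
  rewrite <- Rmult_assoc, Rinv_l, Rmult_1_l by lra. lra. }
pose proof (sin2_cos2 phi) as Es. unfold Rsqr in Es. set (X := M * exp v) in *.
assert (X * cos phi = -1) by (unfold X; lra). assert (X * sin phi = 0) by (unfold X; lra).
assert (X * X = 1) by (replace (X * X) with (X * X * (sin phi * sin phi + cos phi * cos phi)) by (rewrite Es; ring);
  replace (X * X * (sin phi * sin phi + cos phi * cos phi)) with ((X * sin phi) * (X * sin phi) + (X * cos phi) * (X * cos phi)) by ring;
  rewrite H, H0; ring).
nra.
Qed.

(** The image of the real momentum [p = phi - PI / 2]: [sinh w = sin p / M]. *)
Definition path (phi : R) : R := ln ((sin_om (norm1 M) (phi - PI / 2) / norm1 M - cos phi) / M).
Definition dpath (phi : R) : R := norm1 M * sin phi / sin_om (norm1 M) (phi - PI / 2).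

Lemma sin_om_shift phi : sin_om (norm1 M) (phi - PI / 2) = sqrt (1 - (norm1 M * sin phi) ^ 2).
Proof.
unfold sin_om. replace (cos (phi - PI / 2)) with (sin phi); auto.
rewrite <- cos_shift. rewrite <- cos_neg. f_equal. ring.
Qed.

(** Equivalent to [(s / c)^2 = M^2 + cos^2 phi]. Hence [s / c - cos phi] and [s / c + cos phi] are
    [M e^w] and [M e^(- w)] for one and the same [w], which is [path phi]. *)
Lemma path_arg phi : let s := sin_om (norm1 M) (phi - PI / 2) in
  0 < s / norm1 M - cos phi /\ (s / norm1 M - cos phi) * (s / norm1 M + cos phi) = M * M /\ 0 < s / norm1 M + cos phi.
Proof.
intros s. pose proof (norm1_bounds M HM) as Hc. set (c := norm1 M) in *.
assert (Hs : 0 < s) by (apply sin_om_pos; auto).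
assert (Es : s * s = 1 - c * sin phi * (c * sin phi)).
{ unfold s. rewrite sin_om_shift. fold c. rewrite sqrt_sqrt; [ring|]. pose proof (SIN_bound phi).
  assert (sin phi * sin phi <= 1) by nra. assert (c * c < 1) by nra.
  replace ((c * sin phi) ^ 2) with (c * c * (sin phi * sin phi)) by ring. nra. }
pose proof (norm1_sqr M) as En. fold c in En.
pose proof (sin2_cos2 phi) as E2. unfold Rsqr in E2.
assert (EM : (s / c) * (s / c) = M * M + cos phi * cos phi).
{ apply Rmult_eq_reg_r with (c * c); [|nra]. replace (s / c * (s / c) * (c * c)) with (s * s) by (field; lra).
  rewrite Es. replace 1 with (c * c * (1 + M * M)) at 1 by lra.
  replace (c * sin phi * (c * sin phi)) with (c * c * (sin phi * sin phi)) by ring.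
  replace (sin phi * sin phi) with (1 - cos phi * cos phi) by lra. ring. }
assert (0 < s / c) by (apply Rdiv_lt_0_compat; lra).
assert (0 < M * M) by nra.
split; [|split]; nra.
Qed.

Lemma exp_path phi : M * exp (path phi) = sin_om (norm1 M) (phi - PI / 2) / norm1 M - cos phi.
Proof. destruct (path_arg phi) as (H & _ & _). unfold path. rewrite exp_ln by (apply Rdiv_lt_0_compat; auto). pose proof (norm1_pos M). field. lra. Qed.

Lemma exp_opp_path phi : M * exp (- path phi) = sin_om (norm1 M) (phi - PI / 2) / norm1 M + cos phi.
Proof.
destruct (path_arg phi) as (H & E & H2). unfold path. rewrite exp_Ropp, exp_ln by (apply Rdiv_lt_0_compat; auto).
set (a := _ - cos phi) in *. set (b := _ + cos phi) in *.
apply Rmult_eq_reg_l with a; [|lra]. rewrite E. field. lra.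
Qed.

Lemma path_derive phi : is_derive path phi (dpath phi).
Proof.
destruct (path_arg phi) as (H & _ & _). pose proof (norm1_bounds M HM) as Hc.
pose proof (sin_om_pos (norm1 M) Hc (phi - PI / 2)) as Hs.
unfold dpath.
apply (is_derive_ext (fun x => ln ((sqrt (1 - (norm1 M * sin x) ^ 2) / norm1 M - cos x) / M))).
{ intros x. unfold path. rewrite sin_om_shift. reflexivity. }
rewrite sin_om_shift in *. set (c := norm1 M) in *.
assert (Ha : 0 < 1 - (c * sin phi) ^ 2).
{ destruct (Rle_lt_dec (1 - (c * sin phi) ^ 2) 0) as [Hle|]; auto. rewrite sqrt_neg_0 in Hs by auto. lra. }
assert (Eq : 1 + - (c * sin phi * (c * sin phi * 1)) = 1 - (c * sin phi) ^ 2) by ring.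
auto_derive; rewrite !Eq; set (s := sqrt (1 - (c * sin phi) ^ 2)) in *.
- repeat split; auto; try lra. apply Rdiv_lt_0_compat; auto.
- field_simplify_eq; [ring|]. repeat split; try lra.
  assert (0 < s - cos phi * c) by (replace (s - cos phi * c) with (c * (s / c - cos phi)) by (field; lra); apply Rmult_lt_0_compat; lra). lra.
Qed.

Lemma dpath_cont phi : continuous dpath phi.
Proof.
pose proof (norm1_bounds M HM) as Hc. unfold dpath. apply continuous_mult_R.
- apply continuous_mult_R; [apply continuous_const|apply continuous_sin].
- apply (continuous_comp (fun p => p - PI / 2) (fun p => / sin_om (norm1 M) p)); [|apply inv_sin_om_cont; auto].
  apply (continuous_minus (V := R_NormedModule)); [apply continuous_id|apply continuous_const].
Qed.
End Factors.

Lemma CInt_ext_in f g a b : a <= b -> (forall x, a <= x <= b -> f x = g x) -> CInt f a b = CInt g a b.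
Proof.
intros Hab H; unfold CInt; f_equal; apply RInt_ext; intros x Hx; rewrite Rmin_left, Rmax_right in Hx by lra; rewrite H; auto; lra.
Qed.

Lemma csqrt_up_polar r th : 0 < r -> 0 <= cos th -> 0 <= sin th ->
  csqrt_up (r * cos (2 * th), r * sin (2 * th)) = (sqrt r * cos th, sqrt r * sin th).
Proof.
intros Hr Hc Hs. unfold csqrt_up.
assert (E : Cmod (r * cos (2 * th), r * sin (2 * th)) = r).
{ unfold Cmod; cbn [fst snd]. pose proof (sin2_cos2 (2 * th)) as E. unfold Rsqr in E.
  replace ((r * cos (2 * th)) ^ 2 + (r * sin (2 * th)) ^ 2) with
    (r * r * (sin (2 * th) * sin (2 * th) + cos (2 * th) * cos (2 * th))) by ring.
  rewrite E, Rmult_1_r. apply sqrt_square; lra. }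
rewrite E; cbn [fst snd]. pose proof (sin2_cos2 th) as E2. unfold Rsqr in E2.
f_equal.
- rewrite cos_2a_cos. replace ((r + r * (2 * cos th * cos th - 1)) / 2) with (r * (cos th * cos th)) by field.
  rewrite sqrt_mult by nra. rewrite sqrt_square; auto.
- rewrite cos_2a_sin. replace ((r - r * (1 - 2 * sin th * sin th)) / 2) with (r * (sin th * sin th)) by field.
  rewrite sqrt_mult by nra. rewrite sqrt_square; auto.
Qed.

Lemma sin_nonneg_angle a : - (PI / 2) < a < 3 * (PI / 2) -> 0 <= sin a -> 0 <= a <= PI.
Proof.
intros H Hs. pose proof PI_RGT_0. split.
- destruct (Rle_lt_dec 0 a); auto. assert (sin a < 0) by (apply sin_lt_0_var; lra). lra.
- destruct (Rle_lt_dec a PI); auto. assert (sin a < 0) by (apply sin_lt_0; lra). lra.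
Qed.

(** * The Green function as a contour integral *)

Section OnPath.
Variable M : R.
Hypothesis HM : 0 < M.
Let c := norm1 M.

Lemma om_bounds p : 0 < om c p < PI.
Proof. unfold om. pose proof (atan_bound (c * cos p / sin_om c p)). lra. Qed.

Lemma sin_om_plus_p p : sin (om c p + p) = cos p * (sin_om c p + c * sin p).
Proof. pose proof (norm1_bounds M HM) as Hc. fold c in Hc. rewrite sin_plus, sin_om_eq, cos_om by auto. ring. Qed.

Lemma cos_om_plus_p p : cos (om c p + p) = c * (cos p * cos p) - sin_om c p * sin p.
Proof. pose proof (norm1_bounds M HM) as Hc. fold c in Hc. rewrite cos_plus, sin_om_eq, cos_om by auto. ring. Qed.

Lemma sin_om_minus_p p : sin (om c p - p) = cos p * (sin_om c p - c * sin p).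
Proof. pose proof (norm1_bounds M HM) as Hc. fold c in Hc. rewrite sin_minus, sin_om_eq, cos_om by auto. ring. Qed.

Lemma cos_om_minus_p p : cos (om c p - p) = c * (cos p * cos p) + sin_om c p * sin p.
Proof. pose proof (norm1_bounds M HM) as Hc. fold c in Hc. rewrite cos_minus, sin_om_eq, cos_om by auto. ring. Qed.

Lemma shift_trig phi : cos (phi - PI / 2) = sin phi /\ sin (phi - PI / 2) = - cos phi.
Proof.
split.
- rewrite <- cos_shift, <- cos_neg. f_equal; ring.
- rewrite <- sin_shift, <- sin_neg. f_equal; ring.
Qed.

(** Both angles lie in [(- PI / 2, 3 PI / 2)], and their sines are [cos p] times a positive factor,
    hence nonnegative. The halved angles then fall in the first quadrant, the range of
    [csqrt_up]. *)
Lemma half_angles phi : 0 <= phi <= PI -> let p := phi - PI / 2 in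
  (0 <= om c p + p <= PI) /\ (0 <= om c p - p <= PI).
Proof.
intros Hphi p. pose proof PI_RGT_0. pose proof (om_bounds p).
destruct (shift_trig phi) as [E1 E2]. fold p in E1, E2.
destruct (path_arg M HM phi) as (H1 & _ & H2). fold c p in H1, H2.
pose proof (norm1_bounds M HM) as Hc. fold c in Hc.
assert (0 <= sin phi) by (apply sin_ge_0; tauto).
split; apply sin_nonneg_angle; try (unfold p in *; lra).
- rewrite sin_om_plus_p, E1, E2. apply Rmult_le_pos; auto.
  replace (sin_om c p + c * - cos phi) with (c * (sin_om c p / c - cos phi)) by (field; lra). apply Rmult_le_pos; lra.
- rewrite sin_om_minus_p, E1, E2. apply Rmult_le_pos; auto.
  replace (sin_om c p - c * - cos phi) with (c * (sin_om c p / c + cos phi)) by (field; lra). apply Rmult_le_pos; lra.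
Qed.

(** On the curve [1 + M eta = e^(i (om + p)) / c], so after normalization the root is the unit
    vector at half this angle. Likewise [1 - M / eta = e^(i (om - p)) / c] below. *)
Lemma sfac_path phi : 0 <= phi <= PI -> let p := phi - PI / 2 in
  sfac M phi (path M phi) = (cos ((om c p + p) / 2), sin ((om c p + p) / 2)).
Proof.
intros Hphi p. destruct (half_angles phi Hphi) as [Ha _]. fold p in Ha.
pose proof PI_RGT_0. pose proof (norm1_bounds M HM) as Hc. fold c in Hc.
destruct (shift_trig phi) as [E1 E2]. fold p in E1, E2.
unfold sfac. fold c. rewrite ufac_eq.
replace (1 + M * (exp (path M phi) * cos phi), M * (exp (path M phi) * sin phi)) with
  (/ c * cos (2 * ((om c p + p) / 2)), / c * sin (2 * ((om c p + p) / 2))).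
- rewrite csqrt_up_polar.
  + rewrite sqrt_inv. pose proof (sqrt_lt_R0 c (proj1 Hc)). unfold RtoC, Cmult; cbn [fst snd]. f_equal; field; lra.
  + apply Rinv_0_lt_compat; lra.
  + apply cos_ge_0; lra.
  + apply sin_ge_0; lra.
- replace (2 * ((om c p + p) / 2)) with (om c p + p) by field.
  rewrite sin_om_plus_p, cos_om_plus_p, E1, E2, <- !Rmult_assoc, (exp_path M HM). fold c p.
  pose proof (sin2_cos2 phi) as E. unfold Rsqr in E. f_equal.
  + field_simplify; [|lra|lra]. replace (sin phi ^ 2) with (1 - cos phi ^ 2) by lra. field. lra.
  + field. lra.
Qed.

Lemma tfac_path phi : 0 <= phi <= PI -> let p := phi - PI / 2 in
  tfac M phi (path M phi) = (cos ((om c p - p) / 2), sin ((om c p - p) / 2)).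
Proof.
intros Hphi p. destruct (half_angles phi Hphi) as [_ Ha]. fold p in Ha.
pose proof PI_RGT_0. pose proof (norm1_bounds M HM) as Hc. fold c in Hc.
destruct (shift_trig phi) as [E1 E2]. fold p in E1, E2.
unfold tfac. fold c. rewrite vfac_eq.
replace (1 - M * (exp (- path M phi) * cos phi), M * (exp (- path M phi) * sin phi)) with
  (/ c * cos (2 * ((om c p - p) / 2)), / c * sin (2 * ((om c p - p) / 2))).
- rewrite csqrt_up_polar.
  + rewrite sqrt_inv. pose proof (sqrt_lt_R0 c (proj1 Hc)). unfold RtoC, Cmult; cbn [fst snd]. f_equal; field; lra.
  + apply Rinv_0_lt_compat; lra.
  + apply cos_ge_0; lra.
  + apply sin_ge_0; lra.
- replace (2 * ((om c p - p) / 2)) with (om c p - p) by field.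
  rewrite sin_om_minus_p, cos_om_minus_p, E1, E2, <- !Rmult_assoc, (exp_opp_path M HM). fold c p.
  pose proof (sin2_cos2 phi) as E. unfold Rsqr in E. f_equal.
  + field_simplify; [|lra|lra]. replace (sin phi ^ 2) with (1 - cos phi ^ 2) by lra. field. lra.
  + field. lra.
Qed.

(** The velocity of the curve is [e^(i om) / sin_om], because [dpath] is [cos om / sin om]. This
    adds one more [om] to the angle and supplies the denominator of the Fourier integrand. *)
Lemma contour_fun_path k l phi : (0 <= l)%Z -> 0 <= phi <= PI -> let p := phi - PI / 2 in
  let A := IZR (k + l + 2) / 2 * om c p + IZR (k - l) / 2 * p in
  (contour_fun M k l phi (path M phi) * (dpath M phi, 1))%C = (cos A / sin_om c p, sin A / sin_om c p).
Proof.
intros Hl Hphi p A. pose proof (norm1_bounds M HM) as Hc. fold c in Hc.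
destruct (shift_trig phi) as [E1 E2]. fold p in E1, E2.
pose proof (sin_om_pos c Hc p) as Hs.
unfold contour_fun. rewrite sfac_path, tfac_path, zpow_cis, de_moivre, INR_IZR_INZ, Z2Nat.id by auto.
fold p. unfold dpath. fold c p. rewrite <- E1, <- (cos_om c Hc p).
replace 1 with (sin (om c p) / sin_om c p) by (rewrite sin_om_eq by auto; field; lra).
set (B := IZR k * ((om c p + p) / 2)). set (D := IZR l * ((om c p - p) / 2)).
assert (EA : A = B + D + om c p).
{ unfold A, B, D. rewrite !plus_IZR, minus_IZR. field. }
rewrite EA, !cos_plus, !sin_plus, !cos_plus. unfold Cmult; cbn [fst snd]. f_equal; field; lra.
Qed.

Definition zint (x t : Z) : C :=
  CInt (fun phi => contour_fun M (t - 1 - x) (t - 1 + x) phi (path M phi) * (dpath M phi, 1))%C 0 PI.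

Lemma RInt_shift_half (h : R -> R) : (forall x, continuous h x) ->
  RInt (fun phi => h (phi - PI / 2)) 0 PI = RInt h (- (PI / 2)) (PI / 2).
Proof.
intros Hh.
assert (E := RInt_comp (V := R_CompleteNormedModule) h (fun phi => phi - PI / 2) (fun _ => 1) 0 PI). cbv beta in E.
replace (0 - PI / 2) with (- (PI / 2)) in E by ring. replace (PI - PI / 2) with (PI / 2) in E by field.
rewrite <- E.
- apply RInt_ext. intros; unfold scal; simpl; unfold mult; simpl. rewrite Rmult_1_l. reflexivity.
- intros; apply Hh.
- intros x _. split; [auto_derive; auto; ring|apply continuous_const].
Qed.

Lemma RInt_reflect (h : R -> R) a b k : (forall x, continuous h x) ->
  RInt (fun x => h (k - x)) a b = RInt h (k - b) (k - a).
Proof.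
intros Hh.
assert (E := RInt_comp (V := R_CompleteNormedModule) h (fun x => k - x) (fun _ => -1) a b). cbv beta in E.
assert (Hc : forall x, continuous (fun x => h (k - x)) x).
{ intros x. apply (continuous_comp (fun x => k - x) h); auto.
  apply (continuous_minus (V := R_NormedModule)); [apply continuous_const|apply continuous_id]. }
assert (E1 : RInt (fun y => scal (-1) (h (k - y))) a b = -1 * RInt (fun y => h (k - y)) a b).
{ apply (RInt_scal_R (fun y => h (k - y))). apply ex_RInt_cont; auto. }
assert (E2 : - RInt h (k - a) (k - b) = RInt h (k - b) (k - a)).
{ apply (opp_RInt_swap h (k - a)). apply ex_RInt_cont; auto. }
rewrite <- E2, <- E.
- transitivity (- (-1 * RInt (fun y => h (k - y)) a b)); [symmetry; ringR|]. f_equal. symmetry. exact E1.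
- intros; apply Hh.
- intros x _. split; [auto_derive; auto; ring|apply continuous_const].
Qed.

Lemma RInt_odd (h : R -> R) a : (forall x, continuous h x) -> (forall x, h (- x) = - h x) -> RInt h (- a) a = 0.
Proof.
intros Hh Ho. assert (E := RInt_reflect h (- a) a 0 Hh).
rewrite (RInt_ext _ (fun x => -1 * h x)) in E by (intros; rewrite Rminus_0_l, Ho; ringR).
rewrite RInt_scal_R in E by (apply ex_RInt_cont; auto).
replace (0 - a) with (- a) in E by ring. replace (0 - - a) with a in E by ring. simpl in E. lra.
Qed.

Lemma RInt_even_fold (h : R -> R) e : (forall x, continuous h x) -> (forall x, h (- x) = h x) ->
  (forall x, h (PI - x) = e * h x) ->
  RInt h (- (PI / 2)) (PI / 2) = 2 * RInt h 0 (PI / 2) /\ RInt h 0 PI = (1 + e) * RInt h 0 (PI / 2).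
Proof.
intros Hh He Hp.
assert (Hx : forall a b, ex_RInt h a b) by (intros; apply ex_RInt_cont; auto).
split.
- rewrite <- (RInt_Chasles h (- (PI / 2)) 0 (PI / 2)) by auto.
  assert (E := RInt_reflect h 0 (PI / 2) 0 Hh).
  rewrite (RInt_ext _ h) in E by (intros; rewrite Rminus_0_l, He; reflexivity).
  replace (0 - 0) with 0 in E by ring. replace (0 - PI / 2) with (- (PI / 2)) in E by ring.
  rewrite <- E. unfold plus; simpl. ring.
- rewrite <- (RInt_Chasles h 0 (PI / 2) PI) by auto.
  assert (E := RInt_reflect h 0 (PI / 2) PI Hh).
  rewrite (RInt_ext _ (fun x => e * h x)) in E by (intros; apply Hp).
  rewrite RInt_scal_R in E by auto.
  replace (PI - 0) with PI in E by ring. replace (PI - PI / 2) with (PI / 2) in E by field.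
  rewrite <- E. unfold plus; simpl. ring.
Qed.

Lemma om_neg p : om c (- p) = om c p.
Proof. unfold om, sin_om. rewrite cos_neg. reflexivity. Qed.

Lemma om_reflect p : om c (PI - p) = PI - om c p.
Proof.
unfold om, sin_om. replace (cos (PI - p)) with (- cos p).
- replace ((c * - cos p) ^ 2) with ((c * cos p) ^ 2) by ring.
  replace (c * - cos p / sqrt (1 - (c * cos p) ^ 2)) with (- (c * cos p / sqrt (1 - (c * cos p) ^ 2))) by (unfold Rdiv; ring).
  rewrite atan_opp. field.
- rewrite cos_minus, cos_PI, sin_PI. ring.
Qed.

Lemma sin_om_neg p : sin_om c (- p) = sin_om c p.
Proof. unfold sin_om. rewrite cos_neg. reflexivity. Qed.

Lemma sin_om_reflect p : sin_om c (PI - p) = sin_om c p.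
Proof.
unfold sin_om. replace (cos (PI - p)) with (- cos p); [|rewrite cos_minus, cos_PI, sin_PI; ring].
f_equal. ring.
Qed.

Definition zsign (n : Z) : R := if Z.even n then 1 else -1.

Lemma cos_IZR_PI n : cos (IZR n * PI) = zsign n.
Proof.
unfold zsign. destruct (Z.even n) eqn:E.
- apply Z.even_spec in E. destruct E as [k ->]. rewrite mult_IZR.
  replace (2 * IZR k * PI) with (2 * (IZR k * PI)) by ring. rewrite cos_2a_sin, sin_IZR_PI. ring.
- assert (Ho : Z.odd n = true) by (rewrite <- Z.negb_even, E; reflexivity).
  apply Z.odd_spec in Ho. destruct Ho as [k ->]. rewrite plus_IZR, mult_IZR.
  replace ((2 * IZR k + 1) * PI) with (2 * (IZR k * PI) + PI) by ring.
  rewrite neg_cos, cos_2a_sin, sin_IZR_PI. ring.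
Qed.

Lemma zsign_plus a b : zsign (a + b) = zsign a * zsign b.
Proof. unfold zsign. rewrite Z.even_add. destruct (Z.even a), (Z.even b); simpl; ring. Qed.

Lemma cos_reflect n a : cos (IZR n * (PI - a)) = zsign n * cos (IZR n * a).
Proof.
replace (IZR n * (PI - a)) with (IZR n * PI - IZR n * a) by ring.
rewrite cos_minus, sin_IZR_PI, cos_IZR_PI. ring.
Qed.

Lemma sin_reflect n a : sin (IZR n * (PI - a)) = - zsign n * sin (IZR n * a).
Proof.
replace (IZR n * (PI - a)) with (IZR n * PI - IZR n * a) by ring.
rewrite sin_minus, sin_IZR_PI, cos_IZR_PI. ring.
Qed.

(** Here [zint x t] is the integral of [e^(i (t om - x p)) / sin_om] over the half zone
    [[- PI / 2, PI / 2]], while the Green function uses [[0, PI]]. The parts odd in [p] cancel, and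
    [p -> PI - p] sends [om] to [PI - om], so the two halves of [[0, PI]] agree up to a sign
    governed by the parity of [x + t]. This is the origin of the parity cases. *)
Lemma green_zint x t : (0 <= t)%Z -> (0 <= t - 1 + x)%Z ->
  2 * (PI * gim M x t) = (1 + zsign (x + t)) * fst (zint x t) /\
  2 * (PI * gre M x t) = (1 - zsign (x + t)) * snd (zint x t).
Proof.
intros Ht Hl. pose proof PI_RGT_0 as Hpi. pose proof (norm1_bounds M HM) as Hc. fold c in Hc.
assert (Ez : zint x t = CInt (fun phi => (cos (IZR t * om c (phi - PI / 2) - IZR x * (phi - PI / 2)) / sin_om c (phi - PI / 2),
   sin (IZR t * om c (phi - PI / 2) - IZR x * (phi - PI / 2)) / sin_om c (phi - PI / 2))) 0 PI).
{ apply CInt_ext_in; [lra|]. intros phi Hphi. rewrite contour_fun_path by auto.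
  replace (t - 1 - x + (t - 1 + x) + 2)%Z with (2 * t)%Z by ring.
  replace (t - 1 - x - (t - 1 + x))%Z with (- (2 * x))%Z by ring.
  rewrite opp_IZR, !mult_IZR.
  replace (2 * IZR t / 2 * om c (phi - PI / 2) + - (2 * IZR x) / 2 * (phi - PI / 2)) with
    (IZR t * om c (phi - PI / 2) - IZR x * (phi - PI / 2)) by field. reflexivity. }
set (C1 := fun p => cos (IZR x * p) * cos_mode M t p).
set (C2 := fun p => sin (IZR x * p) * sin_mode M t p).
set (S1 := fun p => cos (IZR x * p) * sin_mode M t p).
set (S2 := fun p => sin (IZR x * p) * cos_mode M t p).
assert (Hsx : forall p, continuous (fun p => sin (IZR x * p)) p).
{ intros p. apply (continuous_comp (fun p => IZR x * p) sin); [|apply continuous_sin].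
  apply continuous_mult_R; [apply continuous_const|apply continuous_id]. }
assert (K1 : forall p, continuous C1 p) by (intros; apply continuous_mult_R; [apply continuous_cos_lin|apply cos_mode_cont; auto]).
assert (K2 : forall p, continuous C2 p) by (intros; apply continuous_mult_R; [apply Hsx|apply sin_mode_cont; auto]).
assert (K3 : forall p, continuous S1 p) by (intros; apply continuous_mult_R; [apply continuous_cos_lin|apply sin_mode_cont; auto]).
assert (K4 : forall p, continuous S2 p) by (intros; apply continuous_mult_R; [apply Hsx|apply cos_mode_cont; auto]).
assert (F1 : fst (zint x t) = RInt C1 (- (PI / 2)) (PI / 2)).
{ rewrite Ez. unfold CInt; cbn [fst]. 
  assert (O2 : RInt C2 (- (PI / 2)) (PI / 2) = 0).
  { apply RInt_odd; auto. intros p. unfold C2, sin_mode. fold c. rewrite om_neg, sin_om_neg, <- Ropp_mult_distr_r, sin_neg. ring. }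
  transitivity (RInt C1 (- (PI / 2)) (PI / 2) + RInt C2 (- (PI / 2)) (PI / 2)); [|rewrite O2; apply Rplus_0_r].
  rewrite <- RInt_plus_R by (apply ex_RInt_cont; auto).
  rewrite <- (RInt_shift_half (fun p => C1 p + C2 p)) by (intros; apply continuous_plus_R; auto).
  apply RInt_ext. intros p _. unfold C1, C2, cos_mode, sin_mode. fold c. rewrite cos_minus. unfold Rdiv. ringR. }
assert (F2 : snd (zint x t) = RInt S1 (- (PI / 2)) (PI / 2)).
{ rewrite Ez. unfold CInt; cbn [snd].
  assert (O2 : RInt S2 (- (PI / 2)) (PI / 2) = 0).
  { apply RInt_odd; auto. intros p. unfold S2, cos_mode. fold c. rewrite om_neg, sin_om_neg, <- Ropp_mult_distr_r, sin_neg. ring. }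
  transitivity (1 * RInt S1 (- (PI / 2)) (PI / 2) + (-1) * RInt S2 (- (PI / 2)) (PI / 2)); [|rewrite O2, Rmult_0_r, Rplus_0_r; apply Rmult_1_l].
  rewrite <- RInt_lin by (apply ex_RInt_cont; auto).
  rewrite <- (RInt_shift_half (fun p => 1 * S1 p + (-1) * S2 p)) by (intros; apply continuous_plus_R; apply continuous_mult_R; auto; apply continuous_const).
  apply RInt_ext. intros p _. unfold S1, S2, cos_mode, sin_mode. fold c. rewrite sin_minus. unfold Rdiv. ringR. }
rewrite F1, F2. unfold gim, gre. rewrite Z.abs_eq by auto.
rewrite <- !Rmult_assoc, !(Rmult_assoc 2 PI (/ PI)), Rinv_r, Rmult_1_r by lra.
destruct (RInt_even_fold C1 (zsign (x + t)) K1) as [A1 B1].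
{ intros p. unfold C1, cos_mode. fold c. rewrite om_neg, sin_om_neg, <- Ropp_mult_distr_r, cos_neg. reflexivity. }
{ intros p. unfold C1, cos_mode. fold c. rewrite om_reflect, sin_om_reflect, !cos_reflect, zsign_plus. unfold Rdiv; ring. }
destruct (RInt_even_fold S1 (- zsign (x + t)) K3) as [A2 B2].
{ intros p. unfold S1, sin_mode. fold c. rewrite om_neg, sin_om_neg, <- Ropp_mult_distr_r, cos_neg. reflexivity. }
{ intros p. unfold S1, sin_mode. fold c. rewrite om_reflect, sin_om_reflect, cos_reflect, sin_reflect, zsign_plus. unfold Rdiv; ring. }
rewrite A1, A2. fold C1 S1. rewrite B1, B2. split; ring.
Qed.
End OnPath.

(** * Moving the contour; values on the real axis *)

Section Shifted.
Variable M : R.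
Hypothesis HM : 0 < M.
Let c := norm1 M.

(** The curve ends to the right of the zero of [1 + M eta] and, by [path_0_lt], starts to the left
    of the zero [v = ln M] of [1 - M / eta]. The real segments therefore end where the cut-off
    powers already vanish. *)
Lemma path_PI_gt : - ln M < path M PI.
Proof.
apply exp_lt_inv. rewrite exp_Ropp, exp_ln by auto.
pose proof (exp_path M HM PI) as E. rewrite cos_PI in E.
pose proof (norm1_bounds M HM) as Hc. pose proof (sin_om_pos _ Hc (PI - PI / 2)) as Hs.
assert (0 < sin_om (norm1 M) (PI - PI / 2) / norm1 M) by (apply Rdiv_lt_0_compat; lra).
apply Rmult_lt_reg_l with M; auto. rewrite Rinv_r by lra. lra.
Qed.

Lemma path_0_lt : path M 0 < ln M.
Proof.
apply exp_lt_inv. rewrite exp_ln by auto.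
destruct (path_arg M HM 0) as (H1 & H2 & H3). pose proof (exp_path M HM 0) as E. rewrite cos_0 in *.
set (s := sin_om (norm1 M) (0 - PI / 2) / norm1 M) in *.
apply Rmult_lt_reg_l with M; auto. rewrite E. nra.
Qed.

Lemma contour_fun_c2_0 k l : locally 0 (fun phi => forall v, c2 (contour_fun M k l) phi v).
Proof.
assert (K : locally 0 (fun phi => 0 < cos phi)).
{ apply (continuous_cos 0 (fun y => 0 < y)), (open_gt 0). rewrite cos_0. lra. }
revert K. apply filter_imp. intros phi Hp v. apply contour_fun_c2; auto. right. apply ufac_neq_0_left; auto.
Qed.

Lemma contour_fun_c2_PI k l v0 : (0 <= k)%Z \/ - ln M <= v0 ->
  locally PI (fun phi => forall v, v0 < v -> c2 (contour_fun M k l) phi v).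
Proof.
intros H. apply filter_forall. intros phi v Hv. apply contour_fun_c2; auto.
destruct H as [H|H]; [left; auto|right; apply ufac_neq_0_far; auto; lra].
Qed.

(** For [k >= 0] there is no singularity and any level below both ends works; for negative powers
    the level is the singular one, [- ln M]. *)
Lemma shift_threshold k ell : (0 <= k)%Z \/ - ln M < ell ->
  exists v0, ((0 <= k)%Z \/ - ln M <= v0) /\ v0 < ell /\ v0 < path M PI.
Proof.
intros [H|H].
- exists (Rmin ell (path M PI) - 1). pose proof (Rmin_l ell (path M PI)). pose proof (Rmin_r ell (path M PI)).
  split; [left; auto|lra].
- exists (- ln M). pose proof path_PI_gt. split; [right; lra|lra].
Qed.

Lemma contour_fun_shift k l ell : (0 <= k)%Z \/ - ln M < ell ->
  (CInt (fun phi => contour_fun M k l phi (path M phi) * (dpath M phi, 1)) 0 PI =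
   Ci * CInt (fun phi => contour_fun M k l phi ell) 0 PI
    + CInt (fun v => contour_fun M k l PI v) ell (path M PI) - CInt (fun v => contour_fun M k l 0 v) ell (path M 0))%C.
Proof.
intros H. destruct (shift_threshold k ell H) as (v0 & H0 & H1 & H2).
destruct (contour_fun_hol M HM k l) as [g Hg].
apply (contour_shift (contour_fun M k l) g (path M) (dpath M) ell v0); auto.
- intros; apply path_derive; auto.
- intros; apply dpath_cont; auto.
- apply contour_fun_c2_0.
- apply contour_fun_c2_PI; auto.
Qed.

Definition contour_fun2 k l phi v : C := (RtoC (c * M) * (eta phi v * contour_fun M k l phi v))%C.

Lemma contour_fun2_shift k l ell : (0 <= k)%Z \/ - ln M < ell ->
  (CInt (fun phi => contour_fun2 k l phi (path M phi) * (dpath M phi, 1)) 0 PI =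
   Ci * CInt (fun phi => contour_fun2 k l phi ell) 0 PI
    + CInt (fun v => contour_fun2 k l PI v) ell (path M PI) - CInt (fun v => contour_fun2 k l 0 v) ell (path M 0))%C.
Proof.
intros H. destruct (shift_threshold k ell H) as (v0 & H0 & H1 & H2).
destruct (contour_fun_eta_hol M HM k l) as [g Hg].
assert (Hc2 : forall phi v, c2 (contour_fun M k l) phi v -> c2 (contour_fun2 k l) phi v).
{ intros phi v Hf. exact (c2_mult _ _ _ _ (c2_const (RtoC (c * M)) _ _) (c2_mult _ _ _ _ (eta_c2 phi v) Hf)). }
apply (contour_shift (contour_fun2 k l) g (path M) (dpath M) ell v0); auto.
- intros; apply path_derive; auto.
- intros; apply dpath_cont; auto.
- generalize (contour_fun_c2_0 k l). apply filter_imp. auto.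
- generalize (contour_fun_c2_PI k l v0 H0). apply filter_imp. auto.
Qed.

Definition zint2 (x t : Z) : C :=
  CInt (fun phi => contour_fun2 (t - 2 - x) (t + x) phi (path M phi) * (dpath M phi, 1))%C 0 PI.

Lemma cis_neq_0 th : ((cos th, sin th) : C) <> RtoC 0.
Proof.
intros E. unfold RtoC in E. injection E; intros E1 E2. pose proof (sin2_cos2 th) as H. rewrite E1, E2 in H. unfold Rsqr in H. lra.
Qed.

Lemma ccont_on_path k l a b : (0 <= l)%Z -> 0 <= a -> b <= PI -> a <= b ->
  ex_RInt (fun phi => fst (contour_fun M k l phi (path M phi) * (dpath M phi, 1))%C) a b /\
  ex_RInt (fun phi => snd (contour_fun M k l phi (path M phi) * (dpath M phi, 1))%C) a b.
Proof.
intros Hl Ha Hb Hab. pose proof (norm1_bounds M HM) as Hc. fold c in Hc.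
set (A := fun phi => IZR (k + l + 2) / 2 * om c (phi - PI / 2) + IZR (k - l) / 2 * (phi - PI / 2)).
assert (Csh : forall x, continuous (fun p => p - PI / 2) x).
{ intros. apply (continuous_minus (V := R_NormedModule)); [apply continuous_id|apply continuous_const]. }
assert (CA : forall x, continuous A x).
{ intros x. apply continuous_plus_R; (apply continuous_mult_R; [apply continuous_const|]); auto.
  apply (continuous_comp (fun p => p - PI / 2) (om c)); auto. apply om_cont; auto. }
assert (CS : forall x, continuous (fun phi => / sin_om c (phi - PI / 2)) x).
{ intros x. apply (continuous_comp (fun p => p - PI / 2) (fun p => / sin_om c p)); auto. apply inv_sin_om_cont; auto. }
split.
- apply (ex_RInt_ext (fun phi => cos (A phi) * / sin_om c (phi - PI / 2))).
  + rewrite Rmin_left, Rmax_right by lra. intros phi Hp. rewrite contour_fun_path by (auto; lra). reflexivity.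
  + apply ex_RInt_cont. intros x. apply continuous_mult_R; auto. apply (continuous_comp A cos); auto. apply continuous_cos.
- apply (ex_RInt_ext (fun phi => sin (A phi) * / sin_om c (phi - PI / 2))).
  + rewrite Rmin_left, Rmax_right by lra. intros phi Hp. rewrite contour_fun_path by (auto; lra). reflexivity.
  + apply ex_RInt_cont. intros x. apply continuous_mult_R; auto. apply (continuous_comp A sin); auto. apply continuous_sin.
Qed.

(* [S^2 - c = c M eta] turns a difference of two contour integrands into one with a factor [eta]. *)
Lemma zint2_eq x t : (0 <= t + x)%Z ->
  zint2 x t = (zint M x (t + 1) - RtoC c * zint M (x + 1) t)%C.
Proof.
intros Hl. pose proof PI_RGT_0 as Hpi.
unfold zint2, zint.
replace (t + 1 - 1 - x)%Z with (t - 2 - x + 2)%Z by ring. replace (t + 1 - 1 + x)%Z with (t + x)%Z by ring.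
replace (t - 1 - (x + 1))%Z with (t - 2 - x)%Z by ring. replace (t - 1 + (x + 1))%Z with (t + x)%Z by ring.
set (k := (t - 2 - x)%Z). set (l := (t + x)%Z).
rewrite (CInt_ext_in _ (fun phi => contour_fun M (k + 2) l phi (path M phi) * (dpath M phi, 1)
     - RtoC c * (contour_fun M k l phi (path M phi) * (dpath M phi, 1)))%C) by (try lra;
  intros phi Hphi; unfold contour_fun2, contour_fun;
  assert (Hs := sfac_sqr M HM phi (path M phi) Hphi);
  assert (Hne : sfac M phi (path M phi) <> RtoC 0) by (rewrite sfac_path by auto; apply cis_neq_0);
  replace (k + 2)%Z with (k + 1 + 1)%Z by ring; rewrite !zpow_S by auto;
  unfold ufac in Hs; fold c in Hs; rewrite RtoC_mult; ring [Hs]).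
destruct (ccont_on_path (k + 2) l 0 PI Hl) as [X1 X2]; try lra.
destruct (ccont_on_path k l 0 PI Hl) as [Y1 Y2]; try lra.
unfold CInt, Cminus, Cplus, Copp. unfold Cmult at 5. unfold RtoC. cbn [fst snd].
set (F := fun phi => (contour_fun M (k + 2) l phi (path M phi) * (dpath M phi, 1))%C) in *.
set (G := fun phi => (contour_fun M k l phi (path M phi) * (dpath M phi, 1))%C) in *.
apply injective_projections; cbn [fst snd].
- rewrite (RInt_ext _ (fun phi => 1 * fst (F phi) + (- c) * fst (G phi))) by (intros; unfold F, G; simpl; ringR).
  rewrite RInt_lin by assumption. simpl. ring.
- rewrite (RInt_ext _ (fun phi => 1 * snd (F phi) + (- c) * snd (G phi))) by (intros; unfold F, G; simpl; ringR).
  rewrite RInt_lin by assumption. simpl. ring.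
Qed.

(* Rocq's [sqrt] vanishes on negative numbers. *)
Lemma csqrt_up_real x : csqrt_up (x, 0) = (sqrt x, sqrt (- x)).
Proof.
unfold csqrt_up. replace (Cmod (x, 0)) with (Rabs x); [|symmetry; apply (Cmod_R x)]. cbn [fst].
destruct (Rle_lt_dec 0 x).
- rewrite Rabs_pos_eq by auto. rewrite (sqrt_neg_0 (- x)) by lra. 
  replace ((x + x) / 2) with x by field. replace ((x - x) / 2) with 0 by field. rewrite sqrt_0. reflexivity.
- rewrite Rabs_left by auto. rewrite (sqrt_neg_0 x) by lra.
  replace ((- x + x) / 2) with 0 by field. replace ((- x - x) / 2) with (- x) by field. rewrite sqrt_0. reflexivity.
Qed.

Lemma Cpow_real a n : ((a, 0) ^ n)%C = (a ^ n, 0).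
Proof. induction n as [|n IH]; [reflexivity|]. rewrite Cpow_S, IH. unfold Cmult; simpl. f_equal; ring. Qed.

Lemma Cpow_imag b n : fst ((0, b) ^ (2 * n + 1))%C = 0 /\ snd ((0, b) ^ (2 * n))%C = 0.
Proof.
induction n as [|n [H1 H2]].
- simpl. split; ring.
- replace (2 * S n)%nat with (S (S (2 * n))) by lia. replace (S (S (2 * n)) + 1)%nat with (S (S (2 * n + 1))) by lia.
  split; rewrite !Cpow_S; unfold Cmult; cbn [fst snd].
  + rewrite H1. ring.
  + rewrite H2. ring.
Qed.

Lemma sqrt_exclusive x : sqrt x = 0 \/ sqrt (- x) = 0.
Proof. destruct (Rle_lt_dec 0 x); [right|left]; apply sqrt_neg_0; lra. Qed.

(** For real [x] the root is real or purely imaginary. An odd power of an imaginary number has real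
    part 0, and so has the right side, since the real [sqrt] is 0 on negative numbers: one formula
    covers both signs and describes a truncated power. *)
Lemma csqrt_pow_odd s x n : Nat.Odd n -> fst ((RtoC s * csqrt_up (x, 0)) ^ n)%C = (s * sqrt x) ^ n.
Proof.
intros [m ->]. rewrite csqrt_up_real.
replace (RtoC s * (sqrt x, sqrt (- x)))%C with ((s * sqrt x, s * sqrt (- x)) : C) by (unfold Cmult, RtoC; simpl; f_equal; ring).
destruct (sqrt_exclusive x) as [E|E]; rewrite E, !Rmult_0_r.
- rewrite (proj1 (Cpow_imag _ _)), pow_i; auto. lia.
- rewrite Cpow_real. reflexivity.
Qed.

Lemma csqrt_pow_even s x n : Nat.Even n -> snd ((RtoC s * csqrt_up (x, 0)) ^ n)%C = 0.
Proof.
intros [m ->]. rewrite csqrt_up_real.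
replace (RtoC s * (sqrt x, sqrt (- x)))%C with ((s * sqrt x, s * sqrt (- x)) : C) by (unfold Cmult, RtoC; simpl; f_equal; ring).
destruct (sqrt_exclusive x) as [E|E]; rewrite E, !Rmult_0_r.
- apply Cpow_imag.
- rewrite Cpow_real. reflexivity.
Qed.

Lemma ufac_PI v : ufac M PI v = (1 - M * exp v, 0).
Proof. rewrite ufac_eq, cos_PI, sin_PI. f_equal; ring. Qed.
Lemma vfac_PI v : vfac M PI v = (1 + M * exp (- v), 0).
Proof. rewrite vfac_eq, cos_PI, sin_PI. f_equal; ring. Qed.
Lemma ufac_0 v : ufac M 0 v = (1 + M * exp v, 0).
Proof. rewrite ufac_eq, cos_0, sin_0. f_equal; ring. Qed.
Lemma vfac_0 v : vfac M 0 v = (1 - M * exp (- v), 0).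
Proof. rewrite vfac_eq, cos_0, sin_0. f_equal; ring. Qed.
End Shifted.

(** * Inside the light cone *)

Lemma exp_ge_1p x : 1 + x <= exp x.
Proof. apply exp_ineq1_le. Qed.

Lemma exp_le x y : x <= y -> exp x <= exp y.
Proof. intros [H| ->]; [left; apply exp_increasing; auto|lra]. Qed.

Lemma exp_half_sqr q : exp (q / 2) * exp (q / 2) = exp q.
Proof. rewrite <- exp_plus. f_equal. field. Qed.

Lemma sqrt_exp q : sqrt (exp q) = exp (q / 2).
Proof. rewrite <- exp_half_sqr. apply sqrt_square. left; apply exp_pos. Qed.

Lemma exp_pow q n : exp q ^ n = exp (INR n * q).
Proof.
induction n as [|n IH]; [simpl; rewrite Rmult_0_l, exp_0; reflexivity|].
rewrite S_INR. simpl. rewrite IH, <- exp_plus. f_equal; ring.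
Qed.

Lemma sqrt_pow_le u q n : u <= exp q -> sqrt u ^ n <= exp (INR n * q / 2).
Proof.
intros H. replace (INR n * q / 2) with (INR n * (q / 2)) by field. rewrite <- exp_pow, <- sqrt_exp.
apply pow_incr. split; [apply sqrt_pos|apply sqrt_le_1_alt; auto].
Qed.

Lemma sqrt_pow_ge u q n : exp q <= u -> exp (INR n * q / 2) <= sqrt u ^ n.
Proof.
intros H. replace (INR n * q / 2) with (INR n * (q / 2)) by field. rewrite <- exp_pow, <- sqrt_exp.
apply pow_incr. split; [apply sqrt_pos|apply sqrt_le_1_alt; auto].
Qed.

(** Second-order lower bounds for [ln (1 - y)] and, next, [ln (1 + y)], both from [1 + x <= e^x]
    after taking reciprocals. *)
Lemma one_minus_ge y : 0 <= y <= 1 / 2 -> exp (- (y + 2 * y ^ 2)) <= 1 - y.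
Proof.
intros Hy. rewrite exp_Ropp. pose proof (exp_ge_1p (y + 2 * y ^ 2)) as H.
assert (0 < 1 + (y + 2 * y ^ 2)) by nra.
apply Rmult_le_reg_l with (exp (y + 2 * y ^ 2)); [apply exp_pos|].
rewrite Rinv_r by (apply Rgt_not_eq, exp_pos).
apply Rle_trans with ((1 + (y + 2 * y ^ 2)) * (1 - y)); [|apply Rmult_le_compat_r; lra].
assert (0 <= y ^ 2 * (1 - 2 * y)) by (apply Rmult_le_pos; nra). nra.
Qed.

Lemma one_plus_ge y : 0 <= y -> exp (y - y ^ 2) <= 1 + y.
Proof.
intros Hy. replace (y - y ^ 2) with (- (y ^ 2 - y)) by ring. rewrite exp_Ropp.
pose proof (exp_ge_1p (y ^ 2 - y)) as H.
apply Rmult_le_reg_l with (exp (y ^ 2 - y)); [apply exp_pos|].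
rewrite Rinv_r by (apply Rgt_not_eq, exp_pos).
apply Rle_trans with ((1 + (y ^ 2 - y)) * (1 + y)); [|apply Rmult_le_compat_r; lra].
assert (0 <= y ^ 3) by (apply pow_le; auto). nra.
Qed.

Lemma exp_half_le y : 0 <= y <= 1 -> exp (y / 2) <= 1 + y.
Proof.
intros Hy. pose proof (exp_ge_1p (- (y / 2))) as H. rewrite exp_Ropp in H.
pose proof (exp_pos (y / 2)) as Hp.
assert (exp (y / 2) * (1 + - (y / 2)) <= 1).
{ apply Rle_trans with (exp (y / 2) * / exp (y / 2)); [apply Rmult_le_compat_l; lra|]. rewrite Rinv_r; lra. }
nra.
Qed.

(** Compares [(1 - y)^(k/2) (1 + y')^(l/2)] with its exponential limit. The limit uses [K] and [L],
    which may exceed the exponents by 1 and 2; this shift costs factors [e^(y/2)] and [e^(y')],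
    absorbed in the terms [2 y] and [y']. The quadratic terms come from the logarithms, and [mu]
    from the normalization [ct]. *)
Lemma factor_compare k l K L ct mu y y' :
  (1 <= k)%nat -> INR k <= K <= INR k + 1 -> INR l <= L <= INR l + 2 ->
  1 - mu <= ct <= 1 -> 0 <= mu -> 0 <= ct -> 0 <= y -> 0 <= y' ->
  let E := exp (- (K * y) / 2 + L * y' / 2) in
  Rabs (ct * sqrt (1 - y) ^ k * sqrt (1 + y') ^ l - E) <= E * (2 * y + K * y ^ 2 + y' + L * y' ^ 2 + mu).
Proof.
intros Hk HK HL Hct Hmu Hct0 Hy Hy' E.
assert (HE : 0 < E) by apply exp_pos.
assert (Hk0 : 0 <= INR k) by apply pos_INR. assert (Hl0 : 0 <= INR l) by apply pos_INR.
assert (P1 : 0 <= sqrt (1 - y) ^ k) by (apply pow_le, sqrt_pos).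
assert (P2 : 0 <= sqrt (1 + y') ^ l) by (apply pow_le, sqrt_pos).
assert (Hup : ct * sqrt (1 - y) ^ k * sqrt (1 + y') ^ l <= E * (1 + y)).
{ destruct (Rle_lt_dec y 1) as [Hy1|Hy1].
  - assert (A : sqrt (1 - y) ^ k <= exp (INR k * (- y) / 2)) by (apply sqrt_pow_le; apply exp_ge_1p).
    assert (B : sqrt (1 + y') ^ l <= exp (INR l * y' / 2)) by (apply sqrt_pow_le; apply exp_ge_1p).
    apply Rle_trans with (1 * exp (INR k * (- y) / 2) * exp (INR l * y' / 2)).
    + apply Rmult_le_compat; auto; [apply Rmult_le_pos; auto|apply Rmult_le_compat; auto; lra].
    + rewrite Rmult_1_l, <- exp_plus.
      apply Rle_trans with (E * exp (y / 2)); [|apply Rmult_le_compat_l; [lra|apply exp_half_le; lra]].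
      unfold E. rewrite <- exp_plus. apply exp_le.
      assert (K * y <= (INR k + 1) * y) by (apply Rmult_le_compat_r; lra).
      assert (INR l * y' <= L * y') by (apply Rmult_le_compat_r; lra). lra.
  (* Past [y = 1] the truncated power is 0, because [k >= 1]. *)
  - rewrite (sqrt_neg_0 (1 - y)) by lra. rewrite pow_i by lia. rewrite Rmult_0_r, Rmult_0_l.
    apply Rmult_le_pos; lra. }
assert (Hlo : E * (1 - (2 * y + K * y ^ 2 + y' + L * y' ^ 2 + mu)) <= ct * sqrt (1 - y) ^ k * sqrt (1 + y') ^ l).
{ assert (Q : 0 <= K * y ^ 2) by (apply Rmult_le_pos; [lra|apply pow2_ge_0]).
  assert (Q' : 0 <= L * y' ^ 2) by (apply Rmult_le_pos; [lra|apply pow2_ge_0]).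
  destruct (Rle_lt_dec y (1 / 2)) as [Hy1|Hy1].
  - assert (A : exp (INR k * - (y + 2 * y ^ 2) / 2) <= sqrt (1 - y) ^ k) by (apply sqrt_pow_ge, one_minus_ge; lra).
    assert (B : exp (INR l * (y' - y' ^ 2) / 2) <= sqrt (1 + y') ^ l) by (apply sqrt_pow_ge, one_plus_ge; lra).
    set (q := K * y ^ 2 + y' + L * y' ^ 2).
    assert (D : E * exp (- q) <= sqrt (1 - y) ^ k * sqrt (1 + y') ^ l).
    { apply Rle_trans with (exp (INR k * - (y + 2 * y ^ 2) / 2) * exp (INR l * (y' - y' ^ 2) / 2)).
      - unfold E. rewrite <- !exp_plus. apply exp_le. unfold q.
        assert (INR k * (y + 2 * y ^ 2) <= K * (y + 2 * y ^ 2)) by (apply Rmult_le_compat_r; nra).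
        assert (L * y' <= (INR l + 2) * y') by (apply Rmult_le_compat_r; lra).
        assert (INR l * y' ^ 2 <= L * y' ^ 2) by (apply Rmult_le_compat_r; [apply pow2_ge_0|lra]).
        nra.
      - apply Rmult_le_compat; auto; left; apply exp_pos. }
    pose proof (exp_ge_1p (- q)) as Eq.
    destruct (Rle_lt_dec (1 - mu) 0) as [Hm|Hm].
    + apply Rle_trans with 0; [|rewrite Rmult_assoc; repeat apply Rmult_le_pos; auto].
      assert (1 - (2 * y + K * y ^ 2 + y' + L * y' ^ 2 + mu) <= 0) by lra. nra.
    + rewrite Rmult_assoc. apply Rle_trans with ((1 - mu) * (E * exp (- q))).
      * apply Rle_trans with (E * ((1 - mu) * (1 + - q))).
        -- apply Rmult_le_compat_l; [lra|]. assert (0 <= mu * q) by (apply Rmult_le_pos; unfold q; lra). unfold q in *. nra.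
        -- replace ((1 - mu) * (E * exp (- q))) with (E * ((1 - mu) * exp (- q))) by ring.
           apply Rmult_le_compat_l; [lra|]. apply Rmult_le_compat_l; lra.
      * apply Rmult_le_compat; try lra. apply Rmult_le_pos; [lra|left; apply exp_pos].
  (* For [y > 1/2] the allowed relative error exceeds 1, so the lower bound is negative. *)
  - apply Rle_trans with 0; [|rewrite Rmult_assoc; repeat apply Rmult_le_pos; auto].
    assert (1 - (2 * y + K * y ^ 2 + y' + L * y' ^ 2 + mu) <= 0) by lra. nra. }
assert (Q : 0 <= K * y ^ 2) by (apply Rmult_le_pos; [lra|apply pow2_ge_0]).
assert (Q' : 0 <= L * y' ^ 2) by (apply Rmult_le_pos; [lra|apply pow2_ge_0]).
apply Rabs_le. split; [lra|].
assert (E * (1 + y) <= E * (1 + (2 * y + K * y ^ 2 + y' + L * y' ^ 2 + mu))) by (apply Rmult_le_compat_l; lra). lra.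
Qed.

Lemma cosh_ge_1 w : 1 <= cosh w.
Proof.
unfold cosh. rewrite exp_Ropp. pose proof (exp_pos w) as H.
assert (0 <= (exp w - 1) ^ 2 / exp w) by (apply Rmult_le_pos; [apply pow2_ge_0|left; apply Rinv_0_lt_compat; auto]).
replace ((exp w - 1) ^ 2 / exp w) with (exp w + / exp w - 2) in H0 by (field; lra). lra.
Qed.

Lemma exp_le_2cosh w : exp w <= 2 * cosh w.
Proof. unfold cosh. pose proof (exp_pos (- w)). lra. Qed.

Lemma sinh_pos_le w : 0 <= w -> 0 <= sinh w.
Proof. intros H. unfold sinh. assert (exp (- w) <= exp w) by (apply exp_le; lra). lra. Qed.

Lemma exp_sinh_cont z w : continuous (fun w => exp (- (z * sinh w))) w.
Proof.
apply (ex_derive_continuous (V := R_NormedModule)). unfold sinh. auto_derive. auto.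
Qed.

Lemma cosh_cont w : continuous cosh w.
Proof. apply (ex_derive_continuous (V := R_NormedModule)). unfold cosh. auto_derive. auto. Qed.

Lemma RInt_cosh_exp_sinh_eq z B : 0 < z ->
  RInt (fun w => cosh w * exp (- (z * sinh w))) 0 B = / z * (1 - exp (- (z * sinh B))).
Proof.
intros Hz.
assert (Hc : forall x, continuous (fun w => cosh w * exp (- (z * sinh w))) x).
{ intros; apply continuous_mult_R; [apply cosh_cont|apply exp_sinh_cont]. }
assert (Hd : forall x, is_derive (fun w => - exp (- (z * sinh w)) / z) x (cosh x * exp (- (z * sinh x)))).
{ intros x. unfold sinh, cosh. auto_derive; auto. unfold Rminus, Rdiv. field. lra. }
rewrite (is_RInt_unique _ _ _ _ (is_RInt_derive (V := R_CompleteNormedModule) _ _ 0 B (fun x _ => Hd x) (fun x _ => Hc x))).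
unfold minus, plus, opp; simpl. rewrite sinh_0, Rmult_0_r, Ropp_0, exp_0. field. lra.
Qed.

Lemma RInt_cosh_exp_sinh z B : 0 < z ->
  RInt (fun w => cosh w * exp (- (z * sinh w))) 0 B <= / z.
Proof.
intros Hz. rewrite RInt_cosh_exp_sinh_eq by auto.
assert (0 < / z * exp (- (z * sinh B))) by (apply Rmult_lt_0_compat; [apply Rinv_0_lt_compat; auto|apply exp_pos]). lra.
Qed.

(** For [w >= 0] one has [cosh w <= 1 + sinh w], and the enlarged integrand has an elementary
    primitive. *)
Lemma RInt_cosh2_exp_sinh z B : 0 < z -> 0 <= B ->
  RInt (fun w => cosh w ^ 2 * exp (- (z * sinh w))) 0 B <= / z + / z ^ 2.
Proof.
intros Hz HB.
assert (Hc : forall x, continuous (fun w => cosh w * (1 + sinh w) * exp (- (z * sinh w))) x).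
{ intros; apply continuous_mult_R; [|apply exp_sinh_cont].
  apply (ex_derive_continuous (V := R_NormedModule)). unfold sinh, cosh. auto_derive. auto. }
assert (Hd : forall x, is_derive (fun w => - exp (- (z * sinh w)) * ((1 + sinh w) / z + / z ^ 2)) x (cosh x * (1 + sinh x) * exp (- (z * sinh x)))).
{ intros x. unfold sinh, cosh. auto_derive; auto. unfold Rminus, Rdiv. field. lra. }
apply Rle_trans with (RInt (fun w => cosh w * (1 + sinh w) * exp (- (z * sinh w))) 0 B).
- apply RInt_le; auto.
  + apply ex_RInt_cont. intros; apply continuous_mult_R; [|apply exp_sinh_cont].
    apply (ex_derive_continuous (V := R_NormedModule)). unfold cosh. auto_derive. auto.
  + apply ex_RInt_cont; auto.
  + intros w Hw. apply Rmult_le_compat_r; [left; apply exp_pos|].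
    pose proof (cosh_ge_1 w). simpl. rewrite Rmult_1_r. apply Rmult_le_compat_l; [lra|].
    pose proof (sinh_pos_le w). assert (cosh w - sinh w = exp (- w)) by (unfold cosh, sinh; field).
    assert (exp (- w) <= 1) by (rewrite <- exp_0; apply exp_le; lra). lra.
- rewrite (is_RInt_unique _ _ _ _ (is_RInt_derive (V := R_CompleteNormedModule) _ _ 0 B (fun x _ => Hd x) (fun x _ => Hc x))).
  unfold minus, plus, opp; simpl. rewrite sinh_0, Rmult_0_r, Ropp_0, exp_0.
  assert (0 <= exp (- (z * sinh B)) * ((1 + sinh B) / z + / z ^ 2)).
  { pose proof (sinh_pos_le B HB). apply Rmult_le_pos; [left; apply exp_pos|]. apply Rplus_le_le_0_compat.
    - apply Rmult_le_pos; [lra|left; apply Rinv_0_lt_compat; auto].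
    - left; apply Rinv_0_lt_compat, pow_lt; auto. }
  simpl in H. lra.
Qed.

Lemma abs_RInt_diff_le (f g h : R -> R) a b : a <= b ->
  (forall x, continuous f x) -> (forall x, continuous g x) -> (forall x, continuous h x) ->
  (forall x, a <= x <= b -> Rabs (f x - g x) <= h x) ->
  Rabs (RInt f a b - RInt g a b) <= RInt h a b.
Proof.
intros Hab Hf Hg Hh H.
assert (Hfg : forall x, continuous (fun x => f x - g x) x) by (intros; apply (continuous_minus (V := R_NormedModule)); auto).
replace (RInt f a b - RInt g a b) with (RInt (fun x => f x - g x) a b).
2:{ apply (RInt_minus (V := R_CompleteNormedModule)); apply ex_RInt_cont; auto. }
eapply Rle_trans; [apply abs_RInt_le; auto; apply ex_RInt_cont; auto|].
apply RInt_le; auto; [|apply ex_RInt_cont; auto|intros; apply H; lra].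
apply ex_RInt_cont. intros x. apply (continuous_comp (fun x => f x - g x) Rabs); auto. apply continuous_Rabs.
Qed.

Lemma segment_cont ct a b k l w :
  continuous (fun w => ct * sqrt (1 - a * exp w) ^ k * sqrt (1 + b * exp (- w)) ^ l) w.
Proof.
assert (Cp : forall (f : R -> R) n x, continuous f x -> continuous (fun x => f x ^ n) x).
{ intros f n x Hf. induction n as [|n IH]; [apply continuous_const|]. apply continuous_mult_R; auto. }
apply continuous_mult_R; [apply continuous_mult_R; [apply continuous_const|]|]; apply Cp.
- apply (continuous_comp (fun w => 1 - a * exp w) sqrt); [|apply continuous_sqrt].
  apply (ex_derive_continuous (V := R_NormedModule)). auto_derive. auto.
- apply (continuous_comp (fun w => 1 + b * exp (- w)) sqrt); [|apply continuous_sqrt].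
  apply (ex_derive_continuous (V := R_NormedModule)). auto_derive. auto.
Qed.

(** With [y = a e^w] and [y' = b e^(- w)] the conditions [a K = b L = z] make the limiting exponent
    [- z sinh w]. The relative error is at most quadratic in [cosh w]; integrated against
    [e^(- z sinh w)] it becomes at most [8 / K + 1 / L + 5 a + 2 b], since [a / z = 1 / K] and
    [b / z = 1 / L]. *)
Lemma timelike_segment k l K L ct mu a b z B (g : R -> R) :
  (1 <= k)%nat -> INR k <= K <= INR k + 1 -> INR l <= L <= INR l + 2 -> 0 < L ->
  1 - mu <= ct <= 1 -> 0 <= ct -> 0 <= mu <= z * (a + b) -> 0 < a -> 0 < b -> 0 < z -> a * K = z -> b * L = z -> 0 <= B ->
  (forall w, continuous g w) -> (forall w, 0 <= w -> 0 <= g w <= 1) ->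
  Rabs (RInt (fun w => g w * (ct * sqrt (1 - a * exp w) ^ k * sqrt (1 + b * exp (- w)) ^ l)) 0 B
       - RInt (fun w => g w * exp (- (z * sinh w))) 0 B) <= 9 * (/ K + / L + a + b).
Proof.
intros Hk HK HL HL0 Hct Hct0 Hmu Ha Hb Hz Haz Hbz HB Hgc Hg.
assert (Hk1 : 1 <= INR k) by (apply (le_INR 1); auto).
set (h := fun w => (4 * a + b + z * b + mu) * (cosh w * exp (- (z * sinh w))) + 4 * z * a * (cosh w ^ 2 * exp (- (z * sinh w)))).
assert (Hc1 : forall x, continuous (fun w => cosh w * exp (- (z * sinh w))) x).
{ intros; apply continuous_mult_R; [apply cosh_cont|apply exp_sinh_cont]. }
assert (Hc2 : forall x, continuous (fun w => cosh w ^ 2 * exp (- (z * sinh w))) x).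
{ intros; apply continuous_mult_R; [|apply exp_sinh_cont].
  apply (ex_derive_continuous (V := R_NormedModule)). unfold cosh. auto_derive. auto. }
apply Rle_trans with (RInt h 0 B).
- apply (abs_RInt_diff_le (fun w => g w * (ct * sqrt (1 - a * exp w) ^ k * sqrt (1 + b * exp (- w)) ^ l))
     (fun w => g w * exp (- (z * sinh w)))); auto.
  + intros; apply continuous_mult_R; auto. apply segment_cont.
  + intros; apply continuous_mult_R; auto. apply exp_sinh_cont.
  + intros; apply continuous_plus_R; apply continuous_mult_R; auto; apply continuous_const.
  + intros w Hw. rewrite <- Rmult_minus_distr_l, Rabs_mult. destruct (Hg w) as [G0 G1]; [lra|].
    rewrite (Rabs_pos_eq (g w)) by auto.
    set (y := a * exp w). set (y' := b * exp (- w)).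
    pose proof (exp_pos w) as Ew. pose proof (exp_pos (- w)) as Ew'.
    assert (Hy : 0 <= y) by (apply Rmult_le_pos; lra). assert (Hy' : 0 <= y') by (apply Rmult_le_pos; lra).
    pose proof (factor_compare k l K L ct mu y y' Hk HK HL Hct (proj1 Hmu) Hct0 Hy Hy') as H. cbv zeta in H.
    replace (- (K * y) / 2 + L * y' / 2) with (- (z * sinh w)) in H.
    2:{ unfold y, y', sinh. replace (K * (a * exp w)) with (z * exp w) by (rewrite <- Haz; ring).
        replace (L * (b * exp (- w))) with (z * exp (- w)) by (rewrite <- Hbz; ring). field. }
    eapply Rle_trans; [apply Rmult_le_compat_r; [apply Rabs_pos|exact G1]|]. rewrite Rmult_1_l.
    eapply Rle_trans; [exact H|].
    unfold h. set (E := exp (- (z * sinh w))) in *. assert (HE : 0 < E) by apply exp_pos.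
    pose proof (cosh_ge_1 w) as C1. pose proof (exp_le_2cosh w) as C2.
    assert (y <= 2 * a * cosh w) by (unfold y; replace (2 * a * cosh w) with (a * (2 * cosh w)) by ring; apply Rmult_le_compat_l; lra).
    assert (K * y ^ 2 <= 4 * z * a * cosh w ^ 2).
    { replace (K * y ^ 2) with (z * a * exp w ^ 2) by (unfold y; rewrite <- Haz; ring).
      replace (4 * z * a * cosh w ^ 2) with (z * a * (2 * cosh w) ^ 2) by ring.
      apply Rmult_le_compat_l; [apply Rmult_le_pos; lra|]. apply pow_incr. lra. }
    assert (e1 : exp (- w) <= 1) by (rewrite <- exp_0; apply exp_le; lra).
    assert (y' <= b) by (unfold y'; rewrite <- (Rmult_1_r b) at 2; apply Rmult_le_compat_l; lra).
    assert (L * y' ^ 2 <= z * b).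
    { replace (L * y' ^ 2) with (z * b * exp (- w) ^ 2) by (unfold y'; rewrite <- Hbz; ring).
      rewrite <- (Rmult_1_r (z * b)) at 2. apply Rmult_le_compat_l; [apply Rmult_le_pos; lra|].
      replace 1 with (1 ^ 2) by ring. apply pow_incr. lra. }
    assert (2 * y + K * y ^ 2 + y' + L * y' ^ 2 + mu <= (4 * a + b + z * b + mu) * cosh w + 4 * z * a * cosh w ^ 2).
    { assert (0 <= z * b) by (apply Rmult_le_pos; lra).
      assert (b + z * b + mu <= (b + z * b + mu) * cosh w) by (rewrite <- (Rmult_1_r (b + z * b + mu)) at 1; apply Rmult_le_compat_l; lra). lra. }
    replace ((4 * a + b + z * b + mu) * (cosh w * E) + 4 * z * a * (cosh w ^ 2 * E)) with
      (E * ((4 * a + b + z * b + mu) * cosh w + 4 * z * a * cosh w ^ 2)) by ring.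
    apply Rmult_le_compat_l; lra.
- unfold h. rewrite RInt_lin by (apply ex_RInt_cont; auto).
  pose proof (RInt_cosh_exp_sinh z B Hz) as I1. pose proof (RInt_cosh2_exp_sinh z B Hz HB) as I2.
  assert (0 <= z * b) by (apply Rmult_le_pos; lra).
  apply Rle_trans with ((4 * a + b + z * b + mu) * / z + 4 * z * a * (/ z + / z ^ 2)).
  + apply Rplus_le_compat; apply Rmult_le_compat_l; auto; [lra|]. apply Rmult_le_pos; lra.
  + assert (Ka : a / z = / K) by (rewrite <- Haz; field; split; nra).
    assert (Lb : b / z = / L) by (rewrite <- Hbz; field; split; nra).
    assert (mu / z <= a + b).
    { apply Rmult_le_reg_r with z; auto. unfold Rdiv. rewrite Rmult_assoc, Rinv_l, Rmult_1_r by lra. lra. }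
    replace ((4 * a + b + z * b + mu) * / z + 4 * z * a * (/ z + / z ^ 2)) with
      (8 * (a / z) + b / z + b + mu / z + 4 * a) by (field; lra).
    rewrite Ka, Lb. assert (0 < / K) by (apply Rinv_0_lt_compat; lra). assert (0 < / L) by (apply Rinv_0_lt_compat; lra). lra.
Qed.

Lemma cos_lipschitz x y : Rabs (cos x - cos y) <= Rabs (x - y).
Proof.
destruct (MVT_gen cos y x (fun t => - sin t)) as [t [_ E]].
- intros t _. auto_derive; auto. ring.
- intros t _. apply continuity_cos.
- rewrite E, Rabs_mult. rewrite <- (Rmult_1_l (Rabs (x - y))) at 2. apply Rmult_le_compat_r; [apply Rabs_pos|].
  rewrite Rabs_Ropp. apply Rabs_le, SIN_bound.
Qed.

Lemma sin_lipschitz x y : Rabs (sin x - sin y) <= Rabs (x - y).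
Proof.
destruct (MVT_gen sin y x cos) as [t [_ E]].
- intros t _. auto_derive; auto. ring.
- intros t _. apply continuity_sin.
- rewrite E, Rabs_mult. rewrite <- (Rmult_1_l (Rabs (x - y))) at 2. apply Rmult_le_compat_r; [apply Rabs_pos|].
  apply Rabs_le, COS_bound.
Qed.

Lemma atan_near q : 0 <= q <= 1 -> q - q ^ 2 <= atan q <= q.
Proof.
intros Hq. destruct (MVT_gen atan 0 q (fun t => / (1 + t ^ 2))) as [t [Ht E]].
- intros t _. auto_derive; auto. simpl. field. nra.
- intros t _. apply continuity_pt_filterlim, (ex_derive_continuous (V := R_NormedModule)). auto_derive; auto.
- rewrite Rmin_left, Rmax_right in Ht by lra. rewrite atan_0, !Rminus_0_r in E. rewrite E.
  assert (0 <= t ^ 2 <= q ^ 2) by (split; [apply pow2_ge_0|apply pow_incr; lra]).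
  assert (H1 : / (1 + t ^ 2) <= 1) by (rewrite <- Rinv_1; apply Rinv_le_contravar; lra).
  assert (H2 : 1 - q ^ 2 <= / (1 + t ^ 2)).
  { apply Rmult_le_reg_r with (1 + t ^ 2); [lra|]. rewrite Rinv_l by lra. nra. }
  split; nra.
Qed.

Lemma ln_near q : Rabs q <= 1 / 2 -> Rabs (ln (1 + q) - q) <= 2 * q ^ 2.
Proof.
intros Hq. apply Rabs_le_between in Hq. pose proof (pow2_ge_0 q).
assert (H1 : ln (1 + q) <= q).
{ rewrite <- (ln_exp q) at 2. apply ln_le; [lra|apply exp_ge_1p]. }
assert (H2 : q - 2 * q ^ 2 <= ln (1 + q)).
{ rewrite <- (ln_exp (q - 2 * q ^ 2)). apply ln_le; [apply exp_pos|].
  destruct (Rle_lt_dec 0 q).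
  - eapply Rle_trans; [|apply one_plus_ge; auto]. apply exp_le. lra.
  - pose proof (one_minus_ge (- q)) as K. replace (- (- q + 2 * (- q) ^ 2)) with (q - 2 * q ^ 2) in K by ring.
    replace (1 - - q) with (1 + q) in K by ring. apply K. lra. }
apply Rabs_le. lra.
Qed.

(** Polar coordinates of [1 + a e^(i phi)], with [x = cos phi], [s = sin phi]. *)
Lemma log_mod_near a x : 0 < a <= 1 / 5 -> -1 <= x <= 1 ->
  Rabs (ln (1 + (2 * a * x + a ^ 2)) - 2 * a * x) <= 11 * a ^ 2.
Proof.
intros Ha Hx.
assert (Hax : Rabs (a * x) <= a).
{ rewrite Rabs_mult, (Rabs_pos_eq a) by lra. rewrite <- (Rmult_1_r a) at 2. apply Rmult_le_compat_l; [lra|]. apply Rabs_le; lra. }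
apply Rabs_le_between in Hax.
set (q := 2 * a * x + a ^ 2).
assert (Hq : - (22/10 * a) <= q <= 22/10 * a) by (unfold q; split; nra).
assert (Hq1 : Rabs q <= 1 / 2) by (apply Rabs_le; lra).
pose proof (ln_near q Hq1) as H. apply Rabs_le_between in H.
assert (q ^ 2 <= 484/100 * a ^ 2) by nra.
apply Rabs_le. unfold q in *. split; nra.
Qed.

Lemma arg_near a x s : 0 < a <= 1 / 5 -> -1 <= x <= 1 -> 0 <= s <= 1 ->
  Rabs (atan (a * s / (1 + a * x)) - a * s) <= 3 * a ^ 2.
Proof.
intros Ha Hx Hs.
assert (Hax : - a <= a * x <= a) by (split; nra).
assert (Hd : 8/10 <= 1 + a * x) by lra.
set (q := a * s / (1 + a * x)).
assert (Eq : q * (1 + a * x) = a * s) by (unfold q; field; lra).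
assert (Has : 0 <= a * s <= a) by (split; nra).
assert (Hq0 : 0 <= q) by (apply Rmult_le_pos; [lra|left; apply Rinv_0_lt_compat; lra]).
assert (Hq1 : q <= 125/100 * a) by nra.
assert (Hqa : Rabs (q - a * s) <= 125/100 * a ^ 2).
{ replace (q - a * s) with (- (q * (a * x))) by (rewrite <- Eq; ring).
  rewrite Rabs_Ropp, Rabs_mult, (Rabs_pos_eq q) by auto.
  replace (125/100 * a ^ 2) with (125/100 * a * a) by ring. apply Rmult_le_compat; auto; [apply Rabs_pos|apply Rabs_le; lra]. }
apply Rabs_le_between in Hqa.
destruct (atan_near q) as [A1 A2]; [lra|].
assert (q ^ 2 <= 15625/10000 * a ^ 2) by nra.
apply Rabs_le. lra.
Qed.

Lemma exp_near A : Rabs A <= 2 / 3 -> Rabs (exp A - 1) <= 3 * Rabs A.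
Proof.
intros HA. pose proof (exp_ge_1p A) as H1. pose proof (exp_ge_1p (- A)) as H2.
rewrite exp_Ropp in H2. pose proof (exp_pos A).
assert (H3 : exp A * (1 + - A) <= 1).
{ apply Rle_trans with (exp A * / exp A); [apply Rmult_le_compat_l; lra|rewrite Rinv_r; lra]. }
unfold Rabs in *. destruct (Rcase_abs A), (Rcase_abs (exp A - 1)); nra.
Qed.

Lemma csqrt_up_cis X Y : 0 < X -> 0 <= Y ->
  csqrt_up (X, Y) = (exp (ln (X ^ 2 + Y ^ 2) / 4) * cos (atan (Y / X) / 2), exp (ln (X ^ 2 + Y ^ 2) / 4) * sin (atan (Y / X) / 2)).
Proof.
intros HX HY. set (th := atan (Y / X)).
assert (Hr : 0 < X ^ 2 + Y ^ 2) by nra.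
set (r := sqrt (X ^ 2 + Y ^ 2)). assert (Hrp : 0 < r) by (apply sqrt_lt_R0; auto).
assert (Er : r ^ 2 = X ^ 2 + Y ^ 2) by (apply pow2_sqrt; lra).
assert (Eh : sqrt (1 + (Y / X)²) = r / X).
{ replace (1 + (Y / X)²) with ((r / X)²) by (unfold Rsqr; replace (r / X * (r / X)) with (r ^ 2 / X ^ 2) by (field; lra); rewrite Er; field; lra).
  apply sqrt_Rsqr. left; apply Rdiv_lt_0_compat; auto. }
assert (Ec : X = r * cos (2 * (th / 2))).
{ replace (2 * (th / 2)) with th by field. unfold th. rewrite cos_atan, Eh. field; lra. }
assert (Es : Y = r * sin (2 * (th / 2))).
{ replace (2 * (th / 2)) with th by field. unfold th. rewrite sin_atan, Eh. field; lra. }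
assert (Hth : 0 <= th < PI / 2).
{ unfold th. split; [|apply atan_bound]. destruct HY as [HY|<-].
  - rewrite <- atan_0. left. apply atan_increasing. apply Rdiv_lt_0_compat; auto.
  - unfold Rdiv. rewrite Rmult_0_l, atan_0. lra. }
pose proof PI_RGT_0.
assert (E4 : exp (ln (X ^ 2 + Y ^ 2) / 4) = sqrt r).
{ unfold r. rewrite <- (exp_ln (X ^ 2 + Y ^ 2)) at 2 by auto. rewrite !sqrt_exp. f_equal. field. }
rewrite E4. rewrite Ec at 1. rewrite Es at 1. apply csqrt_up_polar; auto; [apply cos_ge_0; lra|apply sin_ge_0; lra].
Qed.

(** * The integrand on the circle *)

Section Arc.
Variable M : R.
Hypothesis HM : 0 < M.
Let c := norm1 M.

Lemma Cmod_sfac_4 phi v : 0 <= phi <= PI ->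
  Cmod (sfac M phi v) ^ 4 = / (1 + M * M) * (1 + 2 * (M * exp v) * cos phi + (M * exp v) ^ 2).
Proof.
intros Hp. pose proof (sfac_sqr M HM phi v Hp) as E. apply (f_equal Cmod) in E. rewrite !Cmod_mult in E.
replace (Cmod (sfac M phi v) ^ 4) with ((Cmod (sfac M phi v) * Cmod (sfac M phi v)) ^ 2) by ring.
rewrite E, Rpow_mult_distr, Cmod_R, pow2_abs, Cmod_sqr, ufac_eq; cbn [fst snd].
pose proof (norm1_sqr M) as N. pose proof (sin2_cos2 phi) as T. unfold Rsqr in T.
assert (N2 : norm1 M ^ 2 = / (1 + M * M)).
{ apply Rmult_eq_reg_r with (1 + M * M); [|nra]. rewrite Rinv_l by nra. lra. }
rewrite N2. f_equal. set (x := M * exp v).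
replace (1 + M * (exp v * cos phi)) with (1 + x * cos phi) by (unfold x; ring).
replace (M * (exp v * sin phi)) with (x * sin phi) by (unfold x; ring).
replace ((1 + x * cos phi) ^ 2 + (x * sin phi) ^ 2) with (1 + 2 * x * cos phi + x ^ 2 * (sin phi * sin phi + cos phi * cos phi)) by ring.
rewrite T. ring.
Qed.

Lemma Cmod_tfac_4 phi v : 0 <= phi <= PI ->
  Cmod (tfac M phi v) ^ 4 = / (1 + M * M) * (1 - 2 * (M * exp (- v)) * cos phi + (M * exp (- v)) ^ 2).
Proof.
intros Hp. pose proof (tfac_sqr M HM phi v Hp) as E. apply (f_equal Cmod) in E. rewrite !Cmod_mult in E.
replace (Cmod (tfac M phi v) ^ 4) with ((Cmod (tfac M phi v) * Cmod (tfac M phi v)) ^ 2) by ring.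
rewrite E, Rpow_mult_distr, Cmod_R, pow2_abs, Cmod_sqr, vfac_eq; cbn [fst snd].
pose proof (norm1_sqr M) as N. pose proof (sin2_cos2 phi) as T. unfold Rsqr in T.
assert (N2 : norm1 M ^ 2 = / (1 + M * M)).
{ apply Rmult_eq_reg_r with (1 + M * M); [|nra]. rewrite Rinv_l by nra. lra. }
rewrite N2. f_equal. set (x := M * exp (- v)).
replace (1 - M * (exp (- v) * cos phi)) with (1 - x * cos phi) by (unfold x; ring).
replace (M * (exp (- v) * sin phi)) with (x * sin phi) by (unfold x; ring).
replace ((1 - x * cos phi) ^ 2 + (x * sin phi) ^ 2) with (1 - 2 * x * cos phi + x ^ 2 * (sin phi * sin phi + cos phi * cos phi)) by ring.
rewrite T. ring.
Qed.

(* Weighted AM-GM in the form [y <= exp (y - 1)]. *)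
Lemma contour_fun_mod k l phi v : (0 <= k)%Z -> (0 <= l)%Z -> 0 <= phi <= PI ->
  let a := M * exp v in let b := M * exp (- v) in
  IZR k * (2 * a * cos phi + a ^ 2 - M * M) + IZR l * (- 2 * b * cos phi + b ^ 2 - M * M) <= 2 * (1 + M * M) ->
  Cmod (contour_fun M k l phi v) <= 2.
Proof.
intros Hk Hl Hp a b Hq.
assert (HD : 0 < 1 + M * M) by nra.
unfold contour_fun, zpow. destruct (Z.leb_spec 0 k); [|lia]. rewrite Cmod_mult, !Cmod_pow.
set (S := Cmod (sfac M phi v)). set (T := Cmod (tfac M phi v)).
assert (HS : 0 <= S) by apply Cmod_ge_0. assert (HT : 0 <= T) by apply Cmod_ge_0.
assert (ES : S ^ 4 <= exp ((2 * a * cos phi + a ^ 2 - M * M) / (1 + M * M))).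
{ unfold S. rewrite Cmod_sfac_4 by auto. fold a. eapply Rle_trans; [|apply exp_ge_1p]. apply Req_le. field. lra. }
assert (ET : T ^ 4 <= exp ((- 2 * b * cos phi + b ^ 2 - M * M) / (1 + M * M))).
{ unfold T. rewrite Cmod_tfac_4 by auto. fold b. eapply Rle_trans; [|apply exp_ge_1p]. apply Req_le. field. lra. }
assert (H4 : (S ^ Z.to_nat k * T ^ Z.to_nat l) ^ 4 <= exp 2).
{ replace ((S ^ Z.to_nat k * T ^ Z.to_nat l) ^ 4) with ((S ^ 4) ^ Z.to_nat k * (T ^ 4) ^ Z.to_nat l).
  2:{ rewrite Rpow_mult_distr, <- !pow_mult. f_equal; f_equal; lia. }
  eapply Rle_trans.
  { apply Rmult_le_compat; try (apply pow_le, pow_le; auto).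
    - apply pow_incr. split; [apply pow_le; auto|exact ES].
    - apply pow_incr. split; [apply pow_le; auto|exact ET]. }
  rewrite !exp_pow, <- exp_plus, !INR_IZR_INZ, !Z2Nat.id by auto. apply exp_le.
  apply Rmult_le_reg_r with (1 + M * M); auto. field_simplify; [|lra]. lra. }
destruct (Rle_lt_dec (S ^ Z.to_nat k * T ^ Z.to_nat l) 2) as [|H2]; auto. exfalso.
assert (2 ^ 4 <= (S ^ Z.to_nat k * T ^ Z.to_nat l) ^ 4) by (apply pow_incr; lra).
(* The fourth power is at most [e^2], below [2^4 = 16]. *)
assert (exp 2 <= 9).
{ replace 2 with (1 + 1) by ring. rewrite exp_plus. pose proof exp_le_3. pose proof (exp_pos 1). nra. }
lra.
Qed.

(** Here [sqrt c = (1 + M^2)^(- 1/4)], and [0 <= ln (1 + M^2) <= M^2]. *)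
Lemma sqrt_norm1_pow_bounds n : 1 - INR n * (M * M) / 4 <= sqrt c ^ n <= 1.
Proof.
assert (E : sqrt c = exp (- (ln (1 + M * M) / 4))).
{ unfold c, norm1. rewrite <- (exp_ln (1 + M ^ 2)) by nra. rewrite sqrt_exp, <- exp_Ropp, sqrt_exp.
  f_equal. replace (1 + M * M) with (1 + M ^ 2) by ring. field. }
assert (H1 : 0 <= ln (1 + M * M) <= M * M).
{ split; [rewrite <- ln_1; apply ln_le; nra|]. rewrite <- (ln_exp (M * M)) at 2. apply ln_le; [nra|apply exp_ge_1p]. }
pose proof (pos_INR n).
rewrite E, exp_pow. split.
- eapply Rle_trans; [|apply exp_ge_1p].
  assert (INR n * ln (1 + M * M) <= INR n * (M * M)) by (apply Rmult_le_compat_l; lra). lra.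
- apply Rle_trans with (exp 0); [|rewrite exp_0; lra]. apply exp_le. assert (0 <= INR n * ln (1 + M * M)) by (apply Rmult_le_pos; lra). lra.
Qed.

Lemma sqrt_norm1_sqr_R : sqrt c * sqrt c = c.
Proof. apply sqrt_sqrt. left; apply norm1_pos. Qed.

(** For [a, b < 1] both factors lie in the right half-plane, where the argument is an [atan] and
    [csqrt_up] halves it. *)
Lemma contour_fun_cis k l phi v : (0 <= k)%Z -> (0 <= l)%Z -> 0 <= phi <= PI ->
  let a := M * exp v in let b := M * exp (- v) in a < 1 -> b < 1 ->
  let A := (IZR k * ln (1 + (2 * a * cos phi + a ^ 2)) + IZR l * ln (1 + (2 * b * (- cos phi) + b ^ 2))) / 4 in
  let B := (IZR k * atan (a * sin phi / (1 + a * cos phi)) + IZR l * atan (b * sin phi / (1 + b * (- cos phi)))) / 2 in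
  contour_fun M k l phi v = (sqrt c ^ Z.to_nat (k + l) * exp A * cos B, sqrt c ^ Z.to_nat (k + l) * exp A * sin B).
Proof.
intros Hk Hl Hp a b Ha Hb A B.
assert (Ha0 : 0 < a) by (apply Rmult_lt_0_compat; auto; apply exp_pos).
assert (Hb0 : 0 < b) by (apply Rmult_lt_0_compat; auto; apply exp_pos).
pose proof (COS_bound phi) as Hx. assert (Hs : 0 <= sin phi) by (apply sin_ge_0; tauto).
pose proof (sin2_cos2 phi) as T. unfold Rsqr in T.
unfold contour_fun, zpow. destruct (Z.leb_spec 0 k); [|lia].
unfold sfac, tfac. fold c. rewrite ufac_eq, vfac_eq.
replace (1 + M * (exp v * cos phi), M * (exp v * sin phi)) with (1 + a * cos phi, a * sin phi) by (unfold a; f_equal; ring).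
replace (1 - M * (exp (- v) * cos phi), M * (exp (- v) * sin phi)) with (1 + b * (- cos phi), b * sin phi) by (unfold b; f_equal; ring).
rewrite !csqrt_up_cis by nra.
replace ((1 + a * cos phi) ^ 2 + (a * sin phi) ^ 2) with (1 + (2 * a * cos phi + a ^ 2))
 by (replace (a ^ 2) with (a ^ 2 * (sin phi * sin phi + cos phi * cos phi)) at 1 by (rewrite T; ring); ring).
replace ((1 + b * - cos phi) ^ 2 + (b * sin phi) ^ 2) with (1 + (2 * b * - cos phi + b ^ 2))
 by (replace (b ^ 2) with (b ^ 2 * (sin phi * sin phi + cos phi * cos phi)) at 1 by (rewrite T; ring); ring).
set (th1 := atan _). set (th2 := atan (b * sin phi / _)).
set (l1 := ln _). set (l2 := ln (1 + (2 * b * _ + _))).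
set (cis := fun th : R => (cos th, sin th) : C).
assert (P : forall (q th : R) (n : nat), ((RtoC (sqrt c) * (exp (q / 4) * cos (th / 2), exp (q / 4) * sin (th / 2))%R) ^ n)%C =
  (RtoC (sqrt c ^ n * exp (INR n * q / 4)) * cis (INR n * th / 2)%R)%C).
{ intros q th n.
  replace ((exp (q / 4) * cos (th / 2), exp (q / 4) * sin (th / 2)) : C) with (RtoC (exp (q / 4)) * cis (th / 2)%R)%C
    by (unfold cis, Cmult, RtoC; cbn [fst snd]; f_equal; ring).
  unfold cis. rewrite !Cpow_mult_l, de_moivre, <- !RtoC_pow, exp_pow, RtoC_mult.
  replace (INR n * (q / 4)) with (INR n * q / 4) by field. replace (INR n * (th / 2)) with (INR n * th / 2) by field. ring. }
rewrite !P, !INR_IZR_INZ, !Z2Nat.id by auto.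
rewrite Z2Nat.inj_add, pow_add by auto.
assert (EA : exp A = exp (IZR k * l1 / 4) * exp (IZR l * l2 / 4)).
{ rewrite <- exp_plus. f_equal. unfold A. fold l1 l2. field. }
assert (EB : B = IZR k * th1 / 2 + IZR l * th2 / 2) by (unfold B; fold th1 th2; field).
rewrite EA, EB, cos_plus, sin_plus. unfold cis, Cmult, RtoC; cbn [fst snd]. f_equal; ring.
Qed.

(** Because [a K = b L = z], the first-order terms of the log-modulus cancel and those of the
    argument add up to [z sin phi]. Quadratic remainders are of size [K a^2 = z a] and
    [L b^2 = z b]; the offsets [i], [j] between exponents and [K], [L] cost at most [a + b]. The
    prefactor [c] raises the power of [sqrt c] to [K + L], whose distance from 1 is of the order of
    [M^2 (K + L) = z (a + b)]. The smallness assumptions keep [|A| <= 2/3], as [exp_near]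
    requires. *)
Lemma arc_approx k l K L z i j phi v : (0 <= k)%Z -> (0 <= l)%Z -> 0 <= phi <= PI ->
  let a := M * exp v in let b := M * exp (- v) in
  a <= 1 / 5 -> b <= 1 / 5 -> IZR k = K - i -> IZR l = L - j -> 0 <= i <= 2 -> 0 <= j <= 2 -> i + j = 2 ->
  a * K = z -> b * L = z -> z * (a + b) <= 2 / 25 ->
  let ep := 12 * (a + b + z * (a + b)) in
  Rabs (c * fst (contour_fun M k l phi v) - cos (z * sin phi)) <= ep /\
  Rabs (c * snd (contour_fun M k l phi v) - sin (z * sin phi)) <= ep.
Proof.
intros Hk Hl Hp a b Ha Hb Ek El Hi Hj Hij Haz Hbz Hsmall ep.
assert (Ha0 : 0 < a) by (apply Rmult_lt_0_compat; auto; apply exp_pos).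
assert (Hb0 : 0 < b) by (apply Rmult_lt_0_compat; auto; apply exp_pos).
assert (Hab : a * b = M * M).
{ unfold a, b. replace (M * exp v * (M * exp (- v))) with (M * M * (exp v * exp (- v))) by ring.
  rewrite <- exp_plus, Rplus_opp_r, exp_0. ring. }
pose proof (COS_bound phi) as Hx. assert (Hs : 0 <= sin phi <= 1) by (split; [apply sin_ge_0; tauto|apply SIN_bound]).
assert (Hk0 : 0 <= IZR k) by (apply IZR_le; auto). assert (Hl0 : 0 <= IZR l) by (apply IZR_le; auto).
rewrite (contour_fun_cis k l phi v Hk Hl Hp) by (fold a b; lra). fold a b.
set (x := cos phi) in *. set (s := sin phi) in *.
set (l1 := ln _). set (l2 := ln (1 + (2 * b * _ + _))). set (t1 := atan _). set (t2 := atan (b * s / _)).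
assert (L1 : Rabs (l1 - 2 * a * x) <= 11 * a ^ 2) by (apply log_mod_near; lra).
assert (L2 : Rabs (l2 - 2 * b * - x) <= 11 * b ^ 2) by (apply log_mod_near; lra).
assert (T1 : Rabs (t1 - a * s) <= 3 * a ^ 2) by (apply arg_near; lra).
assert (T2 : Rabs (t2 - b * s) <= 3 * b ^ 2) by (apply arg_near; lra).
set (A := (IZR k * l1 + IZR l * l2) / 4). set (B := (IZR k * t1 + IZR l * t2) / 2).
set (E0 := a + b + z * (a + b)).
assert (Ka2 : IZR k * a ^ 2 <= z * a).
{ replace (z * a) with (K * a ^ 2) by (rewrite <- Haz; ring). apply Rmult_le_compat_r; [apply pow2_ge_0|lra]. }
assert (Lb2 : IZR l * b ^ 2 <= z * b).
{ replace (z * b) with (L * b ^ 2) by (rewrite <- Hbz; ring). apply Rmult_le_compat_r; [apply pow2_ge_0|lra]. }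
assert (Hz : 0 <= z) by (rewrite <- Haz; apply Rmult_le_pos; lra).
assert (Hza : 0 <= z * a) by (apply Rmult_le_pos; lra). assert (Hzb : 0 <= z * b) by (apply Rmult_le_pos; lra).
assert (Hscale : forall n u w, 0 <= n -> Rabs u <= w -> Rabs (n * u) <= n * w).
{ intros n u w Hn Hu. rewrite Rabs_mult, (Rabs_pos_eq n) by auto. apply Rmult_le_compat_l; auto. }
apply (Hscale _ _ _ Hk0) in L1. apply (Hscale _ _ _ Hl0) in L2. apply (Hscale _ _ _ Hk0) in T1. apply (Hscale _ _ _ Hl0) in T2.
assert (Hlin : Rabs (IZR k * a * x - IZR l * b * x) <= 2 * (a + b)).
{ replace (IZR k * a * x - IZR l * b * x) with ((j * b - i * a) * x).
  2:{ rewrite Ek, El. replace ((K - i) * a * x - (L - j) * b * x) with ((a * K - b * L + (j * b - i * a)) * x) by ring. rewrite Haz, Hbz. ring. }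
  rewrite Rabs_mult. assert (Rabs x <= 1) by (apply Rabs_le; lra).
  assert (Rabs (j * b - i * a) <= 2 * (a + b)) by (apply Rabs_le; split; nra).
  pose proof (Rabs_pos (j * b - i * a)). pose proof (Rabs_pos x). nra. }
assert (HA : Rabs A <= 11/4 * (z * a + z * b) + (a + b)).
{ apply Rabs_le_between in L1, L2, Hlin. apply Rabs_le. unfold A. split; lra. }
assert (HB : Rabs (B - z * s) <= 3/2 * (z * a + z * b) + (a + b)).
{ apply Rabs_le_between in T1, T2.
  assert (Es : IZR k * (a * s) + IZR l * (b * s) = 2 * (z * s) - (i * a + j * b) * s).
  { rewrite Ek, El. replace ((K - i) * (a * s) + (L - j) * (b * s)) with ((a * K + b * L) * s - (i * a + j * b) * s) by ring. rewrite Haz, Hbz. ring. }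
  assert (0 <= (i * a + j * b) * s <= 2 * (a + b)).
  { assert (0 <= i * a + j * b <= 2 * (a + b)) by (split; nra). split; nra. }
  apply Rabs_le. unfold B. split; lra. }
assert (HA1 : Rabs (exp A - 1) <= 3 * Rabs A) by (apply exp_near; lra).
destruct (sqrt_norm1_pow_bounds (Z.to_nat (k + l + 2))) as [C1 C2].
assert (Ect : c * sqrt c ^ Z.to_nat (k + l) = sqrt c ^ Z.to_nat (k + l + 2)).
{ replace (Z.to_nat (k + l + 2)) with (S (S (Z.to_nat (k + l)))) by lia. simpl.
  rewrite <- Rmult_assoc, sqrt_norm1_sqr_R. reflexivity. }
set (ct := sqrt c ^ Z.to_nat (k + l + 2)) in *.
assert (C1' : 1 - (z * a + z * b) / 4 <= ct).
{ eapply Rle_trans; [|exact C1]. rewrite INR_IZR_INZ, Z2Nat.id by lia. rewrite !plus_IZR, Ek, El, <- Hab.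
  replace (K - i + (L - j) + 2) with (K + L) by lra.
  replace ((K + L) * (a * b)) with (z * b + z * a) by (rewrite <- Haz at 1; rewrite <- Hbz; ring). lra. }
assert (HcA : Rabs (ct * exp A - 1) <= 3 * Rabs A + (z * a + z * b) / 4).
{ replace (ct * exp A - 1) with (ct * (exp A - 1) + (ct - 1)) by ring.
  eapply Rle_trans; [apply Rabs_triang|]. apply Rplus_le_compat.
  - rewrite Rabs_mult. assert (0 <= ct) by (apply pow_le, sqrt_pos). rewrite (Rabs_pos_eq ct) by auto.
    pose proof (Rabs_pos (exp A - 1)). nra.
  - apply Rabs_le. lra. }
assert (Hcomb : forall h, Rabs h <= 1 -> forall h', Rabs (h - h') <= Rabs (B - z * s) -> Rabs (ct * exp A * h - h') <= ep).
{ intros h Hh h' Hd. replace (ct * exp A * h - h') with ((ct * exp A - 1) * h + (h - h')) by ring.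
  eapply Rle_trans; [apply Rabs_triang|]. rewrite Rabs_mult.
  assert (Rabs (ct * exp A - 1) * Rabs h <= (3 * Rabs A + (z * a + z * b) / 4) * 1) by (apply Rmult_le_compat; auto using Rabs_pos).
  unfold ep. fold E0. unfold E0. lra. }
cbn [fst snd]. split.
- replace (c * (sqrt c ^ Z.to_nat (k + l) * exp A * cos B)) with (ct * exp A * cos B) by (rewrite <- Ect; ring).
  apply Hcomb; [apply Rabs_le, COS_bound|apply cos_lipschitz].
- replace (c * (sqrt c ^ Z.to_nat (k + l) * exp A * sin B)) with (ct * exp A * sin B) by (rewrite <- Ect; ring).
  apply Hcomb; [apply Rabs_le, SIN_bound|apply sin_lipschitz].
Qed.
End Arc.

(** [Lim] is a total function, so convergence has to be proved: for a nonnegative integrand the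
    partial integrals increase and are bounded, hence converge to their supremum. Bounds valid for
    all large [B] then pass to the limit. *)
Lemma improper0_approx (f : R -> R) X E B0 : (forall x, continuous f x) -> (forall x, 0 <= x -> 0 <= f x) ->
  (forall B, B0 <= B -> 0 <= B -> Rabs (RInt f 0 B - X) <= E) -> Rabs (improper0 f - X) <= E.
Proof.
intros Hc Hp HE.
set (F := fun B => RInt f 0 B).
assert (Hmono : forall A B, 0 <= A <= B -> F A <= F B).
{ intros A B HAB. unfold F. rewrite <- (RInt_Chasles f 0 A B) by (apply ex_RInt_cont; auto).
  assert (0 <= RInt f A B). { apply RInt_ge_0; [lra|apply ex_RInt_cont; auto|intros; apply Hp; lra]. }
  unfold plus; simpl. lra. }
set (B1 := Rmax B0 0). assert (H1 : B0 <= B1) by apply Rmax_l. assert (H2 : 0 <= B1) by apply Rmax_r.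
assert (Hub : forall B, 0 <= B -> F B <= X + E).
{ intros B HB. assert (H : F B <= F (Rmax B B1)) by (apply Hmono; split; [auto|apply Rmax_l]).
  assert (K : Rabs (F (Rmax B B1) - X) <= E) by (apply HE; pose proof (Rmax_r B B1); lra).
  apply Rabs_le_between in K. lra. }
destruct (completeness (fun y => exists B, 0 <= B /\ y = F B)) as [l [Hl1 Hl2]].
- exists (X + E). intros y [B [HB ->]]. auto.
- exists (F 0), 0. split; [lra|reflexivity].
- assert (Hlim : is_lim F p_infty l).
  { apply is_lim_spec. intros eps.
    assert (He : exists B, 0 <= B /\ l - eps < F B).
    { destruct (Classical_Prop.classic (exists B, 0 <= B /\ l - eps < F B)) as [|Hn]; auto. exfalso.
      assert (l <= l - eps); [|pose proof (cond_pos eps); lra].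
      apply Hl2. intros y [B [HB ->]]. destruct (Rle_lt_dec (F B) (l - eps)); auto. exfalso. apply Hn. exists B; auto. }
    destruct He as [B [HB HBe]]. exists B. intros y Hy.
    assert (F B <= F y) by (apply Hmono; lra). assert (F y <= l) by (apply Hl1; exists y; split; [lra|auto]).
    pose proof (cond_pos eps). apply Rabs_lt_between. lra. }
  unfold improper0. fold F. rewrite (is_lim_unique _ _ _ Hlim). simpl.
  assert (l <= X + E) by (apply Hl2; intros y [B [HB ->]]; auto).
  assert (F B1 <= l) by (apply Hl1; exists B1; auto).
  assert (K : Rabs (F B1 - X) <= E) by (apply HE; auto). apply Rabs_le_between in K.
  apply Rabs_le. lra.
Qed.

Lemma RInt_translate (h : R -> R) ell B : (forall x, continuous h x) ->
  RInt h ell (ell + B) = RInt (fun w => h (ell + w)) 0 B.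
Proof.
intros Hh. assert (E := RInt_comp (V := R_CompleteNormedModule) h (fun w => ell + w) (fun _ => 1) 0 B).
cbv beta in E. rewrite Rplus_0_r in E. rewrite <- E.
- apply RInt_ext. intros; unfold scal; simpl; unfold mult; simpl. rewrite Rmult_1_l. reflexivity.
- intros; apply Hh.
- intros w _. split; [auto_derive; auto; ring|apply continuous_const].
Qed.

Lemma RInt_vanish (h : R -> R) p q : (forall v, Rmin p q < v < Rmax p q -> h v = 0) -> RInt h p q = 0.
Proof.
intros H. rewrite (RInt_ext _ (fun _ => 0)) by auto. rewrite RInt_const. unfold scal; simpl; unfold mult; simpl. apply Rmult_0_r.
Qed.

(** As [h] vanishes past [v0], the end point of the contour may be traded for any common large [B],
    the form in which [improper0_approx] compares integrals. *)
Lemma RInt_tail_right (h : R -> R) ell v0 p B : (forall x, continuous h x) -> (forall v, v0 <= v -> h v = 0) ->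
  v0 <= p -> v0 <= ell + B -> RInt h ell p = RInt (fun w => h (ell + w)) 0 B.
Proof.
intros Hh H0 Hp HB. rewrite <- RInt_translate by auto.
rewrite <- (RInt_Chasles h ell p (ell + B)) by (apply ex_RInt_cont; auto).
rewrite (RInt_vanish h p (ell + B)); [symmetry; apply Rplus_0_r|].
intros v Hv. apply H0. pose proof (Rmin_glb p (ell + B) v0 Hp HB). lra.
Qed.

Lemma RInt_tail_left (h : R -> R) ell v0 p B : (forall x, continuous h x) -> (forall v, v <= v0 -> h v = 0) ->
  p <= v0 -> ell - B <= v0 -> RInt h ell p = - RInt (fun w => h (ell - w)) 0 B.
Proof.
intros Hh H0 Hp HB. rewrite (RInt_reflect h 0 B ell Hh).
replace (ell - 0) with ell by ring.
rewrite <- (RInt_Chasles h ell (ell - B) p) by (apply ex_RInt_cont; auto).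
rewrite (RInt_vanish h (ell - B) p).
- assert (E : - RInt h (ell - B) ell = RInt h ell (ell - B)) by (apply (opp_RInt_swap h); apply ex_RInt_cont; auto).
  rewrite <- E. apply Rplus_0_r.
- intros v Hv. apply H0. pose proof (Rmax_lub (ell - B) p v0 HB Hp). lra.
Qed.

(** For [k >= 1] the truncated power [u_+^((k+2)/2)] is differentiable also at 0, where the
    difference quotient is [sqrt h ^ k] and tends to 0. This permits integration by parts across the
    cut-off point. *)
Lemma is_derive_sqrt_pow k u : (1 <= k)%nat -> is_derive (fun u => sqrt u ^ (k + 2)) u ((INR k + 2) / 2 * sqrt u ^ k).
Proof.
intros Hk.
assert (Hc : forall x, continuous (fun x => sqrt x ^ k) x).
{ intros x. induction k as [|n IH]; [lia|]. destruct n as [|n].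
  - apply (continuous_ext sqrt); [intros; simpl; symmetry; apply Rmult_1_r|apply continuous_sqrt].
  - apply (continuous_mult_R sqrt (fun x => sqrt x ^ S n)); [apply continuous_sqrt|apply IH; lia]. }
assert (E : forall x, sqrt x ^ (k + 2) = x * sqrt x ^ k).
{ intros x. rewrite pow_add. destruct (Rle_lt_dec 0 x) as [Hx|Hx].
  - replace (sqrt x ^ 2) with x by (simpl; rewrite Rmult_1_r, sqrt_sqrt; auto). ring.
  - rewrite sqrt_neg_0 by lra. rewrite (pow_i k) by lia. ring. }
destruct (Rtotal_order u 0) as [Hu|[->|Hu]].
- rewrite sqrt_neg_0 by lra. rewrite (pow_i k), Rmult_0_r by lia.
  apply (is_derive_ext_loc (fun _ => 0)); [|apply (is_derive_const (V := R_NormedModule))].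
  apply (locally_interval _ u m_infty 0); simpl; auto. intros y _ Hy. rewrite sqrt_neg_0 by lra. rewrite pow_i by lia. reflexivity.
- rewrite sqrt_0, (pow_i k), Rmult_0_r by lia.
  apply is_derive_Reals. intros e He.
  destruct (proj1 (filterlim_locally _ _) (Hc 0) (mkposreal e He)) as [d Hd].
  exists d. intros h Hh0 Hh. rewrite Rplus_0_l, !E, Rmult_0_l.
  replace ((h * sqrt h ^ k - 0) / h - 0) with (sqrt h ^ k) by (field; auto).
  specialize (Hd h). unfold ball in Hd. simpl in Hd. unfold AbsRing_ball, abs, minus, plus, opp in Hd. simpl in Hd.
  rewrite sqrt_0, (pow_i k), Ropp_0, !Rplus_0_r in Hd by lia. apply Hd. exact Hh.
- apply (is_derive_ext_loc (fun x => x * sqrt x ^ k)); [exists (mkposreal 1 Rlt_0_1); intros; rewrite E; reflexivity|].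
  auto_derive; auto. assert (Hs : 0 < sqrt u) by (apply sqrt_lt_R0; auto).
  destruct k as [|k]; [lia|]. simpl pred. rewrite <- (sqrt_sqrt u) at 2 by lra. simpl pow.
  rewrite S_INR. field. lra.
Qed.

(** * Estimates in the variables [K = t - x], [L = t + x] *)

Section Timelike.
Variables (M : R) (Kz Lz : Z).
Hypothesis HM : 0 < M.
Hypothesis HK : (1 <= Kz)%Z.
Hypothesis HL : (1 <= Lz)%Z.
Let c := norm1 M.
Let K := IZR Kz.
Let L := IZR Lz.
(** The logarithm of the radius [sqrt (L / K)]. It is the value of [v] at which [M e^v K] and
    [M e^(- v) L] coincide; their common value is [z]. *)
Definition cone_log (Kz Lz : Z) : R := ln (IZR Lz / IZR Kz) / 2.
Let ell := cone_log Kz Lz.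
Let a := M * exp ell.
Let b := M * exp (- ell).
Let z := M * sqrt (K * L).
Let err := a + b + z * (a + b) + / K + / L.

Lemma K_ge_1 : 1 <= K. Proof. apply IZR_le; auto. Qed.
Lemma L_ge_1 : 1 <= L. Proof. apply IZR_le; auto. Qed.

Lemma exp_cone : exp ell = sqrt L / sqrt K /\ exp (- ell) = sqrt K / sqrt L.
Proof.
pose proof K_ge_1. pose proof L_ge_1.
pose proof (sqrt_lt_R0 K ltac:(lra)). pose proof (sqrt_lt_R0 L ltac:(lra)).
assert (E : exp ell = sqrt L / sqrt K).
{ unfold ell, cone_log. fold K L. rewrite <- sqrt_exp, exp_ln by (apply Rdiv_lt_0_compat; lra).
  apply sqrt_div; lra. }
split; auto. rewrite exp_Ropp, E. field. lra.
Qed.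

Lemma cone_facts : 0 < a /\ 0 < b /\ 0 < z /\ a * K = z /\ b * L = z /\ a * b = M * M.
Proof.
pose proof K_ge_1. pose proof L_ge_1.
pose proof (sqrt_lt_R0 K ltac:(lra)). pose proof (sqrt_lt_R0 L ltac:(lra)).
assert (SK : sqrt K * sqrt K = K) by (apply sqrt_sqrt; lra). assert (SL : sqrt L * sqrt L = L) by (apply sqrt_sqrt; lra).
assert (Ez : z = M * (sqrt K * sqrt L)) by (unfold z; rewrite sqrt_mult by lra; reflexivity).
destruct exp_cone as [E1 E2].
split; [apply Rmult_lt_0_compat; auto; apply exp_pos|].
split; [apply Rmult_lt_0_compat; auto; apply exp_pos|].
split; [rewrite Ez; apply Rmult_lt_0_compat; auto; apply Rmult_lt_0_compat; auto|].
unfold a, b. rewrite E1, E2, Ez.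
split; [|split].
- rewrite <- SK at 2. field. lra.
- rewrite <- SL at 2. field. lra.
- field. lra.
Qed.

Lemma err_pos : 0 < err.
Proof.
destruct cone_facts as (Ha & Hb & Hz & _). pose proof K_ge_1. pose proof L_ge_1.
assert (0 < / K) by (apply Rinv_0_lt_compat; lra). assert (0 < / L) by (apply Rinv_0_lt_compat; lra).
assert (0 < z * (a + b)) by (apply Rmult_lt_0_compat; lra). unfold err; lra.
Qed.

(* [a^2 = M^2 L / K] and [b^2 = M^2 K / L], so AM-GM bounds [a + b]. *)
Lemma err_bound : err <= 2 * (/ K + / L + M * M * (K + L)).
Proof.
destruct cone_facts as (Ha & Hb & Hz & Haz & Hbz & Hab). pose proof K_ge_1. pose proof L_ge_1.
assert (E1 : z * (a + b) = M * M * (K + L)).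
{ rewrite <- Hab. replace (a * b * (K + L)) with (b * (a * K) + a * (b * L)) by ring. rewrite Haz, Hbz. ring. }
assert (Ia : a ^ 2 = (M * M * L) * / K).
{ rewrite <- Hab. replace (a * b * L * / K) with (a * (b * L) * / K) by ring. rewrite Hbz, <- Haz. field. lra. }
assert (Ib : b ^ 2 = (M * M * K) * / L).
{ rewrite <- Hab. replace (a * b * K * / L) with (b * (a * K) * / L) by ring. rewrite Haz, <- Hbz. field. lra. }
assert (0 < / K) by (apply Rinv_0_lt_compat; lra). assert (0 < / L) by (apply Rinv_0_lt_compat; lra).
assert (HMM : 0 < M * M) by (apply Rmult_lt_0_compat; auto).
assert (0 < M * M * L) by (apply Rmult_lt_0_compat; lra). assert (0 < M * M * K) by (apply Rmult_lt_0_compat; lra).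
assert (am : forall u p q, 0 < p -> 0 < q -> 0 < u -> u ^ 2 = p * q -> u <= (p + q) / 2).
{ intros u p q Hp Hq Hu E. pose proof (pow2_ge_0 (p - q)). destruct (Rle_lt_dec u ((p + q) / 2)); auto. nra. }
assert (a <= (M * M * L + / K) / 2) by (apply am; auto).
assert (b <= (M * M * K + / L) / 2) by (apply am; auto).
unfold err. rewrite E1. lra.
Qed.

(** Removes the smallness assumption of [arc_approx]. If [a + b + z (a + b) > 2/25], the modulus
    bound 2 makes the difference at most 3, below [40 * 2/25]; this is where 40 comes from. The two
    cases of [i], [j] serve the two components of the propagator. *)
Lemma arc_uniform k l i j phi : (0 <= k)%Z -> (0 <= l)%Z -> 0 <= phi <= PI ->
  IZR k = K - i -> IZR l = L - j -> (i = 1 /\ j = 1) \/ (i = 2 /\ j = 0) ->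
  Rabs (c * fst (contour_fun M k l phi ell) - cos (z * sin phi)) <= 40 * (a + b + z * (a + b)) /\
  Rabs (c * snd (contour_fun M k l phi ell) - sin (z * sin phi)) <= 40 * (a + b + z * (a + b)).
Proof.
intros Hk Hl Hp Ek El Hij.
destruct cone_facts as (Ha & Hb & Hz & Haz & Hbz & Hab).
pose proof (norm1_bounds M HM) as Hc. fold c in Hc.
assert (Hzab : 0 < z * (a + b)) by (apply Rmult_lt_0_compat; lra).
destruct (Rle_lt_dec (a + b + z * (a + b)) (2 / 25)) as [Hs|Hs].
- destruct (arc_approx M HM k l K L z i j phi ell Hk Hl Hp) as [H1 H2]; fold a b; auto; try lra.
  fold a b c in H1, H2. split; lra.
- assert (Hmod : Cmod (contour_fun M k l phi ell) <= 2).
  { apply contour_fun_mod; auto. fold a b. rewrite Ek, El.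
    pose proof (COS_bound phi) as Hx. set (x := cos phi) in *.
    replace ((K - i) * (2 * a * x + a ^ 2 - M * M) + (L - j) * (-2 * b * x + b ^ 2 - M * M)) with
      (2 * x * (a * K - b * L) + a * (a * K) + b * (b * L) - M * M * K - M * M * L
        - i * (2 * a * x + a ^ 2 - M * M) - j * (-2 * b * x + b ^ 2 - M * M)) by ring.
    replace (M * M * K) with (b * (a * K)) by (rewrite <- Hab; ring).
    replace (M * M * L) with (a * (b * L)) by (rewrite <- Hab; ring).
    rewrite Haz, Hbz, <- Hab. destruct Hij as [[-> ->]|[-> ->]].
    - assert (Rabs (2 * x * (b - a)) <= 1 + (b - a) ^ 2).
      { rewrite !Rabs_mult, (Rabs_pos_eq 2) by lra. rewrite <- (pow2_abs (b - a)).
        assert (Rabs x <= 1) by (apply Rabs_le; lra). pose proof (Rabs_pos (b - a)). pose proof (Rabs_pos x).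
        pose proof (pow2_ge_0 (Rabs (b - a) - 1)). nra. }
      apply Rabs_le_between in H. assert (0 < a * b) by (apply Rmult_lt_0_compat; auto). nra.
    - assert (0 < a * b) by (apply Rmult_lt_0_compat; auto). pose proof (pow2_ge_0 (a - 1)). nra. }
  assert (H1 : Rabs (fst (contour_fun M k l phi ell)) <= 2) by (eapply Rle_trans; [apply re_le_Cmod|auto]).
  assert (H2 : Rabs (snd (contour_fun M k l phi ell)) <= 2).
  { eapply Rle_trans; [|apply Hmod]. eapply Rle_trans; [|apply Rmax_Cmod]. apply Rmax_r. }
  apply Rabs_le_between in H1, H2. pose proof (COS_bound (z * sin phi)). pose proof (SIN_bound (z * sin phi)).
  split; apply Rabs_le; split; nra.
Qed.

Lemma arc_cont k l v phi : (0 <= k)%Z ->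
  continuous (fun p => fst (contour_fun M k l p v)) phi /\ continuous (fun p => snd (contour_fun M k l p v)) phi.
Proof.
intros Hk. assert (H : c2 (contour_fun M k l) phi v) by (apply contour_fun_c2; auto).
destruct H as [H1 H2]. split.
- apply (continuous_of_2d_l (fun p v => fst (contour_fun M k l p v))); auto.
- apply (continuous_of_2d_l (fun p v => snd (contour_fun M k l p v))); auto.
Qed.

Lemma abs_RInt_diff_const (f g : R -> R) B : (forall x, continuous f x) -> (forall x, continuous g x) ->
  (forall x, 0 <= x <= PI -> Rabs (f x - g x) <= B) -> Rabs (RInt f 0 PI - RInt g 0 PI) <= PI * B.
Proof.
intros Hf Hg H. pose proof PI_RGT_0.
eapply Rle_trans; [apply (abs_RInt_diff_le f g (fun _ => B)); auto; try lra; intros; apply continuous_const|].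
rewrite RInt_const. unfold scal; simpl; unfold mult; simpl. lra.
Qed.

Lemma continuous_cos_comp (f : R -> R) x : continuous f x -> continuous (fun x => cos (f x)) x.
Proof. intros H. apply (continuous_comp f cos); auto. apply continuous_cos. Qed.

Lemma continuous_sin_comp (f : R -> R) x : continuous f x -> continuous (fun x => sin (f x)) x.
Proof. intros H. apply (continuous_comp f sin); auto. apply continuous_sin. Qed.

Lemma z_sin_cont w x : continuous (fun x => w * sin x) x.
Proof. apply continuous_mult_R; [apply continuous_const|apply continuous_sin]. Qed.

Lemma tfac_PI_pow v n : (tfac M PI v ^ n)%C = RtoC ((sqrt c * sqrt (1 + M * exp (- v))) ^ n).
Proof.
unfold tfac. rewrite vfac_PI, csqrt_up_real. fold c.
assert (0 < M * exp (- v)) by (apply Rmult_lt_0_compat; auto; apply exp_pos).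
rewrite (sqrt_neg_0 (- (1 + M * exp (- v)))) by lra.
replace (RtoC (sqrt c) * (sqrt (1 + M * exp (- v)), 0))%C with (RtoC (sqrt c * sqrt (1 + M * exp (- v)))).
- rewrite <- RtoC_pow. reflexivity.
- unfold RtoC, Cmult; cbn [fst snd]. f_equal; ring.
Qed.

Lemma sfac_0_real v : sfac M 0 v = RtoC (sqrt c * sqrt (1 + M * exp v)).
Proof.
unfold sfac. rewrite ufac_0, csqrt_up_real. fold c.
assert (0 < M * exp v) by (apply Rmult_lt_0_compat; auto; apply exp_pos).
rewrite (sqrt_neg_0 (- (1 + M * exp v))) by lra.
unfold RtoC, Cmult; cbn [fst snd]. f_equal; ring.
Qed.

Lemma to_nat_odd k : (0 <= k)%Z -> Z.odd k = true -> Nat.Odd (Z.to_nat k).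
Proof. intros H Ho. apply Z.odd_spec in Ho. destruct Ho as [m Hm]. exists (Z.to_nat m). lia. Qed.

Lemma to_nat_even k : (0 <= k)%Z -> Z.even k = true -> Nat.Even (Z.to_nat k).
Proof. intros H Ho. apply Z.even_spec in Ho. destruct Ho as [m Hm]. exists (Z.to_nat m). lia. Qed.

Lemma re_mult_R u r : fst (u * RtoC r)%C = fst u * r /\ snd (u * RtoC r)%C = snd u * r.
Proof. simpl. split; ring. Qed.

Lemma contour_fun_PI_odd k l v : (0 <= k)%Z -> Z.odd k = true ->
  fst (contour_fun M k l PI v) = (sqrt c * sqrt (1 - M * exp v)) ^ Z.to_nat k * (sqrt c * sqrt (1 + M * exp (- v))) ^ Z.to_nat l.
Proof.
intros Hk Ho. unfold contour_fun, zpow. destruct (Z.leb_spec 0 k); [|lia].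
rewrite tfac_PI_pow. unfold sfac. rewrite ufac_PI. fold c. rewrite (proj1 (re_mult_R _ _)).
rewrite csqrt_pow_odd by (apply to_nat_odd; auto). reflexivity.
Qed.

Lemma contour_fun_PI_even k l v : (0 <= k)%Z -> Z.even k = true -> snd (contour_fun M k l PI v) = 0.
Proof.
intros Hk Ho. unfold contour_fun, zpow. destruct (Z.leb_spec 0 k); [|lia].
rewrite tfac_PI_pow. unfold sfac. rewrite ufac_PI. fold c. rewrite (proj2 (re_mult_R _ _)).
rewrite csqrt_pow_even by (apply to_nat_even; auto). apply Rmult_0_l.
Qed.

Lemma contour_fun_0_odd k l v : (0 <= k)%Z -> (0 <= l)%Z -> Z.odd l = true ->
  fst (contour_fun M k l 0 v) = (sqrt c * sqrt (1 + M * exp v)) ^ Z.to_nat k * (sqrt c * sqrt (1 - M * exp (- v))) ^ Z.to_nat l.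
Proof.
intros Hk Hl Ho. unfold contour_fun, zpow. destruct (Z.leb_spec 0 k); [|lia].
rewrite sfac_0_real, <- RtoC_pow. unfold tfac. rewrite vfac_0. fold c. rewrite Cmult_comm, (proj1 (re_mult_R _ _)).
rewrite csqrt_pow_odd by (apply to_nat_odd; auto). apply Rmult_comm.
Qed.

Lemma contour_fun_0_even k l v : (0 <= k)%Z -> (0 <= l)%Z -> Z.even l = true -> snd (contour_fun M k l 0 v) = 0.
Proof.
intros Hk Hl Ho. unfold contour_fun, zpow. destruct (Z.leb_spec 0 k); [|lia].
rewrite sfac_0_real, <- RtoC_pow. unfold tfac. rewrite vfac_0. fold c. rewrite Cmult_comm, (proj2 (re_mult_R _ _)).
rewrite csqrt_pow_even by (apply to_nat_even; auto). apply Rmult_0_l.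
Qed.

Definition contour_int (k l : Z) : C := CInt (fun phi => contour_fun M k l phi (path M phi) * (dpath M phi, 1))%C 0 PI.
Definition contour_int2 (k l : Z) : C := CInt (fun phi => contour_fun2 M k l phi (path M phi) * (dpath M phi, 1))%C 0 PI.

(** Even exponents make the integrand real on both segments, so the imaginary part is that of the
    circle alone, where it is close to the integral of [cos (z sin phi)]. *)
Lemma arc_term_J0 k l : (0 <= k)%Z -> (0 <= l)%Z -> IZR k = K - 1 -> IZR l = L - 1 -> Z.even k = true -> Z.even l = true ->
  Rabs (c * snd (contour_int k l) - PI * BesselJ 0 z) <= PI * 40 * err.
Proof.
intros Hk Hl Ek El Pk Pl. pose proof PI_RGT_0 as Hpi. destruct cone_facts as (Ha & Hb & Hz & _).
unfold contour_int. rewrite (contour_fun_shift M HM k l ell (or_introl Hk)).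
unfold CInt, Cminus, Cplus, Copp, Cmult at 2, Ci. cbn [fst snd].
rewrite (RInt_ext (fun v => snd (contour_fun M k l PI v)) (fun _ => 0)) by (intros; apply contour_fun_PI_even; auto).
rewrite (RInt_ext (fun v => snd (contour_fun M k l 0 v)) (fun _ => 0)) by (intros; apply contour_fun_0_even; auto).
rewrite !RInt_const.
set (X := RInt (fun phi => fst (contour_fun M k l phi ell)) 0 PI).
set (Y := RInt (fun phi => snd (contour_fun M k l phi ell)) 0 PI).
match goal with |- Rabs (?u - _) <= _ => replace u with (c * X) by (unfold scal; simpl; unfold mult; simpl; ring) end.
unfold BesselJ. rewrite <- Rmult_assoc, Rinv_r, Rmult_1_l by lra.
assert (C1 := fun x => proj1 (arc_cont k l ell x Hk)).
assert (EX : c * X = RInt (fun phi => c * fst (contour_fun M k l phi ell)) 0 PI)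
  by (symmetry; exact (RInt_scal_R _ c 0 PI (ex_RInt_cont _ 0 PI C1))).
rewrite EX.
rewrite (RInt_ext (fun tau => cos (INR 0 * tau - z * sin tau)) (fun tau => cos (z * sin tau))).
2:{ intros x _. simpl INR. rewrite Rmult_0_l, Rminus_0_l, cos_neg. reflexivity. }
eapply Rle_trans; [apply (abs_RInt_diff_const _ _ (40 * err))|lra].
- intros x. exact (continuous_mult_R _ _ x (continuous_const _ _) (C1 x)).
- intros; apply continuous_cos_comp, z_sin_cont.
- intros phi Hp. destruct (arc_uniform k l 1 1 phi) as [H _]; auto.
  eapply Rle_trans; [apply H|]. pose proof K_ge_1. pose proof L_ge_1.
  assert (0 < / K) by (apply Rinv_0_lt_compat; lra). assert (0 < / L) by (apply Rinv_0_lt_compat; lra). unfold err. lra.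
Qed.

Lemma eta_real phi v : sin phi = 0 -> eta phi v = RtoC (exp v * cos phi).
Proof. intros H. unfold eta, RtoC. rewrite H. f_equal. ring. Qed.

Lemma contour_fun2_boundary k l phi v : sin phi = 0 ->
  fst (contour_fun2 M k l phi v) = M * (exp v * cos phi) * (c * fst (contour_fun M k l phi v)) /\
  snd (contour_fun2 M k l phi v) = M * (exp v * cos phi) * (c * snd (contour_fun M k l phi v)).
Proof.
intros H. unfold contour_fun2. rewrite eta_real by auto. fold c. simpl. split; ring.
Qed.

Lemma contour_fun2_arc k l phi :
  fst (contour_fun2 M k l phi ell) = a * (cos phi * (c * fst (contour_fun M k l phi ell)) - sin phi * (c * snd (contour_fun M k l phi ell))) /\
  snd (contour_fun2 M k l phi ell) = a * (sin phi * (c * fst (contour_fun M k l phi ell)) + cos phi * (c * snd (contour_fun M k l phi ell))).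
Proof.
unfold contour_fun2, eta, a. fold c. simpl. split; ring.
Qed.

(** The extra factor [eta] contributes its modulus to [a] and rotates by [phi]; the rotation mixes
    the two components, which doubles 40 to 80. *)
Lemma arc2_uniform k l phi : (0 <= k)%Z -> (0 <= l)%Z -> 0 <= phi <= PI -> IZR k = K - 2 -> IZR l = L ->
  Rabs (fst (contour_fun2 M k l phi ell) - a * cos (phi + z * sin phi)) <= a * (80 * err) /\
  Rabs (snd (contour_fun2 M k l phi ell) - a * sin (phi + z * sin phi)) <= a * (80 * err).
Proof.
intros Hk Hl Hp Ek El. destruct cone_facts as (Ha & Hb & Hz & _).
destruct (arc_uniform k l 2 0 phi) as [H1 H2]; auto; try lra.
destruct (contour_fun2_arc k l phi) as [E1 E2]. rewrite E1, E2.
set (P := c * fst (contour_fun M k l phi ell)) in *. set (Q := c * snd (contour_fun M k l phi ell)) in *.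
assert (Herr : 40 * (a + b + z * (a + b)) <= 40 * err).
{ pose proof K_ge_1. pose proof L_ge_1.
  assert (0 < / K) by (apply Rinv_0_lt_compat; lra). assert (0 < / L) by (apply Rinv_0_lt_compat; lra). unfold err; lra. }
pose proof (COS_bound phi) as Hc. pose proof (SIN_bound phi) as Hs.
assert (Hmul : forall h u w, -1 <= h <= 1 -> Rabs u <= w -> Rabs (h * u) <= w).
{ intros h u w Hh Hu. rewrite Rabs_mult. assert (Rabs h <= 1) by (apply Rabs_le; lra).
  pose proof (Rabs_pos u). pose proof (Rabs_pos h). nra. }
rewrite cos_plus, sin_plus. split.
- replace (a * (cos phi * P - sin phi * Q) - a * (cos phi * cos (z * sin phi) - sin phi * sin (z * sin phi))) with
    (a * (cos phi * (P - cos (z * sin phi)) + - (sin phi * (Q - sin (z * sin phi))))) by ring.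
  rewrite Rabs_mult, (Rabs_pos_eq a) by lra. apply Rmult_le_compat_l; [lra|].
  eapply Rle_trans; [apply Rabs_triang|]. rewrite Rabs_Ropp.
  pose proof (Hmul _ _ _ Hc H1). pose proof (Hmul _ _ _ Hs H2). lra.
- replace (a * (sin phi * P + cos phi * Q) - a * (sin phi * cos (z * sin phi) + cos phi * sin (z * sin phi))) with
    (a * (sin phi * (P - cos (z * sin phi)) + cos phi * (Q - sin (z * sin phi)))) by ring.
  rewrite Rabs_mult, (Rabs_pos_eq a) by lra. apply Rmult_le_compat_l; [lra|].
  eapply Rle_trans; [apply Rabs_triang|].
  pose proof (Hmul _ _ _ Hs H1). pose proof (Hmul _ _ _ Hc H2). lra.
Qed.

Lemma arc2_cont k l v phi : (0 <= k)%Z ->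
  continuous (fun p => fst (contour_fun2 M k l p v)) phi /\ continuous (fun p => snd (contour_fun2 M k l p v)) phi.
Proof.
intros Hk.
assert (H : c2 (contour_fun2 M k l) phi v).
{ exact (c2_mult _ _ _ _ (c2_const (RtoC (c * M)) _ _) (c2_mult _ _ _ _ (eta_c2 phi v) (contour_fun_c2 M k l phi v (or_introl Hk)))). }
destruct H as [H1 H2]. split.
- exact (continuous_of_2d_l (fun p v => fst (contour_fun2 M k l p v)) _ _ H1).
- exact (continuous_of_2d_l (fun p v => snd (contour_fun2 M k l p v)) _ _ H2).
Qed.

Lemma id_z_sin_cont s x : continuous (fun x => x + s * sin x) x.
Proof. apply continuous_plus_R; [apply continuous_id|apply z_sin_cont]. Qed.

(** As for [J0], only the circle contributes. The reflection [phi -> PI - phi] turns the integral of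
    [cos (phi + z sin phi)] into minus the integral defining [J_1]. *)
Lemma arc_term_J1 k l : (0 <= k)%Z -> (0 <= l)%Z -> IZR k = K - 2 -> IZR l = L -> Z.even k = true -> Z.even l = true ->
  Rabs (snd (contour_int2 k l) + a * (PI * BesselJ 1 z)) <= a * (PI * 80 * err).
Proof.
intros Hk Hl Ek El Pk Pl. pose proof PI_RGT_0 as Hpi. destruct cone_facts as (Ha & Hb & Hz & _).
unfold contour_int2. rewrite (contour_fun2_shift M HM k l ell (or_introl Hk)).
unfold CInt, Cminus, Cplus, Copp, Cmult at 2, Ci. cbn [fst snd].
rewrite (RInt_ext (fun v => snd (contour_fun2 M k l PI v)) (fun _ => 0))
  by (intros; rewrite (proj2 (contour_fun2_boundary k l PI _ sin_PI)), contour_fun_PI_even by auto; rewrite !Rmult_0_r; reflexivity).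
rewrite (RInt_ext (fun v => snd (contour_fun2 M k l 0 v)) (fun _ => 0))
  by (intros; rewrite (proj2 (contour_fun2_boundary k l 0 _ sin_0)), contour_fun_0_even by auto; rewrite !Rmult_0_r; reflexivity).
rewrite !RInt_const.
set (X := RInt (fun phi => fst (contour_fun2 M k l phi ell)) 0 PI).
set (Y := RInt (fun phi => snd (contour_fun2 M k l phi ell)) 0 PI).
match goal with |- Rabs (?u + _) <= _ => replace u with X by (unfold scal; simpl; unfold mult; simpl; symmetry; ringR) end.
unfold BesselJ. rewrite <- (Rmult_assoc PI), Rinv_r, Rmult_1_l by lra.
assert (E : RInt (fun tau => cos (INR 1 * tau - z * sin tau)) 0 PI = - RInt (fun x => cos (x + z * sin x)) 0 PI).
{ assert (R := RInt_reflect (fun x => cos (x + z * sin x)) 0 PI PI (fun x => continuous_cos_comp _ x (id_z_sin_cont z x))).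
  replace (PI - PI) with 0 in R by ring. replace (PI - 0) with PI in R by ring.
  rewrite <- R. rewrite (RInt_ext (fun x => cos (PI - x + z * sin (PI - x))) (fun x => -1 * cos (INR 1 * x - z * sin x))).
  - rewrite RInt_scal_R.
    + set (I := RInt _ _ _). change (I = - (-1 * I)). symmetry; ringR.
    + apply ex_RInt_cont. intros x. apply continuous_cos_comp. simpl INR.
      apply (continuous_minus (V := R_NormedModule)); [apply continuous_mult_R; [apply continuous_const|apply continuous_id]|apply z_sin_cont].
  - intros x _. rewrite sin_PI_x. replace (PI - x + z * sin x) with (- (INR 1 * x - z * sin x) + PI) by (simpl INR; ring).
    rewrite neg_cos, cos_neg. ringR. }
rewrite E.
replace (X + a * - RInt (fun x => cos (x + z * sin x)) 0 PI) with (X - a * RInt (fun x => cos (x + z * sin x)) 0 PI) by ring.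
assert (EX : a * RInt (fun x => cos (x + z * sin x)) 0 PI = RInt (fun x => a * cos (x + z * sin x)) 0 PI)
  by (symmetry; exact (RInt_scal_R _ a 0 PI (ex_RInt_cont _ 0 PI (fun x => continuous_cos_comp _ x (id_z_sin_cont z x))))).
rewrite EX.
replace (a * (PI * 80 * err)) with (PI * (a * (80 * err))) by ring.
apply abs_RInt_diff_const.
- intros x. apply (arc2_cont k l ell x Hk).
- intros x. apply continuous_mult_R; [apply continuous_const|]. apply continuous_cos_comp, id_z_sin_cont.
- intros phi Hp. apply (arc2_uniform k l phi); auto.
Qed.

(** The integrands on the negative real axis ([phi = PI], outwards from the circle) and, for
    [seg_right], on the positive one ([phi = 0], inwards), both parametrized by the logarithmic
    distance [w] from the circle. The [+ 2] in the power of [sqrt c] is the prefactor [c]. *)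
Definition seg_left (k l : nat) (w : R) : R := sqrt c ^ (k + l + 2) * sqrt (1 - a * exp w) ^ k * sqrt (1 + b * exp (- w)) ^ l.
Definition seg_right (k l : nat) (w : R) : R := sqrt c ^ (k + l + 2) * sqrt (1 - b * exp w) ^ l * sqrt (1 + a * exp (- w)) ^ k.

Lemma a_exp w : M * exp (ell + w) = a * exp w.
Proof. unfold a. rewrite exp_plus. ring. Qed.
Lemma b_exp w : M * exp (- (ell + w)) = b * exp (- w).
Proof. unfold b. replace (- (ell + w)) with (- ell + - w) by ring. rewrite exp_plus. ring. Qed.

(** The truncated power vanishes for [v >= - ln M], which lies before the end of the curve, so the
    upper limit may be moved to any [ell + B] beyond that point. The weight [g] is 1 for the first
    component and proportional to [e^v] for the second. *)
Lemma boundary_PI_int k l (g : R -> R) B : (0 <= k)%Z -> Z.odd k = true -> (forall x, continuous g x) -> - ln M <= ell + B ->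
  RInt (fun v => g v * (c * fst (contour_fun M k l PI v))) ell (path M PI) =
  RInt (fun w => g (ell + w) * seg_left (Z.to_nat k) (Z.to_nat l) w) 0 B.
Proof.
intros Hk Ho Hg HB.
set (h := fun v => g v * (sqrt c ^ (Z.to_nat k + Z.to_nat l + 2) * sqrt (1 - M * exp v) ^ Z.to_nat k * sqrt (1 + M * exp (- v)) ^ Z.to_nat l)).
rewrite (RInt_ext _ h).
2:{ intros v _. unfold h. rewrite contour_fun_PI_odd by auto. rewrite !Rpow_mult_distr, !pow_add.
    replace (sqrt c ^ 2) with c by (simpl; rewrite Rmult_1_r; symmetry; apply sqrt_norm1_sqr_R). ringR. }
rewrite (RInt_tail_right h ell (- ln M) (path M PI) B); auto.
- apply RInt_ext. intros w _. unfold h, seg_left. rewrite a_exp, b_exp. reflexivity.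
- intros x. apply continuous_mult_R; auto. apply segment_cont.
- intros v Hv. unfold h. apply exp_le in Hv. rewrite exp_Ropp, exp_ln in Hv by auto.
  assert (1 <= M * exp v).
  { apply Rmult_le_reg_l with (/ M); [apply Rinv_0_lt_compat; auto|]. rewrite <- Rmult_assoc, Rinv_l, Rmult_1_l by lra. lra. }
  rewrite (sqrt_neg_0 (1 - M * exp v)) by lra.
  destruct (to_nat_odd k Hk Ho) as [m ->]. rewrite pow_i by lia. ring.
- left. apply path_PI_gt; auto.
Qed.

Lemma boundary_0_int k l (g : R -> R) B : (0 <= k)%Z -> (0 <= l)%Z -> Z.odd l = true -> (forall x, continuous g x) -> ell - B <= ln M ->
  RInt (fun v => g v * (c * fst (contour_fun M k l 0 v))) ell (path M 0) =
  - RInt (fun w => g (ell - w) * seg_right (Z.to_nat k) (Z.to_nat l) w) 0 B.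
Proof.
intros Hk Hl Ho Hg HB.
set (h := fun v => g v * (sqrt c ^ (Z.to_nat k + Z.to_nat l + 2) * sqrt (1 - M * exp (- v)) ^ Z.to_nat l * sqrt (1 + M * exp v) ^ Z.to_nat k)).
rewrite (RInt_ext _ h).
2:{ intros v _. unfold h. rewrite contour_fun_0_odd by auto. rewrite !Rpow_mult_distr, !pow_add.
    replace (sqrt c ^ 2) with c by (simpl; rewrite Rmult_1_r; symmetry; apply sqrt_norm1_sqr_R). ringR. }
rewrite (RInt_tail_left h ell (ln M) (path M 0) B); auto.
- f_equal. apply RInt_ext. intros w _. unfold h, seg_right.
  replace (ell - w) with (ell + - w) by ring. rewrite a_exp, b_exp, Ropp_involutive. reflexivity.
- intros x. apply continuous_mult_R; auto.
  assert (C := segment_cont (sqrt c ^ (Z.to_nat k + Z.to_nat l + 2)) M M (Z.to_nat l) (Z.to_nat k) (- x)).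
  apply (continuous_comp Ropp) in C; [|apply (continuous_opp (V := R_NormedModule)), continuous_id].
  eapply continuous_ext; [|exact C]. intros v. cbv beta. rewrite Ropp_involutive. reflexivity.
- intros v Hv. unfold h. apply exp_le in Hv. rewrite exp_ln in Hv by auto.
  assert (1 <= M * exp (- v)).
  { rewrite exp_Ropp. pose proof (exp_pos v). apply Rmult_le_reg_r with (exp v); auto. rewrite Rmult_assoc, Rinv_l by lra. lra. }
  rewrite (sqrt_neg_0 (1 - M * exp (- v))) by lra.
  destruct (to_nat_odd l Hl Ho) as [m ->]. rewrite pow_i by lia. ring.
- left. apply path_0_lt; auto.
Qed.

Lemma seg_norm_bounds n : INR n = K + L -> 1 - z * (a + b) <= sqrt c ^ n <= 1.
Proof.
intros En. destruct cone_facts as (Ha & Hb & Hz & Haz & Hbz & Hab).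
destruct (sqrt_norm1_pow_bounds M n) as [C1 C2]. fold c in C1, C2. split; auto.
eapply Rle_trans; [|exact C1]. rewrite En, <- Hab.
replace ((K + L) * (a * b)) with (b * (a * K) + a * (b * L)) by ring. rewrite Haz, Hbz.
assert (0 < z * (a + b)) by (apply Rmult_lt_0_compat; lra). lra.
Qed.

Lemma nine_err : 9 * (/ K + / L + a + b) <= 9 * err.
Proof.
destruct cone_facts as (Ha & Hb & Hz & _). assert (0 < z * (a + b)) by (apply Rmult_lt_0_compat; lra). unfold err; lra.
Qed.

Lemma seg_left_est k l (g : R -> R) B : (1 <= k)%nat -> INR k <= K <= INR k + 1 -> INR l <= L <= INR l + 2 ->
  INR (k + l + 2) = K + L -> 0 <= B -> (forall w, continuous g w) -> (forall w, 0 <= w -> 0 <= g w <= 1) ->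
  Rabs (RInt (fun w => g w * seg_left k l w) 0 B - RInt (fun w => g w * exp (- (z * sinh w))) 0 B) <= 9 * err.
Proof.
intros Hk HkK HlL Hn HB Hg Hg1. destruct cone_facts as (Ha & Hb & Hz & Haz & Hbz & Hab).
pose proof K_ge_1. pose proof L_ge_1. eapply Rle_trans; [|apply nine_err].
apply (timelike_segment k l K L (sqrt c ^ (k + l + 2)) (z * (a + b)) a b z B g); auto; try lra.
- apply seg_norm_bounds; auto.
- apply pow_le, sqrt_pos.
- split; [|lra]. apply Rmult_le_pos; lra.
Qed.

Lemma seg_right_est k l (g : R -> R) B : (1 <= l)%nat -> INR l <= L <= INR l + 1 -> INR k <= K <= INR k + 2 ->
  INR (k + l + 2) = K + L -> 0 <= B -> (forall w, continuous g w) -> (forall w, 0 <= w -> 0 <= g w <= 1) ->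
  Rabs (RInt (fun w => g w * seg_right k l w) 0 B - RInt (fun w => g w * exp (- (z * sinh w))) 0 B) <= 9 * err.
Proof.
intros Hk HkK HlL Hn HB Hg Hg1. destruct cone_facts as (Ha & Hb & Hz & Haz & Hbz & Hab).
pose proof K_ge_1. pose proof L_ge_1. eapply Rle_trans; [|apply nine_err].
replace (/ K + / L + a + b) with (/ L + / K + b + a) by ring.
apply (timelike_segment l k L K (sqrt c ^ (k + l + 2)) (z * (a + b)) b a z B g); auto; try lra.
- apply seg_norm_bounds; auto.
- apply pow_le, sqrt_pos.
- replace (b + a) with (a + b) by ring. split; [|lra]. apply Rmult_le_pos; lra.
Qed.

Lemma seg_left_cont k l w : continuous (seg_left k l) w.
Proof. apply segment_cont. Qed.
Lemma seg_right_cont k l w : continuous (seg_right k l) w.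
Proof. apply segment_cont. Qed.

Lemma to_nat_INR k x : (0 <= k)%Z -> IZR k = x -> INR (Z.to_nat k) = x.
Proof. intros H E. rewrite INR_IZR_INZ, Z2Nat.id; auto. Qed.

(** A logarithmic distance from the circle beyond which both truncated segments vanish. *)
Definition cutoff : R := Rmax (- ln M - ell) (ell - ln M).

(** The circle gives minus the integral of [sin (z sin phi)], and each segment is within [9 err] of
    the integral of [e^(- z sinh w)]. For [n = 0] the improper integral in [BesselY] has twice this
    integrand: one copy per segment, hence 18. *)
Lemma arc_term_Y0 k l : (0 <= k)%Z -> (0 <= l)%Z -> IZR k = K - 1 -> IZR l = L - 1 -> Z.odd k = true -> Z.odd l = true ->
  Rabs (c * fst (contour_int k l) + PI * BesselY 0 z) <= (PI * 40 + 18) * err.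
Proof.
intros Hk Hl Ek El Pk Pl. pose proof PI_RGT_0 as Hpi. destruct cone_facts as (Ha & Hb & Hz & _).
assert (Herr : 40 * (a + b + z * (a + b)) <= 40 * err).
{ pose proof K_ge_1. pose proof L_ge_1.
  assert (0 < / K) by (apply Rinv_0_lt_compat; lra). assert (0 < / L) by (apply Rinv_0_lt_compat; lra). unfold err; lra. }
assert (C2 := fun x => proj2 (arc_cont k l ell x Hk)).
set (X := RInt (fun phi => c * snd (contour_fun M k l phi ell)) 0 PI).
assert (HX : Rabs (X - RInt (fun phi => sin (z * sin phi)) 0 PI) <= PI * (40 * err)).
{ apply abs_RInt_diff_const.
  - intros x. exact (continuous_mult_R _ _ x (continuous_const _ _) (C2 x)).
  - intros x. apply continuous_sin_comp, z_sin_cont.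
  - intros phi Hp. destruct (arc_uniform k l 1 1 phi) as [_ H]; auto. lra. }
set (k' := Z.to_nat k). set (l' := Z.to_nat l).
assert (Hk' : INR k' = K - 1) by (apply to_nat_INR; auto). assert (Hl' : INR l' = L - 1) by (apply to_nat_INR; auto).
assert (Hn : INR (k' + l' + 2) = K + L) by (rewrite !plus_INR, Hk', Hl'; simpl; ring).
assert (Ok : (1 <= k')%nat) by (destruct (to_nat_odd k Hk Pk) as [m Hm]; unfold k'; lia).
assert (Ol : (1 <= l')%nat) by (destruct (to_nat_odd l Hl Pl) as [m Hm]; unfold l'; lia).
assert (Hsplit : forall B, cutoff <= B -> c * fst (contour_int k l) = - X + (RInt (seg_left k' l') 0 B + RInt (seg_right k' l') 0 B)).
{ intros B HB. assert (B1 : - ln M <= ell + B) by (unfold cutoff in HB; pose proof (Rmax_l (- ln M - ell) (ell - ln M)); lra).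
  assert (B2 : ell - B <= ln M) by (unfold cutoff in HB; pose proof (Rmax_r (- ln M - ell) (ell - ln M)); lra).
  pose proof (boundary_PI_int k l (fun _ => 1) B Hk Pk (fun x => continuous_const 1 x) B1) as E1.
  pose proof (boundary_0_int k l (fun _ => 1) B Hk Hl Pl (fun x => continuous_const 1 x) B2) as E2.
  assert (Hc2 : forall phi v, c2 (contour_fun M k l) phi v) by (intros; apply contour_fun_c2; auto).
  assert (Ef : forall phi p q, ex_RInt (fun v => fst (contour_fun M k l phi v)) p q).
  { intros phi p q. apply ex_RInt_cont. intros v. exact (continuous_of_2d (fun p v => fst (contour_fun M k l p v)) _ _ (proj1 (Hc2 phi v))). }
  rewrite (RInt_ext _ (fun v => c * fst (contour_fun M k l PI v))) in E1 by (intros; cbv beta; exact (Rmult_1_l _)).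
  rewrite (RInt_ext _ (fun v => c * fst (contour_fun M k l 0 v))) in E2 by (intros; cbv beta; exact (Rmult_1_l _)).
  rewrite (RInt_scal_R _ c _ _ (Ef PI _ _)) in E1. rewrite (RInt_scal_R _ c _ _ (Ef 0 _ _)) in E2.
  rewrite (RInt_ext (fun w => 1 * seg_left (Z.to_nat k) (Z.to_nat l) w) (seg_left k' l')) in E1 by (intros; cbv beta; exact (Rmult_1_l _)).
  rewrite (RInt_ext (fun w => 1 * seg_right (Z.to_nat k) (Z.to_nat l) w) (seg_right k' l')) in E2 by (intros; cbv beta; exact (Rmult_1_l _)).
  unfold contour_int. rewrite (contour_fun_shift M HM k l ell (or_introl Hk)).
  unfold CInt, Cminus, Cplus, Copp, Cmult at 2, Ci. cbn [fst snd].
  assert (EX : X = c * RInt (fun phi => snd (contour_fun M k l phi ell)) 0 PI)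
    by (exact (RInt_scal_R _ c 0 PI (ex_RInt_cont _ 0 PI C2))).
  rewrite EX. simpl in E1, E2 |- *. lra. }
unfold BesselY.
assert (HI : Rabs (improper0 (fun u => (exp (INR 0 * u) + (-1) ^ 0 * exp (- (INR 0 * u))) * exp (- (z * sinh u)))
    - (c * fst (contour_int k l) + X)) <= 18 * err).
{ apply improper0_approx with (B0 := cutoff).
  - intros x. apply continuous_mult_R; [|apply exp_sinh_cont].
    apply (ex_derive_continuous (V := R_NormedModule)). auto_derive. auto.
  - intros x _. simpl. apply Rmult_le_pos; [|left; apply exp_pos].
    pose proof (exp_pos (0 * x)). pose proof (exp_pos (- (0 * x))). lra.
  - intros B HB HB0. rewrite (Hsplit B HB).
    rewrite (RInt_ext _ (fun w => 2 * exp (- (z * sinh w)))).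
    2:{ intros w _. simpl INR. simpl pow. rewrite Rmult_0_l, Ropp_0, exp_0. ringR. }
    rewrite RInt_scal_R by (apply ex_RInt_cont; intros; apply exp_sinh_cont).
    pose proof (seg_left_est k' l' (fun _ => 1) B Ok ltac:(lra) ltac:(lra) Hn HB0 (fun x => continuous_const 1 x) ltac:(intros; lra)) as S1.
    pose proof (seg_right_est k' l' (fun _ => 1) B Ol ltac:(lra) ltac:(lra) Hn HB0 (fun x => continuous_const 1 x) ltac:(intros; lra)) as S2.
    rewrite (RInt_ext (fun w => 1 * seg_left k' l' w) (seg_left k' l')) in S1 by (intros; cbv beta; exact (Rmult_1_l _)).
    rewrite (RInt_ext (fun w => 1 * seg_right k' l' w) (seg_right k' l')) in S2 by (intros; cbv beta; exact (Rmult_1_l _)).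
    rewrite (RInt_ext (fun w => 1 * exp (- (z * sinh w))) (fun w => exp (- (z * sinh w)))) in S1 by (intros; cbv beta; exact (Rmult_1_l _)).
    rewrite (RInt_ext (fun w => 1 * exp (- (z * sinh w))) (fun w => exp (- (z * sinh w)))) in S2 by (intros; cbv beta; exact (Rmult_1_l _)).
    apply Rabs_le_between in S1, S2. apply Rabs_le. simpl in S1, S2 |- *. lra. }
rewrite (RInt_ext (fun th => sin (z * sin th - INR 0 * th)) (fun th => sin (z * sin th))).
2:{ intros x _. simpl INR. rewrite Rmult_0_l, Rminus_0_r. reflexivity. }
set (I := improper0 _) in *. set (Sn := RInt (fun phi => sin (z * sin phi)) 0 PI) in *.
replace (PI * (/ PI * Sn - / PI * I)) with (Sn - I) by (field; lra).
apply Rabs_le_between in HX, HI. apply Rabs_le. simpl in *. lra.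
Qed.

(** On the left segment the factor [eta] gives the weight [e^w], which is unbounded, so
    [timelike_segment] does not apply. Differentiating the product with exponents [K / 2] and
    [L / 2] replaces it by a boundary term and an integral with a weight at most 1. *)
Lemma left_parts k l B : (1 <= k)%nat -> INR k = K - 2 -> INR l = L -> 
  RInt (fun w => exp w * seg_left k l w) 0 B + RInt (fun w => exp (- w) / (1 + b * exp (- w)) * (sqrt c ^ (k + l + 2) * sqrt (1 - a * exp w) ^ (k + 2) * sqrt (1 + b * exp (- w)) ^ l)) 0 B
  = 2 / z * (sqrt c ^ (k + l + 2) * sqrt (1 - a) ^ (k + 2) * sqrt (1 + b) ^ l
            - sqrt c ^ (k + l + 2) * sqrt (1 - a * exp B) ^ (k + 2) * sqrt (1 + b * exp (- B)) ^ l).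
Proof.
intros Hk Ek El. destruct cone_facts as (Ha & Hb & Hz & Haz & Hbz & Hab).
set (ct := sqrt c ^ (k + l + 2)).
set (F := fun w => ct * sqrt (1 - a * exp w) ^ (k + 2) * sqrt (1 + b * exp (- w)) ^ l).
set (g := fun w => exp (- w) / (1 + b * exp (- w))).
assert (Pw : forall w, 0 < 1 + b * exp (- w)) by (intros w; pose proof (Rmult_lt_0_compat _ _ Hb (exp_pos (- w))); lra).
assert (Cg : forall w, continuous g w).
{ intros w. apply (ex_derive_continuous (V := R_NormedModule)). unfold g. auto_derive. pose proof (Pw w). lra. }
assert (Ce : forall w, continuous exp w) by (intros; apply continuous_exp).
assert (CF : forall w, continuous F w) by (intros; apply segment_cont).
assert (C1 : forall w, continuous (fun w => exp w * seg_left k l w) w) by (intros; apply continuous_mult_R; [apply continuous_exp|apply seg_left_cont]).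
assert (C2 : forall w, continuous (fun w => g w * F w) w) by (intros; apply continuous_mult_R; auto).
assert (D : forall w, is_derive F w (- (z / 2) * (exp w * seg_left k l w + g w * F w))).
{ intros w. unfold F.
  assert (D1 : is_derive (fun w => sqrt (1 - a * exp w) ^ (k + 2)) w (- (a * exp w) * ((INR k + 2) / 2 * sqrt (1 - a * exp w) ^ k))).
  { apply (is_derive_comp (fun u => sqrt u ^ (k + 2)) (fun w => 1 - a * exp w)); [apply is_derive_sqrt_pow; auto|].
    auto_derive; auto. ring. }
  assert (D2 : is_derive (fun w => sqrt (1 + b * exp (- w)) ^ l) w (- (b * exp (- w)) / (1 + b * exp (- w)) * (INR l / 2) * sqrt (1 + b * exp (- w)) ^ l)).
  { pose proof (Pw w) as P. auto_derive; auto. assert (Hs : 0 < sqrt (1 + b * exp (- w))) by (apply sqrt_lt_R0; auto).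
    destruct l as [|l']; [simpl; field; lra|]. simpl pred. simpl pow. rewrite <- (sqrt_sqrt (1 + b * exp (- w))) at 3 by lra. field. lra. }
  assert (D3 := is_derive_mult _ _ w _ _ (is_derive_scal _ w ct _ D1) D2 ltac:(intros; apply Rmult_comm)).
  cbv beta in D3. unfold mult, plus, scal in D3. simpl in D3. unfold mult in D3. simpl in D3.
  replace (- (z / 2) * (exp w * seg_left k l w + g w * (ct * sqrt (1 - a * exp w) ^ (k + 2) * sqrt (1 + b * exp (- w)) ^ l))) with
    (ct * (- (a * exp w) * ((INR k + 2) / 2 * sqrt (1 - a * exp w) ^ k)) * sqrt (1 + b * exp (- w)) ^ l +
     ct * sqrt (1 - a * exp w) ^ (k + 2) * (- (b * exp (- w)) / (1 + b * exp (- w)) * (INR l / 2) * sqrt (1 + b * exp (- w)) ^ l)); [exact D3|].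
  unfold seg_left, g. fold ct. rewrite Ek, El. rewrite <- Haz at 1. replace (K - 2 + 2) with K by ring.
  replace (- (b * exp (- w)) / (1 + b * exp (- w)) * (L / 2)) with (- (b * L) / 2 * (exp (- w) / (1 + b * exp (- w)))) by (field; pose proof (Pw w); lra).
  rewrite Hbz, <- Haz. field. pose proof (Pw w); lra. }
assert (R := is_RInt_unique _ _ _ _ (is_RInt_derive (V := R_CompleteNormedModule) _ _ 0 B (fun x _ => D x)
  (fun x _ => continuous_mult_R _ _ x (continuous_const (- (z / 2)) x) (continuous_plus_R _ _ x (C1 x) (C2 x))))).
assert (R2 : RInt (fun w => - (z / 2) * (exp w * seg_left k l w + g w * F w)) 0 B = - (z / 2) * (RInt (fun w => exp w * seg_left k l w) 0 B + RInt (fun w => g w * F w) 0 B)).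
{ transitivity (- (z / 2) * RInt (fun w => exp w * seg_left k l w + g w * F w) 0 B).
  - exact (RInt_scal_R _ _ 0 B (ex_RInt_cont _ 0 B (fun x => continuous_plus_R _ _ x (C1 x) (C2 x)))).
  - f_equal. apply RInt_plus_R; apply ex_RInt_cont; auto. }
rewrite R2 in R. unfold minus, plus, opp in R. simpl in R.
change (RInt (fun w => exp w * seg_left k l w) 0 B + RInt (fun w => g w * F w) 0 B = 2 / z * (ct * sqrt (1 - a) ^ (k + 2) * sqrt (1 + b) ^ l - F B)).
replace (ct * sqrt (1 - a) ^ (k + 2) * sqrt (1 + b) ^ l) with (F 0) by (unfold F; rewrite Ropp_0, exp_0, !Rmult_1_r; reflexivity).
replace (F 0 - F B) with (- (F B + - F 0)) by ring. rewrite <- R. field. lra.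
Qed.

(** The boundary term at 0 is close to [2 / z], the one at [B] vanishes beyond the cutoff, and the
    bounded weight is replaced by [e^(- w)]. In units of [err] these cost at most 4, 0 and 10, hence
    14. *)
Lemma left_parts_est k l B : (1 <= k)%nat -> INR k = K - 2 -> INR l = L -> cutoff <= B -> 0 <= B ->
  Rabs (RInt (fun w => exp w * seg_left k l w) 0 B - (2 / z - RInt (fun w => exp (- w) * exp (- (z * sinh w))) 0 B)) <= 14 * err.
Proof.
intros Hk Ek El HB HB0. destruct cone_facts as (Ha & Hb & Hz & Haz & Hbz & Hab).
pose proof K_ge_1 as HK1. pose proof L_ge_1 as HL1.
assert (Hn : INR (k + l + 2) = K + L) by (rewrite !plus_INR, Ek, El; simpl; ring).
assert (HK2 : INR (k + 2) = K) by (rewrite plus_INR, Ek; simpl; ring).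
pose proof (left_parts k l B Hk Ek El) as P.
assert (HBv : sqrt (1 - a * exp B) ^ (k + 2) = 0).
{ rewrite <- a_exp. assert (B1 : - ln M <= ell + B) by (unfold cutoff in HB; pose proof (Rmax_l (- ln M - ell) (ell - ln M)); lra).
  apply exp_le in B1. rewrite exp_Ropp, exp_ln in B1 by auto.
  assert (1 <= M * exp (ell + B)).
  { apply Rmult_le_reg_l with (/ M); [apply Rinv_0_lt_compat; auto|]. rewrite <- Rmult_assoc, Rinv_l, Rmult_1_l by lra. lra. }
  rewrite sqrt_neg_0 by lra. apply pow_i. lia. }
rewrite HBv in P. rewrite Rmult_0_r, Rmult_0_l, Rminus_0_r in P.
set (ct := sqrt c ^ (k + l + 2)) in *.
assert (Hct : 1 - z * (a + b) <= ct <= 1) by (apply seg_norm_bounds; auto).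
assert (Hct0 : 0 <= ct) by (apply pow_le, sqrt_pos).
assert (Hzab : 0 < z * (a + b)) by (apply Rmult_lt_0_compat; lra).
pose proof (factor_compare (k + 2) l K L ct (z * (a + b)) a b ltac:(lia) ltac:(lra) ltac:(lra) Hct ltac:(lra) Hct0 ltac:(lra) ltac:(lra)) as FC.
cbv zeta in FC. replace (- (K * a) / 2 + L * b / 2) with 0 in FC by (rewrite (Rmult_comm K), (Rmult_comm L), Haz, Hbz; field).
rewrite exp_0, Rmult_1_l in FC.
replace (2 * a + K * a ^ 2 + b + L * b ^ 2 + z * (a + b)) with (2 * a + (a * K) * a + b + (b * L) * b + z * (a + b)) in FC by ring.
rewrite Haz, Hbz in FC.
set (g := fun w => exp (- w) / (1 + b * exp (- w))).
assert (Pw : forall w, 0 < 1 + b * exp (- w)) by (intros w; pose proof (Rmult_lt_0_compat _ _ Hb (exp_pos (- w))); lra).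
assert (Cg : forall w, continuous g w).
{ intros w. apply (ex_derive_continuous (V := R_NormedModule)). unfold g. auto_derive. pose proof (Pw w). lra. }
assert (Gb : forall w, 0 <= w -> 0 <= exp (- w) - g w <= b /\ 0 <= g w <= 1).
{ intros w Hw. pose proof (exp_pos (- w)) as E0. assert (E1 : exp (- w) <= 1) by (rewrite <- exp_0; apply exp_le; lra).
  pose proof (Pw w) as P0. unfold g. set (e := exp (- w)) in *.
  assert (I0 : 0 < / (1 + b * e)) by (apply Rinv_0_lt_compat; auto).
  assert (I1 : / (1 + b * e) <= 1) by (rewrite <- Rinv_1; apply Rinv_le_contravar; lra || nra).
  replace (e - e / (1 + b * e)) with (b * (e * e * / (1 + b * e))) by (field; lra).
  unfold Rdiv. assert (0 <= e * / (1 + b * e) <= 1) by (split; [apply Rmult_le_pos; lra|nra]).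
  assert (0 <= e * e * / (1 + b * e) <= 1) by (rewrite Rmult_assoc; split; [apply Rmult_le_pos; lra|nra]).
  split; [|auto]. nra. }
pose proof (timelike_segment (k + 2) l K L ct (z * (a + b)) a b z B g ltac:(lia) ltac:(lra) ltac:(lra) ltac:(lra) Hct Hct0 ltac:(lra) Ha Hb Hz Haz Hbz HB0 Cg (fun w Hw => proj2 (Gb w Hw))) as T.
(* Replacing [e^(- w) / (1 + b e^(- w))] by [e^(- w)] costs at most [b / z = 1 / L]. *)
assert (T2 : Rabs (RInt (fun w => exp (- w) * exp (- (z * sinh w))) 0 B - RInt (fun w => g w * exp (- (z * sinh w))) 0 B) <= b * / z).
{ assert (Ce : forall w, continuous (fun w => exp (- w)) w) by (intros w; apply (ex_derive_continuous (V := R_NormedModule)); auto_derive; auto).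
  assert (Cc : forall w, continuous (fun w => cosh w * exp (- (z * sinh w))) w) by (intros w; apply continuous_mult_R; [apply cosh_cont|apply exp_sinh_cont]).
  eapply Rle_trans; [apply (abs_RInt_diff_le _ _ (fun w => b * (cosh w * exp (- (z * sinh w))))); auto|].
  - intros w. apply continuous_mult_R; [apply Ce|apply exp_sinh_cont].
  - intros w. apply continuous_mult_R; [apply Cg|apply exp_sinh_cont].
  - intros w. apply continuous_mult_R; [apply continuous_const|apply Cc].
  - intros w Hw. replace (exp (- w) * exp (- (z * sinh w)) - g w * exp (- (z * sinh w))) with ((exp (- w) - g w) * exp (- (z * sinh w))) by ring.
    destruct (Gb w) as [[G1 G2] _]; [lra|]. pose proof (exp_pos (- (z * sinh w))) as E0.
    rewrite Rabs_pos_eq by (apply Rmult_le_pos; lra). rewrite <- Rmult_assoc. apply Rmult_le_compat_r; [lra|].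
    pose proof (cosh_ge_1 w). nra.
  - rewrite RInt_scal_R by (apply ex_RInt_cont; auto). apply Rmult_le_compat_l; [lra|]. apply RInt_cosh_exp_sinh; auto. }
replace (b * / z) with (/ L) in T2 by (rewrite <- Hbz; field; lra).
set (S0 := ct * sqrt (1 - a) ^ (k + 2) * sqrt (1 + b) ^ l) in *.
assert (FC2 : Rabs (2 / z * S0 - 2 / z) <= 4 * / K + 2 * / L + 4 * (a + b)).
{ replace (2 / z * S0 - 2 / z) with (2 / z * (S0 - 1)) by ring. rewrite Rabs_mult.
  assert (Hi : 0 < 2 / z) by (apply Rdiv_lt_0_compat; lra). rewrite (Rabs_pos_eq (2 / z)) by lra.
  eapply Rle_trans; [apply Rmult_le_compat_l; [lra|exact FC]|].
  replace (/ K) with (a / z) by (rewrite <- Haz; field; lra). replace (/ L) with (b / z) by (rewrite <- Hbz; field; lra).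
  apply Req_le. field. lra. }
assert (HiK : 0 < / K) by (apply Rinv_0_lt_compat; lra). assert (HiL : 0 < / L) by (apply Rinv_0_lt_compat; lra).
set (I1 := RInt (fun w => exp w * seg_left k l w) 0 B) in *.
set (I2 := RInt _ 0 B) in P. change (Rabs (I2 - RInt (fun w => g w * exp (- (z * sinh w))) 0 B) <= 9 * (/ K + / L + a + b)) in T.
set (I3 := RInt (fun w => g w * exp (- (z * sinh w))) 0 B) in *.
set (I4 := RInt (fun w => exp (- w) * exp (- (z * sinh w))) 0 B) in *.
apply Rabs_le_between in T, T2, FC2. apply Rabs_le. unfold err. simpl in *. lra.
Qed.
(** For [n = 1] the improper integrand in [BesselY] is [(e^w - e^(- w)) e^(- z sinh w)], written as
    [2 cosh w - 2 e^(- w)] times the exponential so that its first part integrates exactly to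
    [2 / z]. The constant 24 is 14 for the left segment, 9 for the right one and 1 for cutting the
    integral at [B]. *)
Lemma arc_term_Y1 k l : (0 <= k)%Z -> (0 <= l)%Z -> IZR k = K - 2 -> IZR l = L -> Z.odd k = true -> Z.odd l = true ->
  Rabs (fst (contour_int2 k l) - a * (PI * BesselY 1 z)) <= a * ((PI * 80 + 24) * err).
Proof.
intros Hk Hl Ek El Pk Pl. pose proof PI_RGT_0 as Hpi. destruct cone_facts as (Ha & Hb & Hz & _).
pose proof err_pos as Herr0.
assert (C2 := fun x => proj2 (arc2_cont k l ell x Hk)).
set (X := RInt (fun phi => snd (contour_fun2 M k l phi ell)) 0 PI).
set (S0 := RInt (fun x => sin (x + z * sin x)) 0 PI).
assert (Cs : forall x, continuous (fun x => sin (x + z * sin x)) x) by (intros x; apply continuous_sin_comp, id_z_sin_cont).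
assert (HX : Rabs (X - a * S0) <= a * (PI * 80 * err)).
{ assert (EX : a * S0 = RInt (fun x => a * sin (x + z * sin x)) 0 PI) by (symmetry; exact (RInt_scal_R _ a 0 PI (ex_RInt_cont _ 0 PI Cs))).
  rewrite EX. replace (a * (PI * 80 * err)) with (PI * (a * (80 * err))) by ring.
  apply abs_RInt_diff_const; auto.
  - intros x. apply continuous_mult_R; [apply continuous_const|auto].
  - intros phi Hp. apply (arc2_uniform k l phi); auto. }
set (k' := Z.to_nat k). set (l' := Z.to_nat l).
assert (Hk' : INR k' = K - 2) by (apply to_nat_INR; auto). assert (Hl' : INR l' = L) by (apply to_nat_INR; auto).
assert (Hn : INR (k' + l' + 2) = K + L) by (rewrite !plus_INR, Hk', Hl'; simpl; ring).
assert (Ok : (1 <= k')%nat) by (destruct (to_nat_odd k Hk Pk) as [m Hm]; unfold k'; lia).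
assert (Ol : (1 <= l')%nat) by (destruct (to_nat_odd l Hl Pl) as [m Hm]; unfold l'; lia).
assert (Ce : forall x, continuous (fun w => exp (- w)) x) by (intros w; apply (ex_derive_continuous (V := R_NormedModule)); auto_derive; auto).
assert (Hsplit : forall B, cutoff <= B -> fst (contour_int2 k l) =
  - X - a * RInt (fun w => exp w * seg_left k' l' w) 0 B + a * RInt (fun w => exp (- w) * seg_right k' l' w) 0 B).
{ intros B HB. assert (B1 : - ln M <= ell + B) by (unfold cutoff in HB; pose proof (Rmax_l (- ln M - ell) (ell - ln M)); lra).
  assert (B2 : ell - B <= ln M) by (unfold cutoff in HB; pose proof (Rmax_r (- ln M - ell) (ell - ln M)); lra).
  assert (Cg : forall s x, continuous (fun v => s * (M * exp v)) x).
  { intros s x. apply (ex_derive_continuous (V := R_NormedModule)). auto_derive. auto. }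
  pose proof (boundary_PI_int k l (fun v => -1 * (M * exp v)) B Hk Pk (Cg (-1)) B1) as E1.
  pose proof (boundary_0_int k l (fun v => 1 * (M * exp v)) B Hk Hl Pl (Cg 1) B2) as E2.
  unfold contour_int2. rewrite (contour_fun2_shift M HM k l ell (or_introl Hk)).
  unfold CInt, Cminus, Cplus, Copp, Cmult at 2, Ci. cbn [fst snd].
  rewrite (RInt_ext (fun v => fst (contour_fun2 M k l PI v)) (fun v => -1 * (M * exp v) * (c * fst (contour_fun M k l PI v)))).
  2:{ intros v _. rewrite (proj1 (contour_fun2_boundary k l PI v sin_PI)), cos_PI. ringR. }
  rewrite (RInt_ext (fun v => fst (contour_fun2 M k l 0 v)) (fun v => 1 * (M * exp v) * (c * fst (contour_fun M k l 0 v)))).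
  2:{ intros v _. rewrite (proj1 (contour_fun2_boundary k l 0 v sin_0)), cos_0. ringR. }
  assert (E3 : RInt (fun w => -1 * (M * exp (ell + w)) * seg_left k' l' w) 0 B = - a * RInt (fun w => exp w * seg_left k' l' w) 0 B).
  { transitivity (RInt (fun w => - a * (exp w * seg_left k' l' w)) 0 B).
    - apply RInt_ext. intros w _. rewrite a_exp. ringR.
    - exact (RInt_scal_R _ (- a) 0 B (ex_RInt_cont _ 0 B (fun x => continuous_mult_R _ _ x (continuous_exp x) (seg_left_cont k' l' x)))). }
  assert (E4 : RInt (fun w => 1 * (M * exp (ell - w)) * seg_right k' l' w) 0 B = a * RInt (fun w => exp (- w) * seg_right k' l' w) 0 B).
  { transitivity (RInt (fun w => a * (exp (- w) * seg_right k' l' w)) 0 B).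
    - apply RInt_ext. intros w _. unfold Rminus. rewrite a_exp. ringR.
    - exact (RInt_scal_R _ a 0 B (ex_RInt_cont _ 0 B (fun x => continuous_mult_R _ _ x (Ce x) (seg_right_cont k' l' x)))). }
  cbv beta in E1, E2. fold k' l' in E1, E2. rewrite E3 in E1. rewrite E4 in E2.
  unfold X. simpl in E1, E2 |- *. lra. }
unfold BesselY.
assert (HI : Rabs (improper0 (fun u => (exp (INR 1 * u) + (-1) ^ 1 * exp (- (INR 1 * u))) * exp (- (z * sinh u)))
    - (- (fst (contour_int2 k l) + X) / a)) <= 24 * err).
(* Beyond [4 / (z^2 err)] the tail [2 e^(- z sinh B) / z] is at most [err], by [sinh B >= B / 2] and
   [e^x >= x]. *)
{ apply improper0_approx with (B0 := Rmax cutoff (4 / (z ^ 2 * err))).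
  - intros x. apply continuous_mult_R; [|apply exp_sinh_cont].
    apply (ex_derive_continuous (V := R_NormedModule)). auto_derive. auto.
  - intros x Hx. simpl. apply Rmult_le_pos; [|left; apply exp_pos].
    assert (exp (- (1 * x)) <= exp (1 * x)) by (apply exp_le; lra). lra.
  - intros B HB' HB0. assert (HB : cutoff <= B) by (eapply Rle_trans; [apply Rmax_l|exact HB']).
    assert (HBb : 4 / (z ^ 2 * err) <= B) by (eapply Rle_trans; [apply Rmax_r|exact HB']).
    rewrite (Hsplit B HB).
    assert (Cc : forall w, continuous (fun w => cosh w * exp (- (z * sinh w))) w) by (intros w; apply continuous_mult_R; [apply cosh_cont|apply exp_sinh_cont]).
    assert (Cm : forall w, continuous (fun w => exp (- w) * exp (- (z * sinh w))) w) by (intros w; apply continuous_mult_R; [apply Ce|apply exp_sinh_cont]).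
    assert (ET : RInt (fun u => (exp (INR 1 * u) + (-1) ^ 1 * exp (- (INR 1 * u))) * exp (- (z * sinh u))) 0 B
      = 2 * RInt (fun w => cosh w * exp (- (z * sinh w))) 0 B + -2 * RInt (fun w => exp (- w) * exp (- (z * sinh w))) 0 B).
    { rewrite <- (RInt_lin (fun w => cosh w * exp (- (z * sinh w))) (fun w => exp (- w) * exp (- (z * sinh w))) 2 (-2) 0 B (ex_RInt_cont _ 0 B Cc) (ex_RInt_cont _ 0 B Cm)).
      apply RInt_ext. intros w _. simpl INR. simpl pow. rewrite !Rmult_1_l. unfold cosh. match goal with |- @eq _ ?x ?y => change (@eq R x y) end. field. }
    rewrite ET.
    rewrite RInt_cosh_exp_sinh_eq by auto.
    assert (Hsm : 0 <= 2 * (/ z * exp (- (z * sinh B))) <= err).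
    { pose proof (exp_pos (- (z * sinh B))) as Ex. assert (Hiz : 0 < / z) by (apply Rinv_0_lt_compat; auto).
      split; [apply Rmult_le_pos; [lra|apply Rmult_le_pos; lra]|].
      assert (Hs : B / 2 <= sinh B).
      { unfold sinh. pose proof (exp_ge_1p B). assert (exp (- B) <= 1) by (rewrite <- exp_0; apply exp_le; lra). lra. }
      assert (HBp : 0 < 4 / (z ^ 2 * err)) by (apply Rdiv_lt_0_compat; [lra|apply Rmult_lt_0_compat; [apply pow_lt; auto|auto]]).
      assert (Hq : 2 / (z * err) <= z * sinh B).
      { apply Rle_trans with (z * (4 / (z ^ 2 * err) / 2)); [apply Req_le; field; lra|]. apply Rmult_le_compat_l; lra. }
      assert (Hp : 0 < 2 / (z * err)) by (apply Rdiv_lt_0_compat; [lra|apply Rmult_lt_0_compat; auto]).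
      assert (Hx : exp (- (z * sinh B)) <= z * err / 2).
      { rewrite exp_Ropp. replace (z * err / 2) with (/ (2 / (z * err))) by (field; lra).
        apply Rinv_le_contravar; auto. pose proof (exp_ge_1p (z * sinh B)). lra. }
      replace err with (2 * (/ z * (z * err / 2))) by (field; lra).
      apply Rmult_le_compat_l; [lra|]. apply Rmult_le_compat_l; lra. }
    pose proof (left_parts_est k' l' B Ok Hk' Hl' HB HB0) as S1.
    pose proof (seg_right_est k' l' (fun w => exp (- w)) B Ol ltac:(lra) ltac:(lra) Hn HB0 Ce) as S2.
    assert (Hw : forall w, 0 <= w -> 0 <= exp (- w) <= 1).
    { intros w Hw. pose proof (exp_pos (- w)). assert (exp (- w) <= 1) by (rewrite <- exp_0; apply exp_le; lra). lra. }
    specialize (S2 Hw).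
    set (I1 := RInt (fun w => exp w * seg_left k' l' w) 0 B) in *.
    set (I2 := RInt (fun w => exp (- w) * seg_right k' l' w) 0 B) in *.
    set (I3 := RInt (fun w => exp (- w) * exp (- (z * sinh w))) 0 B) in *.
    assert (Ea : - (- X - a * I1 + a * I2 + X) / a = I1 - I2) by (field; lra).
    apply Rabs_le_between in S1, S2. apply Rabs_le. unfold Rdiv in S1. simpl in *. rewrite Ea. lra. }
assert (E : RInt (fun th => sin (z * sin th - INR 1 * th)) 0 PI = - S0).
{ assert (R := RInt_reflect (fun x => sin (x + z * sin x)) 0 PI PI Cs).
  replace (PI - PI) with 0 in R by ring. replace (PI - 0) with PI in R by ring.
  unfold S0. rewrite <- R. rewrite (RInt_ext (fun x => sin (PI - x + z * sin (PI - x))) (fun x => -1 * sin (z * sin x - INR 1 * x))).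
  - rewrite RInt_scal_R.
    + set (I := RInt _ _ _). change (I = - (-1 * I)). symmetry; ringR.
    + apply ex_RInt_cont. intros x. apply continuous_sin_comp. simpl INR.
      apply (continuous_minus (V := R_NormedModule)); [apply z_sin_cont|apply continuous_mult_R; [apply continuous_const|apply continuous_id]].
  - intros x _. rewrite sin_PI_x. replace (PI - x + z * sin x) with ((z * sin x - INR 1 * x) + PI) by (simpl INR; ring).
    rewrite neg_sin. ringR. }
rewrite E. set (I := improper0 _) in *.
replace (a * (PI * (/ PI * - S0 - / PI * I))) with (- (a * S0) - a * I) by (field; lra).
set (Y := fst (contour_int2 k l)) in *.
replace (Y - (- (a * S0) - a * I)) with (a * (I - (- (Y + X) / a)) + - (X - a * S0)) by (field; lra).
eapply Rle_trans; [apply Rabs_triang|]. rewrite Rabs_Ropp, Rabs_mult, (Rabs_pos_eq a) by lra.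
apply (Rmult_le_compat_l a) in HI; [|lra]. simpl in *. lra.
Qed.
End Timelike.

(** * Outside the light cone *)

Ltac field_sym := symmetry; match goal with |- @eq _ ?x ?y => change (@eq R x y) end; field.

Lemma isqrt_bounds y : 0 <= y -> 0 < / sqrt (1 + y) <= 1 /\ / sqrt (1 + y) ^ 2 = / (1 + y).
Proof.
intros Hy. assert (H1 : 1 <= sqrt (1 + y)) by (rewrite <- sqrt_1 at 1; apply sqrt_le_1; lra).
split; [split|].
- apply Rinv_0_lt_compat; lra.
- apply Rle_trans with (/ 1); [apply Rinv_le_contravar; lra|rewrite Rinv_1; lra].
- f_equal. simpl. rewrite Rmult_1_r. apply sqrt_sqrt. lra.
Qed.

Lemma isqrt_exp_le y n : 0 <= y -> exp (- (INR n * y / 2)) <= (/ sqrt (1 + y)) ^ n.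
Proof.
intros Hy. replace (- (INR n * y / 2)) with (INR n * (- y / 2)) by field. rewrite <- exp_pow. apply pow_incr. split; [left; apply exp_pos|].
replace (- y / 2) with (- (y / 2)) by field. rewrite exp_Ropp, <- sqrt_exp.
apply Rinv_le_contravar; [apply sqrt_lt_R0; lra|]. apply sqrt_le_1; try lra; [left; apply exp_pos|apply exp_ge_1p].
Qed.

(** Outside the cone the factor [(1 + y)^(- n/2)] decays only like a power of [y], so its distance
    from [e^(- n y/2)] cannot be controlled by the exponential. The bound keeps a power of
    [1 / sqrt (1 + y)], which has an explicit integral in [w]. *)
Lemma isqrt_exp_ge y n : 0 <= y ->
  (/ sqrt (1 + y)) ^ n - exp (- (INR n * y / 2)) <= 4 * INR n * (y ^ 2 * (/ sqrt (1 + y)) ^ (n + 4)).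
Proof.
intros Hy. destruct (isqrt_bounds y Hy) as [[S0 S1] S2].
pose proof (pos_INR n) as Hn. assert (Hp : 0 <= (/ sqrt (1 + y)) ^ n) by (apply pow_le; lra).
set (s := / sqrt (1 + y)) in *. rewrite pow_add.
assert (S4 : s ^ 4 = / (1 + y) ^ 2) by (replace (s ^ 4) with ((s ^ 2) ^ 2) by ring; rewrite <- pow_inv; f_equal; unfold s; rewrite pow_inv; exact S2).
destruct (Nat.eq_dec n 0) as [->|Hn0].
{ simpl. rewrite Rmult_0_l. replace (- (0 / 2)) with 0 by field. rewrite exp_0. lra. }
assert (Hn1 : 1 <= INR n) by (apply (le_INR 1); lia).
(* For [y >= 1] this already makes the right side at least the whole power; for [y < 1] it supplies
   the quadratic term of the logarithm. *)
assert (H4 : (Rmin 1 (y ^ 2)) / 4 <= y ^ 2 * s ^ 4).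
{ rewrite S4. assert (0 < (1 + y) ^ 2) by (apply pow_lt; lra).
  apply Rmult_le_reg_r with ((1 + y) ^ 2); auto. rewrite Rmult_assoc, Rinv_l, Rmult_1_r by lra.
  destruct (Rle_lt_dec y 1).
  - assert (Rmin 1 (y ^ 2) <= y ^ 2) by apply Rmin_r. assert (0 <= Rmin 1 (y ^ 2)) by (apply Rmin_glb; [lra|apply pow2_ge_0]).
    assert ((1 + y) ^ 2 <= 4) by nra. nra.
  - assert (Rmin 1 (y ^ 2) <= 1) by apply Rmin_l. nra. }
replace (4 * INR n * (y ^ 2 * (s ^ n * s ^ 4))) with (s ^ n * (INR n * (4 * (y ^ 2 * s ^ 4)))) by ring.
destruct (Rle_lt_dec 1 y) as [H1|H1].
- rewrite Rmin_left in H4 by nra. pose proof (exp_pos (- (INR n * y / 2))).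
  assert (1 <= INR n * (4 * (y ^ 2 * s ^ 4))) by nra. nra.
- rewrite Rmin_right in H4 by nra.
  assert (Hs : s * exp (- (y ^ 2 / 2)) <= exp (- (y / 2))).
  { assert (Hq : sqrt (exp (y - y ^ 2)) <= sqrt (1 + y)) by (apply sqrt_le_1; [left; apply exp_pos|lra|apply one_plus_ge; lra]).
    rewrite sqrt_exp in Hq. apply Rinv_le_contravar in Hq; [|apply exp_pos]. fold s in Hq. rewrite <- exp_Ropp in Hq.
    apply Rle_trans with (exp (- ((y - y ^ 2) / 2)) * exp (- (y ^ 2 / 2))); [apply Rmult_le_compat_r; [left; apply exp_pos|auto]|].
    rewrite <- exp_plus. apply Req_le. f_equal. field. }
  assert (Hs0 : 0 <= s * exp (- (y ^ 2 / 2))) by (apply Rmult_le_pos; [lra|left; apply exp_pos]).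
  pose proof (pow_incr _ _ n (conj Hs0 Hs)) as Hs'. clear Hs. rename Hs' into Hs.
  rewrite Rpow_mult_distr, !exp_pow in Hs.
  replace (INR n * - (y / 2)) with (- (INR n * y / 2)) in Hs by field.
  pose proof (exp_ge_1p (INR n * - (y ^ 2 / 2))) as He.
  assert (s ^ n * (1 + INR n * - (y ^ 2 / 2)) <= exp (- (INR n * y / 2))) by (eapply Rle_trans; [apply Rmult_le_compat_l; [exact Hp|exact He]|exact Hs]).
  assert (INR n * (y ^ 2 / 2) <= INR n * (4 * (y ^ 2 * s ^ 4))) by (apply Rmult_le_compat_l; nra).
  nra.
Qed.

Lemma isqrt_exp_diff y n i : 0 <= y -> (i <= 2)%nat ->
  Rabs ((/ sqrt (1 + y)) ^ (n + i) - exp (- (INR n * y / 2))) <=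
  y * exp (- (INR n * y / 2)) + 4 * INR n * (y ^ 2 * (/ sqrt (1 + y)) ^ (n + i + 4)).
Proof.
intros Hy Hi. destruct (isqrt_bounds y Hy) as [[S0 S1] S2].
pose proof (isqrt_exp_le y n Hy) as U. pose proof (isqrt_exp_ge y n Hy) as D.
pose proof (exp_pos (- (INR n * y / 2))) as He. pose proof (pos_INR n) as Hn.
set (s := / sqrt (1 + y)) in *. set (e := exp (- (INR n * y / 2))) in *.
assert (Hsi : 1 - y <= s ^ i <= 1).
{ split; [|rewrite <- (pow1 i); apply pow_incr; lra].
  apply Rle_trans with (s ^ 2); [|].
  - unfold s. rewrite pow_inv, S2. assert (0 < / (1 + y)) by (apply Rinv_0_lt_compat; lra).
    assert (/ (1 + y) * (1 + y) = 1) by (apply Rinv_l; lra). nra.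
  - destruct i as [|[|[|i]]]; try lia; simpl; nra. }
replace (n + i + 4)%nat with (i + (n + 4))%nat by lia. rewrite (pow_add s i), (Nat.add_comm n i), (pow_add s i).
assert (0 <= s ^ i) by (apply pow_le; lra).
assert (P1 : 0 <= y * e) by (apply Rmult_le_pos; lra).
assert (P2 : 0 <= 4 * INR n * (y ^ 2 * (s ^ i * s ^ (n + 4)))).
{ apply Rmult_le_pos; [lra|]. apply Rmult_le_pos; [apply pow2_ge_0|]. apply Rmult_le_pos; auto. apply pow_le; lra. }
apply Rabs_le. split.
- assert (s ^ i * e <= s ^ i * s ^ n) by (apply Rmult_le_compat_l; auto). nra.
- assert (s ^ i * (s ^ n - e) <= s ^ i * (4 * INR n * (y ^ 2 * s ^ (n + 4)))) by (apply Rmult_le_compat_l; auto). nra.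
Qed.

(** For [y >= 1/2] the factor [4 l y^2] is at least 1 and nothing is left to prove; below, the
    second-order bound on [ln (1 - y)] is used. *)
Lemma sqrt_exp_lower y n l : 0 <= y -> (1 <= l)%nat -> (n <= l)%nat ->
  exp (- (INR l * y / 2)) - sqrt (1 - y) ^ n <= 4 * INR l * (y ^ 2 * exp (- (INR l * y / 2))).
Proof.
intros Hy Hl Hn. pose proof (exp_pos (- (INR l * y / 2))) as He. assert (Hl1 : 1 <= INR l) by (apply (le_INR 1); lia).
assert (Hp : 0 <= sqrt (1 - y) ^ n) by (apply pow_le, sqrt_pos).
destruct (Rle_lt_dec (1 / 2) y) as [H|H].
- assert (1 <= 4 * INR l * y ^ 2) by nra. nra.
- assert (S1 : sqrt (1 - y) <= 1) by (rewrite <- sqrt_1 at 2; apply sqrt_le_1; lra). pose proof (sqrt_pos (1 - y)) as S0.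
  assert (Hln : sqrt (1 - y) ^ l <= sqrt (1 - y) ^ n).
  { assert (El : exists q, l = (n + q)%nat) by (exists (l - n)%nat; lia). destruct El as [q ->]. rewrite pow_add.
    assert (P : sqrt (1 - y) ^ q <= 1 ^ q) by (apply pow_incr; lra). rewrite pow1 in P. nra. }
  assert (Q := sqrt_pow_ge (1 - y) (- (y + 2 * y ^ 2)) l (one_minus_ge y ltac:(lra))).
  replace (INR l * - (y + 2 * y ^ 2) / 2) with (- (INR l * y / 2) + - (INR l * y ^ 2)) in Q by field.
  rewrite exp_plus in Q. pose proof (exp_ge_1p (- (INR l * y ^ 2))).
  assert (exp (- (INR l * y / 2)) * (1 + - (INR l * y ^ 2)) <= exp (- (INR l * y / 2)) * exp (- (INR l * y ^ 2))) by (apply Rmult_le_compat_l; lra).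
  assert (0 <= INR l * (y ^ 2 * exp (- (INR l * y / 2)))) by (apply Rmult_le_pos; [lra|apply Rmult_le_pos; [apply pow2_ge_0|lra]]).
  nra.
Qed.

Lemma sqrt_exp_upper y n : sqrt (1 - y) ^ n <= exp (- (INR n * y / 2)).
Proof.
replace (- (INR n * y / 2)) with (INR n * - y / 2) by field. apply sqrt_pow_le. pose proof (exp_ge_1p (- y)). lra.
Qed.

(** This and the next two comparisons treat exponents short of the limiting one by 0, 1 and 2. In
    the first two the error keeps an exponential, to be integrated over the whole line; the third is
    polynomial, for the range where [y] is bounded. *)
Lemma sqrt_exp_diff0 y l : 0 <= y -> (1 <= l)%nat ->
  Rabs (sqrt (1 - y) ^ l - exp (- (INR l * y / 2))) <= 4 * INR l * (y ^ 2 * exp (- (INR l * y / 2))).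
Proof.
intros Hy Hl. pose proof (sqrt_exp_upper y l). pose proof (sqrt_exp_lower y l l Hy Hl (Nat.le_refl l)). apply Rabs_le. lra.
Qed.

Lemma exp_drop m y q : 0 <= y -> 0 <= q -> exp (- (m * y / 2)) - exp (- ((m + q) * y / 2)) <= exp (- (m * y / 2)) * (q * y / 2).
Proof.
intros Hy Hq. replace (- ((m + q) * y / 2)) with (- (m * y / 2) + - (q * y / 2)) by field. rewrite exp_plus.
pose proof (exp_ge_1p (- (q * y / 2))). pose proof (exp_pos (- (m * y / 2))). nra.
Qed.

Lemma sqrt_exp_diff1 y l : 0 <= y -> (1 <= l)%nat ->
  Rabs (sqrt (1 - y) ^ l - exp (- (INR (l + 1) * y / 2))) <= 4 * INR (l + 1) * (y ^ 2 * exp (- (INR (l + 1) * y / 2))) + y / 2 * exp (- (INR (l + 1) * y / 4)).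
Proof.
intros Hy Hl. pose proof (sqrt_exp_upper y l) as U. pose proof (sqrt_exp_lower y l (l + 1) Hy ltac:(lia) ltac:(lia)) as D.
assert (Hl1 : 1 <= INR l) by (apply (le_INR 1); lia).
pose proof (exp_drop (INR l) y 1 Hy ltac:(lra)) as X. rewrite plus_INR in *. simpl (INR 1) in *.
assert (exp (- (INR l * y / 2)) <= exp (- ((INR l + 1) * y / 4))) by (apply exp_le; nra).
assert (exp (- (INR l * y / 2)) * (1 * y / 2) <= y / 2 * exp (- ((INR l + 1) * y / 4))) by nra.
assert (0 <= y / 2 * exp (- ((INR l + 1) * y / 4))) by (apply Rmult_le_pos; [lra|left; apply exp_pos]).
assert (0 <= 4 * (INR l + 1) * (y ^ 2 * exp (- ((INR l + 1) * y / 2)))).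
{ apply Rmult_le_pos; [lra|]. apply Rmult_le_pos; [apply pow2_ge_0|left; apply exp_pos]. }
apply Rabs_le. lra.
Qed.

Lemma sqrt_exp_diff2 y l : 0 <= y -> (1 <= l)%nat ->
  Rabs (sqrt (1 - y) ^ l - exp (- (INR (l + 2) * y / 2))) <= 4 * INR (l + 2) * y ^ 2 + y.
Proof.
intros Hy Hl. pose proof (sqrt_exp_upper y l) as U. pose proof (sqrt_exp_lower y l (l + 2) Hy ltac:(lia) ltac:(lia)) as D.
assert (Hl1 : 1 <= INR l) by (apply (le_INR 1); lia).
pose proof (exp_drop (INR l) y 2 Hy ltac:(lra)) as X. rewrite plus_INR in *. simpl (INR 2) in *. replace (1 + 1) with 2 in * by ring.
assert (E1 : forall q, 0 <= q -> 0 < exp (- (q * y / 2)) <= 1).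
{ intros q Hq. split; [apply exp_pos|]. rewrite <- exp_0. apply exp_le. nra. }
destruct (E1 (INR l)) as [Ea Eb]; [lra|]. destruct (E1 (INR l + 2)) as [Ec Ed]; [lra|].
assert (0 <= 4 * (INR l + 2) * y ^ 2) by (apply Rmult_le_pos; [lra|apply pow2_ge_0]).
assert (4 * (INR l + 2) * (y ^ 2 * exp (- ((INR l + 2) * y / 2))) <= 4 * (INR l + 2) * y ^ 2) by nra.
apply Rabs_le. split; [lra|nra].
Qed.

Lemma RInt_le_primitive (G g : R -> R) A B U : (forall x, is_derive G x (g x)) -> (forall x, continuous g x) ->
  G B - G A <= U -> RInt g A B <= U.
Proof.
intros Hd Hc HU.
rewrite (is_RInt_unique _ _ _ _ (is_RInt_derive (V := R_CompleteNormedModule) G g A B (fun x _ => Hd x) (fun x _ => Hc x))).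
exact HU.
Qed.

(** The left side increases with [s] on [[0, 1]] and equals 2 at [s = 1]. It yields the denominator
    [n (n + 2)] in [RInt_isqrt2], an order better than bounding the two terms separately. *)
Lemma pow_defect_le n s : 0 <= s <= 1 -> (INR n + 2) * s ^ n - INR n * s ^ (n + 2) <= 2.
Proof.
intros Hs. induction n as [|n IH]; [simpl; nra|].
rewrite S_INR. replace (S n + 2)%nat with (S (n + 2)) by lia. simpl (s ^ S n). simpl (s ^ S (n + 2)).
assert (Hp : 0 <= s ^ n <= 1) by (split; [apply pow_le; lra|rewrite <- (pow1 n); apply pow_incr; lra]).
assert (E : s ^ (n + 2) = s ^ n * s ^ 2) by (apply pow_add).
assert (s * ((INR n + 2) * s ^ n - INR n * s ^ (n + 2)) <= s * 2) by (apply Rmult_le_compat_l; lra).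
assert (s * (s ^ n * (1 - s ^ 2)) <= s * (1 - s ^ 2)).
{ apply Rmult_le_compat_l; [lra|]. assert (0 <= 1 - s ^ 2) by nra. nra. }
assert (2 * s + s * (1 - s ^ 2) <= 2) by (assert (0 <= (1 - s) * (2 - s * (1 + s))) by (apply Rmult_le_pos; nra); nra).
rewrite E in *. nra.
Qed.

(** * Exact integrals in the variable [y = a e^w], where [dw = dy / y] *)

Section Primitives.
Variables a : R.
Hypothesis Ha : 0 < a.
Let y w := a * exp w.
Let s w := / sqrt (1 + y w).

Lemma isqrt_derive n w : is_derive (fun w => s w ^ n) w (- (INR n / 2) * (y w * s w ^ (n + 2))).
Proof.
assert (Hy : 0 < y w) by (apply Rmult_lt_0_compat; auto; apply exp_pos).
assert (Hq : 0 < sqrt (1 + y w)) by (apply sqrt_lt_R0; lra).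
assert (Hqq : sqrt (1 + y w) * sqrt (1 + y w) = 1 + y w) by (apply sqrt_sqrt; lra).
assert (D1 : is_derive s w (- (1 / 2) * (y w * s w ^ 3))).
{ unfold s, y. auto_derive.
  - fold (y w). repeat split; auto; lra.
  - fold (y w). rewrite Rmult_1_l. fold (y w). field. lra. }
destruct n as [|n].
- simpl. rewrite Rdiv_0_l, Ropp_0, Rmult_0_l. apply (is_derive_const (V := R_NormedModule)).
- assert (D := is_derive_pow s (S n) w _ D1). simpl pred in D.
  replace (- (INR (S n) / 2) * (y w * s w ^ (S n + 2))) with (INR (S n) * (- (1 / 2) * (y w * s w ^ 3)) * s w ^ n); [exact D|].
  replace (S n + 2)%nat with (n + 3)%nat by lia. rewrite pow_add. field.
Qed.

Lemma y_cont w : continuous y w.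
Proof. apply (ex_derive_continuous (V := R_NormedModule)). unfold y. auto_derive. auto. Qed.

Lemma isqrt_cont n w : continuous (fun w => s w ^ n) w.
Proof. apply (ex_derive_continuous (V := R_NormedModule)). eexists. apply isqrt_derive. Qed.

Lemma isqrt_range w : 0 < s w <= 1.
Proof. apply isqrt_bounds. left. apply Rmult_lt_0_compat; auto; apply exp_pos. Qed.

Lemma RInt_isqrt1 n A B : (1 <= n)%nat -> RInt (fun w => y w * s w ^ (n + 2)) A B <= 2 / INR n.
Proof.
intros Hn. assert (Hn1 : 1 <= INR n) by (apply (le_INR 1); auto).
apply (RInt_le_primitive (fun w => - (2 / INR n) * s w ^ n)).
- intros w. replace (y w * s w ^ (n + 2)) with (- (2 / INR n) * (- (INR n / 2) * (y w * s w ^ (n + 2)))) by (field; lra).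
  apply is_derive_scal, isqrt_derive.
- intros w. apply continuous_mult_R; [apply y_cont|apply isqrt_cont].
- pose proof (isqrt_range A). pose proof (isqrt_range B). assert (0 <= s B ^ n) by (apply pow_le; lra).
  assert (s A ^ n <= 1) by (rewrite <- (pow1 n); apply pow_incr; lra).
  assert (0 < 2 / INR n) by (apply Rdiv_lt_0_compat; lra). nra.
Qed.

Lemma RInt_isqrt2 n A B : (1 <= n)%nat -> RInt (fun w => y w ^ 2 * s w ^ (n + 4)) A B <= 4 / (INR n * (INR n + 2)).
Proof.
intros Hn. assert (Hn1 : 1 <= INR n) by (apply (le_INR 1); auto).
apply (RInt_le_primitive (fun w => - (2 / INR n) * s w ^ n + 2 / (INR n + 2) * s w ^ (n + 2))).
- intros w. assert (Hy : 0 < y w) by (apply Rmult_lt_0_compat; auto; apply exp_pos).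
  assert (E : y w ^ 2 * s w ^ (n + 4) = - (2 / INR n) * (- (INR n / 2) * (y w * s w ^ (n + 2))) + 2 / (INR n + 2) * (- (INR (n + 2) / 2) * (y w * s w ^ (n + 2 + 2)))).
  { replace (n + 2 + 2)%nat with (n + 2 + 2)%nat by lia. replace (n + 4)%nat with (n + 2 + 2)%nat by lia.
    rewrite (pow_add _ (n + 2) 2), plus_INR. simpl (INR 2).
    assert (T : s w ^ 2 * (1 + y w) = 1) by (unfold s; destruct (isqrt_bounds (y w)) as [_ E]; [lra|]; rewrite pow_inv, E; field; lra).
    set (p := s w ^ (n + 2)) in *. set (q := s w ^ 2) in *.
    transitivity (y w * p * (1 - q)); [|field; lra]. rewrite <- T at 1. ring. }
  rewrite E. apply (is_derive_plus (V := R_NormedModule)); apply is_derive_scal; apply isqrt_derive.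
- intros w. apply continuous_mult_R; [|apply isqrt_cont].
  apply (ex_derive_continuous (V := R_NormedModule)). unfold y. auto_derive. auto.
- pose proof (isqrt_range A). pose proof (isqrt_range B).
  pose proof (pow_defect_le n (s A) ltac:(lra)) as PA.
  assert (Hs : s B ^ (n + 2) <= s B ^ n).
  { rewrite pow_add. assert (0 <= s B ^ n) by (apply pow_le; lra). assert (s B ^ 2 <= 1) by nra. nra. }
  assert (0 <= s B ^ n) by (apply pow_le; lra).
  assert (HB : - (2 / INR n) * s B ^ n + 2 / (INR n + 2) * s B ^ (n + 2) <= 0).
  { assert (2 / (INR n + 2) <= 2 / INR n) by (apply Rmult_le_compat_l; [lra|apply Rinv_le_contravar; lra]).
    assert (0 < 2 / (INR n + 2)) by (apply Rdiv_lt_0_compat; lra).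
    assert (0 <= s B ^ (n + 2)) by (apply pow_le; lra). nra. }
  replace (4 / (INR n * (INR n + 2))) with (2 / (INR n * (INR n + 2)) * 2) by (field; lra).
  assert (HA : 2 / INR n * s A ^ n - 2 / (INR n + 2) * s A ^ (n + 2) <= 2 / (INR n * (INR n + 2)) * 2).
  { replace (2 / INR n * s A ^ n - 2 / (INR n + 2) * s A ^ (n + 2)) with (2 / (INR n * (INR n + 2)) * ((INR n + 2) * s A ^ n - INR n * s A ^ (n + 2))) by (field; lra).
    apply Rmult_le_compat_l; auto. left. apply Rdiv_lt_0_compat; [lra|]. apply Rmult_lt_0_compat; lra. }
  lra.
Qed.

Lemma RInt_y_exp k A B : 0 < k -> RInt (fun w => y w * exp (- (k * y w))) A B <= / k.
Proof.
intros Hk. apply (RInt_le_primitive (fun w => - / k * exp (- (k * y w)))).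
- intros w. unfold y. auto_derive; auto. field. lra.
- intros w. apply (ex_derive_continuous (V := R_NormedModule)). unfold y. auto_derive. auto.
- pose proof (exp_pos (- (k * y B))). assert (0 < / k) by (apply Rinv_0_lt_compat; auto).
  assert (exp (- (k * y A)) <= 1).
  { rewrite <- exp_0. apply exp_le. assert (0 < y A) by (apply Rmult_lt_0_compat; auto; apply exp_pos). nra. }
  nra.
Qed.

Lemma RInt_y2_exp k A B : 0 < k -> RInt (fun w => y w ^ 2 * exp (- (k * y w))) A B <= / k ^ 2.
Proof.
intros Hk. apply (RInt_le_primitive (fun w => - / k * ((y w + / k) * exp (- (k * y w))))).
- intros w. unfold y. auto_derive; auto. field. lra.
- intros w. apply (ex_derive_continuous (V := R_NormedModule)). unfold y. auto_derive. auto.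
- assert (Hi : 0 < / k) by (apply Rinv_0_lt_compat; auto).
  assert (HyA : 0 < y A) by (apply Rmult_lt_0_compat; auto; apply exp_pos).
  assert (HyB : 0 < y B) by (apply Rmult_lt_0_compat; auto; apply exp_pos).
  assert (HB : 0 <= (y B + / k) * exp (- (k * y B))) by (apply Rmult_le_pos; [lra|left; apply exp_pos]).
  assert (HA : (y A + / k) * exp (- (k * y A)) <= / k).
  { rewrite exp_Ropp. pose proof (exp_ge_1p (k * y A)) as E. pose proof (exp_pos (k * y A)).
    apply Rmult_le_reg_r with (exp (k * y A)); auto. rewrite Rmult_assoc, Rinv_l, Rmult_1_r by lra.
    apply Rle_trans with (/ k * (1 + k * y A)); [apply Req_le; field; lra|]. apply Rmult_le_compat_l; lra. }
  replace (/ k ^ 2) with (/ k * / k) by (field; lra). nra.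
Qed.
End Primitives.

Lemma RInt_negate (h : R -> R) A B : (forall x, continuous h x) -> RInt (fun w => h (- w)) A B = RInt h (- B) (- A).
Proof.
intros Hc. pose proof (RInt_reflect h A B 0 Hc) as R. rewrite !Rminus_0_l in R. rewrite <- R.
apply RInt_ext. intros x _. rewrite Rminus_0_l. reflexivity.
Qed.

(** * Comparison of real integrals with those of [e^(- z cosh w)] *)

Section SpacelikeIntegrals.
Variables (n l : nat) (a b z : R).
Hypotheses (Hn : (1 <= n)%nat) (Hl : (1 <= l)%nat) (Ha : 0 < a) (Hb : 0 < b) (Hz : 0 < z).
Hypotheses (Haz : a * INR n = z) (Hbz : b * INR l = z).
Let y w := a * exp w.
Let y' w := b * exp (- w).
Let s w := / sqrt (1 + y w).
Let r w := sqrt (1 - y' w).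
Let eN w := exp (- (INR n * y w / 2)).
Let eL w := exp (- (INR l * y' w / 2)).
Let E w := exp (- (z * cosh w)).

Lemma n_ge_1 : 1 <= INR n. Proof. apply (le_INR 1); auto. Qed.
Lemma l_ge_1 : 1 <= INR l. Proof. apply (le_INR 1); auto. Qed.
Lemma y_pos w : 0 < y w. Proof. apply Rmult_lt_0_compat; auto; apply exp_pos. Qed.
Lemma y'_pos w : 0 < y' w. Proof. apply Rmult_lt_0_compat; auto; apply exp_pos. Qed.
Lemma y_y' w : y w * y' w = a * b.
Proof.
unfold y, y'. replace (a * exp w * (b * exp (- w))) with (a * b * (exp w * exp (- w))) by ring.
rewrite <- exp_plus, Rplus_opp_r, exp_0. ring.
Qed.
(** The conditions [a n = b l = z] balance the two exponents into a hyperbolic cosine. *)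
Lemma eN_eL w : eN w * eL w = E w.
Proof.
unfold eN, eL, E. rewrite <- exp_plus. f_equal. unfold y, y', cosh.
replace (INR n * (a * exp w) / 2) with (z * exp w / 2) by (rewrite <- Haz; field).
replace (INR l * (b * exp (- w)) / 2) with (z * exp (- w) / 2) by (rewrite <- Hbz; field). field.
Qed.
Lemma eN_range w : 0 < eN w <= 1.
Proof. split; [apply exp_pos|]. rewrite <- exp_0. apply exp_le. pose proof (y_pos w). pose proof n_ge_1. nra. Qed.
Lemma eL_range w : 0 < eL w <= 1.
Proof. split; [apply exp_pos|]. rewrite <- exp_0. apply exp_le. pose proof (y'_pos w). pose proof l_ge_1. nra. Qed.
Lemma s_range w : 0 < s w <= 1.
Proof. apply isqrt_bounds. left. apply y_pos. Qed.
Lemma r_range w : 0 <= r w <= 1.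
Proof. split; [apply sqrt_pos|]. unfold r. rewrite <- sqrt_1 at 2. apply sqrt_le_1_alt. pose proof (y'_pos w). lra. Qed.

Lemma pow_range x k : 0 <= x <= 1 -> 0 <= x ^ k <= 1.
Proof. intros Hx. split; [apply pow_le; lra|]. rewrite <- (pow1 k). apply pow_incr; lra. Qed.

Lemma y'_cont w : continuous y' w.
Proof. apply (ex_derive_continuous (V := R_NormedModule)). unfold y'. auto_derive. auto. Qed.
Lemma eN_cont w : continuous eN w.
Proof. apply (ex_derive_continuous (V := R_NormedModule)). unfold eN, y. auto_derive. auto. Qed.
Lemma eL_cont w : continuous eL w.
Proof. apply (ex_derive_continuous (V := R_NormedModule)). unfold eL, y'. auto_derive. auto. Qed.
Lemma E_cont w : continuous E w.
Proof. apply (ex_derive_continuous (V := R_NormedModule)). unfold E, cosh. auto_derive. auto. Qed.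
Lemma pow_cont (f : R -> R) k : (forall x, continuous f x) -> forall x, continuous (fun x => f x ^ k) x.
Proof. intros Hf x. induction k as [|k IH]; [apply continuous_const|]. apply continuous_mult_R; auto. Qed.
Lemma r_pow_cont k w : continuous (fun w => r w ^ k) w.
Proof.
apply pow_cont. intros x. apply (continuous_comp (fun w => 1 - y' w) sqrt); [|apply continuous_sqrt].
apply (continuous_minus (V := R_NormedModule)); [apply continuous_const|apply y'_cont].
Qed.
Lemma s_pow_cont k w : continuous (fun w => s w ^ k) w.
Proof. apply isqrt_cont; auto. Qed.

Lemma RInt_lin4 (f1 f2 f3 f4 : R -> R) c1 c2 c3 c4 A B : (forall x, continuous f1 x) -> (forall x, continuous f2 x) ->
  (forall x, continuous f3 x) -> (forall x, continuous f4 x) ->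
  (forall x, continuous (fun x => c1 * f1 x + c2 * f2 x + (c3 * f3 x + c4 * f4 x)) x) /\
  RInt (fun x => c1 * f1 x + c2 * f2 x + (c3 * f3 x + c4 * f4 x)) A B =
  c1 * RInt f1 A B + c2 * RInt f2 A B + (c3 * RInt f3 A B + c4 * RInt f4 A B).
Proof.
intros H1 H2 H3 H4.
assert (Hm : forall k f, (forall x, continuous f x) -> forall x, continuous (fun x => k * f x) x) by (intros k f Hf x; apply continuous_mult_R; auto; apply continuous_const).
assert (C12 : forall x, continuous (fun x => c1 * f1 x + c2 * f2 x) x) by (intros; apply continuous_plus_R; apply Hm; auto).
assert (C34 : forall x, continuous (fun x => c3 * f3 x + c4 * f4 x) x) by (intros; apply continuous_plus_R; apply Hm; auto).
split; [intros; apply continuous_plus_R; auto|].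
rewrite (RInt_plus_R (fun x => c1 * f1 x + c2 * f2 x) (fun x => c3 * f3 x + c4 * f4 x)) by (apply ex_RInt_cont; auto).
rewrite !RInt_lin by (apply ex_RInt_cont; auto). reflexivity.
Qed.

Lemma RInt_y'_exp k A B : 0 < k -> RInt (fun w => y' w * exp (- (k * y' w))) A B <= / k.
Proof.
intros Hk. unfold y'. rewrite (RInt_negate (fun w => b * exp w * exp (- (k * (b * exp w))))).
- apply (RInt_y_exp b Hb k); auto.
- intros w. apply (ex_derive_continuous (V := R_NormedModule)). auto_derive. auto.
Qed.

Lemma RInt_y'2_exp k A B : 0 < k -> RInt (fun w => y' w ^ 2 * exp (- (k * y' w))) A B <= / k ^ 2.
Proof.
intros Hk. unfold y'. rewrite (RInt_negate (fun w => (b * exp w) ^ 2 * exp (- (k * (b * exp w))))).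
- apply (RInt_y2_exp b Hb k); auto.
- intros w. apply (ex_derive_continuous (V := R_NormedModule)). auto_derive. auto.
Qed.

Lemma product_diff p q e e' : 0 <= q <= 1 -> 0 <= e <= 1 -> Rabs (p * q - e * e') <= Rabs (p - e) + e * Rabs (q - e').
Proof.
intros Hq He. replace (p * q - e * e') with ((p - e) * q + e * (q - e')) by ring.
eapply Rle_trans; [apply Rabs_triang|]. rewrite !Rabs_mult, (Rabs_pos_eq q), (Rabs_pos_eq e) by lra.
pose proof (Rabs_pos (p - e)). nra.
Qed.

(** Four error terms, two from each factor; integrated over any window they give at most [2 / n],
    [16 / n], [16 / l] and [2 / l]. *)
Lemma spacelike_K0 m A B : (1 <= m)%nat -> l = (m + 1)%nat -> A <= B ->
  Rabs (RInt (fun w => s w ^ (n + 1) * r w ^ m) A B - RInt E A B) <= 18 * (/ INR n + / INR l).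
Proof.
intros Hm El HAB. pose proof n_ge_1 as Hn1. pose proof l_ge_1 as Hl1.
destruct (RInt_lin4 (fun w => y w * eN w) (fun w => y w ^ 2 * s w ^ (n + 1 + 4)) (fun w => y' w ^ 2 * eL w) (fun w => y' w * exp (- (INR l / 4 * y' w)))
  1 (4 * INR n) (4 * INR l) (1 / 2) A B) as [Cb Eb].
{ intros; apply continuous_mult_R; [apply y_cont|apply eN_cont]. }
{ intros; apply continuous_mult_R; [apply pow_cont, y_cont|apply s_pow_cont]. }
{ intros; apply continuous_mult_R; [apply pow_cont, y'_cont|apply eL_cont]. }
{ intros; apply (ex_derive_continuous (V := R_NormedModule)). unfold y'. auto_derive. auto. }
set (h := fun w => 1 * (y w * eN w) + 4 * INR n * (y w ^ 2 * s w ^ (n + 1 + 4)) + (4 * INR l * (y' w ^ 2 * eL w) + 1 / 2 * (y' w * exp (- (INR l / 4 * y' w))))).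
apply Rle_trans with (RInt h A B); [apply (abs_RInt_diff_le (fun w => s w ^ (n + 1) * r w ^ m) E h A B HAB)|].
4:{ intros w _. rewrite <- eN_eL. pose proof (y_pos w). pose proof (y'_pos w). pose proof (eN_range w). pose proof (r_range w).
  eapply Rle_trans; [apply product_diff; [apply pow_range; auto|lra]|].
  pose proof (isqrt_exp_diff (y w) n 1 ltac:(lra) ltac:(lia)) as D1.
  pose proof (sqrt_exp_diff1 (y' w) m ltac:(lra) Hm) as D2. rewrite <- El in D2. 
  unfold h. apply Rplus_le_compat; [rewrite Rmult_1_l; exact D1|].
  apply Rle_trans with (Rabs (r w ^ m - eL w)).
  - pose proof (Rabs_pos (r w ^ m - eL w)). nra.
  - eapply Rle_trans; [exact D2|]. apply Req_le. replace (INR l / 4 * y' w) with (INR l * y' w / 4) by field. unfold eL. field. }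
- intros w. apply continuous_mult_R; [apply s_pow_cont|apply r_pow_cont].
- apply E_cont.
- exact Cb.
- unfold h. rewrite Eb.
  assert (B1 : RInt (fun w => y w * eN w) A B <= 2 * / INR n).
  { rewrite (RInt_ext _ (fun w => y w * exp (- (INR n / 2 * y w)))).
    - eapply Rle_trans; [apply (RInt_y_exp a Ha (INR n / 2)); lra|]. apply Req_le. field. lra.
    - intros w _. unfold eN. replace (INR n / 2 * y w) with (INR n * y w / 2) by field. reflexivity. }
  assert (B2 : RInt (fun w => y w ^ 2 * s w ^ (n + 1 + 4)) A B <= 4 / (INR (n + 1) * (INR (n + 1) + 2))) by (apply (RInt_isqrt2 a Ha); lia).
  assert (B3 : RInt (fun w => y' w ^ 2 * eL w) A B <= / (INR l / 2) ^ 2).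
  { rewrite (RInt_ext _ (fun w => y' w ^ 2 * exp (- (INR l / 2 * y' w)))).
    - apply RInt_y'2_exp; lra.
    - intros w _. unfold eL. replace (INR l / 2 * y' w) with (INR l * y' w / 2) by field. reflexivity. }
  assert (B4 : RInt (fun w => y' w * exp (- (INR l / 4 * y' w))) A B <= / (INR l / 4)) by (apply RInt_y'_exp; lra).
  assert (B2' : 4 * INR n * RInt (fun w => y w ^ 2 * s w ^ (n + 1 + 4)) A B <= 16 * / INR n).
  { eapply Rle_trans; [apply Rmult_le_compat_l; [lra|exact B2]|]. rewrite plus_INR. simpl (INR 1).
    replace (4 * INR n * (4 / ((INR n + 1) * (INR n + 1 + 2)))) with (16 * (INR n / ((INR n + 1) * (INR n + 1 + 2)))) by (field; lra).
    apply Rmult_le_compat_l; [lra|]. apply Rmult_le_reg_r with (INR n * ((INR n + 1) * (INR n + 1 + 2))); [apply Rmult_lt_0_compat; [lra|apply Rmult_lt_0_compat; lra]|].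
    replace (INR n / ((INR n + 1) * (INR n + 1 + 2)) * (INR n * ((INR n + 1) * (INR n + 1 + 2)))) with (INR n * INR n) by (field; lra).
    replace (/ INR n * (INR n * ((INR n + 1) * (INR n + 1 + 2)))) with ((INR n + 1) * (INR n + 1 + 2)) by (field; lra). nra. }
  assert (B3' : 4 * INR l * RInt (fun w => y' w ^ 2 * eL w) A B <= 16 * / INR l).
  { eapply Rle_trans; [apply Rmult_le_compat_l; [lra|exact B3]|]. apply Req_le. field. lra. }
  assert (B4' : 1 / 2 * RInt (fun w => y' w * exp (- (INR l / 4 * y' w))) A B <= 2 * / INR l).
  { eapply Rle_trans; [apply Rmult_le_compat_l; [lra|exact B4]|]. apply Req_le. field. lra. }
  lra.
Qed.

Lemma y_derive w : is_derive y w (y w).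
Proof. unfold y. auto_derive; auto. ring. Qed.
Lemma y'_derive w : is_derive y' w (- y' w).
Proof. unfold y'. auto_derive; auto. ring. Qed.
Lemma at_0 : y 0 = a /\ y' 0 = b.
Proof. unfold y, y'. rewrite Ropp_0, exp_0, !Rmult_1_r. auto. Qed.

Lemma RInt_pow_primitive (u : R -> R) k A B sg : (forall w, is_derive u w (sg * u w)) -> sg * sg = 1 ->
  RInt (fun w => u w ^ S k) A B = sg * (u B ^ S k - u A ^ S k) / INR (S k).
Proof.
intros Hu Hs. assert (HS : INR (S k) <> 0) by (apply not_0_INR; lia).
assert (Cu : forall w, continuous u w) by (intros w; apply (ex_derive_continuous (V := R_NormedModule)); eexists; apply Hu).
assert (D : forall w, is_derive (fun w => sg / INR (S k) * u w ^ S k) w (u w ^ S k)).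
{ intros w. assert (D := is_derive_scal _ w (sg / INR (S k)) _ (is_derive_pow u (S k) w _ (Hu w))). simpl pred in D.
  replace (u w ^ S k) with (sg / INR (S k) * (INR (S k) * (sg * u w) * u w ^ k)); [exact D|].
  transitivity (sg * sg * (u w * u w ^ k)); [field; auto|]. rewrite Hs. simpl. ring. }
rewrite (is_RInt_unique _ _ _ _ (is_RInt_derive (V := R_CompleteNormedModule) _ _ A B (fun x _ => D x) (fun x _ => pow_cont u (S k) Cu x))).
unfold minus, plus, opp; simpl. field. exact HS.
Qed.

(** For [w <= 0] the weight [y] is at most [a], so the bound gains the factor [a] directly. The
    dangerous term [y y'^2] is tamed by [y y' = a b], constant in [w]. *)
Lemma spacelike_K1_left A : A <= 0 ->
  Rabs (RInt (fun w => y w * (s w ^ (n + 2) * r w ^ l)) A 0 - RInt (fun w => y w * E w) A 0) <= a * (a + 2 * z * a + 8 * b).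
Proof.
intros HA. pose proof n_ge_1 as Hn1. pose proof l_ge_1 as Hl1.
destruct (RInt_lin4 (fun w => y w ^ 2) (fun w => y w ^ 3) (fun w => y' w * eL w) (fun _ => 0) 1 (4 * INR n) (4 * INR l * (a * b)) 0 A 0) as [Cb Eb].
{ apply pow_cont, y_cont. }
{ apply pow_cont, y_cont. }
{ intros; apply continuous_mult_R; [apply y'_cont|apply eL_cont]. }
{ intros; apply continuous_const. }
set (h := fun w => 1 * y w ^ 2 + 4 * INR n * y w ^ 3 + (4 * INR l * (a * b) * (y' w * eL w) + 0 * 0)).
apply Rle_trans with (RInt h A 0).
- apply (abs_RInt_diff_le (fun w => y w * (s w ^ (n + 2) * r w ^ l)) (fun w => y w * E w) h A 0 HA).
  + intros w. apply continuous_mult_R; [apply y_cont|]. apply continuous_mult_R; [apply s_pow_cont|apply r_pow_cont].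
  + intros w. apply continuous_mult_R; [apply y_cont|apply E_cont].
  + exact Cb.
  + intros w _. pose proof (y_pos w). pose proof (y'_pos w). pose proof (eN_range w). pose proof (r_range w). pose proof (s_range w).
    rewrite <- eN_eL, <- Rmult_minus_distr_l, Rabs_mult, (Rabs_pos_eq (y w)) by lra.
    pose proof (product_diff (s w ^ (n + 2)) (r w ^ l) (eN w) (eL w) (pow_range _ l (r_range w)) ltac:(lra)) as P.
    pose proof (isqrt_exp_diff (y w) n 2 ltac:(lra) ltac:(lia)) as D1.
    pose proof (sqrt_exp_diff0 (y' w) l ltac:(lra) Hl) as D2.
    change (Rabs (s w ^ (n + 2) - eN w) <= y w * eN w + 4 * INR n * (y w ^ 2 * s w ^ (n + 2 + 4))) in D1.
    change (Rabs (r w ^ l - eL w) <= 4 * INR l * (y' w ^ 2 * eL w)) in D2.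
    pose proof (pow_range (s w) (n + 2 + 4) ltac:(lra)) as Ps.
    assert (Q1 : y w * eN w + 4 * INR n * (y w ^ 2 * s w ^ (n + 2 + 4)) <= y w + 4 * INR n * y w ^ 2).
    { apply Rplus_le_compat; [nra|]. apply Rmult_le_compat_l; [lra|]. assert (0 <= y w ^ 2) by apply pow2_ge_0. nra. }
    assert (Q2 : eN w * Rabs (r w ^ l - eL w) <= 4 * INR l * (y' w ^ 2 * eL w)) by (pose proof (Rabs_pos (r w ^ l - eL w)); nra).
    apply Rle_trans with (y w * ((y w + 4 * INR n * y w ^ 2) + 4 * INR l * (y' w ^ 2 * eL w))); [apply Rmult_le_compat_l; lra|].
    unfold h. rewrite <- (y_y' w). apply Req_le. ring.
- unfold h. rewrite Eb.
  rewrite (RInt_pow_primitive y 1 A 0 1), (RInt_pow_primitive y 2 A 0 1) by (try ring; intros; rewrite Rmult_1_l; apply y_derive).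
  rewrite (proj1 at_0). pose proof (y_pos A) as HyA.
  assert (B3 : RInt (fun w => y' w * eL w) A 0 <= 2 * / INR l).
  { rewrite (RInt_ext _ (fun w => y' w * exp (- (INR l / 2 * y' w)))).
    - eapply Rle_trans; [apply (RInt_y'_exp (INR l / 2)); lra|]. apply Req_le. field. lra.
    - intros w _. unfold eL. replace (INR l / 2 * y' w) with (INR l * y' w / 2) by field. reflexivity. }
  assert (Hab : 0 < a * b) by (apply Rmult_lt_0_compat; auto).
  assert (B3' : 4 * INR l * (a * b) * RInt (fun w => y' w * eL w) A 0 <= 8 * (a * b)).
  { eapply Rle_trans; [apply Rmult_le_compat_l; [apply Rmult_le_pos; lra|exact B3]|]. apply Req_le. field. lra. }
  replace (INR 2) with 2 by (simpl; ring). replace (INR 3) with 3 by (simpl; ring).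
  assert (P2 : 0 < y A ^ 2) by (apply pow_lt; auto). assert (P3 : 0 < y A ^ 3) by (apply pow_lt; auto).
  assert (B2 : 4 * INR n * (1 * (a ^ 3 - y A ^ 3) / 3) <= 4 / 3 * z * a ^ 2).
  { apply Rle_trans with (4 * INR n * (1 * a ^ 3 / 3)); [apply Rmult_le_compat_l; lra|]. rewrite <- Haz. apply Req_le. field. }
  assert (0 < z * a ^ 2) by (apply Rmult_lt_0_compat; auto; apply pow_lt; auto).
  assert (0 < a ^ 2) by (apply pow_lt; auto). 
  replace (a * (a + 2 * z * a + 8 * b)) with (a ^ 2 + 2 * (z * a ^ 2) + 8 * (a * b)) by ring. lra.
Qed.

(** For [w >= 0] the weight [y] grows. Differentiating [s^n r^l] trades it for [(l / n) y'], with
    [y' <= b]; [parts_limit] is the same identity for the exponential integrand. *)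
Lemma parts_lattice m B : (1 <= m)%nat -> l = (m + 2)%nat ->
  RInt (fun w => y w * (s w ^ (n + 2) * r w ^ l)) 0 B =
  2 / INR n * (s 0 ^ n * r 0 ^ l - s B ^ n * r B ^ l) + INR l / INR n * RInt (fun w => y' w * (s w ^ n * r w ^ m)) 0 B.
Proof.
intros Hm El. pose proof n_ge_1 as Hn1.
assert (D : forall w, is_derive (fun w => s w ^ n * r w ^ l) w (- (INR n / 2) * (y w * (s w ^ (n + 2) * r w ^ l)) + INR l / 2 * (y' w * (s w ^ n * r w ^ m)))).
{ intros w.
  assert (D2 : is_derive (fun w => r w ^ l) w (y' w * ((INR m + 2) / 2 * r w ^ m))).
  { rewrite El. unfold r. apply (is_derive_comp (fun u => sqrt u ^ (m + 2)) (fun w => 1 - y' w)); [apply is_derive_sqrt_pow; auto|].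
    unfold y'. auto_derive; auto. ring. }
  assert (D := is_derive_mult_R _ _ w _ _ (isqrt_derive a Ha n w) D2). cbv beta in D.
  assert (HLm : INR m + 2 = INR l) by (rewrite El, plus_INR; simpl; ring).
  replace (- (INR n / 2) * (y w * (s w ^ (n + 2) * r w ^ l)) + INR l / 2 * (y' w * (s w ^ n * r w ^ m))) with
    (- (INR n / 2) * (y w * s w ^ (n + 2)) * r w ^ l + s w ^ n * (y' w * ((INR m + 2) / 2 * r w ^ m))) by (rewrite HLm; field).
  exact D. }
assert (C1 : forall w, continuous (fun w => y w * (s w ^ (n + 2) * r w ^ l)) w).
{ intros w. apply continuous_mult_R; [apply y_cont|]. apply continuous_mult_R; [apply s_pow_cont|apply r_pow_cont]. }
assert (C2 : forall w, continuous (fun w => y' w * (s w ^ n * r w ^ m)) w).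
{ intros w. apply continuous_mult_R; [apply y'_cont|]. apply continuous_mult_R; [apply s_pow_cont|apply r_pow_cont]. }
assert (C3 : forall w, continuous (fun w => - (INR n / 2) * (y w * (s w ^ (n + 2) * r w ^ l)) + INR l / 2 * (y' w * (s w ^ n * r w ^ m))) w).
{ intros w. apply continuous_plus_R; (apply continuous_mult_R; [apply continuous_const|]); auto. }
assert (R := is_RInt_unique _ _ _ _ (is_RInt_derive (V := R_CompleteNormedModule) _ _ 0 B (fun x _ => D x) (fun x _ => C3 x))).
rewrite (RInt_lin (fun w => y w * (s w ^ (n + 2) * r w ^ l)) (fun w => y' w * (s w ^ n * r w ^ m))) in R by (apply ex_RInt_cont; auto).
unfold minus, plus, opp in R. simpl in R.
set (I1 := RInt (fun w => y w * (s w ^ (n + 2) * r w ^ l)) 0 B) in *. set (I2 := RInt (fun w => y' w * (s w ^ n * r w ^ m)) 0 B) in *.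
replace (s 0 ^ n * r 0 ^ l - s B ^ n * r B ^ l) with (- (s B ^ n * r B ^ l + - (s 0 ^ n * r 0 ^ l))) by ring.
rewrite <- R. field_sym. lra.
Qed.

Lemma parts_limit B :
  RInt (fun w => y w * E w) 0 B = 2 / INR n * (E 0 - E B) + INR l / INR n * RInt (fun w => y' w * E w) 0 B.
Proof.
pose proof n_ge_1 as Hn1.
assert (D : forall w, is_derive E w (- (INR n / 2) * (y w * E w) + INR l / 2 * (y' w * E w))).
{ intros w. replace (- (INR n / 2) * (y w * E w) + INR l / 2 * (y' w * E w)) with (- (a * INR n / 2 * exp w - b * INR l / 2 * exp (- w)) * E w) by (unfold y, y'; field).
  rewrite Haz, Hbz. unfold E, cosh. auto_derive; auto. unfold Rdiv. ring. }
assert (C1 : forall w, continuous (fun w => y w * E w) w) by (intros w; apply continuous_mult_R; [apply y_cont|apply E_cont]).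
assert (C2 : forall w, continuous (fun w => y' w * E w) w) by (intros w; apply continuous_mult_R; [apply y'_cont|apply E_cont]).
assert (C3 : forall w, continuous (fun w => - (INR n / 2) * (y w * E w) + INR l / 2 * (y' w * E w)) w).
{ intros w. apply continuous_plus_R; (apply continuous_mult_R; [apply continuous_const|]); auto. }
assert (R := is_RInt_unique _ _ _ _ (is_RInt_derive (V := R_CompleteNormedModule) _ _ 0 B (fun x _ => D x) (fun x _ => C3 x))).
rewrite (RInt_lin (fun w => y w * E w) (fun w => y' w * E w)) in R by (apply ex_RInt_cont; auto).
unfold minus, plus, opp in R. simpl in R.
set (I1 := RInt (fun w => y w * E w) 0 B) in *. set (I2 := RInt (fun w => y' w * E w) 0 B) in *.
replace (E 0 - E B) with (- (E B + - E 0)) by ring. rewrite <- R. field_sym. lra.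
Qed.

(** The two integrations by parts are subtracted. As [(l / n) b = a], the remaining integral and the
    boundary term at 0 are of order [a] times small quantities; the boundary term at [B] stays in
    the bound, to be sent to 0. *)
Lemma spacelike_K1_right m B : (1 <= m)%nat -> l = (m + 2)%nat -> 0 <= B ->
  Rabs (RInt (fun w => y w * (s w ^ (n + 2) * r w ^ l)) 0 B - RInt (fun w => y w * E w) 0 B) <=
  a * (16 * a + 9 * b + 2 * z * b) + 4 / INR n * s B ^ n.
Proof.
intros Hm El HB. pose proof n_ge_1 as Hn1. pose proof l_ge_1 as Hl1.
rewrite (parts_lattice m B Hm El), parts_limit.
assert (Hab : 0 < a * b) by (apply Rmult_lt_0_compat; auto).
assert (HI : Rabs (RInt (fun w => y' w * (s w ^ n * r w ^ m)) 0 B - RInt (fun w => y' w * E w) 0 B) <= 8 * (a * b) + b ^ 2 + 2 * z * b ^ 2).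
{ destruct (RInt_lin4 (fun w => y w * s w ^ (n + 2 + 2)) (fun w => y' w ^ 2) (fun w => y' w ^ 3) (fun _ => 0) (4 * INR n * (a * b)) 1 (4 * INR l) 0 0 B) as [Cb Eb].
  { intros; apply continuous_mult_R; [apply y_cont|apply s_pow_cont]. }
  { apply pow_cont, y'_cont. }
  { apply pow_cont, y'_cont. }
  { intros; apply continuous_const. }
  set (h := fun w => 4 * INR n * (a * b) * (y w * s w ^ (n + 2 + 2)) + 1 * y' w ^ 2 + (4 * INR l * y' w ^ 3 + 0 * 0)).
  apply Rle_trans with (RInt h 0 B).
  - apply (abs_RInt_diff_le (fun w => y' w * (s w ^ n * r w ^ m)) (fun w => y' w * E w) h 0 B HB).
    + intros w. apply continuous_mult_R; [apply y'_cont|]. apply continuous_mult_R; [apply s_pow_cont|apply r_pow_cont].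
    + intros w. apply continuous_mult_R; [apply y'_cont|apply E_cont].
    + exact Cb.
    + intros w _. pose proof (y_pos w). pose proof (y'_pos w). pose proof (eN_range w). pose proof (r_range w). pose proof (s_range w).
      rewrite <- eN_eL, <- Rmult_minus_distr_l, Rabs_mult, (Rabs_pos_eq (y' w)) by lra.
      pose proof (product_diff (s w ^ n) (r w ^ m) (eN w) (eL w) (pow_range _ m (r_range w)) ltac:(lra)) as P.
      pose proof (isqrt_exp_le (y w) n ltac:(lra)) as D1. pose proof (isqrt_exp_ge (y w) n ltac:(lra)) as D1'.
      change (eN w <= s w ^ n) in D1. change (s w ^ n - eN w <= 4 * INR n * (y w ^ 2 * s w ^ (n + 4))) in D1'.
      pose proof (sqrt_exp_diff2 (y' w) m ltac:(lra) Hm) as D2. rewrite <- El in D2.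
      change (Rabs (r w ^ m - eL w) <= 4 * INR l * y' w ^ 2 + y' w) in D2.
      rewrite (Rabs_pos_eq (s w ^ n - eN w)) in P by lra.
      assert (Q2 : eN w * Rabs (r w ^ m - eL w) <= 4 * INR l * y' w ^ 2 + y' w) by (pose proof (Rabs_pos (r w ^ m - eL w)); nra).
      apply Rle_trans with (y' w * (4 * INR n * (y w ^ 2 * s w ^ (n + 4)) + (4 * INR l * y' w ^ 2 + y' w))); [apply Rmult_le_compat_l; lra|].
      unfold h. rewrite <- (y_y' w). replace (n + 2 + 2)%nat with (n + 4)%nat by lia. apply Req_le. ring.
  - unfold h. rewrite Eb.
    rewrite (RInt_pow_primitive y' 1 0 B (-1)), (RInt_pow_primitive y' 2 0 B (-1)) by (try ring; intros; replace (-1 * y' w) with (- y' w) by ring; apply y'_derive).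
    rewrite (proj2 at_0). pose proof (y'_pos B) as HyB.
    replace (INR 2) with 2 by (simpl; ring). replace (INR 3) with 3 by (simpl; ring).
    assert (B1 : RInt (fun w => y w * s w ^ (n + 2 + 2)) 0 B <= 2 / INR (n + 2)) by (apply (RInt_isqrt1 a Ha); lia).
    assert (B1' : 4 * INR n * (a * b) * RInt (fun w => y w * s w ^ (n + 2 + 2)) 0 B <= 8 * (a * b)).
    { eapply Rle_trans; [apply Rmult_le_compat_l; [apply Rmult_le_pos; lra|exact B1]|]. rewrite plus_INR. simpl (INR 2).
      replace (4 * INR n * (a * b) * (2 / (INR n + (1 + 1)))) with (8 * (a * b) * (INR n / (INR n + 2))) by (field; lra).
      rewrite <- (Rmult_1_r (8 * (a * b))) at 2. apply Rmult_le_compat_l; [lra|].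
      apply Rmult_le_reg_r with (INR n + 2); [lra|]. unfold Rdiv. rewrite Rmult_assoc, Rinv_l by lra. lra. }
    assert (P2 : 0 < y' B ^ 2) by (apply pow_lt; auto). assert (P3 : 0 < y' B ^ 3) by (apply pow_lt; auto).
    assert (B2 : 4 * INR l * (-1 * (y' B ^ 3 - b ^ 3) / 3) <= 4 / 3 * z * b ^ 2).
    { apply Rle_trans with (4 * INR l * (b ^ 3 / 3)); [apply Rmult_le_compat_l; lra|]. rewrite <- Hbz. apply Req_le. field. }
    assert (0 < z * b ^ 2) by (apply Rmult_lt_0_compat; auto; apply pow_lt; auto).
    assert (0 < b ^ 2) by (apply pow_lt; auto). lra. }
assert (HX : Rabs (s 0 ^ n * r 0 ^ l - E 0) <= 4 * (z * a) + 4 * (z * b)).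
{ rewrite <- eN_eL. pose proof (eN_range 0) as He. pose proof (eL_range 0) as He'. pose proof (s_range 0) as Hs. destruct at_0 as [Y0 Y0'].
  eapply Rle_trans; [apply product_diff; [apply pow_range, r_range|lra]|].
  pose proof (isqrt_exp_le (y 0) n ltac:(lra)) as D1. pose proof (isqrt_exp_ge (y 0) n ltac:(lra)) as D1'.
  pose proof (sqrt_exp_diff0 (y' 0) l ltac:(lra) Hl) as D2.
  change (eN 0 <= s 0 ^ n) in D1. change (s 0 ^ n - eN 0 <= 4 * INR n * (y 0 ^ 2 * s 0 ^ (n + 4))) in D1'.
  change (Rabs (r 0 ^ l - eL 0) <= 4 * INR l * (y' 0 ^ 2 * eL 0)) in D2. rewrite Y0 in D1'. rewrite Y0' in D2.
  rewrite (Rabs_pos_eq (s 0 ^ n - eN 0)) by lra.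
  pose proof (pow_range (s 0) (n + 4) ltac:(lra)) as Ps.
  assert (0 < a ^ 2) by (apply pow_lt; auto). assert (0 < b ^ 2) by (apply pow_lt; auto).
  assert (Q1 : 4 * INR n * (a ^ 2 * s 0 ^ (n + 4)) <= 4 * (z * a)).
  { apply Rle_trans with (4 * INR n * (a ^ 2 * 1)); [apply Rmult_le_compat_l; [lra|apply Rmult_le_compat_l; lra]|]. rewrite <- Haz. apply Req_le. ring. }
  assert (Q2 : 4 * INR l * (b ^ 2 * eL 0) <= 4 * (z * b)).
  { apply Rle_trans with (4 * INR l * (b ^ 2 * 1)); [apply Rmult_le_compat_l; [lra|apply Rmult_le_compat_l; lra]|]. rewrite <- Hbz. apply Req_le. ring. }
  pose proof (Rabs_pos (r 0 ^ l - eL 0)). nra. }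
assert (HB2 : Rabs (E B - s B ^ n * r B ^ l) <= 2 * s B ^ n).
{ rewrite <- eN_eL. pose proof (y_pos B). pose proof (eN_range B). pose proof (eL_range B). pose proof (pow_range _ l (r_range B)). pose proof (s_range B).
  pose proof (isqrt_exp_le (y B) n ltac:(lra)) as D1. change (eN B <= s B ^ n) in D1.
  assert (0 <= s B ^ n) by (apply pow_le; lra). apply Rabs_le. split; nra. }
set (I1 := RInt (fun w => y' w * (s w ^ n * r w ^ m)) 0 B) in *. set (I2 := RInt (fun w => y' w * E w) 0 B) in *.
replace (2 / INR n * (s 0 ^ n * r 0 ^ l - s B ^ n * r B ^ l) + INR l / INR n * I1 - (2 / INR n * (E 0 - E B) + INR l / INR n * I2)) with
  (2 / INR n * (s 0 ^ n * r 0 ^ l - E 0) + 2 / INR n * (E B - s B ^ n * r B ^ l) + INR l / INR n * (I1 - I2)) by (field; lra).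
assert (Hi2 : 0 < 2 / INR n) by (apply Rdiv_lt_0_compat; lra). assert (Hil : 0 < INR l / INR n) by (apply Rdiv_lt_0_compat; lra).
eapply Rle_trans; [apply Rabs_triang|]. eapply Rle_trans; [apply Rplus_le_compat_r, Rabs_triang|].
rewrite !Rabs_mult, (Rabs_pos_eq (2 / INR n)), (Rabs_pos_eq (INR l / INR n)) by lra.
apply (Rmult_le_compat_l (2 / INR n)) in HX, HB2; try lra. apply (Rmult_le_compat_l (INR l / INR n)) in HI; [|lra].
replace (2 / INR n * (4 * (z * a) + 4 * (z * b))) with (a * (8 * a + 8 * b)) in HX by (rewrite <- Haz; field; lra).
replace (2 / INR n * (2 * s B ^ n)) with (4 / INR n * s B ^ n) in HB2 by (field; lra).
assert (Hlb : INR l / INR n * b = a).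
{ replace (INR l / INR n * b) with (b * INR l / INR n) by (field; lra). rewrite Hbz, <- Haz. field. lra. }
replace (INR l / INR n * (8 * (a * b) + b ^ 2 + 2 * z * b ^ 2)) with (INR l / INR n * b * (8 * a + b + 2 * z * b)) in HI by (field; lra).
rewrite Hlb in HI. lra.
Qed.

(** With [l = 1] the exponent cannot be lowered by 2 in the integration by parts. Adjacent to the
    light cone at [n = l = 1] the allowed error is at least of order 1, so it suffices that both
    integrals are close to 2 and at most 2. *)
Lemma spacelike_K1_right_1 B : n = 1%nat -> l = 1%nat -> 0 <= B ->
  Rabs (RInt (fun w => y w * (s w ^ (n + 2) * r w ^ l)) 0 B - RInt (fun w => y w * E w) 0 B) <= 2 * (a + b) + 2 * s B ^ n.
Proof.
intros E1 E2 HB.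
assert (Cs : forall w, continuous (fun w => y w * s w ^ (1 + 2)) w) by (intros; apply continuous_mult_R; [apply y_cont|apply s_pow_cont]).
assert (Ce : forall w, continuous (fun w => y w * eN w) w) by (intros; apply continuous_mult_R; [apply y_cont|apply eN_cont]).
assert (P1 : RInt (fun w => y w * s w ^ (1 + 2)) 0 B = 2 * (s 0 - s B)).
{ assert (D : forall w, is_derive (fun w => -2 * s w ^ 1) w (y w * s w ^ (1 + 2))).
  { intros w. replace (y w * s w ^ (1 + 2)) with (-2 * (- (INR 1 / 2) * (y w * s w ^ (1 + 2)))) by (replace (INR 1) with 1 by reflexivity; set (p := y w * s w ^ (1 + 2)); field).
    apply is_derive_scal, (isqrt_derive a Ha 1). }
  rewrite (is_RInt_unique _ _ _ _ (is_RInt_derive (V := R_CompleteNormedModule) _ _ 0 B (fun x _ => D x) (fun x _ => Cs x))).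
  unfold minus, plus, opp; simpl. ring. }
assert (P2 : RInt (fun w => y w * eN w) 0 B = 2 * (eN 0 - eN B)).
{ assert (D : forall w, is_derive (fun w => -2 * eN w) w (y w * eN w)).
  { intros w. unfold eN, y. rewrite E1. simpl (INR 1). auto_derive; auto. rewrite !Rmult_1_l. unfold Rdiv. field. }
  rewrite (is_RInt_unique _ _ _ _ (is_RInt_derive (V := R_CompleteNormedModule) _ _ 0 B (fun x _ => D x) (fun x _ => Ce x))).
  unfold minus, plus, opp; simpl. ring. }
destruct at_0 as [Y0 Y0'].
assert (Hs0 : 1 - a <= s 0).
{ pose proof (isqrt_bounds (y 0)) as [S1 S2]; [lra|]. rewrite Y0 in *. unfold s. rewrite Y0.
  assert (/ sqrt (1 + a) ^ 2 <= / sqrt (1 + a)).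
  { rewrite <- pow_inv. simpl. nra. }
  rewrite S2 in *. assert (0 < / (1 + a)) by (apply Rinv_0_lt_compat; lra). assert (/ (1 + a) * (1 + a) = 1) by (apply Rinv_l; lra). nra. }
assert (Hr : forall w, 0 <= w -> 1 - b <= r w).
{ intros w Hw. assert (Hy' : y' w <= b). { unfold y'. assert (exp (- w) <= 1) by (rewrite <- exp_0; apply exp_le; lra). nra. }
  unfold r. destruct (Rle_lt_dec (1 - y' w) 0); [rewrite sqrt_neg_0 by auto; lra|].
  pose proof (y'_pos w). pose proof (sqrt_sqrt (1 - y' w) ltac:(lra)). pose proof (r_range w) as Hr. unfold r in Hr. nra. }
assert (He0 : 1 - a <= eN 0).
{ unfold eN. rewrite Y0, E1. simpl (INR 1). pose proof (exp_ge_1p (- (1 * a / 2))). lra. }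
assert (HeL : forall w, 0 <= w -> 1 - b <= eL w).
{ intros w Hw. assert (Hy' : y' w <= b). { unfold y'. assert (exp (- w) <= 1) by (rewrite <- exp_0; apply exp_le; lra). nra. }
  unfold eL. rewrite E2. simpl (INR 1). pose proof (exp_ge_1p (- (1 * y' w / 2))). lra. }
assert (HeB : eN B <= s B).
{ pose proof (y_pos B). pose proof (isqrt_exp_le (y B) n ltac:(lra)) as D. change (eN B <= s B ^ n) in D. rewrite E1, pow_1 in D. exact D. }
assert (G : forall f g : R -> R, (forall w, continuous f w) -> (forall w, continuous g w) -> (forall w, 0 <= f w) -> (forall w, 0 <= g w <= 1) -> (forall w, 0 <= w -> 1 - b <= g w) ->
  RInt f 0 B <= 2 -> (1 - b) * RInt f 0 B <= RInt (fun w => f w * g w) 0 B <= 2 /\ 0 <= RInt (fun w => f w * g w) 0 B).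
{ intros f g Cf Cg Hf Hg Hgb HI. assert (Cfg : forall w, continuous (fun w => f w * g w) w) by (intros; apply continuous_mult_R; auto).
  split; [split|].
  - assert (EX : (1 - b) * RInt f 0 B = RInt (fun w => (1 - b) * f w) 0 B) by (symmetry; exact (RInt_scal_R f (1 - b) 0 B (ex_RInt_cont _ 0 B Cf))).
    rewrite EX. apply RInt_le; auto; try (apply ex_RInt_cont; auto).
    + intros x. apply continuous_mult_R; auto. apply continuous_const.
    + intros w Hw. rewrite Rmult_comm. apply Rmult_le_compat_l; auto. apply Hgb; lra.
  - eapply Rle_trans; [|exact HI]. apply RInt_le; auto; try (apply ex_RInt_cont; auto).
    intros w Hw. pose proof (Hf w). pose proof (Hg w). nra.
  - apply RInt_ge_0; auto; [apply ex_RInt_cont; auto|]. intros. apply Rmult_le_pos; auto. apply Hg. }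
pose proof (s_range 0). pose proof (s_range B). pose proof (eN_range 0). pose proof (eN_range B).
destruct (G (fun w => y w * s w ^ (1 + 2)) (fun w => r w ^ 1)) as [[G1 G2] G3]; auto.
{ intros; apply r_pow_cont. }
{ intros w. apply Rmult_le_pos; [left; apply y_pos|]. apply pow_le. left; apply s_range. }
{ intros w. apply pow_range, r_range. }
{ intros w Hw. rewrite pow_1. auto. }
{ rewrite P1. lra. }
destruct (G (fun w => y w * eN w) eL) as [[G4 G5] G6]; auto.
{ apply eL_cont. }
{ intros w. apply Rmult_le_pos; left; [apply y_pos|apply eN_range]. }
{ intros w. pose proof (eL_range w). lra. }
{ rewrite P2. lra. }
rewrite P1 in G1. rewrite P2 in G4.
rewrite (RInt_ext (fun w => y w * (s w ^ (n + 2) * r w ^ l)) (fun w => y w * s w ^ (1 + 2) * r w ^ 1)) by (intros; rewrite E1, E2; ringR).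
rewrite (RInt_ext (fun w => y w * E w) (fun w => y w * eN w * eL w)) by (intros; rewrite <- eN_eL; ringR).
set (I1 := RInt (fun w => y w * s w ^ (1 + 2) * r w ^ 1) 0 B) in *. set (I2 := RInt (fun w => y w * eN w * eL w) 0 B) in *.
rewrite E1, pow_1.
assert (X1 : 2 - 2 * (a + b) - 2 * s B <= I1) by (destruct (Rle_lt_dec b 1); nra).
assert (X2 : 2 - 2 * (a + b) - 2 * s B <= I2) by (destruct (Rle_lt_dec b 1); nra).
apply Rabs_le. lra.
Qed.
End SpacelikeIntegrals.

Lemma Cmod_parts (u : C) e : Cmod u <= e -> Rabs (fst u) <= e /\ Rabs (snd u) <= e.
Proof.
intros H. pose proof (Rmax_Cmod u) as Hm. pose proof (Rmax_l (Rabs (fst u)) (Rabs (snd u))). pose proof (Rmax_r (Rabs (fst u)) (Rabs (snd u))). lra.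
Qed.

(** * The circle at infinity *)

Section FarArc.
Variable M : R.
Hypothesis HM : 0 < M.
Let c := norm1 M.

Lemma Cmod_sfac_far phi v : 0 <= phi <= PI -> 2 <= M * exp v -> c * (M * exp v) / 2 <= Cmod (sfac M phi v) ^ 2.
Proof.
intros Hp HY. pose proof (norm1_pos M) as Hc. fold c in Hc.
assert (H := Cmod_sfac_4 M HM phi v Hp). set (Y := M * exp v) in *. set (S := Cmod (sfac M phi v)) in *.
assert (Hc2 : / (1 + M * M) = c ^ 2).
{ pose proof (norm1_sqr M) as N. fold c in N. apply Rmult_eq_reg_r with (1 + M * M); [|nra]. rewrite Rinv_l by nra. lra. }
rewrite Hc2 in H.
assert (HS : 0 <= S ^ 2) by apply pow2_ge_0.
assert (Hge : (c * Y / 2) ^ 2 <= (S ^ 2) ^ 2).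
{ replace ((S ^ 2) ^ 2) with (S ^ 4) by ring. rewrite H. pose proof (COS_bound phi) as Cb.
  replace ((c * Y / 2) ^ 2) with (c ^ 2 * (Y / 2) ^ 2) by field. apply Rmult_le_compat_l; [apply pow2_ge_0|].
  assert (0 <= Y * (1 + cos phi)) by (apply Rmult_le_pos; lra). nra. }
assert (0 <= c * Y / 2) by (assert (0 <= c * Y) by (apply Rmult_le_pos; lra); lra).
destruct (Rle_lt_dec (c * Y / 2) (S ^ 2)) as [|Hlt]; auto. exfalso. nra.
Qed.

Lemma Cmod_tfac_far phi v : 0 <= phi <= PI -> M * exp (- v) <= 1 -> Cmod (tfac M phi v) <= 2.
Proof.
intros Hp HY. assert (H := Cmod_tfac_4 M HM phi v Hp). set (Y := M * exp (- v)) in *. set (S := Cmod (tfac M phi v)) in *.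
assert (HY0 : 0 < Y) by (apply Rmult_lt_0_compat; auto; apply exp_pos).
assert (Hi : 0 < / (1 + M * M) <= 1).
{ split; [apply Rinv_0_lt_compat; nra|]. apply Rle_trans with (/ 1); [apply Rinv_le_contravar; nra|rewrite Rinv_1; lra]. }
pose proof (COS_bound phi) as Cb.
assert (0 <= Y * (1 + cos phi)) by (apply Rmult_le_pos; lra).
assert (0 <= Y * (1 - cos phi)) by (apply Rmult_le_pos; lra).
assert (H4 : S ^ 4 <= 4) by (rewrite H; assert (0 <= 1 - 2 * Y * cos phi + Y ^ 2 <= 4) by nra; nra).
assert (0 <= S) by apply Cmod_ge_0.
destruct (Rle_lt_dec S 2) as [|Hlt]; auto. exfalso.
assert (4 < S * S) by nra. assert (16 < S ^ 4) by (replace (S ^ 4) with ((S * S) * (S * S)) by ring; nra). lra.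
Qed.

(** As [v] grows, [|sfac|^2] grows like [e^v] while [tfac] stays bounded, so negative powers tend to
    0. The factor [eta] costs at most [2 |sfac|^2], which is why the second claim asks for
    [p >= 3]. *)
Lemma arc_vanishes (p l : Z) e : (2 <= p)%Z -> 0 < e -> exists V, - ln M < V /\ forall v phi, V <= v -> 0 <= phi <= PI ->
  Cmod (contour_fun M (- p) l phi v) <= e /\ ((3 <= p)%Z -> Cmod (contour_fun2 M (- p) l phi v) <= e).
Proof.
intros Hp He. pose proof (norm1_pos M) as Hc. pose proof (norm1_lt_1 M HM) as Hc1. fold c in Hc, Hc1.
set (T := 2 ^ Z.to_nat l). assert (HT : 0 < T) by (apply pow_lt; lra).
set (Q := 2 * T / e). assert (HQ : 0 < Q) by (apply Rdiv_lt_0_compat; lra).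
(* The first entry forces [|sfac|^2 >= 1 + Q^2], hence [2 T / |sfac| <= e]; the second gives
   [M e^(- v) <= 1]; the third lies strictly beyond the singularity. *)
exists (Rmax (ln (2 * (1 + Q ^ 2) / (c * M))) (Rmax (ln M) (- ln M + 1))).
split; [pose proof (Rmax_r (ln (2 * (1 + Q ^ 2) / (c * M))) (Rmax (ln M) (- ln M + 1))); pose proof (Rmax_r (ln M) (- ln M + 1)); lra|].
intros v phi Hv Hphi.
assert (V1 : ln (2 * (1 + Q ^ 2) / (c * M)) <= v) by (eapply Rle_trans; [apply Rmax_l|exact Hv]).
assert (V2 : ln M <= v).
{ eapply Rle_trans; [apply Rmax_l|]. eapply Rle_trans; [apply Rmax_r|exact Hv]. }
assert (HQ2 : 0 < Q ^ 2) by (apply pow_lt; auto).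
assert (HcM : 0 < c * M) by (apply Rmult_lt_0_compat; auto).
apply exp_le in V1. rewrite exp_ln in V1 by (apply Rdiv_lt_0_compat; lra).
apply exp_le in V2. rewrite exp_ln in V2 by auto.
assert (HX : 1 + Q ^ 2 <= c * (M * exp v) / 2).
{ apply (Rmult_le_compat_l (c * M)) in V1; [|lra]. replace (c * M * (2 * (1 + Q ^ 2) / (c * M))) with (2 * (1 + Q ^ 2)) in V1 by (field; split; apply Rgt_not_eq; auto). lra. }
assert (HY : 2 <= M * exp v).
{ assert (0 < M * exp v) by (apply Rmult_lt_0_compat; auto; apply exp_pos). nra. }
assert (HY' : M * exp (- v) <= 1).
{ rewrite exp_Ropp. pose proof (exp_pos v). apply Rmult_le_reg_r with (exp v); auto. rewrite Rmult_assoc, Rinv_l by lra. lra. }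
pose proof (Cmod_sfac_far phi v Hphi HY) as HS. pose proof (Cmod_tfac_far phi v Hphi HY') as HTf.
set (S := Cmod (sfac M phi v)) in *. assert (HS0 : 0 <= S) by apply Cmod_ge_0.
assert (HSQ : Q <= S) by (destruct (Rle_lt_dec Q S); auto; nra).
assert (HS1 : 1 <= S) by (destruct (Rle_lt_dec 1 S); auto; nra).
assert (Hne : sfac M phi v <> RtoC 0) by (intros E0; unfold S in HS1; rewrite E0, Cmod_0 in HS1; lra).
assert (HiS : 0 < / S <= 1) by (split; [apply Rinv_0_lt_compat; lra|apply Rle_trans with (/ 1); [apply Rinv_le_contravar; lra|rewrite Rinv_1; lra]]).
assert (HiQ : 2 * T * / S <= e).
{ apply Rmult_le_reg_r with S; [lra|]. rewrite Rmult_assoc, Rinv_l, Rmult_1_r by lra.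
  apply (Rmult_le_compat_l e) in HSQ; [|lra]. unfold Q in HSQ. replace (e * (2 * T / e)) with (2 * T) in HSQ by (field; lra). exact HSQ. }
assert (HTl : 0 <= Cmod (tfac M phi v) ^ Z.to_nat l <= T).
{ split; [apply pow_le, Cmod_ge_0|]. apply pow_incr. split; [apply Cmod_ge_0|auto]. }
assert (EC : Cmod (contour_fun M (- p) l phi v) = (/ S) ^ Z.to_nat p * Cmod (tfac M phi v) ^ Z.to_nat l).
{ unfold contour_fun, zpow. destruct (Z.leb_spec 0 (- p)); [lia|]. rewrite Z.opp_involutive, Cmod_mult, !Cmod_pow, Cmod_inv by auto. reflexivity. }
assert (Hpw : forall q, (q <= Z.to_nat p)%nat -> (/ S) ^ Z.to_nat p <= (/ S) ^ q).
{ intros q Hq. replace (Z.to_nat p) with (q + (Z.to_nat p - q))%nat by lia. rewrite pow_add.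
  assert (0 <= (/ S) ^ q) by (apply pow_le; lra). pose proof (pow_incr (/ S) 1 (Z.to_nat p - q) ltac:(lra)) as P. rewrite pow1 in P. nra. }
assert (HP0 : 0 <= (/ S) ^ Z.to_nat p) by (apply pow_le; lra).
split.
- rewrite EC. pose proof (Hpw 1%nat ltac:(lia)) as P. rewrite pow_1 in P.
  apply Rle_trans with (/ S * T); [apply Rmult_le_compat; lra|]. assert (0 < / S * T) by (apply Rmult_lt_0_compat; lra). lra.
- intros Hp3. unfold contour_fun2. rewrite !Cmod_mult, EC. fold c.
  assert (Eeta : Cmod (eta phi v) = exp v).
  { unfold eta, Cmod; cbn [fst snd]. pose proof (sin2_cos2 phi) as T2. unfold Rsqr in T2.
    replace ((exp v * cos phi) ^ 2 + (exp v * sin phi) ^ 2) with (exp v * exp v * (sin phi * sin phi + cos phi * cos phi)) by ring.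
    rewrite T2, Rmult_1_r. apply sqrt_square. left; apply exp_pos. }
  rewrite Eeta, Cmod_R, Rabs_pos_eq by lra.
  pose proof (Hpw 3%nat ltac:(lia)) as P.
  assert (HcY : 0 < c * (M * exp v)) by (rewrite <- Rmult_assoc; apply Rmult_lt_0_compat; auto; apply exp_pos).
  apply Rle_trans with (2 * S ^ 2 * ((/ S) ^ 3 * T)).
  + replace (c * M * (exp v * ((/ S) ^ Z.to_nat p * Cmod (tfac M phi v) ^ Z.to_nat l))) with
      (c * (M * exp v) * ((/ S) ^ Z.to_nat p * Cmod (tfac M phi v) ^ Z.to_nat l)) by ring.
    apply Rmult_le_compat; try lra; [apply Rmult_le_pos; lra|]. apply Rmult_le_compat; lra.
  + replace (2 * S ^ 2 * ((/ S) ^ 3 * T)) with (2 * T * / S) by (field; lra). exact HiQ.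
Qed.
End FarArc.

(** The integrand vanishes to the left of [v0], so the start of the curve may be replaced by
    [ell - B], which makes the window symmetric about the circle. *)
Lemma RInt_window (h : R -> R) ell v0 p B : (forall x, continuous h x) -> (forall v, v <= v0 -> h v = 0) ->
  p <= v0 -> ell - B <= v0 -> RInt h p (ell + B) = RInt (fun w => h (ell + w)) (- B) B.
Proof.
intros Hh H0 Hp HB.
assert (E : RInt h (ell + - B) (ell + B) = RInt (fun w => h (ell + w)) (- B) B).
{ assert (E := RInt_comp (V := R_CompleteNormedModule) h (fun w => ell + w) (fun _ => 1) (- B) B). cbv beta in E. rewrite <- E.
  - apply RInt_ext. intros; unfold scal; simpl; unfold mult; simpl. rewrite Rmult_1_l. reflexivity.
  - intros; apply Hh.
  - intros w _. split; [auto_derive; auto; ring|apply continuous_const]. }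
rewrite <- E. rewrite <- (RInt_Chasles h p (ell + - B) (ell + B)) by (apply ex_RInt_cont; auto).
rewrite (RInt_vanish h p (ell + - B)); [apply Rplus_0_l|].
intros v Hv. apply H0. pose proof (Rmax_lub p (ell + - B) v0 Hp HB). lra.
Qed.

(** * Estimates in the variables [N = x - t], [L = x + t] *)

Section Spacelike.
Variables (M : R) (Nz Lz : Z).
Hypothesis HM : 0 < M.
Hypothesis HN : (1 <= Nz)%Z.
Hypothesis HL : (1 <= Lz)%Z.
Hypothesis HNL : (Nz <= Lz)%Z.
Let c := norm1 M.
Let N := IZR Nz.
Let L := IZR Lz.
Let n := Z.to_nat Nz.
Let l := Z.to_nat Lz.
Let ell := cone_log Nz Lz.
Let a := M * exp ell.
Let b := M * exp (- ell).
Let z := M * sqrt (N * L).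
Let err := a + b + z * (a + b) + / N + / L.
Let ct := sqrt c ^ (l - n).
Let s w := / sqrt (1 + a * exp w).
Let r w := sqrt (1 - b * exp (- w)).
Let E w := exp (- (z * cosh w)).

Lemma spacelike_facts : 0 < a /\ 0 < b /\ 0 < z /\ a * N = z /\ b * L = z /\ a * b = M * M.
Proof. exact (cone_facts M Nz Lz HM HN HL). Qed.

Lemma N_ge_1 : 1 <= N. Proof. apply IZR_le; auto. Qed.
Lemma L'_ge_1 : 1 <= L. Proof. apply IZR_le; auto. Qed.
Lemma INR_n : INR n = N.
Proof. apply to_nat_INR; auto; lia. Qed.
Lemma INR_l : INR l = L.
Proof. apply to_nat_INR; auto; lia. Qed.

Lemma ct_bounds : 0 <= ct <= 1 /\ 1 - ct <= z * (a + b).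
Proof.
destruct spacelike_facts as (Ha & Hb & Hz & Haz & Hbz & Hab). pose proof N_ge_1. pose proof L'_ge_1.
destruct (sqrt_norm1_pow_bounds M (l - n)) as [C1 C2]. fold c ct in C1, C2.
assert (Hct0 : 0 <= ct) by (apply pow_le, sqrt_pos). split; [lra|].
rewrite minus_INR in C1 by (unfold l, n; lia). rewrite INR_n, INR_l, <- Hab in C1.
assert (Q : (L - N) * (a * b) / 4 <= (L + N) * (a * b)).
{ assert (0 < a * b) by (apply Rmult_lt_0_compat; auto). nra. }
replace (z * (a + b)) with (z * b + z * a) by ring.
replace ((L + N) * (a * b)) with (b * L * a + a * N * b) in Q by ring. rewrite Haz, Hbz in Q. lra.
Qed.

Lemma contour_fun_0_neg p q v : (0 < p)%Z -> (0 <= q)%Z -> Z.odd q = true -> 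
  fst (contour_fun M (- p) q 0 v) = (/ (sqrt c * sqrt (1 + M * exp v))) ^ Z.to_nat p * (sqrt c * sqrt (1 - M * exp (- v))) ^ Z.to_nat q.
Proof.
intros Hp Hq Ho. unfold contour_fun, zpow. destruct (Z.leb_spec 0 (- p)); [lia|]. rewrite Z.opp_involutive.
rewrite (sfac_0_real M HM). fold c.
assert (P : sqrt c * sqrt (1 + M * exp v) <> 0).
{ apply Rgt_not_eq. apply Rmult_lt_0_compat; apply sqrt_lt_R0; [apply norm1_pos|]. pose proof (Rmult_lt_0_compat _ _ HM (exp_pos v)). lra. }
rewrite <- RtoC_inv by auto. rewrite <- RtoC_pow. unfold tfac. rewrite vfac_0. fold c. rewrite Cmult_comm, (proj1 (re_mult_R _ _)).
rewrite csqrt_pow_odd by (apply to_nat_odd; auto). apply Rmult_comm.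
Qed.

(** Beyond the singularity [sfac] is purely imaginary on this ray and its odd powers have no real
    part: the side [phi = PI] contributes nothing. *)
Lemma contour_fun_PI_neg p q v : (0 < p)%Z -> (0 <= q)%Z -> Z.odd p = true -> - ln M < v -> fst (contour_fun M (- p) q PI v) = 0.
Proof.
intros Hp Hq Ho Hv. unfold contour_fun, zpow. destruct (Z.leb_spec 0 (- p)); [lia|]. rewrite Z.opp_involutive.
rewrite (tfac_PI_pow M HM). fold c. rewrite (proj1 (re_mult_R _ _)). unfold sfac. rewrite ufac_PI, csqrt_up_real. fold c.
assert (He : 1 < M * exp v).
{ apply exp_increasing in Hv. rewrite exp_Ropp, exp_ln in Hv by auto.
  apply Rmult_lt_reg_l with (/ M); [apply Rinv_0_lt_compat; auto|]. rewrite <- Rmult_assoc, Rinv_l, Rmult_1_l by lra. lra. }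
rewrite (sqrt_neg_0 (1 - M * exp v)) by lra.
replace (- (1 - M * exp v)) with (M * exp v - 1) by ring.
assert (P : 0 < sqrt c * sqrt (M * exp v - 1)) by (apply Rmult_lt_0_compat; apply sqrt_lt_R0; [apply norm1_pos|lra]).
replace (/ (RtoC (sqrt c) * (0, sqrt (M * exp v - 1))))%C with ((0, - / (sqrt c * sqrt (M * exp v - 1))) : C).
- destruct (to_nat_odd p ltac:(lia) Ho) as [m ->]. rewrite (proj1 (Cpow_imag _ _)). apply Rmult_0_l.
- unfold Cinv, Cmult, RtoC; cbn [fst snd]. 
  set (u := sqrt c) in *. set (x := sqrt (M * exp v - 1)) in *.
  assert (u <> 0) by (intros E0; rewrite E0 in P; lra). assert (x <> 0) by (intros E0; rewrite E0 in P; lra).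
  replace (u * 0 - 0 * x) with 0 by ring. replace (u * x + 0 * 0) with (u * x) by ring.
  f_equal; field; auto.
Qed.

(** The negative power contributes inverse powers of [sqrt c], so only the power [l - n] of the
    normalization survives; it is nonnegative because [N <= L]. *)
Lemma sqrt_c_powers p q : (q + 2 = p + (l - n))%nat -> c * (/ sqrt c) ^ p * sqrt c ^ q = ct.
Proof.
intros H. assert (Hs : 0 < sqrt c) by (apply sqrt_lt_R0, norm1_pos).
assert (Hc2 : c = sqrt c * sqrt c) by (symmetry; apply sqrt_norm1_sqr_R).
apply Rmult_eq_reg_l with (sqrt c ^ p); [|apply pow_nonzero; lra].
unfold ct. rewrite <- pow_add, <- H, pow_inv, pow_add. rewrite Hc2 at 2. field. apply pow_nonzero. lra.
Qed.

Lemma spacelike_window p q (g : R -> R) B : (0 < p)%Z -> (0 <= q)%Z -> Z.odd q = true -> (Z.to_nat q + 2 = Z.to_nat p + (l - n))%nat ->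
  (forall x, continuous g x) -> ell - B <= ln M ->
  RInt (fun v => g v * (c * fst (contour_fun M (- p) q 0 v))) (ell + B) (path M 0) =
  - (ct * RInt (fun w => g (ell + w) * (s w ^ Z.to_nat p * r w ^ Z.to_nat q)) (- B) B).
Proof.
intros Hp Hq Ho Hpq Hg HB.
assert (Hs : 0 < sqrt c) by (apply sqrt_lt_R0, norm1_pos).
set (h := fun v => g v * (ct * ((/ sqrt (1 + M * exp v)) ^ Z.to_nat p * sqrt (1 - M * exp (- v)) ^ Z.to_nat q))).
assert (Cr : forall x, continuous (fun v => sqrt (1 - M * exp (- v)) ^ Z.to_nat q) x).
{ apply (pow_cont (fun v => sqrt (1 - M * exp (- v)))). intros x. apply (continuous_comp (fun v => 1 - M * exp (- v)) sqrt); [|apply continuous_sqrt].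
  apply (ex_derive_continuous (V := R_NormedModule)). auto_derive. auto. }
assert (Ch : forall x, continuous h x).
{ intros x. apply continuous_mult_R; auto. apply continuous_mult_R; [apply continuous_const|]. apply continuous_mult_R; auto.
  apply (isqrt_cont M HM). }
rewrite (RInt_ext _ h).
2:{ intros v _. unfold h. rewrite contour_fun_0_neg by auto. rewrite Rinv_mult, !Rpow_mult_distr.
    rewrite <- (sqrt_c_powers _ _ Hpq). ringR. }
assert (W : RInt h (path M 0) (ell + B) = RInt (fun w => h (ell + w)) (- B) B).
{ apply (RInt_window h ell (ln M) (path M 0) B); auto.
  - intros v Hv. unfold h. apply exp_le in Hv. rewrite exp_ln in Hv by auto.
    assert (1 <= M * exp (- v)).
    { rewrite exp_Ropp. pose proof (exp_pos v). apply Rmult_le_reg_r with (exp v); auto. rewrite Rmult_assoc, Rinv_l by lra. lra. }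
    rewrite (sqrt_neg_0 (1 - M * exp (- v))) by lra.
    destruct (to_nat_odd q Hq Ho) as [m ->]. rewrite (pow_i (2 * m + 1)) by lia. ring.
  - left. apply path_0_lt; auto. }
assert (Es : RInt h (ell + B) (path M 0) = - RInt h (path M 0) (ell + B)).
{ symmetry. apply (opp_RInt_swap h). apply ex_RInt_cont; auto. }
rewrite Es, W. f_equal.
assert (Cs : forall x, continuous (fun w => g (ell + w) * (s w ^ Z.to_nat p * r w ^ Z.to_nat q)) x).
{ intros x. apply continuous_mult_R.
  - apply (continuous_comp (fun w => ell + w) g); auto. apply (continuous_plus (V := R_NormedModule)); [apply continuous_const|apply continuous_id].
  - destruct spacelike_facts as (Ha & _). apply continuous_mult_R; [apply (isqrt_cont a Ha)|].
    apply (pow_cont r). intros y. apply (continuous_comp (fun w => 1 - b * exp (- w)) sqrt); [|apply continuous_sqrt].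
    apply (ex_derive_continuous (V := R_NormedModule)). auto_derive. auto. }
transitivity (RInt (fun w => ct * (g (ell + w) * (s w ^ Z.to_nat p * r w ^ Z.to_nat q))) (- B) B).
- apply RInt_ext. intros w _. unfold h, s, r, a, b. rewrite exp_plus. replace (- (ell + w)) with (- ell + - w) by ring. rewrite exp_plus.
  rewrite <- !Rmult_assoc. ringR.
- exact (RInt_scal_R _ ct _ _ (ex_RInt_cont _ _ _ Cs)).
Qed.

Lemma err_pos' : 0 < err.
Proof. exact (err_pos M Nz Lz HM HN HL). Qed.

Lemma RInt_cosh_exp_cosh B : 0 <= B -> 0 <= RInt (fun w => cosh w * E w) 0 B <= / z.
Proof.
intros HB. destruct spacelike_facts as (Ha & Hb & Hz & _).
assert (C1 : forall w, continuous (fun w => cosh w * E w) w).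
{ intros w. apply continuous_mult_R; [apply cosh_cont|]. apply (ex_derive_continuous (V := R_NormedModule)). unfold E, cosh. auto_derive. auto. }
assert (C2 : forall w, continuous (fun w => cosh w * exp (- (z * sinh w))) w) by (intros; apply continuous_mult_R; [apply cosh_cont|apply exp_sinh_cont]).
split.
- apply RInt_ge_0; auto; [apply ex_RInt_cont; auto|]. intros w _. pose proof (cosh_ge_1 w). apply Rmult_le_pos; [lra|left; apply exp_pos].
- eapply Rle_trans; [|apply (RInt_cosh_exp_sinh z B Hz)]. apply RInt_le; auto; try (apply ex_RInt_cont; auto).
  intros w Hw. pose proof (cosh_ge_1 w). apply Rmult_le_compat_l; [lra|]. apply exp_le. 
  assert (sinh w <= cosh w) by (unfold sinh, cosh; pose proof (exp_pos (- w)); lra). nra.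
Qed.

Lemma E_continuous w : continuous E w.
Proof. apply (ex_derive_continuous (V := R_NormedModule)). unfold E, cosh. auto_derive. auto. Qed.

Lemma E_even w : E (- w) = E w.
Proof. unfold E, cosh. rewrite Ropp_involutive. f_equal. f_equal. f_equal. field. Qed.

Lemma RInt_symmetric (h : R -> R) B : (forall x, continuous h x) -> RInt h (- B) B = RInt (fun w => h w + h (- w)) 0 B.
Proof.
intros Hh. assert (Hm : forall x, continuous (fun w => h (- w)) x).
{ intros x. apply (continuous_comp Ropp h); auto. apply (continuous_opp (V := R_NormedModule)), continuous_id. }
rewrite (RInt_plus_R h (fun w => h (- w))) by (apply ex_RInt_cont; auto).
rewrite <- (RInt_Chasles h (- B) 0 B) by (apply ex_RInt_cont; auto).
rewrite (RInt_negate h 0 B Hh), Ropp_0. unfold plus; simpl. apply Rplus_comm.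
Qed.

Lemma arc_small (f : R -> R) e : (forall x, continuous f x) -> (forall x, 0 <= x <= PI -> Rabs (f x) <= e) -> Rabs (RInt f 0 PI) <= PI * e.
Proof.
intros Hf He. pose proof PI_RGT_0.
pose proof (abs_RInt_diff_const f (fun _ => 0) e Hf (fun x => continuous_const 0 x)) as H0.
rewrite RInt_const in H0. unfold scal in H0; simpl in H0; unfold mult in H0; simpl in H0. rewrite Rmult_0_r, Rminus_0_r in H0.
apply H0. intros x Hx. rewrite Rminus_0_r. auto.
Qed.

(** Shifting the contour to level [ell + B] and letting [B] grow, the arc becomes smaller than any
    [e] and the side [phi = PI] has zero real part. What remains is the side [phi = 0], the real
    integral over [[- B, B]] around [ell]. *)
Lemma contour_window p q : (2 <= p)%Z -> (0 <= q)%Z -> Z.odd p = true -> Z.odd q = true -> (Z.to_nat q + 2 = Z.to_nat p + (l - n))%nat ->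
  forall e, 0 < e -> exists B0, forall B, B0 <= B ->
  Rabs (c * fst (contour_int M (- p) q) - ct * RInt (fun w => s w ^ Z.to_nat p * r w ^ Z.to_nat q) (- B) B) <= e.
Proof.
intros Hp Hq Op Oq Hpq e He. pose proof PI_RGT_0 as Hpi. pose proof (norm1_pos M) as Hc. pose proof (norm1_lt_1 M HM) as Hc1. fold c in Hc, Hc1.
destruct (arc_vanishes M HM p q (e / PI)) as [V [HV Hsm]]; [auto|apply Rdiv_lt_0_compat; lra|].
exists (Rmax (V - ell) (ell - ln M)). intros B HB.
assert (B1 : V <= ell + B) by (pose proof (Rmax_l (V - ell) (ell - ln M)); lra).
assert (B2 : ell - B <= ln M) by (pose proof (Rmax_r (V - ell) (ell - ln M)); lra).
unfold contour_int. rewrite (contour_fun_shift M HM (- p) q (ell + B)) by (right; lra).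
unfold CInt, Cminus, Cplus, Copp, Cmult at 2, Ci. cbn [fst snd].
rewrite (RInt_vanish (fun v => fst (contour_fun M (- p) q PI v)) (ell + B) (path M PI)).
2:{ intros v Hv. apply contour_fun_PI_neg; auto; try lia. pose proof (path_PI_gt M HM). 
    assert (- ln M < Rmin (ell + B) (path M PI)) by (apply Rmin_glb_lt; lra). lra. }
pose proof (spacelike_window p q (fun _ => 1) B ltac:(lia) Hq Oq Hpq (fun x => continuous_const 1 x) B2) as W. cbv beta in W.
assert (Ef : ex_RInt (fun v => fst (contour_fun M (- p) q 0 v)) (ell + B) (path M 0)).
{ apply ex_RInt_cont. intros v. pose proof (locally_singleton _ _ (contour_fun_c2_0 M HM (- p) q)) as H2.
  exact (continuous_of_2d (fun p0 v => fst (contour_fun M (- p) q p0 v)) _ _ (proj1 (H2 v))). }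
assert (W' : c * RInt (fun v => fst (contour_fun M (- p) q 0 v)) (ell + B) (path M 0) = - (ct * RInt (fun w => s w ^ Z.to_nat p * r w ^ Z.to_nat q) (- B) B)).
{ transitivity (RInt (fun v => 1 * (c * fst (contour_fun M (- p) q 0 v))) (ell + B) (path M 0)).
  - transitivity (RInt (fun v => c * fst (contour_fun M (- p) q 0 v)) (ell + B) (path M 0)).
    + symmetry. exact (RInt_scal_R _ c _ _ Ef).
    + apply RInt_ext. intros v _. symmetry. exact (Rmult_1_l _).
  - rewrite W. do 2 f_equal. apply RInt_ext. intros v _. exact (Rmult_1_l _). }
set (F := fun phi => snd (contour_fun M (- p) q phi (ell + B))).
assert (HF : Rabs (RInt F 0 PI) <= PI * (e / PI)).
{ apply arc_small.
  - intros x. apply (continuous_of_2d_l (fun p0 v => snd (contour_fun M (- p) q p0 v))). apply (contour_fun_c2 M). right. apply ufac_neq_0_far; auto. lra.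
  - intros x Hx. apply Cmod_parts, Hsm; auto. }
replace (PI * (e / PI)) with e in HF by (field; lra).
set (I1 := RInt (fun v => fst (contour_fun M (- p) q 0 v)) (ell + B) (path M 0)) in *.
set (I2 := RInt (fun w => s w ^ Z.to_nat p * r w ^ Z.to_nat q) (- B) B) in *.
match goal with |- Rabs ?u <= _ => replace u with (- (c * RInt F 0 PI)) end.
- rewrite Rabs_Ropp, Rabs_mult, (Rabs_pos_eq c) by lra. pose proof (Rabs_pos (RInt F 0 PI)). nra.
- fold F. simpl in W' |- *. set (G := RInt F 0 PI) in *. nra.
Qed.

Lemma contour_window2 p q : (3 <= p)%Z -> (0 <= q)%Z -> Z.odd p = true -> Z.odd q = true -> (Z.to_nat q + 2 = Z.to_nat p + (l - n))%nat ->
  forall e, 0 < e -> exists B0, forall B, B0 <= B ->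
  Rabs (fst (contour_int2 M (- p) q) - ct * RInt (fun w => a * exp w * (s w ^ Z.to_nat p * r w ^ Z.to_nat q)) (- B) B) <= e.
Proof.
intros Hp Hq Op Oq Hpq e He. pose proof PI_RGT_0 as Hpi.
destruct (arc_vanishes M HM p q (e / PI)) as [V [HV Hsm]]; [lia|apply Rdiv_lt_0_compat; lra|].
exists (Rmax (V - ell) (ell - ln M)). intros B HB.
assert (B1 : V <= ell + B) by (pose proof (Rmax_l (V - ell) (ell - ln M)); lra).
assert (B2 : ell - B <= ln M) by (pose proof (Rmax_r (V - ell) (ell - ln M)); lra).
unfold contour_int2. rewrite (contour_fun2_shift M HM (- p) q (ell + B)) by (right; lra).
unfold CInt, Cminus, Cplus, Copp, Cmult at 2, Ci. cbn [fst snd].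
rewrite (RInt_vanish (fun v => fst (contour_fun2 M (- p) q PI v)) (ell + B) (path M PI)).
2:{ intros v Hv. rewrite (proj1 (contour_fun2_boundary M (- p) q PI v sin_PI)), contour_fun_PI_neg; auto; try lia; [ring|]. pose proof (path_PI_gt M HM). 
    assert (- ln M < Rmin (ell + B) (path M PI)) by (apply Rmin_glb_lt; lra). lra. }
assert (Cg : forall x, continuous (fun v => M * exp v) x) by (intros x; apply (ex_derive_continuous (V := R_NormedModule)); auto_derive; auto).
pose proof (spacelike_window p q (fun v => M * exp v) B ltac:(lia) Hq Oq Hpq Cg B2) as W. cbv beta in W.
assert (W' : RInt (fun v => fst (contour_fun2 M (- p) q 0 v)) (ell + B) (path M 0) = - (ct * RInt (fun w => a * exp w * (s w ^ Z.to_nat p * r w ^ Z.to_nat q)) (- B) B)).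
{ transitivity (RInt (fun v => M * exp v * (c * fst (contour_fun M (- p) q 0 v))) (ell + B) (path M 0)).
  - apply RInt_ext. intros v _. rewrite (proj1 (contour_fun2_boundary M (- p) q 0 v sin_0)), cos_0. fold c. ringR.
  - rewrite W. do 2 f_equal. apply RInt_ext. intros v _. assert (Ea : M * exp (ell + v) = a * exp v) by (unfold a; rewrite exp_plus; ring). rewrite Ea. reflexivity. }
set (F := fun phi => snd (contour_fun2 M (- p) q phi (ell + B))).
assert (HF : Rabs (RInt F 0 PI) <= PI * (e / PI)).
{ apply arc_small.
  - intros x. apply (continuous_of_2d_l (fun p0 v => snd (contour_fun2 M (- p) q p0 v))).
    assert (Hne : ufac M x (ell + B) <> RtoC 0) by (apply ufac_neq_0_far; auto; lra).
    exact (proj2 (c2_mult _ _ _ _ (c2_const (RtoC (c * M)) _ _) (c2_mult _ _ _ _ (eta_c2 x (ell + B)) (contour_fun_c2 M (- p) q x (ell + B) (or_intror Hne))))).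
  - intros x Hx. apply Cmod_parts, Hsm; auto. }
replace (PI * (e / PI)) with e in HF by (field; lra).
set (I1 := RInt (fun v => fst (contour_fun2 M (- p) q 0 v)) (ell + B) (path M 0)) in *.
set (I2 := RInt (fun w => a * exp w * (s w ^ Z.to_nat p * r w ^ Z.to_nat q)) (- B) B) in *.
match goal with |- Rabs ?u <= _ => replace u with (- RInt F 0 PI) end.
- rewrite Rabs_Ropp. exact HF.
- fold F. simpl in W' |- *. set (G := RInt F 0 PI) in *. lra.
Qed.

Lemma ct_shrink I T X : Rabs (I - T) <= X -> 0 <= T -> Rabs (ct * I - T) <= X + z * (a + b) * T.
Proof.
intros H HT. destruct ct_bounds as [H1 H2].
replace (ct * I - T) with (ct * (I - T) + - ((1 - ct) * T)) by ring. eapply Rle_trans; [apply Rabs_triang|].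
rewrite Rabs_Ropp, !Rabs_mult, (Rabs_pos_eq ct), (Rabs_pos_eq (1 - ct)), (Rabs_pos_eq T) by lra.
pose proof (Rabs_pos (I - T)). apply Rplus_le_compat; [nra|]. apply Rmult_le_compat_r; auto.
Qed.

(** The limiting integrand [e^(- z cosh w)] is even, so the symmetric window gives twice the
    half-line integral of [BesselK]. Replacing [ct] by 1 costs at most [2 (a + b)], as that integral
    is at most [1 / z]. *)
Lemma contour_K0 : Z.even Nz = true -> Z.even Lz = true ->
  Rabs (c * fst (contour_int M (- (Nz + 1)) (Lz - 1)) - 2 * BesselK 0 z) <= 42 * err.
Proof.
intros EN EL. destruct spacelike_facts as (Ha & Hb & Hz & Haz & Hbz & Hab). pose proof N_ge_1 as HN1. pose proof L'_ge_1 as HL1.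
assert (HN2 : (2 <= Nz)%Z) by (apply Z.even_spec in EN; destruct EN; lia).
assert (HL2 : (2 <= Lz)%Z) by (apply Z.even_spec in EL; destruct EL; lia).
pose proof err_pos' as He.
assert (HiN : 0 < / N) by (apply Rinv_0_lt_compat; lra). assert (HiL : 0 < / L) by (apply Rinv_0_lt_compat; lra).
assert (Hzab : 0 < z * (a + b)) by (apply Rmult_lt_0_compat; lra).
destruct (contour_window (Nz + 1) (Lz - 1) ltac:(lia) ltac:(lia)) with (e := err) as [B0 HB0]; auto.
{ rewrite Z.odd_add. rewrite <- Z.negb_even, EN. reflexivity. }
{ rewrite Z.odd_sub. rewrite <- Z.negb_even, EL. reflexivity. }
{ unfold n, l. lia. }
replace (Z.to_nat (Nz + 1)) with (n + 1)%nat in HB0 by (unfold n; lia).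
assert (Hl1 : l = (Z.to_nat (Lz - 1) + 1)%nat) by (unfold l; lia).
set (m := Z.to_nat (Lz - 1)) in *. set (X := c * fst _) in *.
assert (HK : Rabs (BesselK 0 z - X / 2) <= 21 * err).
{ unfold BesselK. apply improper0_approx with (B0 := B0).
  - intros x. apply continuous_mult_R; [apply E_continuous|]. apply (ex_derive_continuous (V := R_NormedModule)). unfold cosh. auto_derive. auto.
  - intros x _. apply Rmult_le_pos; [left; apply exp_pos|]. pose proof (cosh_ge_1 (INR 0 * x)). lra.
  - intros B HB HBp. specialize (HB0 B HB).
    assert (EI : RInt (fun u => exp (- (z * cosh u)) * cosh (INR 0 * u)) 0 B = RInt E 0 B).
    { apply RInt_ext. intros u _. simpl INR. rewrite Rmult_0_l, cosh_0. exact (Rmult_1_r _). }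
    rewrite EI.
    assert (ES : RInt E (- B) B = 2 * RInt E 0 B).
    { rewrite (RInt_symmetric E B E_continuous). transitivity (RInt (fun w => 2 * E w) 0 B).
      - apply RInt_ext. intros w _. rewrite E_even. ringR.
      - exact (RInt_scal_R E 2 0 B (ex_RInt_cont _ 0 B E_continuous)). }
    pose proof (spacelike_K0 n l a b z ltac:(unfold n; lia) ltac:(unfold l; lia) Ha Hb) as K. rewrite INR_n, INR_l in K.
    specialize (K Haz Hbz m (- B) B ltac:(unfold m; lia) Hl1 ltac:(lra)). cbv zeta in K.
    change (Rabs (RInt (fun w => s w ^ (n + 1) * r w ^ m) (- B) B - RInt E (- B) B) <= 18 * (/ N + / L)) in K.
    assert (HE : 0 <= RInt E 0 B <= / z).
    { destruct (RInt_cosh_exp_cosh B HBp) as [_ U]. split.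
      - apply RInt_ge_0; auto; [apply ex_RInt_cont, E_continuous|]. intros; left; apply exp_pos.
      - eapply Rle_trans; [|exact U]. apply RInt_le; auto; [apply ex_RInt_cont, E_continuous| |].
        + apply ex_RInt_cont. intros w. apply continuous_mult_R; [apply cosh_cont|apply E_continuous].
        + intros w _. pose proof (cosh_ge_1 w). assert (0 < E w) by apply exp_pos. nra. }
    rewrite ES in K.
    assert (HI0 : 0 <= 2 * RInt E 0 B) by lra.
    pose proof (ct_shrink _ _ _ K HI0) as K2.
    assert (Q : z * (a + b) * (2 * RInt E 0 B) <= 2 * (a + b)).
    { apply Rle_trans with (z * (a + b) * (2 * / z)); [apply Rmult_le_compat_l; lra|]. apply Req_le. field. lra. }
    set (I1 := RInt (fun w => s w ^ (n + 1) * r w ^ m) (- B) B) in *. set (I2 := RInt E 0 B) in *.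
    apply Rabs_le_between in K2, HB0. apply Rabs_le. unfold err in *. simpl in *. lra. }
apply Rabs_le_between in HK. apply Rabs_le. lra.
Qed.

Lemma s_small e : 0 < e -> exists B0, forall B, B0 <= B -> s B <= e.
Proof.
intros He. destruct spacelike_facts as (Ha & _). exists (ln (/ (a * e ^ 2))). intros B HB.
assert (Hae : 0 < a * e ^ 2) by (apply Rmult_lt_0_compat; auto; apply pow_lt; auto).
apply exp_le in HB. rewrite exp_ln in HB by (apply Rinv_0_lt_compat; auto).
unfold s. assert (H : / e <= sqrt (1 + a * exp B)).
{ assert (0 < / e) by (apply Rinv_0_lt_compat; auto). rewrite <- (sqrt_square (/ e)) by lra. apply sqrt_le_1_alt.
  apply (Rmult_le_compat_l a) in HB; [|lra]. replace (a * / (a * e ^ 2)) with (/ e * / e) in HB by (field; lra). lra. }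
apply Rinv_le_contravar in H; [|apply Rinv_0_lt_compat; auto]. rewrite Rinv_inv in H. exact H.
Qed.

(** The window is split at [w = 0]: the weight [a e^w] is small on the left and is integrated by
    parts on the right. As [a e^w + a e^(- w) = 2 a cosh w], the symmetric limit is [2 a] times the
    integral of [BesselK 1]. Since [L] is odd, either [L >= 3] leaves room for the integration by
    parts or [N = L = 1]. *)
Lemma contour_K1 : Z.odd Nz = true -> Z.odd Lz = true -> (Lz = 1 -> Nz = 1)%Z ->
  Rabs (fst (contour_int2 M (- (Nz + 2)) Lz) - a * (2 * BesselK 1 z)) <= a * (40 * err).
Proof.
intros EN EL HL1N. destruct spacelike_facts as (Ha & Hb & Hz & Haz & Hbz & Hab). pose proof N_ge_1 as HN1. pose proof L'_ge_1 as HL1.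
pose proof err_pos' as He.
assert (HiN : 0 < / N) by (apply Rinv_0_lt_compat; lra). assert (HiL : 0 < / L) by (apply Rinv_0_lt_compat; lra).
assert (Hzab : 0 < z * (a + b)) by (apply Rmult_lt_0_compat; lra).
destruct (contour_window2 (Nz + 2) Lz ltac:(lia) ltac:(lia)) with (e := a * err) as [B0 HB0]; auto.
{ rewrite Z.odd_add, EN. reflexivity. }
{ unfold n, l. lia. }
{ apply Rmult_lt_0_compat; auto. }
destruct (s_small (a * err / 4)) as [B1 HB1]; [assert (0 < a * err) by (apply Rmult_lt_0_compat; auto); lra|].
replace (Z.to_nat (Nz + 2)) with (n + 2)%nat in HB0 by (unfold n; lia). fold l in HB0.
set (X := fst _) in *.
assert (HK : Rabs (BesselK 1 z - X / (2 * a)) <= 20 * err).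
{ unfold BesselK. apply improper0_approx with (B0 := Rmax B0 B1).
  - intros x. apply continuous_mult_R; [apply E_continuous|]. apply (ex_derive_continuous (V := R_NormedModule)). unfold cosh. auto_derive. auto.
  - intros x _. apply Rmult_le_pos; [left; apply exp_pos|]. pose proof (cosh_ge_1 (INR 1 * x)). lra.
  - intros B HB HBp. specialize (HB0 B (Rle_trans _ _ _ (Rmax_l _ _) HB)). specialize (HB1 B (Rle_trans _ _ _ (Rmax_r _ _) HB)).
    assert (EI : RInt (fun u => exp (- (z * cosh u)) * cosh (INR 1 * u)) 0 B = RInt (fun w => cosh w * E w) 0 B).
    { apply RInt_ext. intros u _. simpl INR. rewrite Rmult_1_l. exact (Rmult_comm _ _). }
    rewrite EI.
    assert (Cy : forall w, continuous (fun w => a * exp w) w) by (intros w; apply (y_cont a)).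
    assert (CyE : forall w, continuous (fun w => a * exp w * E w) w) by (intros w; apply continuous_mult_R; [apply Cy|apply E_continuous]).
    assert (Cc : forall w, continuous (fun w => cosh w * E w) w) by (intros w; apply continuous_mult_R; [apply cosh_cont|apply E_continuous]).
    assert (ES : RInt (fun w => a * exp w * E w) (- B) B = 2 * a * RInt (fun w => cosh w * E w) 0 B).
    { rewrite (RInt_symmetric (fun w => a * exp w * E w) B CyE). transitivity (RInt (fun w => 2 * a * (cosh w * E w)) 0 B).
      - apply RInt_ext. intros w _. rewrite E_even. unfold cosh. field_sym.
      - exact (RInt_scal_R _ (2 * a) 0 B (ex_RInt_cont _ 0 B Cc)). }
    pose proof (spacelike_K1_left n l a b z ltac:(unfold n; lia) ltac:(unfold l; lia) Ha Hb Hz) as KL. rewrite INR_n, INR_l in KL.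
    specialize (KL Haz Hbz (- B) ltac:(lra)). cbv zeta in KL.
    change (Rabs (RInt (fun w => a * exp w * (s w ^ (n + 2) * r w ^ l)) (- B) 0 - RInt (fun w => a * exp w * E w) (- B) 0) <= a * (a + 2 * z * a + 8 * b)) in KL.
    assert (Hs : 0 < s B <= 1) by (apply isqrt_bounds; pose proof (Rmult_lt_0_compat _ _ Ha (exp_pos B)); lra).
    assert (Hsn : s B ^ n <= s B).
    { replace n with (1 + (n - 1))%nat by (unfold n; lia). rewrite pow_add, pow_1. pose proof (pow_incr (s B) 1 (n - 1) ltac:(lra)) as P. rewrite pow1 in P. nra. }
    assert (KR : Rabs (RInt (fun w => a * exp w * (s w ^ (n + 2) * r w ^ l)) 0 B - RInt (fun w => a * exp w * E w) 0 B) <= a * (17 * err)).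
    { assert (Hae : 0 < a * err) by (apply Rmult_lt_0_compat; auto).
      assert (Hza : 0 < z * a) by (apply Rmult_lt_0_compat; auto). assert (Hzb : 0 < z * b) by (apply Rmult_lt_0_compat; auto).
      destruct (Z.eq_dec Lz 1) as [E1|E1].
      - pose proof (HL1N E1) as E2.
        pose proof (spacelike_K1_right_1 n l a b z ltac:(unfold n; lia) ltac:(unfold l; lia) Ha Hb) as K. rewrite INR_n, INR_l in K.
        specialize (K Haz Hbz B ltac:(unfold n; lia) ltac:(unfold l; lia) HBp). cbv zeta in K.
        change (Rabs (RInt (fun w => a * exp w * (s w ^ (n + 2) * r w ^ l)) 0 B - RInt (fun w => a * exp w * E w) 0 B) <= 2 * (a + b) + 2 * s B ^ n) in K.
        eapply Rle_trans; [exact K|].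
        assert (EN1 : N = 1) by (unfold N; rewrite E2; reflexivity). assert (EL1 : L = 1) by (unfold L; rewrite E1; reflexivity).
        assert (Eab : a = b) by (rewrite EN1 in Haz; rewrite EL1 in Hbz; lra).
        assert (He2 : 2 <= err). { unfold err. rewrite EN1, EL1, Rinv_1. lra. }
        rewrite <- Eab. assert (a * 2 <= a * err) by (apply Rmult_le_compat_l; lra). lra.
      - assert (HL3 : (3 <= Lz)%Z) by (apply Z.odd_spec in EL; destruct EL; lia).
        pose proof (spacelike_K1_right n l a b z ltac:(unfold n; lia) ltac:(unfold l; lia) Ha Hb Hz) as K. rewrite INR_n, INR_l in K.
        specialize (K Haz Hbz (l - 2)%nat B ltac:(unfold l; lia) ltac:(unfold l; lia) HBp). cbv zeta in K.
        change (Rabs (RInt (fun w => a * exp w * (s w ^ (n + 2) * r w ^ l)) 0 B - RInt (fun w => a * exp w * E w) 0 B) <= a * (16 * a + 9 * b + 2 * z * b) + 4 / N * s B ^ n) in K.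
        eapply Rle_trans; [exact K|].
        assert (Q : 4 / N * s B ^ n <= a * err).
        { apply Rle_trans with (4 * s B); [|lra]. unfold Rdiv. rewrite Rmult_assoc. apply Rmult_le_compat_l; [lra|].
          assert (/ N <= 1) by (apply Rle_trans with (/ 1); [apply Rinv_le_contravar; lra|rewrite Rinv_1; lra]).
          assert (0 <= s B ^ n) by (apply pow_le; lra). nra. }
        assert (a * (16 * a + 9 * b + 2 * z * b) <= a * (16 * err)) by (apply Rmult_le_compat_l; [lra|unfold err; lra]). lra. }
    assert (Cf : forall w, continuous (fun w => a * exp w * (s w ^ (n + 2) * r w ^ l)) w).
    { intros w. apply continuous_mult_R; [apply Cy|]. apply continuous_mult_R; [apply (s_pow_cont a Ha)|apply (r_pow_cont b)]. }
    assert (KT : Rabs (RInt (fun w => a * exp w * (s w ^ (n + 2) * r w ^ l)) (- B) B - RInt (fun w => a * exp w * E w) (- B) B) <= a * (25 * err)).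
    { rewrite <- (RInt_Chasles (fun w => a * exp w * (s w ^ (n + 2) * r w ^ l)) (- B) 0 B), <- (RInt_Chasles (fun w => a * exp w * E w) (- B) 0 B) by (apply ex_RInt_cont; auto).
      assert (a * (a + 2 * z * a + 8 * b) <= a * (8 * err)) by (apply Rmult_le_compat_l; [lra|]; assert (0 < z * b) by (apply Rmult_lt_0_compat; auto); unfold err; lra).
      unfold plus; simpl in KL, KR |- *. apply Rabs_le_between in KL, KR. apply Rabs_le. lra. }
    destruct (RInt_cosh_exp_cosh B HBp) as [U0 U].
    rewrite ES in KT.
    assert (HI0 : 0 <= 2 * a * RInt (fun w => cosh w * E w) 0 B) by (apply Rmult_le_pos; lra).
    pose proof (ct_shrink _ _ _ KT HI0) as K2.
    assert (Q : z * (a + b) * (2 * a * RInt (fun w => cosh w * E w) 0 B) <= a * (2 * (a + b))).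
    { apply Rle_trans with (z * (a + b) * (2 * a * / z)); [apply Rmult_le_compat_l; [lra|]; apply Rmult_le_compat_l; lra|]. apply Req_le. field. lra. }
    assert (Q2 : a * (2 * (a + b)) <= a * (2 * err)) by (apply Rmult_le_compat_l; [lra|unfold err; lra]).
    set (I1 := RInt (fun w => a * exp w * (s w ^ (n + 2) * r w ^ l)) (- B) B) in *. set (I2 := RInt (fun w => cosh w * E w) 0 B) in *.
    assert (F : Rabs (2 * a * I2 - X) <= 2 * a * (20 * err)).
    { apply Rabs_le_between in K2, HB0. apply Rabs_le. simpl in *. assert (0 < a * err) by (apply Rmult_lt_0_compat; auto). lra. }
    replace (I2 - X / (2 * a)) with (/ (2 * a) * (2 * a * I2 - X)) by (field; lra).
    assert (Hi2 : 0 < / (2 * a)) by (apply Rinv_0_lt_compat; lra).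
    rewrite Rabs_mult, (Rabs_pos_eq (/ (2 * a))) by lra.
    apply Rmult_le_reg_l with (2 * a); [lra|]. rewrite <- Rmult_assoc, Rinv_r, Rmult_1_l by lra. simpl in *. lra. }
replace (X - a * (2 * BesselK 1 z)) with (- (2 * a * (BesselK 1 z - X / (2 * a)))) by (field; lra).
rewrite Rabs_Ropp, Rabs_mult, (Rabs_pos_eq (2 * a)) by lra.
apply (Rmult_le_compat_l (2 * a)) in HK; [|lra]. lra.
Qed.
End Spacelike.

(** * Symmetries and assembly *)

Definition cone_scale (M : R) (K L : Z) : R := M * exp (cone_log K L).
Definition cone_err (M : R) (K L : Z) : R :=
  cone_scale M K L + M * exp (- cone_log K L) + M * sqrt (IZR K * IZR L) * (cone_scale M K L + M * exp (- cone_log K L)) + / IZR K + / IZR L.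

(** The quantity [eps * Delta] of the theorem in lattice units; [interval] is [s / eps]. *)
Definition defect (M : R) (i j : Z) : R := / IZR (Z.abs (Z.abs i - Z.abs j)) + M * M * IZR (Z.abs i + Z.abs j).
Definition interval (i j : Z) : R := sqrt (IZR (Z.abs (j * j - i * i))).

Lemma defect_abs M i j i' j' : Z.abs i = Z.abs i' -> Z.abs j = Z.abs j' -> defect M i j = defect M i' j'.
Proof. intros H1 H2. unfold defect. rewrite H1, H2. reflexivity. Qed.

Lemma interval_abs i j i' j' : Z.abs i = Z.abs i' -> Z.abs j = Z.abs j' -> interval i j = interval i' j'.
Proof.
intros H1 H2. unfold interval. do 2 f_equal.
assert (Sq : forall k k', Z.abs k = Z.abs k' -> (k * k = k' * k')%Z) by (intros; lia).
rewrite (Sq i i' H1), (Sq j j' H2). reflexivity.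
Qed.

(** The factor 4 is 2 from [err_bound] times 2: [1 / K] and [1 / L] are each at most the first term
    of [defect], and [K + L <= 2 (|i| + |j|)]. *)
Lemma cone_err_defect M i j K L : 0 < M -> (1 <= K)%Z -> (1 <= L)%Z ->
  (K = Z.abs (j - i) /\ L = Z.abs (i + j) \/ K = Z.abs (i + j) /\ L = Z.abs (j - i))%Z -> cone_err M K L <= 4 * defect M i j.
Proof.
intros HM HK HL EKL. eapply Rle_trans; [exact (err_bound M K L HM HK HL)|]. unfold defect.
set (D := Z.abs (Z.abs i - Z.abs j)). set (S := (Z.abs i + Z.abs j)%Z).
destruct (Z.eq_dec D 0) as [E0|E0]; [lia|].
assert (HD : 1 <= IZR D) by (apply IZR_le; lia).
assert (Hinv : forall k, (D <= k)%Z -> / IZR k <= / IZR D).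
{ intros k Hk. apply IZR_le in Hk. apply Rinv_le_contravar; lra. }
pose proof (Hinv K ltac:(lia)) as H1. pose proof (Hinv L ltac:(lia)) as H2.
assert (HS : IZR K + IZR L <= 2 * IZR S) by (rewrite <- plus_IZR, <- mult_IZR; apply IZR_le; lia).
assert (0 < M * M) by (apply Rmult_lt_0_compat; auto).
assert (M * M * (IZR K + IZR L) <= M * M * (2 * IZR S)) by (apply Rmult_le_compat_l; lra). lra.
Qed.

Lemma interval_cone i j K L : (0 <= K * L)%Z -> (K * L = Z.abs (j * j - i * i))%Z -> interval i j = sqrt (IZR K * IZR L).
Proof. intros H0 H. unfold interval. rewrite <- H, mult_IZR. reflexivity. Qed.

Lemma cone_scale_eq M K L : 0 < M -> (1 <= K)%Z -> (1 <= L)%Z -> cone_scale M K L = M * IZR L / sqrt (IZR K * IZR L).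
Proof.
intros HM HK HL. unfold cone_scale. rewrite (proj1 (exp_cone K L HK HL)).
assert (H1 : 0 < IZR K) by (apply IZR_lt; lia). assert (H2 : 0 < IZR L) by (apply IZR_lt; lia).
rewrite sqrt_mult by lra. assert (0 < sqrt (IZR K)) by (apply sqrt_lt_R0; auto). assert (0 < sqrt (IZR L)) by (apply sqrt_lt_R0; auto).
rewrite <- (sqrt_sqrt (IZR L)) at 2 by lra. field. lra.
Qed.

Lemma Csub_0_eq (u v : C) : (u - v)%C = 0%C -> u = v.
Proof. intros H. replace u with (u - v + v)%C by ring. rewrite H. ring. Qed.

(** The error is real, all phases being in [pre]. The constant is [420 = 4 * 105], with 4 from
    [cone_err_defect] and 105 the ratio allowed in [near_scaled]. *)
Definition near (M : R) (i j : Z) (X pre : C) (F : R) : Prop :=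
  exists e : R, Rabs e <= 420 * defect M i j /\ X = (pre * RtoC (F + e))%C.

Lemma near_intro M i j X pre F Y : X = (pre * RtoC Y)%C -> Rabs (Y - F) <= 420 * defect M i j -> near M i j X pre F.
Proof.
intros HX HY. exists (Y - F). split; auto. rewrite HX. do 2 f_equal. ring.
Qed.

(** * Parity, symmetries and vanishing of the propagator *)

Section Propagator.
Variable M : R.
Hypothesis HM : 0 < M.
Let c := norm1 M.
Let G := green M 0.

Definition prop1 (i j : Z) : C := (RtoC (norm1 M * M) * green M 0 i j)%C.
Definition prop2 (i j : Z) : C := (green M 0 i (j + 1) - RtoC (norm1 M) * green M 0 (i + 1) j)%C.

Lemma green0_even_x i j : G (- i)%Z j = G i j.
Proof. apply green_even_x. Qed.

Lemma green0_even_t i j : G i (- j)%Z = G i j.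
Proof. apply green_even_t. Qed.

Lemma green0_abs i j : G i j = G (Z.abs i) (Z.abs j).
Proof.
destruct (Z.abs_spec i) as [[_ ->]|[_ ->]], (Z.abs_spec j) as [[_ ->]|[_ ->]]; rewrite ?green0_even_x, ?green0_even_t; reflexivity.
Qed.

(** One of the factors [1 + zsign] and [1 - zsign] in [green_zint] is 0 and the other 2, so the
    Green function is purely imaginary or purely real. *)
Lemma green_parity x t : (0 <= t)%Z -> (0 <= t - 1 + x)%Z ->
  (Z.even (x + t) = true -> G x t = (0, fst (zint M x t) / PI)) /\ (Z.odd (x + t) = true -> G x t = (snd (zint M x t) / PI, 0)).
Proof.
intros Ht Hx. pose proof PI_RGT_0 as Hpi. destruct (green_zint M HM x t Ht Hx) as [H1 H2].
unfold G. rewrite (green_massive M HM). unfold zsign in *. split; intros Hp.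
- rewrite Hp in H1, H2. assert (E1 : gim M x t = fst (zint M x t) / PI).
  { apply Rmult_eq_reg_l with (2 * PI); [|lra]. replace (2 * PI * gim M x t) with (2 * (PI * gim M x t)) by ring. rewrite H1. field. lra. }
  assert (E2 : gre M x t = 0).
  { apply Rmult_eq_reg_l with (2 * PI); [|lra]. replace (2 * PI * gre M x t) with (2 * (PI * gre M x t)) by ring. rewrite H2. ring. }
  rewrite E1, E2. reflexivity.
- assert (Hev : Z.even (x + t) = false) by (rewrite <- Z.negb_odd, Hp; reflexivity). rewrite Hev in H1, H2. assert (E1 : gim M x t = 0).
  { apply Rmult_eq_reg_l with (2 * PI); [|lra]. replace (2 * PI * gim M x t) with (2 * (PI * gim M x t)) by ring. rewrite H1. ring. }
  assert (E2 : gre M x t = snd (zint M x t) / PI).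
  { apply Rmult_eq_reg_l with (2 * PI); [|lra]. replace (2 * PI * gre M x t) with (2 * (PI * gre M x t)) by ring. rewrite H2. field. lra. }
  rewrite E1, E2. reflexivity.
Qed.

Lemma prop2_parity x t : (0 <= t)%Z -> (0 <= t + x)%Z ->
  (Z.odd (x + t) = true -> prop2 x t = (0, fst (zint2 M x t) / PI)) /\ (Z.even (x + t) = true -> prop2 x t = (snd (zint2 M x t) / PI, 0)).
Proof.
intros Ht Hx. pose proof PI_RGT_0 as Hpi. unfold prop2. fold G c.
destruct (green_parity x (t + 1) ltac:(lia) ltac:(lia)) as [A1 A2]. destruct (green_parity (x + 1) t ltac:(lia) ltac:(lia)) as [B1 B2].
replace (x + 1 + t)%Z with (x + (t + 1))%Z in B1, B2 by ring.
assert (P : Z.even (x + (t + 1)) = Z.odd (x + t)) by (rewrite Z.add_assoc, Z.even_add, <- Z.negb_even; destruct (Z.even (x + t)); reflexivity).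
rewrite (zint2_eq M HM x t Hx). fold c. split; intros Hp.
- rewrite A1, B1 by (rewrite P; auto). unfold Cminus, Cplus, Copp, Cmult, RtoC; cbn [fst snd]. f_equal; field; lra.
- assert (P' : Z.odd (x + (t + 1)) = true) by (rewrite <- Z.negb_even, P, <- Z.negb_even, Hp; reflexivity).
  rewrite A2, B2 by auto. unfold Cminus, Cplus, Copp, Cmult, RtoC; cbn [fst snd]. f_equal; field; lra.
Qed.

(** A rearrangement of [green0_flip]. It exchanges [K] and [L], so that points close to one side of
    the cone are read off from the other side. *)
Lemma prop2_flip i j : (0 <= j)%Z -> (RtoC (IZR (j - i)) * prop2 i j = RtoC (IZR (j + i)) * prop2 (- i) j)%C.
Proof.
intros Hj. pose proof (green0_flip M HM i j Hj) as F. fold c in F. unfold prop2. fold c G in F |- *.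
rewrite green0_even_x. replace (- i + 1)%Z with (- (i - 1))%Z by ring. rewrite green0_even_x.
rewrite minus_IZR, plus_IZR. 
assert (E : (RtoC (2 * IZR i) * G i (j + 1)%Z - RtoC c * (RtoC (IZR i - IZR j) * G (i + 1)%Z j + RtoC (IZR i + IZR j) * G (i - 1)%Z j) = 0)%C) by (rewrite F; ring).
apply Csub_0_eq. 
transitivity (- (RtoC (2 * IZR i) * G i (j + 1)%Z - RtoC c * (RtoC (IZR i - IZR j) * G (i + 1)%Z j + RtoC (IZR i + IZR j) * G (i - 1)%Z j)))%C; [|rewrite E; ring].
rewrite !RtoC_minus, !RtoC_plus, !RtoC_mult. ring.
Qed.

(** Since [G] is even in both variables, this is the Klein-Gordon equation at [(i, j)], which is
    homogeneous away from the origin. *)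
Lemma prop2_neg i j : (i, j) <> (0, 0)%Z -> prop2 i j = (- prop2 (- i) (- j))%C.
Proof.
intros H. unfold prop2. fold G c. replace (- j + 1)%Z with (- (j - 1))%Z by ring. replace (- i + 1)%Z with (- (i - 1))%Z by ring.
rewrite !green0_even_x, !green0_even_t. pose proof (green0_KG M HM i j H) as K. fold G c in K.
apply Csub_0_eq. transitivity (G i (j + 1)%Z + G i (j - 1)%Z - RtoC c * (G (i + 1)%Z j + G (i - 1)%Z j))%C; [ring|].
rewrite K. ring.
Qed.

(** Induction on time with the Klein-Gordon recurrence, which relates sites of one parity only: the
    row [t = 0] vanishes because its real part contains [sin 0] and its imaginary part is excluded
    by parity. *)
Lemma green_zero_cone n : forall t x, (0 <= t <= Z.of_nat n)%Z -> (t < x)%Z -> Z.odd (x + t) = true -> G x t = 0%C.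
Proof.
assert (H0 : forall x, (0 < x)%Z -> Z.odd x = true -> G x 0 = 0%C).
{ intros x Hx Ho. assert (He : Z.odd (x + 0) = true) by (rewrite Z.add_0_r; auto).
  pose proof (proj2 (green_parity x 0 ltac:(lia) ltac:(lia)) He) as E. unfold G in *. rewrite (green_massive M HM) in E |- *.
  injection E as _ E2. rewrite E2. unfold RtoC. f_equal. unfold gre.
  rewrite (RInt_ext _ (fun _ => 0)).
  - rewrite RInt_const. unfold scal; simpl; unfold mult; simpl. ring.
  - intros p _. unfold sin_mode. simpl Z.abs. rewrite Rmult_0_l, sin_0. unfold Rdiv. rewrite Rmult_0_l. apply Rmult_0_r. }
assert (Hodd : forall a b, Z.odd (a + b) = true -> b = 1%Z \/ b = (-1)%Z -> Z.even a = true).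
{ intros a b H [-> | ->]; rewrite Z.odd_add, <- Z.negb_even in H; destruct (Z.even a); auto. }
assert (Hstep : forall x t, (0 <= t)%Z -> (x, t) <> (0, 0)%Z -> G (x + 1)%Z t = 0%C -> G (x - 1)%Z t = 0%C -> (G x (t + 1)%Z + G x (t - 1)%Z = 0)%C).
{ intros x t Ht Hne E1 E2. pose proof (green0_KG M HM x t Hne) as K. fold G c in K. rewrite K, E1, E2. ring. }
induction n as [|n IH].
- intros t x Ht Hx Ho. assert (t = 0%Z) by lia. subst t. rewrite Z.add_0_r in Ho. apply H0; auto.
- intros t x Ht Hx Ho. destruct (Z_le_gt_dec t (Z.of_nat n)) as [Hle|Hgt]; [apply IH; auto; lia|].
  assert (Et : t = (t - 1 + 1)%Z) by ring.
  assert (P1 : Z.odd (x + 1 + (t - 1)) = true) by (replace (x + 1 + (t - 1))%Z with (x + t)%Z by ring; auto).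
  assert (P2 : Z.odd (x - 1 + (t - 1)) = true) by (replace (x - 1 + (t - 1))%Z with (x + t - 2)%Z by ring; rewrite Z.odd_sub, Ho; reflexivity).
  pose proof (Hstep x (t - 1)%Z ltac:(lia) ltac:(intros E; injection E; lia) (IH (t - 1)%Z (x + 1)%Z ltac:(lia) ltac:(lia) P1) (IH (t - 1)%Z (x - 1)%Z ltac:(lia) ltac:(lia) P2)) as K.
  rewrite <- Et in K. destruct (Z.eq_dec t 1) as [E1|E1].
  (* For [t = 1] the row two steps back is [t = -1], equal to the current one by evenness, so the
     recurrence reads [2 G = 0]. *)
  + subst t. replace (1 - 1 - 1)%Z with (- (1))%Z in K by ring. rewrite green0_even_t in K.
    apply (Cmult_cancel_l (RtoC 2)); [intros E; apply RtoC_inj in E; lra|]. rewrite Cmult_0_r, <- K. unfold Cmult, Cplus, RtoC. simpl. f_equal; ring.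
  + assert (P3 : Z.odd (x + (t - 1 - 1)) = true) by (replace (x + (t - 1 - 1))%Z with (x + t - 2)%Z by ring; rewrite Z.odd_sub, Ho; reflexivity).
    rewrite (IH (t - 1 - 1)%Z x ltac:(lia) ltac:(lia) P3) in K. rewrite Cplus_0_r in K. exact K.
Qed.

Lemma green_zero i j : (Z.abs j < Z.abs i)%Z -> Z.odd (i + j) = true -> G i j = 0%C.
Proof.
intros H Ho. rewrite green0_abs. apply (green_zero_cone (Z.abs_nat j)); try lia.
rewrite <- Ho. destruct (Z.abs_spec i) as [[_ ->]|[_ ->]], (Z.abs_spec j) as [[_ ->]|[_ ->]]; rewrite ?Z.odd_add, ?Z.odd_opp; reflexivity.
Qed.

Lemma prop2_zero i j : (Z.abs j < Z.abs i)%Z -> Z.even (i + j) = true -> prop2 i j = 0%C.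
Proof.
assert (H0 : forall i j, (0 <= j < i)%Z -> Z.even (i + j) = true -> prop2 i j = 0%C).
{ intros x t H He. unfold prop2. fold G c.
  assert (Hp : Z.odd (x + t + 1) = true) by (rewrite Z.odd_add, <- Z.negb_even, He; reflexivity).
  (* Parity excludes [x = t + 1], so [(x, t + 1)] is still strictly outside the cone. *)
  assert (x <> t + 1)%Z. { intros ->. replace (t + 1 + t)%Z with (1 + 2 * t)%Z in He by ring. rewrite Z.even_add_mul_2 in He. discriminate. }
  rewrite (green_zero x (t + 1)), (green_zero (x + 1) t).
  - ring.
  - lia.
  - rewrite <- Hp. f_equal. ring.
  - lia.
  - rewrite <- Hp. f_equal. ring. }
assert (H1 : forall i j, (0 <= j < Z.abs i)%Z -> Z.even (i + j) = true -> prop2 i j = 0%C).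
{ intros x t H He. destruct (Z_le_gt_dec 0 x); [apply H0; auto; lia|].
  assert (He' : Z.even (- x + t) = true) by (rewrite Z.even_add, Z.even_opp, <- Z.even_add; auto).
  pose proof (prop2_flip x t ltac:(lia)) as F. rewrite (H0 (- x)%Z t ltac:(lia) He') in F.
  apply (Cmult_cancel_l (RtoC (IZR (t - x)))); [|rewrite F, !Cmult_0_r; reflexivity].
  intros E. apply RtoC_inj, eq_IZR in E. lia. }
intros H He. destruct (Z_le_gt_dec 0 j); [apply H1; auto; lia|].
rewrite prop2_neg by (intros E; injection E; lia). rewrite H1; [ring|lia|].
rewrite <- Z.opp_add_distr, Z.even_opp. auto.
Qed.
End Propagator.

Ltac parity i j := match goal with H : _ = true |- _ => revert H end; rewrite <- ?Z.negb_even; repeat (rewrite Z.even_sub || rewrite Z.even_add || rewrite Z.even_opp); destruct (Z.even i), (Z.even j); simpl; auto.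

(** * The asymptotic formulas in lattice units *)

Section Near.
Variable M : R.
Hypothesis HM : 0 < M.
Let c := norm1 M.

Lemma PI_gt_2 : 2 < PI.
Proof. pose proof PI2_1. lra. Qed.

(** Turns the estimates above, of the form [|Y - k F| <= C0 err], into [near]. The largest ratio
    [C0 / k] that occurs is [(80 PI + 24) / PI], for [Y_1], which is below 105. *)
Lemma near_scaled i j K L X pre F Y (k C0 : R) : 0 < k -> 0 <= C0 -> C0 <= 105 * k -> (1 <= K)%Z -> (1 <= L)%Z ->
  (K = Z.abs (j - i) /\ L = Z.abs (i + j) \/ K = Z.abs (i + j) /\ L = Z.abs (j - i))%Z ->
  X = (pre * RtoC (Y / k))%C -> Rabs (Y - k * F) <= C0 * cone_err M K L -> near M i j X pre F.
Proof.
intros Hk HC0 HC HK HL EKL HX HY. apply (near_intro M i j X pre F (Y / k) HX).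
pose proof (cone_err_defect M i j K L HM HK HL EKL) as HE.
assert (He : 0 < cone_err M K L) by exact (err_pos M K L HM HK HL).
replace (Y / k - F) with ((Y - k * F) / k) by (field; lra).
unfold Rdiv. rewrite Rabs_mult, Rabs_inv, (Rabs_pos_eq k) by lra.
apply Rmult_le_reg_r with k; auto. rewrite Rmult_assoc, Rinv_l, Rmult_1_r by lra.
assert (C0 * cone_err M K L <= 105 * k * cone_err M K L) by (apply Rmult_le_compat_r; lra).
assert (105 * k * cone_err M K L <= 105 * k * (4 * defect M i j)) by (apply Rmult_le_compat_l; lra). lra.
Qed.

Lemma interval_pos i j : Z.abs i <> Z.abs j -> 0 < interval i j.
Proof. intros H. apply sqrt_lt_R0, IZR_lt. nia. Qed.

Lemma interval_timelike i j : (Z.abs i < j)%Z -> interval i j = sqrt (IZR (j - i) * IZR (j + i)).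
Proof. intros H. apply interval_cone; nia. Qed.

Lemma interval_spacelike i j : (0 <= j < i)%Z -> interval i j = sqrt (IZR (i - j) * IZR (i + j)).
Proof. intros H. apply interval_cone; nia. Qed.

Lemma near_J0 i j : (Z.abs i < j)%Z -> Z.odd (i + j) = true -> near M i j (prop1 M i j) (RtoC M) (BesselJ 0 (M * interval i j)).
Proof.
intros H Ho. pose proof PI_gt_2. rewrite (interval_timelike i j H).
apply (near_scaled i j (j - i) (j + i) _ _ _ (c * snd (zint M i j)) PI (PI * 40)); try lra; try lia.
- unfold prop1. rewrite (proj2 (green_parity M HM i j ltac:(lia) ltac:(lia)) Ho). fold c. unfold Cmult, RtoC; cbn [fst snd]. f_equal; field; lra.
- apply (arc_term_J0 M (j - i) (j + i) HM ltac:(lia) ltac:(lia) (j - 1 - i) (j - 1 + i)); try lia.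
  + rewrite <- minus_IZR. f_equal. lia.
  + rewrite <- minus_IZR. f_equal. lia.
  + parity i j.
  + parity i j.
Qed.

Lemma near_Y0 i j : (Z.abs i < j)%Z -> Z.even (i + j) = true -> near M i j (prop1 M i j) (- Ci * RtoC M)%C (BesselY 0 (M * interval i j)).
Proof.
intros H Ho. pose proof PI_gt_2. rewrite (interval_timelike i j H).
apply (near_scaled i j (j - i) (j + i) _ _ _ (- (c * fst (zint M i j))) PI (PI * 40 + 18)); try lra; try lia.
- unfold prop1. rewrite (proj1 (green_parity M HM i j ltac:(lia) ltac:(lia)) Ho). fold c. unfold Cmult, Copp, Ci, RtoC; cbn [fst snd]. f_equal; field; lra.
- rewrite <- Rabs_Ropp. match goal with |- Rabs ?u <= _ => replace u with (c * fst (zint M i j) + PI * BesselY 0 (M * sqrt (IZR (j - i) * IZR (j + i)))) by ring end.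
  apply (arc_term_Y0 M (j - i) (j + i) HM ltac:(lia) ltac:(lia) (j - 1 - i) (j - 1 + i)); try lia.
  + rewrite <- minus_IZR. f_equal. lia.
  + rewrite <- minus_IZR. f_equal. lia.
  + parity i j.
  + parity i j.
Qed.

Lemma near_K0 i j : (0 <= j < i)%Z -> Z.even (i + j) = true -> near M i j (prop1 M i j) (RtoC 2 * Ci * RtoC M / RtoC PI)%C (BesselK 0 (M * interval i j)).
Proof.
intros H Ho. pose proof PI_gt_2. rewrite (interval_spacelike i j H).
apply (near_scaled i j (i - j) (i + j) _ _ _ (c * fst (zint M i j)) 2 42); try lra; try lia.
- unfold prop1. rewrite (proj1 (green_parity M HM i j ltac:(lia) ltac:(lia)) Ho). fold c.
  unfold Cdiv. rewrite <- RtoC_inv by lra. unfold Cmult, Copp, Ci, RtoC; cbn [fst snd]. f_equal; field; lra.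
- assert (E1 : Z.even (i - j) = true) by parity i j.
  pose proof (contour_K0 M (i - j) (i + j) HM ltac:(lia) ltac:(lia) ltac:(lia) E1 Ho) as K.
  replace (- (i - j + 1))%Z with (j - 1 - i)%Z in K by ring. replace (i + j - 1)%Z with (j - 1 + i)%Z in K by ring. exact K.
Qed.

(** The prefactor [M (t + x) / s] of the theorem; on the sides treated directly it equals [a], which
    is why the estimates for [A_2] carry the factor [a]. *)
Definition cone_pre (w : C) (i j : Z) : C := (w * RtoC (M * IZR (j + i) / interval i j))%C.

Lemma near_J1 i j : (Z.abs i < j)%Z -> Z.even (i + j) = true -> near M i j (prop2 M i j) (cone_pre (-1) i j) (BesselJ 1 (M * interval i j)).
Proof.
intros H Ho. pose proof PI_gt_2 as Hpi. pose proof (interval_timelike i j H) as Ei.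
(* An even positive [j - i] is at least 2, so the exponent [j - 2 - i] is nonnegative. *)
assert (HK2 : (2 <= j - i)%Z). { assert (Ho' : Z.even (j - i) = true) by parity i j. apply Z.even_spec in Ho'. destruct Ho'. lia. }
assert (Ea : cone_scale M (j - i) (j + i) = M * IZR (j + i) / interval i j) by (rewrite Ei; apply cone_scale_eq; auto; lia).
assert (Ha : 0 < cone_scale M (j - i) (j + i)) by (apply Rmult_lt_0_compat; auto; apply exp_pos).
apply (near_scaled i j (j - i) (j + i) _ _ _ (- snd (zint2 M i j)) (cone_scale M (j - i) (j + i) * PI) (cone_scale M (j - i) (j + i) * (PI * 80))); try lia.
- apply Rmult_lt_0_compat; lra.
- apply Rmult_le_pos; lra.
- assert (0 <= cone_scale M (j - i) (j + i) * PI) by (apply Rmult_le_pos; lra). lra.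
- rewrite (proj2 (prop2_parity M HM i j ltac:(lia) ltac:(lia)) Ho). unfold cone_pre. rewrite <- Ea. unfold Cmult, RtoC; cbn [fst snd]. f_equal; field; lra.
- rewrite <- Rabs_Ropp, Ei.
  match goal with |- Rabs ?u <= ?v => replace u with (snd (zint2 M i j) + cone_scale M (j - i) (j + i) * (PI * BesselJ 1 (M * sqrt (IZR (j - i) * IZR (j + i))))) by ring end.
  rewrite Rmult_assoc.
  apply (arc_term_J1 M (j - i) (j + i) HM ltac:(lia) ltac:(lia) (j - 2 - i) (j + i)); try lia.
  + rewrite <- minus_IZR. f_equal. lia.
  + reflexivity.
  + parity i j.
  + parity i j.
Qed.

Lemma near_Y1_far i j : (Z.abs i < j)%Z -> (2 <= j - i)%Z -> Z.odd (i + j) = true -> near M i j (prop2 M i j) (cone_pre Ci i j) (BesselY 1 (M * interval i j)).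
Proof.
intros H HK2 Ho. pose proof PI_gt_2 as Hpi. pose proof (interval_timelike i j H) as Ei.
assert (Ea : cone_scale M (j - i) (j + i) = M * IZR (j + i) / interval i j) by (rewrite Ei; apply cone_scale_eq; auto; lia).
assert (Ha : 0 < cone_scale M (j - i) (j + i)) by (apply Rmult_lt_0_compat; auto; apply exp_pos).
apply (near_scaled i j (j - i) (j + i) _ _ _ (fst (zint2 M i j)) (cone_scale M (j - i) (j + i) * PI) (cone_scale M (j - i) (j + i) * (PI * 80 + 24))); try lia.
- apply Rmult_lt_0_compat; lra.
- apply Rmult_le_pos; lra.
- rewrite <- Rmult_assoc, (Rmult_comm 105), Rmult_assoc. apply Rmult_le_compat_l; lra.
- rewrite (proj1 (prop2_parity M HM i j ltac:(lia) ltac:(lia)) Ho). unfold cone_pre. rewrite <- Ea. unfold Cmult, Ci, RtoC; cbn [fst snd]. f_equal; field; lra.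
- rewrite Ei, !Rmult_assoc.
  apply (arc_term_Y1 M (j - i) (j + i) HM ltac:(lia) ltac:(lia) (j - 2 - i) (j + i)); try lia.
  + rewrite <- minus_IZR. f_equal. lia.
  + reflexivity.
  + parity i j.
  + parity i j.
Qed.

Lemma near_K1_right i j : (0 <= j < i)%Z -> Z.odd (i + j) = true -> near M i j (prop2 M i j) (cone_pre (RtoC 2 * Ci / RtoC PI) i j) (BesselK 1 (M * interval i j)).
Proof.
intros H Ho. pose proof PI_gt_2 as Hpi. pose proof (interval_spacelike i j H) as Ei.
assert (Ea : cone_scale M (i - j) (i + j) = M * IZR (j + i) / interval i j) by (rewrite Ei, (Z.add_comm j i); apply cone_scale_eq; auto; lia).
assert (Ha : 0 < cone_scale M (i - j) (i + j)) by (apply Rmult_lt_0_compat; auto; apply exp_pos).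
apply (near_scaled i j (i - j) (i + j) _ _ _ (fst (zint2 M i j)) (cone_scale M (i - j) (i + j) * 2) (cone_scale M (i - j) (i + j) * 40)); try lra; try lia.
- rewrite (proj1 (prop2_parity M HM i j ltac:(lia) ltac:(lia)) Ho). unfold cone_pre. rewrite <- Ea.
  unfold Cdiv. rewrite <- RtoC_inv by lra. unfold Cmult, Ci, RtoC; cbn [fst snd]. f_equal; field; lra.
- rewrite Ei, !Rmult_assoc. assert (E1 : Z.odd (i - j) = true) by parity i j.
  pose proof (contour_K1 M (i - j) (i + j) HM ltac:(lia) ltac:(lia) ltac:(lia) E1 Ho ltac:(lia)) as K.
  replace (- (i - j + 2))%Z with (j - 2 - i)%Z in K by ring. replace (zint2 M i j) with (contour_int2 M (j - 2 - i) (i + j)) by (unfold zint2, contour_int2; rewrite (Z.add_comm i j); reflexivity). exact K.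
Qed.

(** The prefactor is odd under central reflection, as is the second component by [prop2_neg], so the
    same error serves both points. *)
Lemma near_neg w F i j : (i, j) <> (0, 0)%Z -> near M (- i) (- j) (prop2 M (- i) (- j)) (cone_pre w (- i) (- j)) F -> near M i j (prop2 M i j) (cone_pre w i j) F.
Proof.
intros H [e [He E]]. exists e. rewrite (defect_abs M i j (- i) (- j)) by lia. split; auto.
rewrite prop2_neg, E by auto. unfold cone_pre. rewrite (interval_abs i j (- i) (- j)) by lia.
replace (- j + - i)%Z with (- (j + i))%Z by ring. rewrite opp_IZR.
replace (M * - IZR (j + i) / interval (- i) (- j)) with (- (M * IZR (j + i) / interval (- i) (- j))) by (unfold Rdiv; ring).
rewrite RtoC_opp. ring.
Qed.

(** Under [i -> - i] the prefactors are in the ratio [j + i] to [j - i], exactly the ratio in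
    [prop2_flip]; the error is carried over unchanged. *)
Lemma near_flip w F i j : (0 <= j)%Z -> i <> j -> near M (- i) j (prop2 M (- i) j) (cone_pre w (- i) j) F -> near M i j (prop2 M i j) (cone_pre w i j) F.
Proof.
intros H0 H [e [He E]]. exists e. rewrite (defect_abs M i j (- i) j) by lia. split; auto.
pose proof (prop2_flip M HM i j H0) as Fl. rewrite E in Fl.
assert (Hne : IZR (j - i) <> 0) by (apply not_0_IZR; lia).
apply (Cmult_cancel_l (RtoC (IZR (j - i)))); [intros E0; apply RtoC_inj in E0; auto|].
rewrite Fl. unfold cone_pre. rewrite (interval_abs i j (- i) j) by lia. replace (j + - i)%Z with (j - i)%Z by ring.
unfold Rdiv. rewrite !RtoC_mult. ring.
Qed.

(** Isolates the pole of [Y_1] at 0 with a remainder bounded for all [z]: the finite integral is at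
    most [PI], and the improper one is [2 / z] minus twice an integral between 0 and 1. *)
Lemma BesselY1_singular z : 0 < z -> Rabs (PI * BesselY 1 z + 2 / z) <= PI + 3.
Proof.
intros Hz. pose proof PI_gt_2 as Hpi. unfold BesselY.
assert (Cs : forall x, continuous (fun th => sin (z * sin th - INR 1 * th)) x).
{ intros x. apply continuous_sin_comp. apply (continuous_minus (V := R_NormedModule)); [apply z_sin_cont|apply continuous_mult_R; [apply continuous_const|apply continuous_id]]. }
assert (H1 : Rabs (RInt (fun th => sin (z * sin th - INR 1 * th)) 0 PI) <= PI * 1).
{ apply arc_small; auto. intros x _. apply Rabs_le. pose proof (SIN_bound (z * sin x - INR 1 * x)). lra. }
assert (HI : Rabs (improper0 (fun u => (exp (INR 1 * u) + (-1) ^ 1 * exp (- (INR 1 * u))) * exp (- (z * sinh u))) - (2 / z - 1)) <= 2).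
{ apply improper0_approx with (B0 := 4 / (z * z)).
  - intros x. apply continuous_mult_R; [|apply exp_sinh_cont].
    apply (ex_derive_continuous (V := R_NormedModule)). auto_derive. auto.
  - intros x Hx. simpl. apply Rmult_le_pos; [|left; apply exp_pos].
    assert (exp (- (1 * x)) <= exp (1 * x)) by (apply exp_le; lra). lra.
  - intros B HB HB0.
    assert (Ce : forall x, continuous (fun w => exp (- w)) x) by (intros w; apply (ex_derive_continuous (V := R_NormedModule)); auto_derive; auto).
    assert (Cc : forall w, continuous (fun w => cosh w * exp (- (z * sinh w))) w) by (intros w; apply continuous_mult_R; [apply cosh_cont|apply exp_sinh_cont]).
    assert (Cm : forall w, continuous (fun w => exp (- w) * exp (- (z * sinh w))) w) by (intros w; apply continuous_mult_R; [apply Ce|apply exp_sinh_cont]).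
    assert (ET : RInt (fun u => (exp (INR 1 * u) + (-1) ^ 1 * exp (- (INR 1 * u))) * exp (- (z * sinh u))) 0 B
      = 2 * RInt (fun w => cosh w * exp (- (z * sinh w))) 0 B + -2 * RInt (fun w => exp (- w) * exp (- (z * sinh w))) 0 B).
    { rewrite <- (RInt_lin (fun w => cosh w * exp (- (z * sinh w))) (fun w => exp (- w) * exp (- (z * sinh w))) 2 (-2) 0 B (ex_RInt_cont _ 0 B Cc) (ex_RInt_cont _ 0 B Cm)).
      apply RInt_ext. intros w _. simpl INR. simpl pow. rewrite !Rmult_1_l. unfold cosh. field_sym. }
    rewrite ET, RInt_cosh_exp_sinh_eq by auto.
    assert (Ht : 0 <= 2 * (/ z * exp (- (z * sinh B))) <= 1).
    { pose proof (exp_pos (- (z * sinh B))) as Ex. assert (Hiz : 0 < / z) by (apply Rinv_0_lt_compat; auto).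
      split; [apply Rmult_le_pos; [lra|apply Rmult_le_pos; lra]|].
      assert (Hs : B / 2 <= sinh B).
      { unfold sinh. pose proof (exp_ge_1p B). assert (exp (- B) <= 1) by (rewrite <- exp_0; apply exp_le; lra). lra. }
      assert (Hq : 2 / z <= z * sinh B).
      { apply Rle_trans with (z * (4 / (z * z) / 2)); [apply Req_le; field; lra|]. apply Rmult_le_compat_l; lra. }
      assert (Hp : 0 < 2 / z) by (apply Rdiv_lt_0_compat; lra).
      assert (Hx : exp (- (z * sinh B)) <= z / 2).
      { rewrite exp_Ropp. replace (z / 2) with (/ (2 / z)) by (field; lra). apply Rinv_le_contravar; auto. pose proof (exp_ge_1p (z * sinh B)). lra. }
      replace 1 with (2 * (/ z * (z / 2))) by (field; lra). apply Rmult_le_compat_l; [lra|]. apply Rmult_le_compat_l; lra. }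
    assert (HJ : 0 <= RInt (fun w => exp (- w) * exp (- (z * sinh w))) 0 B <= 1).
    { split.
      - apply RInt_ge_0; auto; [apply ex_RInt_cont; auto|]. intros; apply Rmult_le_pos; left; apply exp_pos.
      - apply Rle_trans with (RInt (fun w => exp (- w)) 0 B).
        + apply RInt_le; auto; try (apply ex_RInt_cont; auto). intros w Hw. pose proof (exp_pos (- w)).
          assert (exp (- (z * sinh w)) <= 1). { rewrite <- exp_0. apply exp_le. assert (0 <= z * sinh w) by (apply Rmult_le_pos; [lra|apply sinh_pos_le; lra]). lra. }
          nra.
        + apply (RInt_le_primitive (fun w => - exp (- w))); auto.
          * intros w. auto_derive; auto. ring.
          * rewrite Ropp_0, exp_0. pose proof (exp_pos (- B)). lra. }
    set (J := RInt (fun w => exp (- w) * exp (- (z * sinh w))) 0 B) in *.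
    set (x := exp (- (z * sinh B))) in *. unfold Rdiv. apply Rabs_le. simpl in *. lra. }
set (I := improper0 _) in *. set (S := RInt _ 0 PI) in *.
replace (PI * (/ PI * S - / PI * I) + 2 / z) with (S - I + 2 / z) by (field; lra).
apply Rabs_le_between in H1, HI. apply Rabs_le. simpl in *. lra.
Qed.

Lemma sin_om_near_sin p : 0 <= p <= PI -> Rabs (sin_om c p - sin p) <= M.
Proof.
intros Hp. pose proof (norm1_sqr M) as N. fold c in N. pose proof (norm1_pos M) as Hc. fold c in Hc. pose proof (norm1_lt_1 M HM) as Hc1. fold c in Hc1.
assert (Hs : 0 <= sin p) by (apply sin_ge_0; lra). pose proof (sin2_cos2 p) as T. unfold Rsqr in T.
assert (E : 1 - (c * cos p) ^ 2 = sin p * sin p + c * c * (M * M) * (cos p * cos p)).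
{ replace (c * c * (M * M)) with (c * c * (1 + M * M) - c * c) by ring. rewrite N. nra. }
assert (Hu : 0 <= c * c * (M * M) * (cos p * cos p) <= M * M).
{ assert (0 <= cos p * cos p <= 1) by nra. assert (0 <= c * c <= 1) by nra.
  assert (0 <= c * c * (cos p * cos p) <= 1) by nra. assert (0 < M * M) by nra.
  replace (c * c * (M * M) * (cos p * cos p)) with (M * M * (c * c * (cos p * cos p))) by ring. split; [apply Rmult_le_pos; lra|nra]. }
unfold sin_om. rewrite E. set (u := c * c * (M * M) * (cos p * cos p)) in *.
assert (H1 : sin p <= sqrt (sin p * sin p + u)) by (rewrite <- (sqrt_square (sin p)) at 1 by auto; apply sqrt_le_1_alt; lra).
assert (H2 : sqrt (sin p * sin p + u) <= sin p + M).
{ rewrite <- (sqrt_square (sin p + M)) by lra. apply sqrt_le_1_alt. assert (0 <= sin p * M) by (apply Rmult_le_pos; lra). lra. }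
apply Rabs_le. lra.
Qed.

(** With [cos om = c cos p], the combination [cos (2 om) - c cos p cos om] equals [- sin_om^2],
    which cancels the denominator. *)
Lemma prop2_origin : prop2 M 0 1 = (0, - / PI * RInt (sin_om c) 0 PI).
Proof.
pose proof PI_gt_2 as Hpi. pose proof (norm1_bounds M HM) as Hc. fold c in Hc.
pose proof (proj1 (prop2_parity M HM 0 1 ltac:(lia) ltac:(lia)) eq_refl) as E.
rewrite E. f_equal. apply (f_equal snd) in E. cbn [snd] in E. rewrite <- E. unfold prop2. fold c.
rewrite !(green_massive M HM). unfold Cminus, Cplus, Copp, Cmult, RtoC; cbn [fst snd]. unfold gim.
change (Z.abs (1 + 1)) with 2%Z. change (Z.abs 1) with 1%Z. change (0 + 1)%Z with 1%Z.
assert (C1 : forall x, continuous (fun p => cos (0 * p) * cos_mode M 2 p) x).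
{ intros x. apply continuous_mult_R; [apply continuous_cos_lin|apply cos_mode_cont; auto]. }
assert (C2 : forall x, continuous (fun p => cos (1 * p) * cos_mode M 1 p) x).
{ intros x. apply continuous_mult_R; [apply continuous_cos_lin|apply cos_mode_cont; auto]. }
assert (EI : RInt (sin_om c) 0 PI = -1 * RInt (fun p => cos (0 * p) * cos_mode M 2 p) 0 PI + c * RInt (fun p => cos (1 * p) * cos_mode M 1 p) 0 PI).
{ rewrite <- (RInt_lin (fun p => cos (0 * p) * cos_mode M 2 p) (fun p => cos (1 * p) * cos_mode M 1 p) (-1) c 0 PI (ex_RInt_cont _ 0 PI C1) (ex_RInt_cont _ 0 PI C2)).
  apply RInt_ext. intros p _. unfold cos_mode. fold c. rewrite Rmult_0_l, cos_0, !Rmult_1_l, cos_2a, sin_om_eq, cos_om by auto.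
  pose proof (sin_om_pos c Hc p). field_sym. lra. }
rewrite EI. set (I1 := RInt (fun p => cos (0 * p) * cos_mode M 2 p) 0 PI). set (I2 := RInt (fun p => cos (1 * p) * cos_mode M 1 p) 0 PI).
change (/ PI * I1 + - (c * (/ PI * I2) + 0 * (/ PI * RInt (fun p => cos (1 * p) * sin_mode M 1 p) 0 PI)) = - / PI * (-1 * I1 + c * I2)). ring.
Qed.

(** Here [K = L = 1] and the reflection [i -> - i] fixes the point, so neither contour nor flip
    helps. But [defect >= 1], so a bounded error is enough: the integral of [sin_om] is within
    [PI M] of 2, and its leading part [2 / (PI M)] cancels the pole of [Y_1]. *)
Lemma near_Y1_origin : near M 0 1 (prop2 M 0 1) (cone_pre Ci 0 1) (BesselY 1 (M * interval 0 1)).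
Proof.
pose proof PI_gt_2 as Hpi. pose proof (norm1_bounds M HM) as Hc. fold c in Hc.
assert (E1 : interval 0 1 = 1) by (unfold interval; simpl; apply sqrt_1).
assert (ED : 1 <= defect M 0 1) by (unfold defect; simpl; rewrite Rinv_1; assert (0 < M * M) by (apply Rmult_lt_0_compat; auto); lra).
set (S := RInt (sin_om c) 0 PI).
apply (near_intro M 0 1 _ _ _ (- S / (PI * M))).
- rewrite prop2_origin. fold S. unfold cone_pre. rewrite E1. change (IZR (1 + 0)) with 1.
  unfold Cmult, Ci, RtoC; cbn [fst snd]. f_equal; field; lra.
- rewrite E1, Rmult_1_r.
  assert (HS : Rabs (S - 2) <= PI * M).
  { replace 2 with (RInt sin 0 PI).
    - apply abs_RInt_diff_const; [|apply continuous_sin|apply sin_om_near_sin].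
      intros x. apply sin_om_cont; auto.
    - rewrite (is_RInt_unique sin 0 PI (minus (- cos PI) (- cos 0))).
      + rewrite cos_PI, cos_0. unfold minus, plus, opp; simpl. ring.
      + apply (is_RInt_derive (V := R_CompleteNormedModule) (fun x => - cos x) sin); intros; [auto_derive; auto; ring|apply continuous_sin]. }
  pose proof (BesselY1_singular M HM) as HY.
  replace (- S / (PI * M) - BesselY 1 M) with (- ((S - 2) / (PI * M)) + - ((PI * BesselY 1 M + 2 / M) / PI)) by (field; lra).
  assert (HpM : 0 < PI * M) by (apply Rmult_lt_0_compat; lra).
  assert (X1 : Rabs ((S - 2) / (PI * M)) <= 1).
  { unfold Rdiv. rewrite Rabs_mult, Rabs_inv, (Rabs_pos_eq (PI * M)) by lra.
    apply Rmult_le_reg_r with (PI * M); auto. rewrite Rmult_assoc, Rinv_l, Rmult_1_r, Rmult_1_l by lra. exact HS. }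
  assert (X2 : Rabs ((PI * BesselY 1 M + 2 / M) / PI) <= 3).
  { unfold Rdiv at 1. rewrite Rabs_mult, Rabs_inv, (Rabs_pos_eq PI) by lra.
    apply Rmult_le_reg_r with PI; [lra|]. rewrite Rmult_assoc, Rinv_l, Rmult_1_r by lra. lra. }
  eapply Rle_trans; [apply Rabs_triang|]. rewrite !Rabs_Ropp. lra.
Qed.

(** If [j - i = 1] and [i <> 0] then [i >= 1], and the flipped point has difference [j + i >= 3];
    only [(0, 1)] is left over. *)
Lemma near_Y1 i j : (Z.abs i < j)%Z -> Z.odd (i + j) = true -> near M i j (prop2 M i j) (cone_pre Ci i j) (BesselY 1 (M * interval i j)).
Proof.
intros H Ho. destruct (Z_le_gt_dec 2 (j - i)) as [Hf|Hf]; [apply near_Y1_far; auto|].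
destruct (Z.eq_dec i 0) as [->|Hi].
- assert (j = 1%Z) by lia. subst j. apply near_Y1_origin.
- apply near_flip; try lia. rewrite (interval_abs i j (- i) j) by lia. apply near_Y1_far; try lia.
  parity i j.
Qed.

Lemma near_K1 i j : (0 <= j < Z.abs i)%Z -> Z.odd (i + j) = true -> near M i j (prop2 M i j) (cone_pre (RtoC 2 * Ci / RtoC PI) i j) (BesselK 1 (M * interval i j)).
Proof.
intros H Ho. destruct (Z_le_gt_dec 0 i) as [Hi|Hi]; [apply near_K1_right; auto; lia|].
apply near_flip; try lia. rewrite (interval_abs i j (- i) j) by lia. apply near_K1_right; try lia.
parity i j.
Qed.

Lemma prop1_abs i j : prop1 M i j = prop1 M (Z.abs i) (Z.abs j).
Proof. unfold prop1. rewrite green0_abs. reflexivity. Qed.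

Lemma near_prop1_abs pre F i j : near M (Z.abs i) (Z.abs j) (prop1 M (Z.abs i) (Z.abs j)) pre F -> near M i j (prop1 M i j) pre F.
Proof. unfold near. rewrite <- prop1_abs, (defect_abs M (Z.abs i) (Z.abs j) i j) by lia. auto. Qed.

(** Reduces to the upper half-plane by central reflection, which preserves [|i|], [|j|] and the
    parity of [i + j]. *)
Lemma near_prop2_up w F i j : (i, j) <> (0, 0)%Z ->
  (forall i' j', (0 <= j')%Z -> Z.abs i' = Z.abs i -> Z.abs j' = Z.abs j -> Z.even (i' + j') = Z.even (i + j) -> near M i' j' (prop2 M i' j') (cone_pre w i' j') F) ->
  near M i j (prop2 M i j) (cone_pre w i j) F.
Proof.
intros H Hn. destruct (Z_le_gt_dec 0 j) as [Hj|Hj]; [apply Hn; auto|].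
apply near_neg; auto. apply Hn; try lia. rewrite <- Z.opp_add_distr. apply Z.even_opp.
Qed.
End Near.

Lemma propagator_asymptotics M i j : 0 < M -> Z.abs i <> Z.abs j ->
  let s := interval i j in
  ((Z.abs i < Z.abs j)%Z -> Z.odd (i + j) = true -> near M i j (prop1 M i j) (RtoC M) (BesselJ 0 (M * s))) /\
  ((Z.abs i < Z.abs j)%Z -> Z.even (i + j) = true -> near M i j (prop1 M i j) (- Ci * RtoC M)%C (BesselY 0 (M * s))) /\
  ((Z.abs j < Z.abs i)%Z -> Z.odd (i + j) = true -> prop1 M i j = 0%C) /\
  ((Z.abs j < Z.abs i)%Z -> Z.even (i + j) = true -> near M i j (prop1 M i j) (RtoC 2 * Ci * RtoC M / RtoC PI)%C (BesselK 0 (M * s))) /\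
  ((Z.abs i < Z.abs j)%Z -> Z.even (i + j) = true -> near M i j (prop2 M i j) (cone_pre M (-1) i j) (BesselJ 1 (M * s))) /\
  ((Z.abs i < Z.abs j)%Z -> Z.odd (i + j) = true -> near M i j (prop2 M i j) (cone_pre M Ci i j) (BesselY 1 (M * s))) /\
  ((Z.abs j < Z.abs i)%Z -> Z.even (i + j) = true -> prop2 M i j = 0%C) /\
  ((Z.abs j < Z.abs i)%Z -> Z.odd (i + j) = true -> near M i j (prop2 M i j) (cone_pre M (RtoC 2 * Ci / RtoC PI) i j) (BesselK 1 (M * s))).
Proof.
intros HM Hij s.
assert (Pe : Z.even (Z.abs i + Z.abs j) = Z.even (i + j)).
{ rewrite !Z.even_add. destruct (Z.abs_spec i) as [[_ ->]|[_ ->]], (Z.abs_spec j) as [[_ ->]|[_ ->]]; rewrite ?Z.even_opp; reflexivity. }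
assert (Po : Z.odd (Z.abs i + Z.abs j) = Z.odd (i + j)) by (rewrite <- !Z.negb_even, Pe; reflexivity).
assert (Es : s = interval (Z.abs i) (Z.abs j)) by (apply interval_abs; lia).
assert (Hne : (i, j) <> (0, 0)%Z) by (intros E; injection E; lia).
assert (Odd : forall i' j', Z.even (i' + j') = Z.even (i + j) -> Z.odd (i + j) = true -> Z.odd (i' + j') = true) by (intros i' j' E Ho; rewrite <- Z.negb_even, E, Z.negb_even; auto).
repeat split; intros H Hp.
- apply near_prop1_abs. rewrite Es. apply near_J0; auto; try lia; congruence.
- apply near_prop1_abs. rewrite Es. apply near_Y0; auto; try lia; congruence.
- unfold prop1. rewrite (green_zero M HM) by auto. ring.
- apply near_prop1_abs. rewrite Es. apply near_K0; auto; try lia; congruence.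
- apply near_prop2_up; auto. intros i' j' Hj Ei Ej E. unfold s. rewrite (interval_abs i j i' j') by auto. apply near_J1; auto; try lia; congruence.
- apply near_prop2_up; auto. intros i' j' Hj Ei Ej E. unfold s. rewrite (interval_abs i j i' j') by auto. apply near_Y1; auto; lia.
- apply prop2_zero; auto.
- apply near_prop2_up; auto. intros i' j' Hj Ei Ej E. unfold s. rewrite (interval_abs i j i' j') by auto. apply near_K1; auto; lia.
Qed.

Theorem theorem2 :
  exists Cst : R, forall m eps : R, 0 < m -> 0 < eps -> forall i j : Z,
  let x := eps * IZR i in
  let t := eps * IZR j in
  Rabs x <> Rabs t ->
  let s := sqrt (Rabs (t ^ 2 - x ^ 2)) in
  let D := / Rabs (Rabs x - Rabs t) + m ^ 2 * (Rabs x + Rabs t) in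
  let O := fun e : C => Cmod e <= Cst * eps * D in
  (* A~_1 *)
  (Rabs x < Rabs t -> Z.odd (i + j) = true ->
     exists e, O e /\ Atilde1 m eps i j = (RtoC (m * eps) * (RtoC (BesselJ 0 (m * s)) + e))%C) /\
  (Rabs x < Rabs t -> Z.even (i + j) = true ->
     exists e, O e /\ Atilde1 m eps i j = (- Ci * RtoC (m * eps) * (RtoC (BesselY 0 (m * s)) + e))%C) /\
  (Rabs x > Rabs t -> Z.odd (i + j) = true -> Atilde1 m eps i j = RtoC 0) /\
  (Rabs x > Rabs t -> Z.even (i + j) = true ->
     exists e, O e /\ Atilde1 m eps i j =
       (RtoC 2 * Ci * RtoC (m * eps) * (RtoC (BesselK 0 (m * s)) + e) / RtoC PI)%C) /\
  (* A~_2 *)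
  (Rabs x < Rabs t -> Z.even (i + j) = true ->
     exists e, O e /\ Atilde2 m eps i j =
       (- RtoC (m * eps * (t + x)) * (RtoC (BesselJ 1 (m * s)) + e) / RtoC s)%C) /\
  (Rabs x < Rabs t -> Z.odd (i + j) = true ->
     exists e, O e /\ Atilde2 m eps i j =
       (Ci * RtoC (m * eps * (t + x)) * (RtoC (BesselY 1 (m * s)) + e) / RtoC s)%C) /\
  (Rabs x > Rabs t -> Z.even (i + j) = true -> Atilde2 m eps i j = RtoC 0) /\
  (Rabs x > Rabs t -> Z.odd (i + j) = true ->
     exists e, O e /\ Atilde2 m eps i j =
       (RtoC 2 * Ci * RtoC (m * eps * (t + x)) * (RtoC (BesselK 1 (m * s)) + e)
        / (RtoC PI * RtoC s))%C).
Proof.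
(* The constant of [near]: by [HD] below, [eps * D] equals [defect] exactly, so nothing is lost in
   rescaling. *)
exists 420. intros m eps Hm He i j x t Hxt s D O. pose proof PI_gt_2 as Hpi.
assert (HM : 0 < m * eps) by (apply Rmult_lt_0_compat; auto).
assert (Ax : Rabs x = eps * IZR (Z.abs i)) by (unfold x; rewrite Rabs_mult, (Rabs_pos_eq eps), abs_IZR by lra; reflexivity).
assert (At : Rabs t = eps * IZR (Z.abs j)) by (unfold t; rewrite Rabs_mult, (Rabs_pos_eq eps), abs_IZR by lra; reflexivity).
assert (Hij : Z.abs i <> Z.abs j) by (intros E; apply Hxt; rewrite Ax, At, E; reflexivity).
assert (Hlt : forall a b, eps * IZR a < eps * IZR b -> (a < b)%Z) by (intros a b H; apply lt_IZR; apply Rmult_lt_reg_l with eps; auto).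
assert (Hs : s = eps * interval i j).
{ unfold s, interval. replace (t ^ 2 - x ^ 2) with (eps * eps * IZR (j * j - i * i)) by (unfold t, x; rewrite minus_IZR, !mult_IZR; ring).
  rewrite Rabs_mult, (Rabs_pos_eq (eps * eps)) by nra. rewrite sqrt_mult, sqrt_square, abs_IZR by (try apply Rabs_pos; nra). reflexivity. }
assert (Hsp : 0 < interval i j) by (apply interval_pos; auto).
assert (Hms : m * s = m * eps * interval i j) by (rewrite Hs; ring).
assert (HD : 420 * eps * D = 420 * defect (m * eps) i j).
{ unfold D, defect. rewrite Ax, At, <- Rmult_minus_distr_l, <- Rmult_plus_distr_l, Rabs_mult, (Rabs_pos_eq eps), <- minus_IZR, <- plus_IZR, <- abs_IZR by lra.
  assert (0 < IZR (Z.abs (Z.abs i - Z.abs j))) by (apply IZR_lt; lia). field. lra. }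
destruct (propagator_asymptotics (m * eps) i j HM Hij) as (T1 & T2 & T3 & T4 & T5 & T6 & T7 & T8). cbv zeta in *.
destruct (Atilde_green m eps i j Hm He) as [E1 E2]. cbv zeta in E1, E2.
fold (prop1 (m * eps) i j) in E1. fold (prop2 (m * eps) i j) in E2. rewrite E1, E2, Hms.
assert (Lift : forall X pre F Q, near (m * eps) i j X pre F -> (forall e : R, (pre * RtoC (F + e))%C = Q (RtoC e)) -> exists e : C, O e /\ X = Q e).
{ intros X pre F Q [e [H1 H2]] HQ. exists (RtoC e). split; [unfold O; rewrite HD, Cmod_R; exact H1|]. rewrite H2. apply HQ. }
assert (Hfs : m * eps * IZR (j + i) / interval i j = m * eps * (t + x) / s).
{ rewrite Hs. unfold t, x. rewrite plus_IZR. field. lra. }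
assert (Hs0 : s <> 0) by (rewrite Hs; apply Rgt_not_eq, Rmult_lt_0_compat; auto).
assert (HsC : RtoC s <> 0%C) by (intros E; apply RtoC_inj in E; auto).
assert (HpC : RtoC PI <> 0%C) by (intros E; apply RtoC_inj in E; lra).
rewrite Ax, At.
repeat split; intros H Hp; apply Hlt in H.
- apply (Lift _ _ _ (fun e => (RtoC (m * eps) * (RtoC (BesselJ 0 (m * eps * interval i j)) + e))%C) (T1 H Hp)). intros e. rewrite RtoC_plus. reflexivity.
- apply (Lift _ _ _ (fun e => (- Ci * RtoC (m * eps) * (RtoC (BesselY 0 (m * eps * interval i j)) + e))%C) (T2 H Hp)). intros e. rewrite RtoC_plus. reflexivity.
- apply T3; auto.
- apply (Lift _ _ _ (fun e => (RtoC 2 * Ci * RtoC (m * eps) * (RtoC (BesselK 0 (m * eps * interval i j)) + e) / RtoC PI)%C) (T4 H Hp)). intros e. rewrite RtoC_plus. field; auto.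
- apply (Lift _ _ _ (fun e => (- RtoC (m * eps * (t + x)) * (RtoC (BesselJ 1 (m * eps * interval i j)) + e) / RtoC s)%C) (T5 H Hp)).
  intros e. unfold cone_pre. rewrite Hfs, RtoC_plus, RtoC_div by auto. field; auto.
- apply (Lift _ _ _ (fun e => (Ci * RtoC (m * eps * (t + x)) * (RtoC (BesselY 1 (m * eps * interval i j)) + e) / RtoC s)%C) (T6 H Hp)).
  intros e. unfold cone_pre. rewrite Hfs, RtoC_plus, RtoC_div by auto. field; auto.
- apply T7; auto.
- apply (Lift _ _ _ (fun e => (RtoC 2 * Ci * RtoC (m * eps * (t + x)) * (RtoC (BesselK 1 (m * eps * interval i j)) + e) / (RtoC PI * RtoC s))%C) (T8 H Hp)).
  intros e. unfold cone_pre. rewrite Hfs, RtoC_plus, RtoC_div by auto. field; auto.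
Qed.
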